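(* Let $d\ge2$, $r\in(0,1)$, $s=d/2+r$. Consider a Maxwellian collision model on $\mathbb{R}^d$ with angular measure $\bar\gamma$ on $(0,\pi]$ (the common value of all the measures $\bar\gamma_u$, $u>0$), and let $Q$ be its Boltzmann collision kernel. Set $$\kappa=\int_0^{\pi}\big[1-\cos(\theta/2)^r-\sin(\theta/2)^r\big]\,d\bar\gamma(\theta).$$ Then $Q$, when restricted to the probability measures with finite $r$-th moment, satisfies the $\kappa$-contractivity property in $\dot H^{-s}(\mathbb{R}^d)$: the differential of $\mu\mapsto Q(\mu,\mu)$ at $\mu$ in direction $f$ being $2Q(\mu,f)$, for every probability measure $\mu$ on $\mathbb{R}^d$ with $\int|v|^r\,d\mu(v)<\infty$ and every $f\in\dot H^{-s}(\mathbb{R}^d)$, $$\big\langle 2Q(\mu,f),f\big\rangle_{\dot H^{-s}}\le-\kappa\,\|f\|_{\dot H^{-s}}^2 .$$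
   Context: Sobolev space: with $\hat f(\xi)=(2\pi)^{-d/2}\int f(x)e^{-i\xi\cdot x}dx$, $\dot H^{-s}(\mathbb{R}^d)$ is the Hilbert completion of the Schwartz functions $f$ with $\|f\|_{\dot H^{-s}}^2=\int|\hat f(\xi)|^2|\xi|^{-2s}d\xi<\infty$, with inner product $\langle f,g\rangle_{\dot H^{-s}}=\int\hat f\,\overline{\hat g}\,|\xi|^{-2s}d\xi$ (in inequalities its real part is meant). A signed measure is regarded as an element of $\dot H^{-s}$ when its Fourier transform lies in $L^2(|\xi|^{-2s}d\xi)$; for $r\in(0,1)$ this holds for signed measures of total mass $0$ with finite $r$-th absolute moment. Probability measures themselves are not in $\dot H^{-s}$, but differences of two probability measures with finite $r$-th moment are. Collision model: for $v,w\in\mathbb{R}^d$, $\gamma_{v,w}$ is the positive measure on $(\mathbb{R}^d)^2$ of collision rates from $(v,w)$ to $(v',w')$. Collisions conserve momentum and energy ($v'+w'=v+w$, $|w'-v'|=|w-v|$ $\gamma_{v,w}$-a.e.) and the model is invariant under isometries. It is then described by measures $\bar\gamma_u$ on $(0,\pi]$, $u>0$: with $u=|v-w|$, $\gamma_{v,w}$ is the law obtained by choosing the deviation angle $\theta$ according to $\bar\gamma_u$ and then setting $v'=\frac{v+w}{2}+\frac{u}{2}\sigma$, $w'=\frac{v+w}{2}-\frac{u}{2}\sigma$ with $\sigma$ uniform on the set of unit vectors making angle $\theta$ with $v-w$ (for $v=w$ collisions have no effect). The model is Maxwellian if $\bar\gamma_u=\bar\gamma$ does not depend on $u$. Collision kernel: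 $Q(\mu,\nu)=\frac12\int\Big(\int(-\delta_v-\delta_w+\delta_{v'}+\delta_{w'})\,d\gamma_{v,w}(v',w')\Big)d\mu(v)\,d\nu(w)$, a bilinear symmetric expression; for $\mu$ a probability measure, $Q(\mu,\cdot)$ is regarded as a linear operator on $\dot H^{-s}$, extended from zero-mass signed measures by density. The integrand defining $\kappa$ is nonpositive, so $\kappa\in[-\infty,0]$ is well defined; the assertion is void if $\kappa=-\infty$.
   Formalization: When the angular measure is infinite (with κ finite), Q(μ,·) is in general unbounded on Ḣ^{-s}, so the inequality is stated for every f at which its extension by density (the closure) is defined; for a finite angular measure it covers every f. *)

(* Defs.v *)
From HB Require Import structures.
From mathcomp Require Import all_boot all_order all_algebra.
From mathcomp Require Import complex.
From mathcomp Require Import all_classical all_reals all_analysis.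
From mathcomp Require Import measurable_realfun.

Set Implicit Arguments.
Unset Strict Implicit.
Unset Printing Implicit Defensive.

Import Order.TTheory GRing.Theory Num.Theory.
Import numFieldNormedType.Exports.

Local Open Scope classical_set_scope.
Local Open Scope ring_scope.

(* R^n is 'rV[R]_n with its Borel sigma-algebra, generated by the coordinates. *)
Section borel_rV.
Context (R : realType) (n : nat).

Let coord (i : 'I_n) (x : 'rV[R]_n) : R := x 0 i.

Let rV_set0 : g_sigma_preimage coord set0.
Proof. exact: sigma_algebra0. Qed.

Let rV_setC A : g_sigma_preimage coord A -> g_sigma_preimage coord (~` A).
Proof. exact: sigma_algebraC. Qed.

Let rV_bigcup (F : (set 'rV[R]_n)^nat) :
  (forall i, g_sigma_preimage coord (F i)) ->
  g_sigma_preimage coord (\bigcup_i (F i)).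
Proof. exact: sigma_algebra_bigcup. Qed.

HB.instance Definition _ := @isMeasurable.Build default_measure_display
  'rV[R]_n (g_sigma_preimage coord) rV_set0 rV_setC rV_bigcup.

Lemma measurable_coord (i : 'I_n) :
  measurable_fun [set: 'rV[R]_n] (fun x => x 0 i).
Proof.
move=> _ Y mY; rewrite setTI; apply: sub_sigma_algebra => /=.
rewrite -bigcup_seq/=; exists i => /=; first by rewrite mem_index_enum.
by exists Y => //; rewrite setTI.
Qed.

Lemma measurable_fun_rVP d (T : measurableType d) (f : T -> 'rV[R]_n) :
  (forall i, measurable_fun [set: T] (fun t => f t 0 i)) ->
  measurable_fun [set: T] f.
Proof.
move=> mf.
have sub : preimage_set_system setT f measurable `<=` measurable.
  have -> : preimage_set_system setT f measurable =
      g_sigma_preimage (fun i => coord i \o f) by rewrite g_sigma_preimage_comp.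
  apply: smallest_sub; first exact: sigma_algebra_measurable.
  move=> A; rewrite -bigcup_seq => -[i _ [B mB <-]].
  exact: mf.
by move=> _ A mA; apply: sub; exists A.
Qed.

End borel_rV.

Definition pushforward_measure d1 d2 (T1 : measurableType d1)
    (T2 : measurableType d2) (R : realType) (m : {measure set T1 -> \bar R})
    (f : T1 -> T2) (mf : measurable_fun [set: T1] f) :
  {measure set T2 -> \bar R}.
Proof. by refine (pushforward m f : {measure set T2 -> \bar R}). Defined.

Section euclidean.
Context (R : realType).

(* The library's norm on 'rV[R]_n is the sup norm, hence enorm. *)
Definition dotv n (x y : 'rV[R]_n) : R := \sum_(i < n) x 0 i * y 0 i.
Definition enorm n (x : 'rV[R]_n) : R := Num.sqrt (dotv x x).
(* unitv 0 = 0 *)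
Definition unitv n (x : 'rV[R]_n) : 'rV[R]_n := (enorm x)^-1 *: x.

Definition cons_rV n (p : 'rV[R]_n * measurableTypeR R) : 'rV[R]_n.+1 :=
  row_mx (p.2%:M : 'rV[R]_1) p.1.

Lemma measurable_cons_rV n : measurable_fun setT (@cons_rV n).
Proof.
apply: measurable_fun_rVP => i.
case: (split_ordP (i : 'I_(1 + n))) => j ->.
- rewrite (_ : (fun t => _) = snd); first exact: measurable_snd.
  apply/funext => t; apply: etrans (row_mxEl _ _ _ _) _.
  by rewrite mxE !ord1 eqxx mulr1n.
- rewrite (_ : (fun t => _) = (fun x : 'rV[R]_n => x 0 j) \o fst).
    exact: (measurableT_comp (measurable_coord j) measurable_fst).
  by apply/funext => t; apply: etrans (row_mxEr _ _ _ _) _.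
Qed.

Fixpoint lebesgue_rV n : {measure set 'rV[R]_n -> \bar R} :=
  if n is m.+1 then
    pushforward_measure (lebesgue_rV m \x @lebesgue_measure R)%E
      (@measurable_cons_rV m)
  else dirac (0 : 'rV[R]_0).

Lemma measurable_dotv d (T : measurableType d) n (f g : T -> 'rV[R]_n) :
  measurable_fun setT f -> measurable_fun setT g ->
  measurable_fun setT (fun t => dotv (f t) (g t)).
Proof.
move=> mf mg; apply: measurable_sum => i; apply: measurable_funM.
  exact: (measurableT_comp (measurable_coord i) mf).
exact: (measurableT_comp (measurable_coord i) mg).
Qed.

Lemma measurable_enorm d (T : measurableType d) n (f : T -> 'rV[R]_n) :
  measurable_fun setT f -> measurable_fun setT (fun t => enorm (f t)).
Proof.
move=> mf.
have ms : measurable_fun setT (@Num.sqrt R).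
  by apply: continuous_measurable_fun; exact: sqrt_continuous.
exact: (measurableT_comp ms (measurable_dotv mf mf)).
Qed.

Lemma measurable_addv d (T : measurableType d) n (f g : T -> 'rV[R]_n) :
  measurable_fun setT f -> measurable_fun setT g ->
  measurable_fun setT (fun t => f t + g t).
Proof.
move=> mf mg; apply: measurable_fun_rVP => i; under eq_fun do rewrite mxE.
apply: measurable_funD.
  exact: (measurableT_comp (measurable_coord i) mf).
exact: (measurableT_comp (measurable_coord i) mg).
Qed.

Lemma measurable_scalev d (T : measurableType d) n (c : T -> R)
    (f : T -> 'rV[R]_n) :
  measurable_fun setT c -> measurable_fun setT f ->
  measurable_fun setT (fun t => c t *: f t).
Proof.
move=> mc mf; apply: measurable_fun_rVP => i; under eq_fun do rewrite mxE.
apply: measurable_funM => //.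
exact: (measurableT_comp (measurable_coord i) mf).
Qed.

Lemma measurable_oppv d (T : measurableType d) n (f : T -> 'rV[R]_n) :
  measurable_fun setT f -> measurable_fun setT (fun t => - f t).
Proof.
move=> mf; under eq_fun do rewrite -scaleN1r.
exact: measurable_scalev.
Qed.

Lemma measurable_unitv d (T : measurableType d) n (f : T -> 'rV[R]_n) :
  measurable_fun setT f -> measurable_fun setT (fun t => unitv (f t)).
Proof.
move=> mf; apply: measurable_scalev => //.
rewrite (_ : (fun t => _) = (@powR R ^~ (-1)) \o (fun t => enorm (f t))).
  exact: (measurableT_comp (measurable_powR (-1)) (measurable_enorm mf)).
by apply/funext => t /=; rewrite powR_inv1// sqrtr_ge0.
Qed.

Definition unit_ball n : set 'rV[R]_n := [set x | enorm x <= 1].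

Lemma measurable_unit_ball n : measurable (@unit_ball n).
Proof.
have me := @measurable_enorm _ _ n id (@measurable_id _ _ setT).
rewrite (_ : @unit_ball n = setT `&` (fun x => enorm x) @^-1` `]-oo, 1]).
  exact: me.
by rewrite setTI; apply/seteqP; split => x /=; rewrite in_itv.
Qed.

Definition uniform_ball n : probability 'rV[R]_n R :=
  mnormalize (mrestr (lebesgue_rV n) (@measurable_unit_ball n))
    (dirac (0 : 'rV[R]_n)).

End euclidean.

Section signed_measure.
Context d (T : measurableType d) (R : realType).
Variable nu : {charge set T -> \bar R}.

Definition hahn_pos : set T := sval (cid (Hahn_decomposition nu)).
Definition hahn_neg : set T :=
  sval (cid (svalP (cid (Hahn_decomposition nu)))).

Lemma hahn_posnegP : hahn_decomposition nu hahn_pos hahn_neg.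
Proof. exact: svalP (cid (svalP (cid (Hahn_decomposition nu)))). Qed.

Definition charge_Rintegral (f : T -> R) : R :=
  \int[jordan_pos hahn_posnegP]_x f x - \int[jordan_neg hahn_posnegP]_x f x.

End signed_measure.

Section collisions.
Context (R : realType) (n : nat).
Local Notation V := 'rV[R]_n.

(* If x is uniform in the unit ball and e is a unit vector, then the normalized
   projection of x on the orthogonal of e is uniform on the unit sphere of that
   hyperplane, so that cone_point e theta x is uniform on the set of unit
   vectors making the angle theta with e. *)
Definition cone_point (e : V) (theta : R) (x : V) : V :=
  cos theta *: e + sin theta *: unitv (x - dotv x e *: e).

Definition post_collision (v w : V) (p : R * V) : V * V :=
  let c := 2^-1 *: (v + w) in
  let h := (enorm (v - w) / 2) *: cone_point (unitv (v - w)) p.1 p.2 in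
  (c + h, c - h).

Lemma measurable_post_collision v w : measurable_fun setT (post_collision v w).
Proof.
have mh : measurable_fun [set: R * V] (fun p =>
    (enorm (v - w) / 2) *: cone_point (unitv (v - w)) p.1 p.2).
  apply: measurable_scalev; first exact: measurable_cst.
  have mcos : measurable_fun setT (@cos R).
    by apply: continuous_measurable_fun; exact: continuous_cos.
  have msin : measurable_fun setT (@sin R).
    by apply: continuous_measurable_fun; exact: continuous_sin.
  apply: measurable_addv; apply: measurable_scalev.
  - exact: (measurableT_comp mcos measurable_fst).
  - exact: measurable_cst.
  - exact: (measurableT_comp msin measurable_fst).
  - apply: measurable_unitv; apply: measurable_addv; first exact: measurable_snd.
    apply: measurable_oppv; apply: measurable_scalev; last exact: measurable_cst.
    by apply: measurable_dotv; [exact: measurable_snd|exact: measurable_cst].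
apply: measurable_fun_pair; apply: measurable_addv => //.
exact: measurable_oppv.
Qed.

(* A measure on (0, pi] is a measure on R that does not charge the
   complement of `]0, pi]. *)
Record collision_model := CollisionModel {
  angular : R -> {measure set R -> \bar R} ;
  angular_supp : forall u, 0 < u -> angular u (~` `]0, pi]) = 0%E }.

Definition maxwellian (M : collision_model)
    (gbar : {measure set R -> \bar R}) : Prop :=
  forall u, 0 < u -> angular M u = gbar.

(* For v = w the outcome is (v, v) whatever the angle: post_collision has u = 0. *)
Definition collision_rate (M : collision_model) (v w : V) :
    {measure set (V * V) -> \bar R} :=
  pushforward_measure (angular M (enorm (v - w)) \x uniform_ball R n)%E
    (measurable_post_collision v w).

(* Q(mu, nu) acts on test functions; when the angular measure is infinite it need
   not be a measure, but the innermost integral still converges for the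
   trigonometric psi used below. *)
Definition Qtest (M : collision_model) (mu : probability V R)
    (nu : {charge set V -> \bar R}) (psi : V -> R) : R :=
  2^-1 * \int[mu]_v charge_Rintegral nu (fun w =>
    \int[collision_rate M v w]_p (- psi v - psi w + psi p.1 + psi p.2)).

End collisions.

Section sobolev.
Context (R : realType) (n : nat).
Local Notation V := 'rV[R]_n.
Local Notation C := R[i].

(* Fourier transform of the real distribution psi |-> T psi. *)
Definition fourier (T : (V -> R) -> R) (xi : V) : C :=
  let c := (2 * pi) `^ (- (n%:R / 2)) in
  ((c * T (fun x => cos (dotv xi x))) +i*
   (- (c * T (fun x => sin (dotv xi x)))))%C.

(* Fourier transform of the complex distribution T1 + i T2. *)
Definition fourierC (T1 T2 : (V -> R) -> R) (xi : V) : C :=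
  fourier T1 xi + 'i%C * fourier T2 xi.

Definition hdot (s : R) (F G : V -> C) : C :=
  let w xi := enorm xi `^ (- (2 * s)) in
  ((\int[lebesgue_rV R n]_xi (complex.Re (F xi * (G xi)^*%C) * w xi)) +i*
   (\int[lebesgue_rV R n]_xi (complex.Im (F xi * (G xi)^*%C) * w xi)))%C.

Definition hnorm2 (s : R) (F : V -> C) : \bar R :=
  (\int[lebesgue_rV R n]_xi
    ((complex.Re (F xi) ^+ 2 + complex.Im (F xi) ^+ 2)
      * enorm xi `^ (- (2 * s)))%:E)%E.

Definition weighted_L2 (s : R) (F : V -> C) : Prop :=
  [/\ measurable_fun setT (fun xi => complex.Re (F xi)),
      measurable_fun setT (fun xi => complex.Im (F xi))
    & (hnorm2 s F < +oo)%E].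

Definition partials (l : seq 'I_n) (f : V -> R) : V -> R :=
  foldr (fun i g x => 'D_(delta_mx 0 i) g x) f l.

(* Existence and boundedness of all iterated partials entails smoothness. *)
Definition schwartz (f : V -> R) : Prop :=
  forall l : seq 'I_n,
    (forall x i, derivable (partials l f) x (delta_mx 0 i)) /\
    (forall k : nat, exists c : R,
      forall x, enorm x ^+ k * `|partials l f x| <= c).

Definition fourier_fun (f g : V -> R) : V -> C :=
  fourierC (fun psi => \int[lebesgue_rV R n]_x (f x * psi x))
           (fun psi => \int[lebesgue_rV R n]_x (g x * psi x)).

Definition hcvg (s : R) (Fk : nat -> V -> C) (F : V -> C) : Prop :=
  hnorm2 s (fun xi => Fk k xi - F xi) @[k --> \oo] --> 0%E.

(* The completion of the Schwartz functions of finite norm, realized through the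
   Fourier transform (an isometry) as their closure in L^2(|xi|^(-2s) dxi); an
   element f is represented by a representative F of its Fourier transform. *)
Definition Hdot (s : R) (F : V -> C) : Prop :=
  weighted_L2 s F /\
  exists f g : nat -> V -> R,
    (forall k, [/\ schwartz (f k), schwartz (g k)
                 & (hnorm2 s (fourier_fun (f k) (g k)) < +oo)%E]) /\
    hcvg s (fun k => fourier_fun (f k) (g k)) F.

Definition zero_mass (r : R) (nu : {charge set V -> \bar R}) : Prop :=
  nu setT = 0%E /\
  (\int[jordan_pos (hahn_posnegP nu)]_v (enorm v `^ r)%:E
   + \int[jordan_neg (hahn_posnegP nu)]_v (enorm v `^ r)%:E < +oo)%E.

(* nu1 + i nu2, for real signed measures nu1 and nu2 *)
Record cmeasure := CMeasure {
  re_part : {charge set V -> \bar R} ;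
  im_part : {charge set V -> \bar R} }.

Definition fourier_meas (nu : cmeasure) : V -> C :=
  fourierC (charge_Rintegral (re_part nu)) (charge_Rintegral (im_part nu)).

Definition core (r : R) (nu : cmeasure) : Prop :=
  zero_mass r (re_part nu) /\ zero_mass r (im_part nu).

Definition fourier_Q (M : collision_model R) (mu : probability V R)
    (nu : cmeasure) : V -> C :=
  fourierC (Qtest M mu (re_part nu)) (Qtest M mu (im_part nu)).

(* g = Q(mu, f), the extension by density being the closure of the graph of
   nu |-> Q(mu, nu); F and G are the Fourier transforms of f and g. *)
Definition Qext (M : collision_model R) (r s : R) (mu : probability V R)
    (F G : V -> C) : Prop :=
  weighted_L2 s G /\
  exists nu : nat -> cmeasure,
    [/\ forall k, core r (nu k),
        hcvg s (fun k => fourier_meas (nu k)) F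
      & hcvg s (fun k => fourier_Q M mu (nu k)) G].

End sobolev.

Definition kappa (R : realType) (r : R) (gbar : {measure set R -> \bar R}) :
    \bar R :=
  (\int[gbar]_(theta in `]0%R, pi])
     (1 - cos (theta / 2) `^ r - sin (theta / 2) `^ r)%:E)%E.

Definition finite_moment (R : realType) (n : nat) (r : R)
    (mu : probability 'rV[R]_n R) : Prop :=
  (\int[mu]_v (enorm v `^ r)%:E < +oo)%E.

(* Q(mu, .) is a densely defined operator with values in the Sobolev space, and
   is defined everywhere when the angular measure is finite. *)
Definition Q_operator (R : realType) (n : nat) (M : collision_model R)
    (gbar : {measure set R -> \bar R}) (r s : R) : Prop :=
  forall mu : probability 'rV[R]_n R, finite_moment r mu ->
  (forall nu : cmeasure R n, core r nu ->
     weighted_L2 s (fourier_meas nu) /\ weighted_L2 s (fourier_Q M mu nu)) /\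
  ((gbar setT < +oo)%E ->
     forall F, Hdot s F -> exists G, Qext M r s mu F G).

(* The differential of mu |-> Q(mu, mu) at mu in the direction f is 2 Q(mu, f). *)
Definition contractive (R : realType) (n : nat) (M : collision_model R)
    (r s : R) (k : \bar R) : Prop :=
  forall mu : probability 'rV[R]_n R, finite_moment r mu ->
  forall F G : 'rV[R]_n -> R[i], Hdot s F -> Qext M r s mu F G ->
  ((complex.Re (hdot s (fun xi => 2 * G xi) F))%:E <= - k * hnorm2 s F)%E.

(* Main.v *)
Require Import Defs.
From HB Require Import structures.
From mathcomp Require Import all_boot all_order all_algebra.
From mathcomp Require Import complex.
From mathcomp Require Import all_classical all_reals all_analysis.
From mathcomp Require Import measurable_realfun.
From mathcomp Require Import ring lra.

(* By Bobylev's identity, the Fourier transform of [2 Q(mu, f)] at [xi] is the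
   integral over the angle [theta] and the direction of
   [A(xi+) F(xi-) + A(xi-) F(xi+) - F(xi) - A(xi) F(0)], where [A] and [F] are the
   Fourier transforms of [mu] and [f], [|A| <= 1], [F(0) = 0], and [xi+], [xi-] have
   norms [|xi| cos(theta/2)] and [|xi| sin(theta/2)]. With the weight
   [|xi|^(-2s) = |xi|^(-n-2r)], the change of scale and the symmetry of the cone
   of directions give [F(xi+)] a norm at most [cos(theta/2)^r] times that of [F], and
   similarly [sin(theta/2)^r] for [F(xi-)]; the Cauchy-Schwarz inequality at each
   [theta] then yields the contraction rate [kappa] on zero-mass measures. When the
   angular measure is infinite, an energy estimate of order [min(sin, cos)^r (theta/2)]
   at each [theta] makes the integral over [theta] converge. The inequality passes to the
   limit in the weighted L2 space. A Schwartz function of finite norm has zero mass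
   since [|xi|^(-2s)] is not integrable, so zero-mass measures are dense; when the
   angular measure is finite [Q(mu, .)] is Lipschitz on them, and completeness of
   L2 extends it. *)

Set Implicit Arguments.
Unset Strict Implicit.
Unset Printing Implicit Defensive.

Import Order.TTheory GRing.Theory Num.Theory.
Import numFieldNormedType.Exports.

Local Open Scope classical_set_scope.
Local Open Scope ring_scope.

(** * Lebesgue measure on the Euclidean space *)

(** The bound on [F(xi+)] compares an integral over [xi] and a random direction with an integral
    over one variable [z]. In polar coordinates it would be an equality; only the upper bound is
    needed, and it is reached without them. The value of a function at a point [y] of norm [|xi|] is
    replaced by its mean over the ball of radius [e |xi|] around [y]. Whether [z] lies in this ball
    depends only on [|xi|], [|z|] and an inner product, and the reflection exchanging the directions
    of [xi] and [z] turns the cone around [xi] into the cone around [z]. Integrating in [xi] first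
    then costs a factor tending to 1 with [e] tending to 0, and Fatou's lemma concludes. A
    reflection of the same kind gives Bobylev's identity. The angular integrals converge because
    [sin^r + cos^r - 1] at the half angle dominates [min(sin, cos)^r / 4], so that finiteness of
    [kappa] integrates the energy estimate. The angle [pi] is removed beforehand: the integrand of
    [kappa] vanishes there, so the angular measure may have an infinite atom, while on [(0, pi)] it
    is sigma-finite and Tonelli's theorem applies. *)

Section parameter_integrals.
Context d1 d2 (T1 : measurableType d1) (T2 : measurableType d2) (R : realType).
Variables (m1 : {sigma_finite_measure set T1 -> \bar R})
  (m2 : {sigma_finite_measure set T2 -> \bar R}).

Lemma measurable_integral_snd (f : T1 * T2 -> \bar R) :
  measurable_fun setT f -> (forall z, 0 <= f z)%E ->
  measurable_fun setT (fun x => \int[m2]_y f (x, y))%E.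
Proof. by move=> mf f0; exact: measurable_fun_fubini_tonelli_F. Qed.

Lemma measurable_integral_fst (f : T1 * T2 -> \bar R) :
  measurable_fun setT f -> (forall z, 0 <= f z)%E ->
  measurable_fun setT (fun y => \int[m1]_x f (x, y))%E.
Proof. by move=> mf f0; exact: measurable_fun_fubini_tonelli_G. Qed.

Lemma tonelli (f : T1 * T2 -> \bar R) :
  measurable_fun setT f -> (forall z, 0 <= f z)%E ->
  (\int[m1]_x \int[m2]_y f (x, y) = \int[m2]_y \int[m1]_x f (x, y))%E.
Proof. by move=> mf f0; exact: fubini_tonelli f mf f0. Qed.

Lemma tonelli_prod (f : T1 * T2 -> \bar R) :
  measurable_fun setT f -> (forall z, 0 <= f z)%E ->
  (\int[m1 \x m2]_z f z = \int[m1]_x \int[m2]_y f (x, y))%E.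
Proof. by move=> mf f0; exact: fubini_tonelli1 f mf f0. Qed.

Lemma ge0_integralZlT (f : T2 -> \bar R) (c : \bar R) :
  measurable_fun setT f -> (forall y, 0 <= f y)%E -> (0 <= c)%E ->
  (\int[m2]_y (c * f y) = c * \int[m2]_y f y)%E.
Proof. by move=> mf f0 c0; rewrite ge0_integralZl. Qed.

Lemma ge0_integralZrT (f : T2 -> \bar R) (c : \bar R) :
  measurable_fun setT f -> (forall y, 0 <= f y)%E -> (0 <= c)%E ->
  (\int[m2]_y (f y * c) = (\int[m2]_y f y) * c)%E.
Proof. by move=> mf f0 c0; rewrite ge0_integralZr. Qed.

(** The inner integral is the [fine] of a difference of two Tonelli integrals, hence measurable even
    at the points [x] where the section is not integrable and the value is a default. *)
Lemma measurable_Rintegral_snd (f : T1 * T2 -> R) :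
  measurable_fun setT f -> measurable_fun setT (fun x => \int[m2]_y f (x, y)).
Proof.
move=> mf; apply: measurableT_comp => //; under eq_fun do rewrite integralE.
have mEf : measurable_fun setT (EFin \o f) by exact/measurable_EFinP.
have mp := measurable_integral_snd (measurable_funepos mEf) (funepos_ge0 _).
have mn := measurable_integral_snd (measurable_funeneg mEf) (funeneg_ge0 _).
rewrite (_ : (fun x => _) = (fun x => \int[m2]_y (EFin \o f)^\+ (x, y) -
    \int[m2]_y (EFin \o f)^\- (x, y))%E); first exact: emeasurable_funB.
by apply/funext => x; congr (_ - _)%E; apply: eq_integral => y _; rewrite unlock.
Qed.

End parameter_integrals.

Section euclidean_norm.
Context (R : realType) (n : nat).
Implicit Types (x y z : 'rV[R]_n) (a c : R).

Lemma dotvC x y : dotv x y = dotv y x.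
Proof. by apply: eq_bigr => i _; rewrite mulrC. Qed.

Lemma dotvDl x y z : dotv (x + y) z = dotv x z + dotv y z.
Proof. by rewrite -big_split; apply: eq_bigr => i _; rewrite mxE mulrDl. Qed.

Lemma dotvZl a x y : dotv (a *: x) y = a * dotv x y.
Proof. by rewrite mulr_sumr; apply: eq_bigr => i _; rewrite mxE mulrA. Qed.

Lemma dotvDr x y z : dotv x (y + z) = dotv x y + dotv x z.
Proof. by rewrite dotvC dotvDl !(dotvC _ x). Qed.

Lemma dotvZr a x y : dotv x (a *: y) = a * dotv x y.
Proof. by rewrite dotvC dotvZl dotvC. Qed.

Lemma dotvNl x y : dotv (- x) y = - dotv x y.
Proof. by rewrite -scaleN1r dotvZl mulN1r. Qed.

Lemma dotvNr x y : dotv x (- y) = - dotv x y.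
Proof. by rewrite dotvC dotvNl dotvC. Qed.

Lemma dotvBl x y z : dotv (x - y) z = dotv x z - dotv y z.
Proof. by rewrite dotvDl dotvNl. Qed.

Lemma dotvBr x y z : dotv x (y - z) = dotv x y - dotv x z.
Proof. by rewrite dotvDr dotvNr. Qed.

Lemma dotv0l x : dotv 0 x = 0.
Proof. by rewrite -(scale0r 0) dotvZl mul0r. Qed.

Lemma dotv0r x : dotv x 0 = 0.
Proof. by rewrite dotvC dotv0l. Qed.

Lemma dotvv_ge0 x : 0 <= dotv x x.
Proof. by apply: sumr_ge0 => i _; rewrite -expr2 sqr_ge0. Qed.

Lemma enorm_ge0 x : 0 <= enorm x. Proof. exact: sqrtr_ge0. Qed.

Lemma sqr_enorm x : enorm x ^+ 2 = dotv x x.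
Proof. by rewrite sqr_sqrtr// dotvv_ge0. Qed.

Lemma normr_coord_le x i : `|x 0 i| <= enorm x.
Proof.
rewrite -(ler_pXn2r (n := 2))// ?nnegrE// ?enorm_ge0// sqr_enorm real_normK ?num_real//.
by rewrite /dotv (bigD1 i)//= -expr2 lerDl sumr_ge0// => j _; rewrite -expr2 sqr_ge0.
Qed.

Lemma enorm_eq0 x : (enorm x == 0) = (x == 0).
Proof.
apply/eqP/eqP => [h|->]; last by rewrite /enorm dotv0l sqrtr0.
apply/rowP => i; apply/eqP; rewrite mxE -normr_le0 -h; exact: normr_coord_le.
Qed.

Lemma enorm0 : enorm (0 : 'rV[R]_n) = 0.
Proof. by apply/eqP; rewrite enorm_eq0. Qed.

Lemma enorm_gt0 x : (0 < enorm x) = (x != 0).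
Proof. by rewrite lt_neqAle enorm_ge0 andbT eq_sym enorm_eq0. Qed.

Lemma enormZ a x : enorm (a *: x) = `|a| * enorm x.
Proof. by rewrite /enorm dotvZl dotvZr mulrA -expr2 sqrtrM ?sqr_ge0// sqrtr_sqr. Qed.

Lemma enormN x : enorm (- x) = enorm x.
Proof. by rewrite -scaleN1r enormZ normrN1 mul1r. Qed.

Lemma enormC x y : enorm (x - y) = enorm (y - x).
Proof. by rewrite -enormN opprB. Qed.

Lemma dotv_CS x y : `|dotv x y| <= enorm x * enorm y.
Proof.
have [->|y0] := eqVneq y 0; first by rewrite dotv0r normr0 mulr_ge0// enorm_ge0.
rewrite -(ler_pXn2r (n := 2))// ?nnegrE ?mulr_ge0 ?enorm_ge0//.
rewrite exprMn !sqr_enorm real_normK ?num_real//.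
have yy : 0 < dotv y y by rewrite -sqr_enorm exprn_gt0// enorm_gt0.
(* This vector is [dotv y y] times the component of [x] orthogonal to [y]; its squared norm is
   [dotv y y] times the Cauchy-Schwarz defect. *)
have := dotvv_ge0 (dotv y y *: x - dotv x y *: y).
rewrite dotvBl !dotvBr !dotvZl !dotvZr (dotvC y x) => h.
rewrite -subr_ge0 -(pmulr_rge0 _ yy).
by apply: le_trans h _; rewrite le_eqVlt; apply/orP; left; apply/eqP; ring.
Qed.

Lemma enorm_triangle x y : enorm (x + y) <= enorm x + enorm y.
Proof.
rewrite -(ler_pXn2r (n := 2))// ?nnegrE ?addr_ge0 ?enorm_ge0//.
rewrite sqr_enorm dotvDl !dotvDr (dotvC y x) sqrrD !sqr_enorm.
have := le_trans (ler_norm _) (dotv_CS x y); lra.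
Qed.

Lemma enorm_sub_ge x y : enorm x - enorm y <= enorm (x - y).
Proof. by have := enorm_triangle (x - y) y; rewrite subrK; lra. Qed.

Lemma sqr_enormB x y : enorm (x - y) ^+ 2 = dotv x x - 2 * dotv x y + dotv y y.
Proof. by rewrite sqr_enorm dotvBl !dotvBr (dotvC y x); ring. Qed.

Lemma unitvE x : x = enorm x *: unitv x.
Proof.
have [->|x0] := eqVneq x 0; first by rewrite enorm0 scale0r.
by rewrite scalerA divff ?scale1r// enorm_eq0.
Qed.

Lemma enorm_unitv x : x != 0 -> enorm (unitv x) = 1.
Proof.
by move=> x0; rewrite enormZ ger0_norm ?invr_ge0 ?enorm_ge0// mulVf// enorm_eq0.
Qed.

End euclidean_norm.

Section lebesgue_line.
Context (R : realType).
Local Notation leb1 := (@lebesgue_measure R).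

(** Lebesgue measure is determined by its values on half-open intervals, which the pushforward by
    the shift preserves. *)
Lemma lebesgue_shift (b : R) (f : measurableTypeR R -> \bar R) :
  measurable_fun setT f -> (forall x, 0 <= f x)%E ->
  (\int[leb1]_t f (t + b)%R = \int[leb1]_t f t)%E.
Proof.
move=> mf f0.
have mshift : @measurable_fun _ _ (measurableTypeR R) (measurableTypeR R) setT (fun t => t + b : measurableTypeR R).
  exact: measurable_funD.
transitivity (\int[pushforward_measure leb1 mshift]_t f t)%E.
  by rewrite (ge0_integral_pushforward mshift)// => y _; exact: f0.
apply: eq_measure_integral => A mA _.
apply/esym; apply: lebesgue_measure_unique => // X -[[x y] /= _ <-].
rewrite /pushforward (_ : _ @^-1` _ = `]x - b, y - b]%classic); last first.
  by apply/seteqP; split => t /=; rewrite !in_itv/= ltrBlDr lerBrDr.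
rewrite !lebesgue_measure_itv/= !lte_fin ltrD2r.
by case: ifP => // _; rewrite -!EFinB; congr (_%:E); lra.
Qed.

Lemma lebesgue_dilate (c : R) (f : measurableTypeR R -> \bar R) : 0 < c ->
  measurable_fun setT f -> (forall x, 0 <= f x)%E ->
  (\int[leb1]_t f (c * t)%R = c^-1%:E * \int[leb1]_t f t)%E.
Proof.
move=> c0 mf f0.
have mdil : @measurable_fun _ _ (measurableTypeR R) (measurableTypeR R) setT (fun t => c * t : measurableTypeR R).
  exact: measurable_funM.
have c'0 : 0 <= c by apply: ltW.
transitivity (c^-1%:E * (c%:E * \int[pushforward_measure leb1 mdil]_t f t))%E.
  rewrite muleA -EFinM mulVf ?gt_eqF// mul1e.
  by rewrite (ge0_integral_pushforward mdil)// => y _; exact: f0.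
congr (_ * _)%E.
rewrite -(@ge0_integral_mscale _ _ _ _ _ _ (NngNum c'0))//.
apply: eq_measure_integral => A mA _.
apply/esym; apply: lebesgue_measure_unique => // X -[[x y] /= _ <-].
rewrite /mscale/= /pushforward (_ : _ @^-1` _ = `]x / c, y / c]%classic); last first.
  by apply/seteqP; split => t /=; rewrite !in_itv/= ltr_pdivrMr// ler_pdivlMr// mulrC.
rewrite !lebesgue_measure_itv/= !lte_fin ltr_pM2r ?invr_gt0//.
case: ifP => // _; last by rewrite mule0.
by rewrite -!EFinB -EFinM; congr (_%:E); field; rewrite gt_eqF.
Qed.

End lebesgue_line.

Section lebesgue_space.
Context (R : realType).
Local Notation leb1 := (@lebesgue_measure R).
Local Notation V n := 'rV[R]_n.

Lemma cons_rV_lshift n (p : V n * measurableTypeR R) (j : 'I_1) :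
  cons_rV p 0 (lshift n j) = p.2.
Proof. by apply: etrans (row_mxEl _ _ _ _) _; rewrite mxE ord1 eqxx. Qed.

Lemma cons_rV_rshift n (p : V n * measurableTypeR R) (j : 'I_n) :
  cons_rV p 0 (rshift 1 j) = p.1 0 j.
Proof. exact: row_mxEr. Qed.

(** Cubes exhaust the space by sets whose measure follows from the recursive definition of
    [lebesgue_rV]; the unit ball is compared with them to see that its volume is positive and
    finite. *)
Definition cube n (c : R) : set (V n) := [set x | forall i, `|x 0 i| <= c].

Lemma measurable_cube n c : measurable (@cube n c).
Proof.
rewrite (_ : cube c = \bigcap_(i in [set: 'I_n]) ((fun x : V n => x 0 i) @^-1` `[- c, c])).
  apply: fin_bigcap_measurable => // i _; rewrite -[X in measurable X]setTI.
  exact: measurable_coord.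
apply/seteqP; split => x h i.
  by move=> _ /=; rewrite in_itv/= -ler_norml.
by have := h i Logic.I; rewrite /= in_itv/= -ler_norml.
Qed.

Lemma lebesgue_rV_cube n c : 0 <= c -> lebesgue_rV R n (cube c) = ((2 * c) ^+ n)%:E.
Proof.
move=> c0; elim: n => [|n IH].
  by rewrite /= diracE mem_set// => -[].
rewrite /= /pushforward.
rewrite (_ : _ @^-1` _ = cube c `*` `[- c, c]%classic); last first.
  apply/seteqP; split => -[x t] /=.
    move=> h; split.
      move=> i; have := h (rshift 1 i).
      by rewrite cons_rV_rshift.
    have := h (lshift n (ord0 : 'I_1)).
    by rewrite cons_rV_lshift in_itv/= -ler_norml.
  move=> [hx]; rewrite in_itv/= -ler_norml => ht i.
  case: (split_ordP (i : 'I_(1 + n))) => j ->.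
    by rewrite cons_rV_lshift.
  by rewrite cons_rV_rshift; exact: hx.
rewrite product_measure1E//=; last exact: measurable_cube.
rewrite IH lebesgue_measure_itv/= lte_fin.
case: ifPn => [_|].
  by rewrite -EFinB -EFinM exprS mulrC; congr (_ * _)%:E; lra.
rewrite -leNgt => cc; have -> : c = 0 by lra.
by rewrite mulr0 mule0 expr0n.
Qed.

Lemma lebesgue_rV_sigma_finite n : sigma_finite setT (lebesgue_rV R n).
Proof.
exists (fun k => cube k%:R).
  apply/esym; rewrite -subTset => x _.
  (* An integer above all coordinates: the sum of their truncations dominates each of them. *)
  exists (\sum_i Num.truncn `|x 0%R i|%R).+1 => // i /=.
  have /andP[_ /ltW/le_trans->//] := truncn_itv (normr_ge0 (x 0 i)).
  by rewrite ler_nat ltnS (bigD1 i)//= leq_addr.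
by move=> k; split; [exact: measurable_cube|rewrite lebesgue_rV_cube// ltry].
Qed.

(* The library's Fubini-Tonelli needs a sigma-finite instance, which the
   fixpoint [lebesgue_rV] does not carry. *)
Definition lebV n : set (V n) -> \bar R := lebesgue_rV R n.
Arguments lebV : clear implicits.
HB.instance Definition _ n := Measure.copy (lebV n) (lebesgue_rV R n).
HB.instance Definition _ n :=
  Measure_isSigmaFinite.Build _ _ _ (lebV n) (lebesgue_rV_sigma_finite n).

Lemma integral_lebVE n D (f : V n -> \bar R) :
  (\int[lebesgue_rV R n]_(x in D) f x = \int[lebV n]_(x in D) f x)%E.
Proof. by []. Qed.

Lemma integral_lebVS n (f : V n.+1 -> \bar R) :
  measurable_fun setT f -> (forall x, 0 <= f x)%E ->
  (\int[lebV n.+1]_x f x =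
   \int[lebV n]_y \int[leb1]_t f (cons_rV (y, t)))%E.
Proof.
move=> mf f0.
transitivity (\int[pushforward_measure (lebV n \x leb1)%E
  (@measurable_cons_rV R n)]_x f x)%E; first by [].
rewrite (ge0_integral_pushforward (@measurable_cons_rV R n))//.
  rewrite fubini_tonelli1//=.
  exact: measurableT_comp (@measurable_cons_rV R n).
Qed.

Lemma lebV_shift n (b : V n) (f : V n -> \bar R) :
  measurable_fun setT f -> (forall x, 0 <= f x)%E ->
  (\int[lebV n]_x f (x + b)%R = \int[lebV n]_x f x)%E.
Proof.
elim: n b f => [|n IH] b f mf f0.
  by apply: eq_integral => x _; congr f; apply/rowP => -[].
have mfb : measurable_fun setT (fun x : V _ => f (x + b)).
  by apply: measurableT_comp => //; exact: measurable_addv.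
have mfc := measurableT_comp mf (@measurable_cons_rV R n).
rewrite (integral_lebVS mfb (fun x => f0 _)) (integral_lebVS mf f0).
pose b1 := b 0 (lshift n (ord0 : 'I_1)).
pose b2 : V n := \row_j b 0 (rshift 1 j).
have E y t : cons_rV (y, t) + b = cons_rV (y + b2, t + b1).
  apply/rowP => i; rewrite mxE.
  case: (split_ordP (i : 'I_(1 + n))) => j ->.
    by rewrite !cons_rV_lshift/= /b1 ord1.
  by rewrite !cons_rV_rshift/= !mxE.
transitivity (\int[lebV n]_y \int[leb1]_t f (cons_rV ((y + b2)%R, t)))%E.
  apply: eq_integral => y _; under eq_integral do rewrite E.
  apply: (lebesgue_shift b1 (f := fun t => f (cons_rV (y + b2, t)))) => //.
  exact: (measurableT_comp mfc (pair1_measurable _)).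
rewrite (IH b2 (fun y => \int[leb1]_t f (cons_rV (y, t)))%E)//.
- exact: (measurable_integral_snd leb1 mfc (fun z => f0 _)).
- by move=> y; exact: integral_ge0.
Qed.

Lemma lebV_dilate n c (f : V n -> \bar R) : 0 < c ->
  measurable_fun setT f -> (forall x, 0 <= f x)%E ->
  (\int[lebV n]_x f (c *: x)%R = (c ^- n)%:E * \int[lebV n]_x f x)%E.
Proof.
move=> c0; elim: n f => [|n IH] f mf f0.
  rewrite expr0 invr1 mul1e.
  by apply: eq_integral => x _; congr f; apply/rowP => -[].
have mfb : measurable_fun setT (fun x : V _ => f (c *: x)).
  by apply: measurableT_comp => //; exact: measurable_scalev.
have mfc := measurableT_comp mf (@measurable_cons_rV R n).
rewrite (integral_lebVS mfb (fun x => f0 _)) (integral_lebVS mf f0).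
have E (y : V n) t : c *: cons_rV (y, t) = cons_rV (c *: y, c * t).
  apply/rowP => i; rewrite mxE.
  case: (split_ordP (i : 'I_(1 + n))) => j ->.
    by rewrite !cons_rV_lshift.
  by rewrite !cons_rV_rshift/= !mxE.
transitivity (\int[lebV n]_y (c^-1%:E * \int[leb1]_t f (cons_rV ((c *: y)%R, t))))%E.
  apply: eq_integral => y _; under eq_integral do rewrite E.
  apply: (lebesgue_dilate (f := fun t => f (cons_rV (c *: y, t)))) => //.
  exact: (measurableT_comp mfc (pair1_measurable _)).
have mF : measurable_fun setT (fun y => \int[leb1]_t f (cons_rV (y, t)))%E.
  exact: (measurable_integral_snd leb1 mfc (fun z => f0 _)).
have F0 y : (0 <= \int[leb1]_t f (cons_rV (y, t)))%E by exact: integral_ge0.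
rewrite ge0_integralZl; first 1 last.
- exact: measurableT.
- by apply: measurableT_comp mF _; exact: measurable_scalev.
- by move=> y _; exact: F0.
- by rewrite lee_fin invr_ge0 ltW.
by rewrite (IH _ mF F0) muleA -EFinM exprS invfM.
Qed.

Lemma unit_ball_sub_cube n : @unit_ball R n `<=` cube 1.
Proof. by move=> x; rewrite /unit_ball /= => x1 i; exact: le_trans (normr_coord_le x i) x1. Qed.

(** With [n] coordinates of size at most [1/(n+1)], the squared norm is at most [n/(n+1)]; the
    successor also covers dimension 0. *)
Lemma cube_sub_unit_ball n : cube n.+1%:R^-1 `<=` @unit_ball R n.
Proof.
move=> x h; rewrite /unit_ball /= -(ler_pXn2r (n := 2))// ?nnegrE ?enorm_ge0//.
rewrite sqr_enorm expr1n (@le_trans _ _ (\sum_(i < n) n.+1%:R^-1))//.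
  apply: ler_sum => i _; rewrite -expr2 -real_normK ?num_real//.
  apply: (@le_trans _ _ (n.+1%:R^-1 ^+ 2)).
    by rewrite ler_pXn2r// ?nnegrE// ?invr_ge0// ?ler0n//; exact: h.
  by rewrite expr2 ler_piMr ?invr_ge0 ?ler0n// invf_le1 ?ltr0n// ler1n.
rewrite sumr_const card_ord -[leLHS]mulr_natl ler_pdivrMr ?ltr0n// mul1r ler_nat.
exact: leqnSn.
Qed.

Lemma lebV_unit_ball_lty n : (lebV n (@unit_ball R n) < +oo)%E.
Proof.
apply: (@le_lt_trans _ _ (lebV n (cube 1))).
  by apply: le_measure; rewrite ?inE;
    [exact: measurable_unit_ball|exact: measurable_cube|exact: unit_ball_sub_cube].
by rewrite /lebV lebesgue_rV_cube// ltry.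
Qed.

Lemma lebV_unit_ball_gt0 n : (0 < lebV n (@unit_ball R n))%E.
Proof.
apply: (@lt_le_trans _ _ (lebV n (cube n.+1%:R^-1))).
  by rewrite /lebV lebesgue_rV_cube ?invr_ge0// lte_fin exprn_gt0// mulr_gt0// invr_gt0.
by apply: le_measure; rewrite ?inE;
  [exact: measurable_cube|exact: measurable_unit_ball|exact: cube_sub_unit_ball].
Qed.

(* The measure [f |-> \int f (L x) dx] is translation invariant; a translation
   invariant measure is proportional to Lebesgue measure by Tonelli's theorem
   applied to [f (L x) * g (y + L x)]. *)
Lemma lebV_haar n (L : V n -> V n) (f g : V n -> \bar R) :
  (forall x y, L (x + y) = L x + L y) -> involutive L -> measurable_fun setT L ->
  measurable_fun setT f -> (forall x, 0 <= f x)%E ->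
  measurable_fun setT g -> (forall x, 0 <= g x)%E ->
  ((\int[lebV n]_x f (L x)) * \int[lebV n]_y g y =
   (\int[lebV n]_x g (L x)) * \int[lebV n]_y f (- y)%R)%E.
Proof.
move=> LD LK mL mf f0 mg g0.
have mfL : measurable_fun setT (fun x => f (L x)) by exact: measurableT_comp.
have mgL : measurable_fun setT (fun x => g (L x)) by exact: measurableT_comp.
have mfN : measurable_fun setT (fun x : V n => f (- x)).
  by apply: measurableT_comp => //; exact: measurable_oppv.
have mLf : measurable_fun setT (fun z : V n * V n => L z.1).
  exact: (measurableT_comp mL measurable_fst).
transitivity (\int[lebV n]_x \int[lebV n]_y (f (L x) * g (y + L x)%R))%E.
  rewrite -(ge0_integralZrT (lebV n) mfL (fun x => f0 _)); last first.
    by apply: integral_ge0 => x _; exact: g0.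
  apply: eq_integral => x _.
  rewrite (ge0_integralZlT (lebV n) _ (fun y => g0 _) (f0 _)); last first.
    by apply: measurableT_comp mg _; exact: measurable_addv.
  by rewrite (lebV_shift (L x) mg).
pose h (z : V n * V n) := (f (L z.1) * g (z.2 + L z.1)%R)%E.
have mh : measurable_fun setT h.
  apply: emeasurable_funM; first exact: measurableT_comp mf mLf.
  by apply: measurableT_comp => //; exact: measurable_addv.
have h0 z : (0 <= h z)%E by exact: mule_ge0.
rewrite (tonelli (lebV n) (lebV n) mh h0).
pose k (z : V n * V n) := (f (L z.1 - z.2)%R * g (L z.1))%E.
have mk : measurable_fun setT k.
  apply: emeasurable_funM; last exact: measurableT_comp mg mLf.
  apply: measurableT_comp => //; apply: measurable_addv => //.
  exact: measurable_oppv.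
have k0 z : (0 <= k z)%E by exact: mule_ge0.
transitivity (\int[lebV n]_y \int[lebV n]_x k (x, y))%E.
  apply: eq_integral => y _.
  (* The translation from [x] to [x - L y] replaces [L x] by [L x - y], as [L] is additive and
     involutive. *)
  rewrite -(lebV_shift (- L y) (f := fun x => h (x, y)))//.
    apply: eq_integral => x _; rewrite /h /k/= LD.
    have -> : L (- L y) = - y.
      apply/eqP; rewrite -subr_eq0 opprK -{2}(LK y) -LD addrC subrr.
      by apply/eqP; apply: (addrI (L 0)); rewrite -LD !addr0.
    by rewrite addrCA subrr addr0.
  exact: (measurableT_comp mh (pair2_measurable _)).
rewrite -(tonelli (lebV n) (lebV n) mk k0).
rewrite -(ge0_integralZrT (lebV n) mgL (fun x => g0 _)); last first.
  by apply: integral_ge0 => x _; exact: f0.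
apply: eq_integral => x _; rewrite /k/=.
rewrite (ge0_integralZrT (lebV n) _ (fun y => f0 _) (g0 _)); last first.
  apply: measurableT_comp mf _; apply: measurable_addv => //.
  exact: measurable_oppv.
rewrite muleC; congr (_ * _)%E.
rewrite -(lebV_shift (L x) (f := fun y => f (L x - y)))//.
  by apply: eq_integral => y _; rewrite opprD addrCA subrr addr0.
apply: measurableT_comp => //; apply: measurable_addv => //.
exact: measurable_oppv.
Qed.

(** The unit ball is invariant under [L], so with its indicator as [g] the identity [lebV_haar] has
    the same right-hand side for [L] and for the identity map; the volume of the ball, positive and
    finite, cancels. *)
Lemma lebV_isometry n (L : V n -> V n) (f : V n -> \bar R) :
  (forall x y, L (x + y) = L x + L y) -> involutive L -> measurable_fun setT L ->
  (forall x, enorm (L x) = enorm x) ->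
  measurable_fun setT f -> (forall x, 0 <= f x)%E ->
  (\int[lebV n]_x f (L x) = \int[lebV n]_x f x)%E.
Proof.
move=> LD LK mL LN mf f0.
pose g (x : V n) : \bar R := (\1_(@unit_ball R n) x)%:E.
have mg : measurable_fun setT g.
  by apply/measurable_EFinP; apply: measurable_indic; exact: measurable_unit_ball.
have g0 x : (0 <= g x)%E by rewrite lee_fin.
have gE : (\int[lebV n]_x g x)%E = lebV n (@unit_ball R n).
  by rewrite integral_indic ?setIT//; exact: measurable_unit_ball.
have := lebV_haar LD LK mL mf f0 mg g0.
have -> : (\int[lebV n]_x g (L x))%E = lebV n (@unit_ball R n).
  rewrite -gE; apply: eq_integral => x _; rewrite /g !indicE.
  by rewrite (_ : (L x \in _) = (x \in @unit_ball R n))//; apply/idP/idP;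
    rewrite !inE /unit_ball/= LN.
have := @lebV_haar n id f g (fun _ _ => erefl) (fun _ => erefl)
  (@measurable_id _ _ setT) mf f0 mg g0.
rewrite gE => h1 h2; move: h1; rewrite -h2.
have := lebV_unit_ball_gt0 n; have := lebV_unit_ball_lty n.
case: (lebV n _) => // b _; rewrite lte_fin => b0 h.
have bK (a : \bar R) : (a = a * b%:E * b^-1%:E)%E.
  by rewrite -muleA -EFinM divff ?mule1// gt_eqF.
by rewrite [LHS]bK [RHS]bK h.
Qed.

End lebesgue_space.

Arguments lebV : clear implicits.

(** * Random directions on a cone *)

Section reflections.
Context (R : realType) (n : nat).
Implicit Types (x y f : 'rV[R]_n).

(** The reflection in the hyperplane orthogonal to [f]. As [0^-1 = 0], it is the identity for
    [f = 0], so that [reflect_swap] also covers equal vectors. *)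
Definition reflect f y : 'rV[R]_n := y - (2 * dotv y f / dotv f f) *: f.

Lemma dotvv_gt0 f : f != 0 -> 0 < dotv f f.
Proof. by move=> f0; rewrite -sqr_enorm exprn_gt0// enorm_gt0. Qed.

Lemma reflect0 y : reflect 0 y = y.
Proof. by rewrite /reflect scaler0 subr0. Qed.

Lemma reflectD f x y : reflect f (x + y) = reflect f x + reflect f y.
Proof.
by rewrite /reflect dotvDl mulrDr mulrDl scalerDl opprD addrACA.
Qed.

Lemma reflectZ f a y : reflect f (a *: y) = a *: reflect f y.
Proof. by rewrite /reflect dotvZl scalerBr scalerA; congr (_ - _ *: _); ring. Qed.

Lemma reflectN f y : reflect f (- y) = - reflect f y.
Proof. by rewrite -scaleN1r reflectZ scaleN1r. Qed.

Lemma dotv_reflect f x y : dotv (reflect f x) (reflect f y) = dotv x y.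
Proof.
have [->|f0] := eqVneq f 0; first by rewrite !reflect0.
rewrite /reflect dotvBl !dotvBr !dotvZl !dotvZr (dotvC f y).
by field; rewrite gt_eqF// dotvv_gt0.
Qed.

Lemma reflectK f : involutive (reflect f).
Proof.
move=> y; have [->|f0] := eqVneq f 0; first by rewrite !reflect0.
rewrite /reflect dotvBl dotvZl -!addrA -opprD -scalerDl.
rewrite (_ : dotv y f - _ * _ = - dotv y f); first by
  rewrite mulrN mulNr subrr scale0r subr0.
by field; rewrite gt_eqF// dotvv_gt0.
Qed.

Lemma enorm_reflect f y : enorm (reflect f y) = enorm y.
Proof. by rewrite /enorm dotv_reflect. Qed.

Lemma unitv_reflect f y : unitv (reflect f y) = reflect f (unitv y).
Proof. by rewrite /unitv enorm_reflect reflectZ. Qed.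

Lemma reflect_swap x y : enorm x = enorm y -> reflect (x - y) x = y.
Proof.
move=> xy; have [->|/eqP xNy] := eqVneq x y; first by rewrite subrr reflect0.
have d0 : dotv (x - y) (x - y) != 0.
  by rewrite gt_eqF// dotvv_gt0// subr_eq0; apply/eqP.
rewrite /reflect; have -> : 2 * dotv x (x - y) = dotv (x - y) (x - y).
  have : dotv x x = dotv y y by rewrite -!sqr_enorm xy.
  by rewrite !dotvBr !dotvBl (dotvC y x) => ->; ring.
by rewrite divff// scale1r opprB addrC subrK.
Qed.

Lemma reflect_swapr x y : enorm x = enorm y -> reflect (x - y) y = x.
Proof. by move=> xy; rewrite -{2}(reflect_swap xy) reflectK. Qed.

Lemma measurable_reflect f : measurable_fun setT (reflect f).
Proof.
apply: measurable_addv => //; apply: measurable_oppv; apply: measurable_scalev => //.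
apply: measurable_funM => //; apply: measurable_funM => //.
exact: measurable_dotv.
Qed.

Lemma reflect_cone_point f e theta x :
  reflect f (cone_point e theta x) = cone_point (reflect f e) theta (reflect f x).
Proof.
rewrite /cone_point reflectD (reflectZ _ (cos _)) (reflectZ _ (sin _)).
rewrite -unitv_reflect reflectD reflectN reflectZ.
by rewrite dotv_reflect.
Qed.

Lemma dotv_cone_point e theta x : enorm e = 1 ->
  dotv e (cone_point e theta x) = cos theta.
Proof.
move=> e1; have ee : dotv e e = 1 by rewrite -sqr_enorm e1 expr1n.
rewrite /cone_point dotvDr !dotvZr ee mulr1 dotvBr dotvZr ee.
by rewrite (dotvC e x) mulr1 subrr !mulr0 addr0.
Qed.

Lemma enorm_cone_point e theta x : enorm e = 1 -> x - dotv x e *: e != 0 ->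
  enorm (cone_point e theta x) = 1.
Proof.
move=> e1 x0; have ee : dotv e e = 1 by rewrite -sqr_enorm e1 expr1n.
set u := unitv (x - dotv x e *: e).
have eu : dotv e u = 0.
  by rewrite /u dotvZr dotvBr dotvZr ee (dotvC e x) mulr1 subrr mulr0.
have uu : dotv u u = 1 by rewrite -sqr_enorm enorm_unitv// expr1n.
rewrite /cone_point -/u; clearbody u; rewrite /enorm dotvDl !dotvDr !dotvZl !dotvZr (dotvC u e) ee uu eu.
by rewrite !mulr0 addr0 add0r !mulr1 -!expr2 cos2Dsin2 sqrtr1.
Qed.

End reflections.

(** Each line in the first direction meets the hyperplane in one point, so Tonelli's theorem gives
    0. *)
Lemma lebV_hyperplane0 (R : realType) n :
  lebV R n.+1 [set x : 'rV[R]_n.+1 | x 0 (lshift n (ord0 : 'I_1)) = 0] = 0%E.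
Proof.
set H : set 'rV[R]_n.+1 := [set x | _].
have mH : measurable H.
  rewrite -[X in measurable X]setTI; apply: measurable_coord _ _ _ [set 0] _ => //.
rewrite -[LHS]mul1e -integral_cst// integral_mkcond integral_lebVS; last 2 first.
- by apply/measurable_restrict => //; exact: measurableI.
- by move=> x; rewrite patchE; case: ifP.
apply: integral0_eq => y _.
transitivity (\int[@lebesgue_measure R]_(t in [set 0%R]) (cst 1%E) t)%E; last first.
  by rewrite integral_set1.
rewrite [RHS]integral_mkcond; apply: eq_integral => t _; rewrite !patchE.
by rewrite (_ : (_ \in H) = (t \in [set 0]))//; apply/idP/idP; rewrite !inE /H/= cons_rV_lshift.
Qed.

Section uniform_on_ball.
Context (R : realType).
Local Notation V n := 'rV[R]_n.
Local Notation U n := (uniform_ball R n).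

Lemma uniform_ballE n (A : set (V n)) : measurable A ->
  U n A = ((fine (lebV R n (@unit_ball R n)))^-1%:E * lebV R n (A `&` @unit_ball R n))%E.
Proof.
move=> mA; transitivity (mnormalize (mrestr (lebesgue_rV R n)
  (@measurable_unit_ball R n)) (dirac (0 : V n)) A); first by [].
have := lebV_unit_ball_gt0 R n; have := lebV_unit_ball_lty R n; rewrite /lebV => h1 h2.
have E : mrestr (lebesgue_rV R n) (@measurable_unit_ball R n) setT =
  lebesgue_rV R n (@unit_ball R n) by rewrite /mrestr setTI.
rewrite /mnormalize; case: ifPn => [/orP[] /eqP h|_].
- by move: h2; rewrite -E [X in (_ < X)%E]h ltxx.
- by move: h1; rewrite -E [X in (X < _)%E]h ltxx.
- by rewrite muleC; congr ((fine _)^-1%:E * _)%E; exact: E.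
Qed.

Lemma uniform_ball_reflect n (f : V n) (A : set (V n)) : measurable A ->
  U n (reflect f @^-1` A) = U n A.
Proof.
move=> mA; have mr := measurable_reflect f.
rewrite !uniform_ballE//; last by rewrite -[X in measurable X]setTI; exact: mr.
congr (_ * _)%E.
have mI : measurable (A `&` @unit_ball R n).
  by apply: measurableI => //; exact: measurable_unit_ball.
have mI' : measurable (reflect f @^-1` (A `&` @unit_ball R n)).
  by rewrite -[X in measurable X]setTI; exact: mr.
rewrite (_ : _ `&` _ = reflect f @^-1` (A `&` @unit_ball R n)); last first.
  by apply/seteqP; split => x /=; rewrite /unit_ball/= enorm_reflect.
rewrite -[LHS]mul1e -[RHS]mul1e -!integral_cst// integral_mkcond [RHS]integral_mkcond.
rewrite -[RHS](lebV_isometry (L := reflect f)) //.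
- by move=> x y; exact: reflectD.
- exact: reflectK.
- by move=> x; exact: enorm_reflect.
- by apply/measurable_restrict => //; exact: measurableI.
- by move=> x; rewrite patchE; case: ifP.
Qed.

Lemma integral_uniform_ball_reflect n (g : V n) (f : V n -> \bar R) :
  measurable_fun setT f ->
  (\int[U n]_x f (reflect g x) = \int[U n]_x f x)%E.
Proof.
have pos (h : V n -> \bar R) : measurable_fun setT h -> (forall x, 0 <= h x)%E ->
    (\int[U n]_x h (reflect g x) = \int[U n]_x h x)%E.
  move=> mh h0.
  transitivity (\int[pushforward_measure (U n) (measurable_reflect g)]_x h x)%E.
    by rewrite (ge0_integral_pushforward (measurable_reflect g)).
  by apply: eq_measure_integral => A mA _; exact: uniform_ball_reflect.
move=> mf; rewrite integralE [RHS]integralE; congr (_ - _)%E.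
  rewrite -(pos _ (measurable_funepos mf) (funepos_ge0 _)).
  by apply: eq_integral => x _; rewrite unlock.
rewrite -(pos _ (measurable_funeneg mf) (funeneg_ge0 _)).
by apply: eq_integral => x _; rewrite unlock.
Qed.

Lemma measurable_cone_point d (T : measurableType d) n (e x : T -> V n) (t : T -> R) :
  measurable_fun setT e -> measurable_fun setT t -> measurable_fun setT x ->
  measurable_fun setT (fun z => cone_point (e z) (t z) (x z)).
Proof.
move=> me mt mx.
have mcos : measurable_fun setT (@cos R).
  by apply: continuous_measurable_fun; exact: continuous_cos.
have msin : measurable_fun setT (@sin R).
  by apply: continuous_measurable_fun; exact: continuous_sin.
apply: measurable_addv; apply: measurable_scalev.
- exact: measurableT_comp mcos mt.
- by [].
- exact: measurableT_comp msin mt.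
- apply: measurable_unitv; apply: measurable_addv => //.
  by apply: measurable_oppv; apply: measurable_scalev => //; exact: measurable_dotv.
Qed.

(* The reflection exchanging the directions of [a] and [b] preserves the law of [x]. *)
Lemma cone_point_swap n (a b : V n) theta (phi : R -> \bar R) :
  measurable_fun setT phi ->
  (\int[U n]_x phi (enorm b * dotv a (cone_point (unitv b) theta x))%R =
   \int[U n]_x phi (enorm a * dotv b (cone_point (unitv a) theta x))%R)%E.
Proof.
move=> mphi.
have [->|a0] := eqVneq a 0.
  by rewrite enorm0; apply: eq_integral => x _; rewrite dotv0l mulr0 mul0r.
have [->|b0] := eqVneq b 0.
  by rewrite enorm0; apply: eq_integral => x _; rewrite dotv0l mulr0 mul0r.
set f := unitv a - unitv b.
have nab : enorm (unitv a) = enorm (unitv b) by rewrite !enorm_unitv.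
rewrite -[RHS](integral_uniform_ball_reflect f); last first.
  apply: measurableT_comp => //; apply: measurable_funM => //.
  by apply: measurable_dotv => //; exact: measurable_cone_point.
apply: eq_integral => x _; congr phi.
have E : dotv (unitv a) (cone_point (unitv b) theta x) =
    dotv (unitv b) (cone_point (unitv a) theta (reflect f x)).
  rewrite -(dotv_reflect f) reflect_cone_point.
  by rewrite /f (reflect_swap nab) (reflect_swapr nab).
have dE (c y : V n) : dotv c y = enorm c * dotv (unitv c) y.
  by rewrite -dotvZl -unitvE.
by rewrite (dE a) (dE b) E mulrCA.
Qed.

(** A reflection carries the line spanned by [e] to the second coordinate axis, which exists for
    [n >= 2] and lies in the null hyperplane where the first coordinate vanishes. *)
Lemma uniform_ball_line n (e : V n) : (1 < n)%N -> enorm e = 1 ->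
  U n [set x | x - dotv x e *: e = 0] = 0%E.
Proof.
case: n e => [//|[//|n]] e _ e1.
set L := [set x | _].
have mL : measurable L.
  rewrite (_ : L = setT `&` (fun x => enorm (x - dotv x e *: e)) @^-1` [set 0]).
    have mE : measurable_fun setT (fun x : V n.+2 => enorm (x - dotv x e *: e)).
      apply: measurable_enorm; apply: measurable_addv => //; apply: measurable_oppv.
      by apply: measurable_scalev => //; exact: measurable_dotv.
    exact: mE.
  rewrite setTI; apply/seteqP; split => x /=; first by rewrite /L/= => ->; rewrite enorm0.
  by move/eqP; rewrite enorm_eq0 => /eqP.
rewrite uniform_ballE//.
suff -> : lebV R n.+2 (L `&` @unit_ball R n.+2) = 0%E by rewrite mule0.
pose i1 : 'I_n.+2 := rshift 1 (ord0 : 'I_n.+1).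
pose e' : V n.+2 := delta_mx 0 i1.
have e'1 : enorm e' = enorm e.
  rewrite e1; apply/eqP; rewrite -(@eqrXn2 _ 2%N) ?enorm_ge0// expr1n sqr_enorm /dotv.
  rewrite (bigD1 i1)//= big1 ?addr0; first by rewrite !mxE !eqxx mulr1.
  by move=> j ji; rewrite !mxE (negbTE ji) mulr0.
set H : set (V n.+2) := [set x : V n.+2 | x 0 (lshift n.+1 (ord0 : 'I_1)) = 0].
have mH : measurable H.
  rewrite -[X in measurable X]setTI; apply: measurable_coord _ _ _ [set 0] _ => //.
have mr := measurable_reflect (e' - e).
have mH' : measurable (reflect (e' - e) @^-1` H).
  by rewrite -[X in measurable X]setTI; exact: mr.
apply/eqP; rewrite eq_le measure_ge0 andbT.
apply: (@le_trans _ _ (lebV R n.+2 (reflect (e' - e) @^-1` H))).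
  apply: le_measure; rewrite ?inE//.
    by apply: measurableI => //; exact: measurable_unit_ball.
  move=> x [Lx _]; move: Lx; rewrite /L/= => /eqP; rewrite subr_eq0 => /eqP ->.
  rewrite reflectZ reflect_swapr// /H/= !mxE eqxx.
  by rewrite (_ : (_ == i1) = false) ?mulr0//; apply/negbTE/eqP => /(congr1 val).
rewrite -[leLHS]mul1e -integral_cst// integral_mkcond.
rewrite (_ : patch _ _ _ = fun x => patch (fun=> 0%E) H (cst 1%E) (reflect (e' - e) x))//.
rewrite (lebV_isometry (L := reflect (e' - e))) //.
- rewrite -integral_mkcond integral_cst// mul1e le_eqVlt; apply/orP; left; apply/eqP.
  exact: lebV_hyperplane0.
- by move=> x y; exact: reflectD.
- exact: reflectK.
- by move=> x; exact: enorm_reflect.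
- by apply/measurable_restrict => //; exact: measurableI.
- by move=> x; rewrite patchE; case: ifP.
Qed.

(** The cone point can fail to be a unit vector only on the line of [e], where the normalized
    projection has the default value [unitv 0 = 0]. *)
Lemma ae_enorm_cone_point n (e : V n) theta : (1 < n)%N -> enorm e = 1 ->
  {ae U n, forall x, enorm (cone_point e theta x) = 1}.
Proof.
move=> n1 e1; exists [set x | x - dotv x e *: e = 0]; split.
- rewrite (_ : mkset _ = setT `&` (fun x => enorm (x - dotv x e *: e)) @^-1` [set 0]).
    have mE : measurable_fun setT (fun x : V n => enorm (x - dotv x e *: e)).
      apply: measurable_enorm; apply: measurable_addv => //; apply: measurable_oppv.
      by apply: measurable_scalev => //; exact: measurable_dotv.
    exact: mE.
  rewrite setTI; apply/seteqP; split => x /=; first by move=> ->; rewrite enorm0.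
  by move/eqP; rewrite enorm_eq0 => /eqP.
- exact: uniform_ball_line.
- move=> x /=; apply: contra_notP => /eqP x0; exact: enorm_cone_point.
Qed.

End uniform_on_ball.

(** * Means over cones of frequencies *)

Section fatou_bound.
Context (R : realType).

(** Testing against real numbers [a < y] covers infinite values of [y] as well. *)
Lemma limn_einf_ge (v : (\bar R)^nat) (y : \bar R) :
  (forall a : R, (a%:E < y)%E -> \forall m \near \oo, (a%:E <= v m)%E) ->
  (y <= limn_einf v)%E.
Proof.
move=> h; rewrite limn_einf_lim (cvg_lim _ (@cvg_einfs_sup R v))//.
rewrite leNgt; apply/negP => sy.
have key (a : R) : (a%:E < y)%E -> (a%:E <= ereal_sup (range (einfs v)))%E.
  move=> /h[N _ hN]; apply: (@le_trans _ _ (einfs v N)).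
    by apply: le_ereal_inf_tmp => _ [k /= Nk <-]; exact: hN.
  by apply: ereal_sup_ubound; exists N.
move: sy key; case: (ereal_sup _) => [s| |]; case: y h => [y| |] h //=.
- rewrite lte_fin => sy /(_ ((s + y) / 2)); rewrite lte_fin lee_fin.
  by move=> k; have := k _; rewrite midf_lt// => /(_ isT); rewrite leNgt midf_lt.
- by move=> _ /(_ (s + 1)); rewrite ltry lee_fin => /(_ isT); rewrite gerDl ler10.
- by move=> _ /(_ (y - 1)); rewrite lte_fin ltrBlDr ltrDl ltr01 => /(_ isT).
- by move=> _ /(_ 0); rewrite ltry => /(_ isT).
Qed.

Lemma limn_einf_le (v : (\bar R)^nat) (y : \bar R) :
  (\forall m \near \oo, (v m <= y)%E) -> (limn_einf v <= y)%E.
Proof.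
move=> [N _ hN]; rewrite limn_einf_lim (cvg_lim _ (@cvg_einfs_sup R v))//.
apply: ge_ereal_sup => _ [k _ <-].
apply: (@le_trans _ _ (v (maxn N k))); last by apply: hN; rewrite /= leq_maxl.
by apply: ereal_inf_lbound; exists (maxn N k) => //=; rewrite leq_maxr.
Qed.

(** Fatou's lemma with the pointwise limit replaced by eventual lower bounds by reals, so that no
    limit of [u] has to be exhibited. *)
Lemma fatou_bound d (T : measurableType d) (mu : {measure set T -> \bar R})
    (f : T -> \bar R) (u : nat -> T -> \bar R) (K : R) :
  measurable_fun setT f -> (forall x, 0 <= f x)%E ->
  (forall m, measurable_fun setT (u m)) -> (forall m x, 0 <= u m x)%E ->
  {ae mu, forall x, forall a : R, (a%:E < f x)%E -> \forall m \near \oo, (a%:E <= u m x)%E} ->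
  (forall e : R, 0 < e -> \forall m \near \oo, (\int[mu]_x u m x <= (K + e)%:E)%E) ->
  (\int[mu]_x f x <= K%:E)%E.
Proof.
move=> mf f0 mu_ u0 h hK.
have mlim : measurable_fun setT (fun x => limn_einf (u ^~ x)).
  rewrite (_ : (fun x => _) = fun x => (- limn_esup (fun m => - u m x))%E)//.
  apply: measurableT_comp => //; apply: measurable_fun_limn_esup => m.
  exact: measurableT_comp.
apply: (@le_trans _ _ (\int[mu]_x limn_einf (u ^~ x))%E).
  apply: ae_ge0_le_integral => //.
    move=> x _; apply: limn_einf_ge => a; rewrite lte_fin => a0.
    by apply: nearW => m; apply: le_trans (u0 m x); rewrite lee_fin ltW.
  by case: h => N [mN N0 hN]; exists N; split => // x /= nx; apply: hN => /= hx;
    apply: nx => _; exact: limn_einf_ge.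
apply: le_trans (fatou mu measurableT mu_ (fun m x _ => u0 m x)) _.
apply/lee_addgt0Pr => e e0; rewrite -EFinD.
by apply: limn_einf_le; exact: hK.
Qed.

End fatou_bound.

Lemma integral_prob_cst d (T : measurableType d) (R : realType)
  (P : probability T R) (c : \bar R) : (\int[P]_x c = c)%E.
Proof.
transitivity (\int[P]_x cst c x)%E; first by [].
rewrite integral_cst// -[RHS]mule1; congr (_ * _)%E; exact: probability_setT.
Qed.

Lemma measurable_indic_le d (T : measurableType d) (R : realType) (f g : T -> R) :
  measurable_fun setT f -> measurable_fun setT g ->
  measurable_fun setT (fun t => ((f t <= g t)%R%:R : R)).
Proof.
move=> mf mg; have mb := measurable_fun_ler mf mg.
rewrite (_ : (fun t => _) = fun t => if f t <= g t then 1 else 0); last first.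
  by apply/funext => t; case: (_ <= _).
exact: measurable_fun_ifT.
Qed.

(** * Cone means as limits of averages over small balls *)

Section ball_average.
Context (R : realType) (n : nat).
Local Notation V := 'rV[R]_n.
Local Notation U := (uniform_ball R n).
Implicit Types (x y z xi : V).

Definition ball_volume : R := fine (lebV R n (@unit_ball R n)).

Lemma ball_volumeE : lebV R n (@unit_ball R n) = ball_volume%:E.
Proof.
rewrite /ball_volume fineK// ge0_fin_numE; first exact: lebV_unit_ball_lty.
exact: measure_ge0.
Qed.

Lemma ball_volume_gt0 : 0 < ball_volume.
Proof. by rewrite -lte_fin -ball_volumeE; exact: lebV_unit_ball_gt0. Qed.

Lemma integral_ball y rho : 0 < rho ->
  (\int[lebV R n]_z ((enorm (z - y) <= rho)%R%:R)%:E =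
   (rho ^+ n * ball_volume)%:E)%E.
Proof.
move=> r0.
have mE : measurable_fun setT (fun z : V => ((enorm z <= rho)%R%:R)%:E : \bar R).
  apply/measurable_EFinP; apply: measurable_indic_le => //.
  exact: measurable_enorm.
have r'0 : 0 < rho^-1 by rewrite invr_gt0.
transitivity (\int[lebV R n]_z ((enorm z <= rho)%R%:R)%:E)%E.
  by rewrite -(lebV_shift (- y) mE).
have h := lebV_dilate r0 mE (fun z => _).
have {h} : ((rho ^- n)%:E * \int[lebV R n]_x ((enorm x <= rho)%R%:R)%:E =
    ball_volume%:E)%E.
  rewrite -h; last by move=> z; rewrite lee_fin ler0n.
  rewrite -ball_volumeE -[RHS]mul1e -integral_cst//; last exact: measurable_unit_ball.
  rewrite [RHS]integral_mkcond; apply: eq_integral => z _.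
  rewrite patchE enormZ gtr0_norm// -ler_pdivlMl// mulVf ?gt_eqF//.
  case: ifPn => [/set_mem|/negP nz]; first by rewrite /unit_ball/= => ->.
  by case hz : (_ <= _) => //; exfalso; apply: nz; exact: mem_set.
rewrite EFinM => <-; rewrite muleA -EFinM divff ?mul1e// gt_eqF// exprn_gt0//.
Qed.

Lemma powR_inv (t b : R) : 0 <= t -> t `^ (- b) = t^-1 `^ b.
Proof. by move=> t0; rewrite -mulN1r powRrM powR_inv1. Qed.

Variables (a theta : R).
Hypotheses (n1 : (1 < n)%N) (a0 : 0 < a).

Let W xi : R := enorm xi `^ (- a).
(** An integer exponent above [a], so that the loss [C e] below is a rational function of [e]
    tending to 1 as [e] tends to 0. *)
Let N := (Num.truncn a).+1.
Let C (e : R) : R := (1 + e) ^+ N * ((1 + e) ^+ n / (1 - e) ^+ n).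
(** The weight divided by the volume of the ball of radius [e |xi|]; at [xi = 0] it vanishes with
    [W]. *)
Let coef (e : R) xi : R := W xi / (ball_volume * (e * enorm xi) ^+ n).
(** Indicator of [|z - y| <= e |xi|] when [|y| = |xi|] and [t] is the inner product of [z] and [y].
    Directions enter through [t] alone, the form to which [cone_point_swap] applies. *)
Let kap (e : R) xi z (t : R) : R :=
  (dotv z z + dotv xi xi - 2 * t <= e ^+ 2 * dotv xi xi)%R%:R.

Let W_ge0 xi : 0 <= W xi. Proof. exact: powR_ge0. Qed.

Let W0 : W 0 = 0. Proof. by rewrite /W enorm0 powR0// oppr_eq0 gt_eqF. Qed.

Let coef_ge0 e xi : 0 <= e -> 0 <= coef e xi.
Proof.
move=> e0; rewrite divr_ge0// mulr_ge0 ?(ltW ball_volume_gt0)//.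
by rewrite exprn_ge0// mulr_ge0// enorm_ge0.
Qed.

(** For [|z'| = |z|] the same expression is a condition on [xi] near [z'], while [kapE'] reads it as
    a condition on [z] near a point of norm [|xi|]. *)
Let kapE e xi z z' : 0 <= e -> enorm z' = enorm z ->
  kap e xi z (dotv xi z') = (enorm (xi - z') <= e * enorm xi)%R%:R.
Proof.
move=> e0 zz; rewrite /kap; congr (_%:R); congr nat_of_bool.
rewrite -[RHS](ler_pXn2r (n := 2))// ?nnegrE ?mulr_ge0 ?enorm_ge0//.
rewrite sqr_enormB exprMn !sqr_enorm.
have -> : dotv z' z' = dotv z z by rewrite -!sqr_enorm zz.
by congr (_ <= _); ring.
Qed.

Let kapE' e xi z y : 0 <= e -> enorm y = enorm xi ->
  kap e xi z (dotv z y) = (enorm (z - y) <= e * enorm xi)%R%:R.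
Proof.
move=> e0 yx; rewrite /kap; congr (_%:R); congr nat_of_bool.
rewrite -[RHS](ler_pXn2r (n := 2))// ?nnegrE ?mulr_ge0 ?enorm_ge0//.
rewrite sqr_enormB exprMn !sqr_enorm.
have -> : dotv y y = dotv xi xi by rewrite -!sqr_enorm yx.
by congr (_ <= _); ring.
Qed.

Let measurable_W d (T : measurableType d) (xi : T -> V) :
  measurable_fun setT xi -> measurable_fun setT (fun p => W (xi p)).
Proof.
by move=> mxi; exact: (measurableT_comp (measurable_powR _) (measurable_enorm _)).
Qed.

Let measurable_coef d (T : measurableType d) e (xi : T -> V) : 0 <= e ->
  measurable_fun setT xi -> measurable_fun setT (fun p => coef e (xi p)).
Proof.
move=> e0 mxi; apply: measurable_funM; first exact: measurable_W.
rewrite (_ : (fun t => _) = fun t => (ball_volume * (e * enorm (xi t)) ^+ n) `^ (-1)).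
  apply: (measurableT_comp (measurable_powR _)).
  apply: measurable_funM => //; apply: measurable_funX.
  by apply: measurable_funM => //; exact: measurable_enorm.
apply/funext => t; rewrite powR_inv1// mulr_ge0 ?(ltW ball_volume_gt0)// exprn_ge0//.
by rewrite mulr_ge0 ?enorm_ge0.
Qed.

Let measurable_kap d (T : measurableType d) e (xi z : T -> V) (t : T -> R) :
  measurable_fun setT xi -> measurable_fun setT z -> measurable_fun setT t ->
  measurable_fun setT (fun p => kap e (xi p) (z p) (t p)).
Proof.
move=> mxi mz mt; apply: measurable_indic_le.
  apply: measurable_funB; last exact: measurable_funM.
  by apply: measurable_funD => //; exact: measurable_dotv.
by apply: measurable_funM => //; exact: measurable_dotv.
Qed.

(** On the support of the integrand, [|xi|] lies between [|z|/(1+e)] and [|z|/(1-e)]. *)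
Let inner_bound e z z' : 0 < e < 1 -> z != 0 -> enorm z' = enorm z ->
  (\int[lebV R n]_xi (coef e xi * kap e xi z (dotv xi z'))%:E <= (C e * W z)%:E)%E.
Proof.
move=> /andP[e0 e1] z0 zz.
have nz : 0 < enorm z by rewrite enorm_gt0.
have c0 := ball_volume_gt0.
have e1' : 0 < 1 - e by rewrite subr_gt0.
have e1'' : 0 < 1 + e by rewrite addr_gt0.
(* From [|xi - z'| <= e |xi|] and [|xi| <= |z|/(1-e)], the point [xi] is in the ball of radius [rho]
   around [z']. *)
pose rho := e * enorm z / (1 - e).
have rho0 : 0 < rho by rewrite divr_gt0// mulr_gt0.
(* The value of [coef] at the smallest admissible norm [|xi| = |z|/(1+e)], where it is largest. *)
pose D := ((1 + e) / enorm z) `^ a * ((1 + e) / enorm z) ^+ n / (ball_volume * e ^+ n).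
have D0 : 0 <= D.
  rewrite /D divr_ge0// mulr_ge0 ?powR_ge0 ?exprn_ge0 ?divr_ge0// ?ltW//.
apply: (@le_trans _ _ (\int[lebV R n]_xi (D%:E * ((enorm (xi - z') <= rho)%R%:R)%:E))%E).
  apply: ge0_le_integral => //.
  - by move=> xi _; rewrite lee_fin mulr_ge0// coef_ge0// ltW.
  - apply/measurable_EFinP; apply: measurable_funM.
      by apply: measurable_coef => //; exact: ltW.
    by apply: measurable_kap => //; exact: measurable_dotv.
  - apply/measurable_EFinP; apply: measurable_funM => //.
    apply: measurable_indic_le => //; apply: measurable_enorm.
    exact: measurable_addv.
  - move=> xi _; rewrite -EFinM lee_fin (kapE _ (ltW e0) zz).
    case h : (enorm (xi - z') <= e * enorm xi); last by rewrite mulr0 mulr_ge0.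
    have h1 : enorm z <= (1 + e) * enorm xi.
      by have := enorm_sub_ge z' xi; rewrite enormC zz; lra.
    have h2 : (1 - e) * enorm xi <= enorm z.
      by have := enorm_sub_ge xi z'; rewrite zz; lra.
    have x0 : 0 < enorm xi by rewrite -(pmulr_rgt0 _ e1''); exact: lt_le_trans h1.
    have -> : (enorm (xi - z') <= rho).
      apply: (le_trans h); rewrite /rho ler_pdivlMr// -mulrA ler_pM2l//.
      by rewrite mulrC.
    rewrite !mulr1 /coef /D /W powR_inv ?enorm_ge0//.
    have h3 : (enorm xi)^-1 <= (1 + e) / enorm z.
      by rewrite -[leLHS]mul1r ler_pdivrMr// mulrAC ler_pdivlMr// mul1r.
    have -> : (enorm xi)^-1 `^ a / (ball_volume * (e * enorm xi) ^+ n) =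
        (enorm xi)^-1 `^ a * (enorm xi)^-1 ^+ n / (ball_volume * e ^+ n).
      by rewrite exprMn exprVn; field; rewrite !gt_eqF ?exprn_gt0.
    apply: ler_wpM2r.
      by rewrite invr_ge0 mulr_ge0 ?(ltW c0)// exprn_ge0 ?(ltW e0).
    have h4 : 0 <= (enorm xi)^-1 by rewrite invr_ge0 (ltW x0).
    have h5 : 0 <= (1 + e) / enorm z by exact: le_trans h3.
    apply: ler_pM; rewrite ?powR_ge0 ?exprn_ge0//.
      by apply: ge0_ler_powR => //; exact: ltW.
    by apply: lerXn2r; rewrite ?nnegrE.
rewrite ge0_integralZlT//; last first.
  apply/measurable_EFinP; apply: measurable_indic_le => //; apply: measurable_enorm.
  exact: measurable_addv.
rewrite integral_ball// -EFinM lee_fin.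
have -> : D * (rho ^+ n * ball_volume) =
    ((1 + e) / enorm z) `^ a * ((1 + e) ^+ n / (1 - e) ^+ n).
  rewrite /D /rho !exprMn !exprVn; field.
  by rewrite !gt_eqF ?exprn_gt0.
rewrite powRM ?invr_ge0 ?enorm_ge0 ?(ltW e1'')// -powR_inv ?enorm_ge0//.
rewrite /C mulrAC -/(W z) -!mulrA ler_wpM2r//.
  by rewrite mulr_ge0 ?exprn_ge0 ?(ltW e1'')// mulr_ge0// invr_ge0 exprn_ge0 ?(ltW e1').
rewrite -powR_mulrn ?(ltW e1'')//; apply: ler_powR; first by rewrite lerDl ltW.
by have /andP[_ /ltW] := truncn_itv (ltW a0).
Qed.

(** [cone_point_swap] is applied at fixed [xi] and [z], between two uses of Tonelli's theorem;
    afterwards [xi] is integrated first, near one point of norm [|z|], where [inner_bound]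
    applies. *)
Let upper_bound (h : V -> R) (K : R) (e : R) :
  measurable_fun setT h -> (forall z, 0 <= h z) -> 0 < e < 1 ->
  (\int[lebV R n]_z (W z * h z)%:E = K%:E)%E ->
  (\int[lebV R n]_xi \int[U]_x ((coef e xi)%:E *
     \int[lebV R n]_z (kap e xi z
       (enorm xi * dotv z (cone_point (unitv xi) theta x)) * h z)%:E)
   <= (C e * K)%:E)%E.
Proof.
move=> mh h0 e01; have /andP[e0 e1] := e01.
pose g xi x z : R := coef e xi * h z *
  kap e xi z (enorm xi * dotv z (cone_point (unitv xi) theta x)).
pose g' xi x z : R := coef e xi * h z *
  kap e xi z (enorm z * dotv xi (cone_point (unitv z) theta x)).
have g0 xi x z : (0 <= (g xi x z)%:E)%E.
  by rewrite lee_fin mulr_ge0// mulr_ge0// coef_ge0// ltW.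
have g'0 xi x z : (0 <= (g' xi x z)%:E)%E.
  by rewrite lee_fin mulr_ge0// mulr_ge0// coef_ge0// ltW.
have mg d (T : measurableType d) (xi x z : T -> V) :
    measurable_fun setT xi -> measurable_fun setT x -> measurable_fun setT z ->
    measurable_fun setT (fun p => (g (xi p) (x p) (z p))%:E).
  move=> mxi mx mz; apply/measurable_EFinP; apply: measurable_funM.
    apply: measurable_funM; last exact: measurableT_comp mh mz.
    by apply: measurable_coef => //; exact: ltW.
  apply: measurable_kap => //; apply: measurable_funM; first exact: measurable_enorm.
  apply: measurable_dotv => //; apply: measurable_cone_point => //.
  exact: measurable_unitv.
have mg' d (T : measurableType d) (xi x z : T -> V) :
    measurable_fun setT xi -> measurable_fun setT x -> measurable_fun setT z ->
    measurable_fun setT (fun p => (g' (xi p) (x p) (z p))%:E).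
  move=> mxi mx mz; apply/measurable_EFinP; apply: measurable_funM.
    apply: measurable_funM; last exact: measurableT_comp mh mz.
    by apply: measurable_coef => //; exact: ltW.
  apply: measurable_kap => //; apply: measurable_funM; first exact: measurable_enorm.
  apply: measurable_dotv => //; apply: measurable_cone_point => //.
  exact: measurable_unitv.
move=> hK.
apply: (@le_trans _ _ (\int[lebV R n]_z \int[U]_x \int[lebV R n]_xi (g' xi x z)%:E)%E).
  rewrite le_eqVlt; apply/orP; left; apply/eqP.
  transitivity (\int[lebV R n]_xi \int[lebV R n]_z \int[U]_x (g' xi x z)%:E)%E.
    apply: eq_integral => xi _.
    transitivity (\int[U]_x \int[lebV R n]_z (g xi x z)%:E)%E.
      apply: eq_integral => x _; rewrite -ge0_integralZlT//.
      - by apply: eq_integral => z _; rewrite -EFinM /g -mulrA (mulrC (h z)).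
      - apply/measurable_EFinP; apply: measurable_funM => //.
        apply: measurable_kap => //; apply: measurable_funM => //.
        exact: measurable_dotv.
      - by move=> z; rewrite lee_fin mulr_ge0.
      - by rewrite lee_fin coef_ge0// ltW.
    rewrite (tonelli U (lebV R n) (f := fun p => (g xi p.1 p.2)%:E)).
    - apply: eq_integral => z _.
      apply: (cone_point_swap z xi theta (phi := fun t => (coef e xi * h z * kap e xi z t)%:E)).
      by apply/measurable_EFinP; apply: measurable_funM => //; exact: measurable_kap.
    - by apply: mg => //; exact: measurable_fst.
    - by move=> p; exact: g0.
  rewrite (tonelli (lebV R n) (lebV R n)
    (f := fun p => (\int[U]_x (g' p.1 x p.2)%:E)%E)).
  - apply: eq_integral => z _.
    rewrite (tonelli (lebV R n) U (f := fun p => (g' p.1 p.2 z)%:E))//.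
    by apply: mg'.
  - apply: (measurable_integral_snd U (f := fun q => (g' q.1.1 q.2 q.1.2)%:E)).
      apply: mg'; [|exact: measurable_snd|].
        exact: (measurableT_comp measurable_fst measurable_fst).
      exact: (measurableT_comp measurable_snd measurable_fst).
    by move=> q; exact: g'0.
  - by move=> p; exact: integral_ge0.
have C0 : 0 <= C e.
  have p1 : 0 <= 1 + e by rewrite addr_ge0// ltW.
  have p2 : 0 <= 1 - e by rewrite subr_ge0 ltW.
  by apply: mulr_ge0; [|apply: divr_ge0]; exact: exprn_ge0.
have Wh0 z : (0 <= (W z * h z)%:E)%E by rewrite lee_fin mulr_ge0.
have mWh : measurable_fun setT (fun z => (W z * h z)%:E).
  by apply/measurable_EFinP; apply: measurable_funM => //; exact: measurable_W.
have minner : measurable_fun setT (fun p : V * V => \int[lebV R n]_xi (g' xi p.1 p.2)%:E)%E.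
  apply: (measurable_integral_snd (lebV R n) (f := fun q => (g' q.2 q.1.1 q.1.2)%:E)).
    apply: mg'; first exact: measurable_snd.
      exact: (measurableT_comp measurable_fst measurable_fst).
    exact: (measurableT_comp measurable_snd measurable_fst).
  by move=> q; exact: g'0.
apply: (@le_trans _ _ (\int[lebV R n]_z ((C e)%:E * (W z * h z)%:E))%E); last first.
  by rewrite ge0_integralZlT// hK.
apply: ge0_le_integral => //.
- by move=> z _; apply: integral_ge0 => x _; exact: integral_ge0.
- apply: (measurable_integral_snd U (f := fun p => \int[lebV R n]_xi (g' xi p.2 p.1)%:E)%E).
    apply: (measurable_integral_snd (lebV R n) (f := fun q => (g' q.2 q.1.2 q.1.1)%:E)).
      apply: mg'; first exact: measurable_snd.
        exact: (measurableT_comp measurable_snd measurable_fst).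
      exact: (measurableT_comp measurable_fst measurable_fst).
    by move=> q; exact: g'0.
  by move=> p; exact: integral_ge0.
- exact: measurable_funeM.
(* At [z = 0] the condition reads [|xi| <= e |xi|] with [e < 1], which leaves only [xi = 0], where
   [coef] vanishes. *)
move=> z _; have [->|z0] := eqVneq z 0.
  rewrite W0 mul0r mule0 integral0_eq// => x _; rewrite integral0_eq// => xi _.
  rewrite /g' /kap enorm0 mul0r mulr0 subr0 dotv0l add0r.
  have [->|xi0] := eqVneq xi 0; first by rewrite /coef W0 !mul0r.
  have : 0 < dotv xi xi by rewrite dotvv_gt0.
  move=> xx; rewrite -[X in (X <= _)%R]mul1r ler_pM2r// leNgt.
  by rewrite expr_lt1 ?(ltW e0)// e1 mulr0.
apply: (@le_trans _ _ (\int[U]_x cst ((C e)%:E * (W z * h z)%:E) x)%E); last first.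
  by rewrite integral_prob_cst.
apply: ae_ge0_le_integral => //.
- by move=> x _; exact: integral_ge0.
- exact: (measurableT_comp minner (pair2_measurable z)).
- by move=> x _; rewrite mule_ge0.
have uz : enorm (unitv z) = 1 by rewrite enorm_unitv.
have [A [mA A0 hA]] := ae_enorm_cone_point theta n1 uz.
exists A; split => // x nx; apply: hA => cx; apply: nx => _.
have zz : enorm (enorm z *: cone_point (unitv z) theta x) = enorm z.
  by rewrite enormZ cx mulr1 ger0_norm// enorm_ge0.
apply: (@le_trans _ _ ((h z)%:E * \int[lebV R n]_xi
    (coef e xi * kap e xi z (dotv xi (enorm z *: cone_point (unitv z) theta x)))%:E)%E).
  rewrite -ge0_integralZlT//.
  - rewrite le_eqVlt; apply/orP; left; apply/eqP; apply: eq_integral => xi _.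
    by rewrite -EFinM dotvZr /g' mulrA [h z * _]mulrC.
  - apply/measurable_EFinP; apply: measurable_funM.
      by apply: measurable_coef => //; exact: ltW.
    by apply: measurable_kap => //; exact: measurable_dotv.
  - by move=> xi; rewrite lee_fin mulr_ge0// coef_ge0// ltW.
  by rewrite lee_fin.
rewrite /cst -EFinM (_ : C e * (W z * h z) = h z * (C e * W z)); last by ring.
by rewrite EFinM; apply: lee_wpmul2l; [rewrite lee_fin|exact: inner_bound].
Qed.

(** [u m] is the weight times the mean of [h] over a ball of radius [|xi|/(m+2)]. By continuity of
    [h] it is eventually above any number below the integrand, and [upper_bound] controls its
    integral, so that [fatou_bound] applies. An infinite right-hand side is trivial. *)
Lemma cone_mean_le (h : V -> R) :
  measurable_fun setT h -> (forall z, 0 <= h z) ->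
  (forall y e, 0 < e -> exists2 d, 0 < d &
    forall z, enorm (z - y) < d -> `|h z - h y| < e) ->
  (\int[lebV R n]_xi \int[U]_x
     (W xi * h (enorm xi *: cone_point (unitv xi) theta x))%:E
   <= \int[lebV R n]_z (W z * h z)%:E)%E.
Proof.
move=> mh h0 ch; have K0 : (0 <= \int[lebV R n]_z (W z * h z)%:E)%E.
  by apply: integral_ge0 => z _; rewrite lee_fin mulr_ge0.
case hK : (\int[lebV R n]_z (W z * h z)%:E)%E => [K| |]; last by rewrite hK in K0.
  2: by rewrite leey.
(* The shift by 2 keeps [e m] strictly below 1. *)
pose e m : R := m.+2%:R^-1.
have e0 m : 0 < e m by rewrite invr_gt0 ltr0n.
have e1 m : e m < 1 by rewrite invf_lt1 ?ltr0n// ltr1n.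
pose f (p : V * V) := (W p.1 * h (enorm p.1 *: cone_point (unitv p.1) theta p.2))%:E.
pose q m (p : V * V) z := (kap (e m) p.1 z
       (enorm p.1 * dotv z (cone_point (unitv p.1) theta p.2)) * h z)%:E.
pose u m (p : V * V) := ((coef (e m) p.1)%:E * \int[lebV R n]_z q m p z)%E.
have mcone d (T : measurableType d) (xi x : T -> V) :
    measurable_fun setT xi -> measurable_fun setT x ->
    measurable_fun setT (fun p => cone_point (unitv (xi p)) theta (x p)).
  by move=> mxi mx; apply: measurable_cone_point => //; exact: measurable_unitv.
have mf : measurable_fun setT f.
  apply/measurable_EFinP; apply: measurable_funM; first exact: measurable_W measurable_fst.
  apply: measurableT_comp => //; apply: measurable_scalev.
    exact: measurable_enorm measurable_fst.
  by apply: mcone; [exact: measurable_fst|exact: measurable_snd].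
have f0 p : (0 <= f p)%E by rewrite lee_fin mulr_ge0.
have q0 m p z : (0 <= q m p z)%E by rewrite lee_fin mulr_ge0.
have mq m : measurable_fun setT (fun t : (V * V) * V => q m t.1 t.2).
  have m11 := measurableT_comp (@measurable_fst _ _ V V) (@measurable_fst _ _ (V * V)%type V).
  have m12 := measurableT_comp (@measurable_snd _ _ V V) (@measurable_fst _ _ (V * V)%type V).
  apply/measurable_EFinP; apply: measurable_funM; last exact: measurableT_comp mh measurable_snd.
  apply: measurable_kap => //; apply: measurable_funM; first exact: measurable_enorm m11.
  by apply: measurable_dotv => //; exact: mcone.
have mu_ m : measurable_fun setT (u m).
  apply: emeasurable_funM.
    by apply/measurable_EFinP; apply: measurable_coef; [exact: ltW|exact: measurable_fst].
  exact: (measurable_integral_snd (lebV R n) (mq m) (fun t => q0 m _ _)).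
have u0 m p : (0 <= u m p)%E.
  by rewrite mule_ge0 ?integral_ge0// lee_fin coef_ge0// ltW.
rewrite -(tonelli_prod (lebV R n) U mf f0).
apply: (fatou_bound (u := u) mf f0 mu_ u0).
  (* The exceptional pairs, null by [ae_enorm_cone_point] on each section; [xi = 0] is kept, the
     weight being 0 there. *)
  pose A := [set p : V * V | p.1 != 0 /\ enorm (cone_point (unitv p.1) theta p.2) != 1].
  have mA : measurable A.
    have m1 : measurable_fun setT (fun p : V * V => enorm p.1).
      exact: measurable_enorm measurable_fst.
    have m2 : measurable_fun setT (fun p : V * V => enorm (cone_point (unitv p.1) theta p.2)).
      by apply: measurable_enorm; apply: mcone; [exact: measurable_fst|exact: measurable_snd].
    have -> : A = ((fun p : V * V => enorm p.1) @^-1` ~` [set 0]) `&`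
        ((fun p : V * V => enorm (cone_point (unitv p.1) theta p.2)) @^-1` ~` [set 1]).
      apply/seteqP; split => p /=; rewrite /A/=.
        by move=> [p0 /eqP p1]; split => //; apply/eqP; rewrite enorm_eq0.
      by move=> [/eqP p0 p1]; split; [rewrite -enorm_eq0|exact/eqP].
    apply: measurableI.
      by rewrite -[X in measurable X]setTI; apply: m1 => //; exact: measurableC.
    by rewrite -[X in measurable X]setTI; apply: m2 => //; exact: measurableC.
  exists A; split => //.
    apply: integral0_eq => xi _ /=.
    have mX : measurable (xsection A xi) by exact: measurable_xsection.
    have [xi0|xi0] := eqVneq xi 0.
      rewrite (_ : xsection A xi = set0) ?measure0//.
      by apply/seteqP; split => // x; rewrite /xsection/= inE /A/= xi0 eqxx => -[].
    have ux : enorm (unitv xi) = 1 by rewrite enorm_unitv.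
    have [B [mB B0 hB]] := ae_enorm_cone_point theta n1 ux.
    apply: (subset_measure0 mX mB _ B0) => x; rewrite /xsection/= inE => -[_ /= /eqP c1].
    exact: hB.
  move=> [xi x] /= nx.
  have [/eqP xi0|xi0] := boolP (xi == 0).
    exfalso; apply: nx => b; rewrite /f/= xi0 W0 mul0r lte_fin => b0.
    by apply: nearW => m; apply: le_trans (u0 _ _); rewrite lee_fin ltW.
  split => //=; apply: contra_notN nx => /eqP cx b bf.
  have [b0|b0] := leP b 0.
    by apply: nearW => m; apply: le_trans (u0 _ _); rewrite lee_fin.
  have nxi : 0 < enorm xi by rewrite enorm_gt0.
  have Wxi : 0 < W xi by rewrite powR_gt0.
  set y := enorm xi *: cone_point (unitv xi) theta x.
  have ny : enorm y = enorm xi by rewrite enormZ cx mulr1 gtr0_norm.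
  have by_ : b / W xi < h y.
    by rewrite ltr_pdivrMr// mulrC -lte_fin.
  have [d d0 hd] := ch y (h y - b / W xi) ltac:(by rewrite subr_gt0).
  have dx0 : 0 < d / enorm xi by rewrite divr_gt0.
  near=> m.
  have em : e m * enorm xi < d.
    rewrite -ltr_pdivlMr//; apply: (@le_lt_trans _ _ m.+1%:R^-1).
      by rewrite lef_pV2 ?posrE ?ltr0n// ler_nat.
    by near: m; exact: near_infty_natSinv_lt (PosNum dx0).
  have c0 := ball_volume_gt0.
  have b1 : 0 < b / W xi by rewrite divr_gt0.
  have me : measurable_fun setT (fun z => ((enorm (z - y) <= e m * enorm xi)%R%:R)%:E : \bar R).
    apply/measurable_EFinP; apply: measurable_indic_le => //; apply: measurable_enorm.
    exact: measurable_addv.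
  have mqm : measurable_fun setT (q m (xi, x)).
    exact: (measurableT_comp (mq m) (pair1_measurable (xi, x))).
  (* On the ball [h] exceeds [b / W xi], and [coef] times the volume of the ball is [W xi], whence
     the lower bound [b]. *)
  apply: (@le_trans _ _ ((coef (e m) xi)%:E * \int[lebV R n]_z ((b / W xi)%:E *
      ((enorm (z - y) <= e m * enorm xi)%R%:R)%:E))%E); last first.
    apply: lee_wpmul2l; first by rewrite lee_fin coef_ge0// ltW.
    apply: ge0_le_integral => //.
    - by move=> z _; rewrite mule_ge0 ?lee_fin// ltW.
    - exact: measurable_funeM.
    - move=> z _; rewrite /q/= -dotvZr kapE'// ?(ltW (e0 m))// -/y -EFinM lee_fin.
      case hz : (enorm (z - y) <= _); last by rewrite mulr0 mul0r.
      rewrite mulr1 mul1r; have := hd z (le_lt_trans hz em).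
      by rewrite ltr_norml => /andP[]; lra.
  rewrite ge0_integralZlT//; last first.
    by rewrite lee_fin ltW.
  rewrite integral_ball ?mulr_gt0// -!EFinM lee_fin /coef.
  rewrite le_eqVlt; apply/orP; left; apply/eqP; field.
  by rewrite !gt_eqF ?exprn_gt0 ?mulr_gt0.
move=> eps eps0.
have Ccvg : C (e m) * K @[m --> \oo] --> K.
  have ecvg : e m @[m --> \oo] --> 0.
    by rewrite (cvg_shiftS (@harmonic R)); exact: cvg_harmonic.
  rewrite -[X in _ --> X]mul1r; apply: cvgMl.
  have h1 : 1 + e m @[m --> \oo] --> (1 : R).
    by rewrite -[X in _ --> X]addr0; apply: cvgD => //; exact: cvg_cst.
  have h2 : 1 - e m @[m --> \oo] --> (1 : R).
    by rewrite -[X in _ --> X]subr0; apply: cvgB => //; exact: cvg_cst.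
  have hX k (v : nat -> R) : v m @[m --> \oo] --> (1 : R) -> v m ^+ k @[m --> \oo] --> (1 : R).
    move=> hv; elim: k => [|k IH]; first by under eq_fun do rewrite expr0; exact: cvg_cst.
    rewrite (_ : (fun m => v m ^+ k.+1) = (fun m => v m * v m ^+ k)); last first.
      by apply/funext => m; rewrite exprS.
    rewrite -[X in _ --> X](mulr1 (1 : R)).
    exact: cvgM hv IH.
  rewrite (_ : 1 = 1 * (1 / 1)); last by rewrite divr1 mulr1.
  apply: cvgM; first exact: hX.
  apply: cvgM; first exact: hX.
  by apply: cvgV; [exact: oner_neq0|exact: hX].
have /cvgrPdist_le/(_ eps eps0) := Ccvg.
apply: filterS => m hm; rewrite tonelli_prod//.
apply: (@le_trans _ _ (C (e m) * K)%:E).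
  by apply: (upper_bound (e := e m) mh h0 _ hK); rewrite e0 e1.
by rewrite lee_fin; move: hm; rewrite ler_norml => /andP[]; lra.
Unshelve. all: by end_near. Qed.

End ball_average.

(** * Energy integrals of trigonometric functions *)

Section ge0_integrals.
Context d (T : measurableType d) (R : realType).
Variable m : {measure set T -> \bar R}.
Implicit Types f g : T -> \bar R.

Lemma ge0_le_integralT f g : measurable_fun setT f -> measurable_fun setT g ->
  (forall x, 0 <= f x)%E -> (forall x, f x <= g x)%E ->
  (\int[m]_x f x <= \int[m]_x g x)%E.
Proof. by move=> mf mg f0 fg; exact: ge0_le_integral. Qed.

Lemma ge0_integralDT f g : measurable_fun setT f -> measurable_fun setT g ->
  (forall x, 0 <= f x)%E -> (forall x, 0 <= g x)%E ->
  (\int[m]_x (f x + g x) = \int[m]_x f x + \int[m]_x g x)%E.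
Proof. by move=> mf mg f0 g0; exact: ge0_integralD. Qed.

End ge0_integrals.

Section real_integrable.
Context d (T : measurableType d) (R : realType).
Variable m : {measure set T -> \bar R}.
Implicit Types f g : T -> R.
Local Notation int f := (m.-integrable setT (EFin \o f)).

Lemma rint_measurable f : int f -> measurable_fun setT f.
Proof. by move=> /integrableP[/measurable_EFinP]. Qed.

Lemma rintD f g : int f -> int g -> int (fun x => f x + g x).
Proof. by move=> hf hg; have := integrableD measurableT hf hg; exact: eq_integrable. Qed.

Lemma rintN f : int f -> int (fun x => - f x).
Proof. by move=> hf; have := integrableN hf; exact: eq_integrable. Qed.

Lemma rintB f g : int f -> int g -> int (fun x => f x - g x).
Proof. by move=> hf hg; apply: rintD => //; exact: rintN. Qed.

Lemma rintZ c f : int f -> int (fun x => c * f x).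
Proof. by move=> hf; have := integrableZl measurableT c hf; exact: eq_integrable. Qed.

Lemma rint_ge0 f : measurable_fun setT f -> (forall x, 0 <= f x) ->
  (\int[m]_x (f x)%:E < +oo)%E -> int f.
Proof.
move=> mf f0 fi; apply/integrableP; split; first exact/measurable_EFinP.
by under eq_integral do rewrite /= ger0_norm//.
Qed.

Lemma rint_le f g : measurable_fun setT f -> (forall x, `|f x| <= g x) -> int g -> int f.
Proof.
move=> mf fg; apply: le_integrable => //; first exact/measurable_EFinP.
by move=> x _ /=; rewrite lee_fin (le_trans (fg x))// ler_norm.
Qed.

Lemma EFin_Rintegral f : int f -> ((\int[m]_x f x)%:E = \int[m]_x (f x)%:E)%E.
Proof. by move=> hf; rewrite fineK//; exact: integrable_fin_num. Qed.

Lemma rint_lty f : int f -> (\int[m]_x `|f x|%:E < +oo)%E.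
Proof. by move=> /integrableP[]. Qed.

Lemma rintegralD f g : int f -> int g ->
  \int[m]_x (f x + g x) = \int[m]_x f x + \int[m]_x g x.
Proof. by move=> hf hg; rewrite RintegralD. Qed.

Lemma rintegralB f g : int f -> int g ->
  \int[m]_x (f x - g x) = \int[m]_x f x - \int[m]_x g x.
Proof. by move=> hf hg; rewrite RintegralB. Qed.

Lemma rintegralZ c f : int f -> \int[m]_x (c * f x) = c * \int[m]_x f x.
Proof. by move=> hf; rewrite RintegralZl. Qed.

Lemma rintegral_le f g : int f -> int g -> (forall x, f x <= g x) ->
  \int[m]_x f x <= \int[m]_x g x.
Proof. by move=> hf hg fg; apply: le_Rintegral. Qed.

Lemma rintegral_norm f : int f -> `|\int[m]_x f x| <= \int[m]_x `|f x|.
Proof. by move=> hf; exact: le_normr_Rintegral. Qed.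

(* Pointwise [2 c g <= g^2 / rho + c^2 rho]; [g^2 / 0 = 0] is harmless as [g]
   vanishes with [rho]. *)
Lemma weighted_CS (g rho : T -> R) (a : R) :
  int g -> measurable_fun setT rho -> (forall x, 0 <= rho x) ->
  (forall x, rho x = 0 -> g x = 0) ->
  0 < a -> (\int[m]_x (rho x)%:E <= a%:E)%E ->
  (((\int[m]_x g x) ^+ 2)%:E <= a%:E * \int[m]_x (g x ^+ 2 / rho x)%:E)%E.
Proof.
move=> ig mr r0 rg a0 ra.
have mg := rint_measurable ig.
have mq : measurable_fun setT (fun x => g x ^+ 2 / rho x).
  rewrite (_ : (fun x => _) = fun x => g x ^+ 2 * rho x `^ (-1)); last first.
    by apply/funext => x; rewrite powR_inv1.
  apply: measurable_funM; first exact: measurable_funX.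
  exact: (measurableT_comp (measurable_powR _) mr).
have q0 x : 0 <= g x ^+ 2 / rho x by rewrite divr_ge0// sqr_ge0.
have [b_oo|b_fin] := eqVneq (\int[m]_x (g x ^+ 2 / rho x)%:E)%E +oo%E.
  by rewrite b_oo gt0_muley ?leey// lte_fin.
have iq : int (fun x => g x ^+ 2 / rho x).
  by apply: rint_ge0 => //; rewrite lt_neqAle b_fin leey.
have ir : int rho.
  by apply: rint_ge0 => //; apply: le_lt_trans ra _; rewrite ltry.
rewrite -EFin_Rintegral// -EFinM lee_fin.
set I := \int[m]_x g x; set b := \int[m]_x _.
have hr : \int[m]_x rho x <= a by rewrite -lee_fin EFin_Rintegral.
(* The choice of [c] that makes the integrated inequality [2 c I <= b + c^2 a] sharpest. *)
pose c := I / a.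
have h : 2 * c * I <= b + c ^+ 2 * \int[m]_x rho x.
  rewrite /I /b -!rintegralZ// -rintegralD//; last exact: rintZ.
  apply: rintegral_le; [exact: rintZ|by apply: rintD => //; exact: rintZ|].
  move=> x; have [rx|rx] := eqVneq (rho x) 0.
    by rewrite (rg x rx) rx !mulr0 expr0n/= mul0r addr0.
  have rx0 : 0 < rho x by rewrite lt_neqAle eq_sym rx r0.
  rewrite -subr_ge0.
  have -> : g x ^+ 2 / rho x + c ^+ 2 * rho x - 2 * c * g x =
    (g x - c * rho x) ^+ 2 / rho x by field.
  by rewrite divr_ge0// sqr_ge0.
have h2 : c ^+ 2 * \int[m]_x rho x <= c ^+ 2 * a by rewrite ler_wpM2l// sqr_ge0.
have : 2 * c * I <= b + c ^+ 2 * a by apply: le_trans h _; rewrite lerD2l.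
rewrite /c -subr_ge0 => h3; rewrite -subr_ge0.
have -> : a * b - I ^+ 2 = a * (b + (I / a) ^+ 2 * a - 2 * (I / a) * I).
  by field; rewrite gt_eqF.
by rewrite mulr_ge0// ltW.
Qed.

End real_integrable.

Section finite_measures.
Context d (T : measurableType d) (R : realType).

Lemma rint_bounded (m : {finite_measure set T -> \bar R}) (f : T -> R) (c : R) :
  measurable_fun setT f -> (forall x, `|f x| <= c) -> m.-integrable setT (EFin \o f).
Proof.
move=> mf fc; apply: (rint_le (g := cst c)) => //.
apply/integrableP; split; first exact/measurable_EFinP.
rewrite (_ : (fun x => _) = cst `|c%:E|%E)// integral_cst// lte_mul_pinfty ?abse_ge0//.
by rewrite ltey_eq fin_num_measure.
Qed.

(** Jensen's inequality for the square, as [weighted_CS] with the constant weight 1. *)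
Lemma sqr_rintegral_prob (P : probability T R) (g : T -> R) :
  P.-integrable setT (EFin \o g) ->
  (((\int[P]_x g x) ^+ 2)%:E <= \int[P]_x (g x ^+ 2)%:E)%E.
Proof.
move=> ig; have := @weighted_CS _ _ _ P g (cst 1) 1 ig.
have -> : (\int[P]_x (cst (1 : R) x)%:E = 1)%E by exact: (integral_prob_cst P 1%E).
rewrite lexx mul1e => h.
apply: le_trans (h _ _ _ _ _) _ => //.
  by move=> x /eqP; rewrite oner_eq0.
by under eq_integral do rewrite /cst divr1.
Qed.

Lemma rintegral_prob_cst (P : probability T R) (c : R) : \int[P]_x c = c.
Proof. by rewrite /Rintegral (integral_prob_cst P). Qed.

End finite_measures.

Section real_fubini.
Context d1 d2 (T1 : measurableType d1) (T2 : measurableType d2) (R : realType).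
Variables (m1 : {sigma_finite_measure set T1 -> \bar R})
  (m2 : {sigma_finite_measure set T2 -> \bar R}).
Variable f : T1 * T2 -> R.
Hypothesis intf : (m1 \x m2)%E.-integrable setT (EFin \o f).

Lemma rfubini1 : \int[m1]_x \int[m2]_y f (x, y) = \int[(m1 \x m2)%E]_z f z.
Proof.
rewrite /Rintegral -(integral12_prod_meas1 intf); congr fine.
apply: ae_eq_integral => //.
- apply/measurable_EFinP; apply: measurable_Rintegral_snd.
  exact: rint_measurable intf.
- exact: (measurable_fubini_F intf).
have [N [mN N0 hN]] := ae_integrable1 intf.
exists N; split => // x nx; apply: hN => ix; apply: nx => _.
by rewrite /= fineK//; apply: integrable_fin_num.
Qed.

Lemma rfubini2 : \int[m2]_y \int[m1]_x f (x, y) = \int[(m1 \x m2)%E]_z f z.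
Proof.
rewrite /Rintegral -(integral21_prod_meas1 intf); congr fine.
apply: ae_eq_integral => //.
- apply/measurable_EFinP.
  apply: (measurable_Rintegral_snd m1 (f := fun z => f (z.2, z.1))).
  apply: measurableT_comp (rint_measurable intf) _.
  by apply: measurable_fun_pair; [exact: measurable_snd|exact: measurable_fst].
- exact: (measurable_fubini_G intf).
have [N [mN N0 hN]] := ae_integrable2 intf.
exists N; split => // x nx; apply: hN => ix; apply: nx => _.
by rewrite /= fineK//; apply: integrable_fin_num.
Qed.

Lemma rfubini : \int[m1]_x \int[m2]_y f (x, y) = \int[m2]_y \int[m1]_x f (x, y).
Proof. by rewrite rfubini1 rfubini2. Qed.

Lemma rint_fubini1 : m1.-integrable setT (EFin \o (fun x => \int[m2]_y f (x, y))).
Proof.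
have h := integrable_fubini_F intf.
have [N [mN N0 hN]] := ae_integrable1 intf.
have mF : measurable_fun setT (fun x => \int[m2]_y f (x, y)).
  by apply: measurable_Rintegral_snd; exact: rint_measurable intf.
apply/integrableP; split; first exact/measurable_EFinP.
move/integrableP: h => [mh]; congr (_ < _)%E; apply: ae_eq_integral => //.
- exact: measurableT_comp.
- by apply: measurableT_comp => //; exact/measurable_EFinP.
exists N; split => // x nx; apply: hN => ix; apply: nx => _.
by rewrite /= /fubini_F -(EFin_Rintegral (f := fun y => f (x, y))).
Qed.

End real_fubini.

Lemma measurable_indic_bool d (T : measurableType d) (R : realType) (b : T -> bool) :
  measurable_fun setT b -> measurable_fun setT (fun t => (b t)%:R : R).
Proof.
move=> mb; rewrite (_ : (fun t => _) = fun t => if b t then 1 else 0); last first.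
  by apply/funext => t; case: (b t).
exact: measurable_fun_ifT.
Qed.

Section trigonometric.
Context (R : realType).

(** What the estimates use of [cos] and [sin]; the real and imaginary parts of Fourier transforms
    are thus treated at once. *)
Definition trig (psi : R -> R) : Prop :=
  [/\ forall x, `|psi x| <= 1, forall x y, `|psi x - psi y| <= `|x - y|
    & measurable_fun setT psi].

Lemma derive_lipschitz (f f' : R -> R) :
  (forall x : R, is_derive x (1 : R) f (f' x)) -> (forall x, `|f' x| <= 1) ->
  forall x y, `|f x - f y| <= `|x - y|.
Proof.
move=> fd f1; suff H x y : x <= y -> `|f x - f y| <= `|x - y|.
  by move=> x y; have [/H//|/ltW/H] := leP x y; rewrite distrC (distrC y).
move=> xy; have cf : {within `[x, y], continuous f}.
  by apply: continuous_subspaceT => z; apply: differentiable_continuous; apply/derivable1_diffP.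
have [z _ e] := MVT_segment xy (fun z _ => fd z) cf.
by rewrite distrC e normrM (distrC x) ler_piMl.
Qed.

Lemma trig_cos : trig cos.
Proof.
split; first exact: cos_max.
- apply: (derive_lipschitz (@is_derive_cos R)) => x.
  by rewrite normrN sin_max.
- by apply: continuous_measurable_fun; exact: continuous_cos.
Qed.

Lemma trig_sin : trig sin.
Proof.
split; first exact: sin_max.
- by apply: (derive_lipschitz (@is_derive_sin R)) => x; exact: cos_max.
- by apply: continuous_measurable_fun; exact: continuous_sin.
Qed.

Lemma trig_diff_sqr psi x y : trig psi ->
  (psi x - psi y) ^+ 2 <= Num.min 4 ((x - y) ^+ 2).
Proof.
move=> [p1 pL _]; rewrite le_min; apply/andP; split.
  rewrite -[leRHS](_ : 2 ^+ 2 = 4 :> R); last by rewrite expr2; ring.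
  rewrite -real_normK ?num_real// ler_pXn2r ?nnegrE//.
  by apply: le_trans (ler_normB _ _) _; have := p1 x; have := p1 y; lra.
rewrite -real_normK ?num_real// -[leRHS]real_normK ?num_real//.
by rewrite ler_pXn2r ?nnegrE.
Qed.

End trigonometric.

(** * Integrals of powers of the norm at the origin and at infinity *)

Section power_integrals.
Context (R : realType) (n : nat).
Local Notation V := 'rV[R]_n.

Lemma measurable_enorm_powR d (T : measurableType d) (p : R) (f : T -> V) :
  measurable_fun setT f -> measurable_fun setT (fun x => enorm (f x) `^ p).
Proof.
by move=> mf; exact: (measurableT_comp (measurable_powR _) (measurable_enorm mf)).
Qed.

(** The dilation by [lam] multiplies the integral by [q = lam^(beta - n)], so the integrals satisfy
    [I (m+1) <= q I m + K] and stay below [K/(1-q)]. *)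
Lemma power_shells (beta lam K : R) (D : nat -> V -> bool) :
  0 < lam -> lam `^ (beta - n%:R) < 1 -> 0 <= K ->
  (forall m, measurable_fun setT (D m)) -> (forall xi, D 0%N xi = false) ->
  (forall m xi, D m.+1 xi -> D m (lam *: xi) || D 1%N xi) ->
  (\int[lebV R n]_xi ((D 1%N xi)%:R * enorm xi `^ (- beta))%:E <= K%:E)%E ->
  forall m, (\int[lebV R n]_xi ((D m xi)%:R * enorm xi `^ (- beta))%:E
    <= (K / (1 - lam `^ (beta - n%:R)))%:E)%E.
Proof.
move=> l0 q1 K0 mD D0 DS hK; set q := lam `^ _ in q1 *.
have q0 : 0 <= q by exact: powR_ge0.
have q1' : 0 < 1 - q by rewrite subr_gt0.
have mphi m : measurable_fun setT (fun xi => ((D m xi)%:R * enorm xi `^ (- beta))%:E).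
  apply/measurable_EFinP; apply: measurable_funM; first exact: measurable_indic_bool.
  exact: measurable_enorm_powR.
have phi0 m xi : (0 <= ((D m xi)%:R * enorm xi `^ (- beta))%:E)%E.
  by rewrite lee_fin mulr_ge0// powR_ge0.
elim=> [|m IH].
  under eq_integral do rewrite D0 mul0r.
  by rewrite integral0 lee_fin divr_ge0// ltW.
have mphil : measurable_fun setT (fun xi : V =>
    ((D m (lam *: xi))%:R * enorm (lam *: xi) `^ (- beta))%:E).
  by apply: measurableT_comp (mphi m) _; exact: measurable_scalev.
apply: (@le_trans _ _ (\int[lebV R n]_xi
   ((lam `^ beta)%:E * ((D m (lam *: xi))%:R * enorm (lam *: xi) `^ (- beta))%:E
    + ((D 1%N xi)%:R * enorm xi `^ (- beta))%:E))%E).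
  apply: ge0_le_integralT; [exact: mphi| |exact: phi0|].
  - apply: emeasurable_funD; last exact: mphi.
    exact: measurable_funeM mphil.
  - move=> xi; rewrite -EFinM -EFinD lee_fin enormZ gtr0_norm//.
    rewrite powRM ?enorm_ge0 ?(ltW l0)// (powRN lam).
    have -> : lam `^ beta * ((D m (lam *: xi))%:R * ((lam `^ beta)^-1 * enorm xi `^ (- beta)))
      = (D m (lam *: xi))%:R * enorm xi `^ (- beta).
      by field; rewrite gt_eqF// powR_gt0.
    rewrite -mulrDl ler_wpM2r ?powR_ge0// -natrD ler_nat.
    by case h : (D m.+1 xi) => //; have := DS _ _ h; case: (D m _); case: (D 1%N xi).
rewrite ge0_integralDT; [|exact: measurable_funeM mphil|exact: mphi| |exact: phi0]; last first.
  by move=> xi; rewrite mule_ge0// lee_fin ?powR_ge0// mulr_ge0// powR_ge0.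
rewrite ge0_integralZlT//; last by rewrite lee_fin powR_ge0.
rewrite (lebV_dilate l0 (mphi m) (phi0 m)) muleA -EFinM.
have -> : lam `^ beta / lam ^+ n = q.
  rewrite /q powRB; last by rewrite (gt_eqF l0) implybT.
  by rewrite powR_mulrn// ltW.
apply: (@le_trans _ _ (q%:E * (K / (1 - q))%:E + K%:E)%E).
  by apply: leeD => //; apply: lee_wpmul2l.
by rewrite -EFinM -EFinD lee_fin le_eqVlt; apply/orP; left; apply/eqP; field; rewrite gt_eqF.
Qed.

Lemma shell_bound (beta : R) (D : V -> bool) : 0 <= beta ->
  measurable_fun setT D -> (forall xi, D xi -> 2^-1 <= enorm xi <= 2) ->
  (\int[lebV R n]_xi ((D xi)%:R * enorm xi `^ (- beta))%:E <=
   (2 `^ beta * (2 ^+ n * ball_volume R n))%:E)%E.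
Proof.
move=> b0 mD hD; have mb : measurable_fun setT (fun z : V => ((enorm (z - 0) <= 2)%R%:R)%:E : \bar R).
  apply/measurable_EFinP; apply: measurable_indic_le => //; apply: measurable_enorm.
  exact: measurable_addv.
rewrite EFinM -(@integral_ball R n 0 2)// -ge0_integralZlT//.
apply: ge0_le_integral => //.
- by move=> xi _; rewrite lee_fin mulr_ge0// powR_ge0.
- apply/measurable_EFinP; apply: measurable_funM; first exact: measurable_indic_bool.
  exact: measurable_enorm_powR.
- exact: measurable_funeM.
move=> xi _; rewrite -EFinM lee_fin subr0.
case h : (D xi); last by rewrite mul0r mulr_ge0// powR_ge0.
have /andP[h1 h2] := hD _ h; rewrite h2 mul1r mulr1 powR_inv ?enorm_ge0//.
have x0 : 0 < enorm xi by apply: lt_le_trans h1; rewrite invr_gt0.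
apply: ge0_ler_powR; rewrite ?nnegrE ?invr_ge0 ?enorm_ge0//.
by rewrite -[leRHS]invrK lef_pV2// posrE invr_gt0.
Qed.

Variable r : R.
Hypothesis r01 : 0 < r < 1.

Let s := n%:R / 2 + r.

(** The weight of the Sobolev norm of exponent [- t]; at the origin it is 0 for nonzero [t]. *)
Definition weight (t : R) (xi : V) : R := enorm xi `^ (- (2 * t)).

Lemma weight_ge0 t xi : 0 <= weight t xi. Proof. exact: powR_ge0. Qed.

Lemma measurable_weight t : measurable_fun setT (weight t).
Proof. exact: measurable_enorm_powR. Qed.

Let twos : 2 * s = n%:R + 2 * r. Proof. by rewrite /s mulrDr; field. Qed.

Let two_powR (b : R) : b < 0 -> (2 : R) `^ b < 1.
Proof.
move=> b0; rewrite -[b]opprK powRN invf_lt1 ?powR_gt0//.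
rewrite -[X in X < _](_ : 1 `^ (- b) = 1); last by rewrite powR1.
by apply: gt0_ltr_powR; rewrite ?oppr_gt0 ?nnegrE// ltr1n.
Qed.

(** Dyadic shells with [lam = 1/2] have ratio [2^(-2r)]: convergence at infinity rests on
    [r > 0]. *)
Lemma outer_integral : exists K : R,
  (\int[lebV R n]_xi ((1 <= enorm xi)%R%:R * weight s xi)%:E <= K%:E)%E.
Proof.
have /andP[r0 r1] := r01.
pose D m (xi : V) := (1 <= enorm xi) && (enorm xi < 2 ^+ m).
have mD m : measurable_fun setT (D m).
  apply: measurable_and.
    by apply: measurable_fun_ler => //; exact: measurable_enorm.
  by apply: measurable_fun_ltr => //; exact: measurable_enorm.
have b0 : 0 <= 2 * s by rewrite twos addr_ge0// mulr_ge0// ltW.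
pose K1 := 2 `^ (2 * s) * (2 ^+ n * ball_volume R n).
have K10 : 0 <= K1.
  by rewrite mulr_ge0 ?powR_ge0// mulr_ge0 ?exprn_ge0// ltW// ball_volume_gt0.
have q1 : (2^-1 : R) `^ (2 * s - n%:R) < 1.
  rewrite -powR_inv//; apply: two_powR.
  by rewrite twos addrAC subrr add0r oppr_lt0 mulr_gt0.
have D0 xi : D 0%N xi = false by rewrite /D expr0; apply/negbTE/negP => /andP[]; lra.
have DS m xi : D m.+1 xi -> D m (2^-1 *: xi) || D 1%N xi.
  rewrite /D enormZ gtr0_norm// => /andP[h1 h2]; rewrite h1 expr1/=.
  case: (ltP (enorm xi) 2) => h3; rewrite ?orbT// orbF.
  apply/andP; split; first by rewrite ler_pdivlMl// mulr1.
  by rewrite ltr_pdivrMl// -exprS.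
have hK1 : (\int[lebV R n]_xi ((D 1%N xi)%:R * enorm xi `^ (- (2 * s)))%:E <= K1%:E)%E.
  apply: shell_bound => // xi /andP[h1 h2]; rewrite expr1 in h2.
  by apply/andP; split; lra.
have l0 : 0 < (2^-1 : R) by rewrite invr_gt0.
have H := power_shells l0 q1 K10 mD D0 DS hK1.
exists (K1 / (1 - 2^-1 `^ (2 * s - n%:R))).
apply: (fatou_bound (u := fun m xi => ((D m xi)%:R * enorm xi `^ (- (2 * s)))%:E)).
- apply/measurable_EFinP; apply: measurable_funM; last exact: measurable_weight.
  by apply: measurable_indic_le => //; exact: measurable_enorm.
- by move=> xi; rewrite lee_fin mulr_ge0// weight_ge0.
- move=> m; apply/measurable_EFinP; apply: measurable_funM; first exact: measurable_indic_bool.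
  exact: measurable_enorm_powR.
- by move=> m xi; rewrite lee_fin mulr_ge0// powR_ge0.
- apply: aeW => xi a ha.
  have [k hk] : exists k, enorm xi < 2 ^+ k.
    exists (Num.truncn (enorm xi)).+1; have /andP[_ h] := truncn_itv (enorm_ge0 xi).
    apply: lt_le_trans h _; rewrite -natrX ler_nat; exact: ltnW (ltn_expl _ _).
  exists k => // m /= km; apply: le_trans (ltW ha) _; rewrite lee_fin /weight /D.
  have -> : enorm xi < 2 ^+ m by apply: lt_le_trans hk _; rewrite ler_eXn2l// ltr1n.
  by rewrite andbT.
- move=> e e0; apply: nearW => m; apply: le_trans (H m) _.
  by rewrite lee_fin lerDl ltW.
Qed.

Hypothesis n1 : (1 < n)%N.

(** With [lam = 2] the ratio is [2^(2s - 2 - n) = 2^(2r - 2)], below 1 because [r < 1]: the factor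
    [|xi|^2] compensates the singularity at the origin. For [n >= 2] the exponent [2s - 2] is
    nonnegative, as [shell_bound] requires. *)
Lemma inner_integral : exists K : R,
  (\int[lebV R n]_xi ((enorm xi <= 1)%R%:R * (enorm xi ^+ 2 * weight s xi))%:E <= K%:E)%E.
Proof.
have /andP[r0 r1] := r01.
pose D m (xi : V) := (2 ^- m < enorm xi) && (enorm xi <= 1).
have mD m : measurable_fun setT (D m).
  apply: measurable_and.
    by apply: measurable_fun_ltr => //; exact: measurable_enorm.
  by apply: measurable_fun_ler => //; exact: measurable_enorm.
have b0 : 0 <= 2 * s - 2.
  have : (2%:R : R) <= n%:R by rewrite ler_nat.
  by rewrite twos; lra.
pose K1 := 2 `^ (2 * s - 2) * (2 ^+ n * ball_volume R n).
have K10 : 0 <= K1.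
  by rewrite mulr_ge0 ?powR_ge0// mulr_ge0 ?exprn_ge0// ltW// ball_volume_gt0.
have q1 : (2 : R) `^ (2 * s - 2 - n%:R) < 1 by apply: two_powR; rewrite twos; lra.
have D0 xi : D 0%N xi = false by rewrite /D expr0 invr1; apply/negbTE/negP => /andP[]; lra.
have DS m xi : D m.+1 xi -> D m (2 *: xi) || D 1%N xi.
  rewrite /D enormZ gtr0_norm// => /andP[h1 h2]; rewrite h2 expr1 andbT.
  case: (ltP 2^-1 (enorm xi)) => h3; rewrite ?orbT// orbF.
  apply/andP; split; first by rewrite -ltr_pdivrMl// -invfM -exprS.
  by rewrite -ler_pdivlMl// mulr1.
have hK1 : (\int[lebV R n]_xi ((D 1%N xi)%:R * enorm xi `^ (- (2 * s - 2)))%:E <= K1%:E)%E.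
  apply: shell_bound => // xi /andP[h1 h2]; rewrite expr1 in h1.
  by apply/andP; split; lra.
have l0 : 0 < (2 : R) by [].
have H := power_shells l0 q1 K10 mD D0 DS hK1.
exists (K1 / (1 - 2 `^ (2 * s - 2 - n%:R))).
apply: (fatou_bound (u := fun m xi => ((D m xi)%:R * enorm xi `^ (- (2 * s - 2)))%:E)).
- apply/measurable_EFinP; apply: measurable_funM.
    by apply: measurable_indic_le => //; exact: measurable_enorm.
  apply: measurable_funM; last exact: measurable_weight.
  by apply: measurable_funX; exact: measurable_enorm.
- by move=> xi; rewrite lee_fin mulr_ge0// mulr_ge0 ?weight_ge0// sqr_ge0.
- move=> m; apply/measurable_EFinP; apply: measurable_funM; first exact: measurable_indic_bool.
  exact: measurable_enorm_powR.
- by move=> m xi; rewrite lee_fin mulr_ge0// powR_ge0.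
- apply: aeW => xi a ha.
  have [x0|x0] := leP (enorm xi) 0.
    apply: nearW => m; apply: le_trans (ltW ha) _; rewrite lee_fin.
    have -> : enorm xi = 0 by apply/eqP; rewrite eq_le x0 enorm_ge0.
    by rewrite expr0n/= mul0r mulr0 mulr_ge0// powR_ge0.
  have [k hk] : exists k, 2 ^- k < enorm xi.
    exists (Num.truncn (enorm xi)^-1).+1.
    have /andP[_ h] := truncn_itv (ltW (eq_ind_r (fun b => is_true b) x0 (invr_gt0 (enorm xi)))).
    rewrite -[ltRHS]invrK ltf_pV2 ?posrE ?invr_gt0 ?exprn_gt0//.
    apply: lt_le_trans h _; rewrite -natrX ler_nat; exact: ltnW (ltn_expl _ _).
  exists k => // m /= km; apply: le_trans (ltW ha) _; rewrite lee_fin /weight /D.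
  have -> : 2 ^- m < enorm xi.
    by apply: le_lt_trans hk; rewrite lef_pV2 ?posrE ?exprn_gt0// ler_eXn2l// ltr1n.
  rewrite /= opprB -powR_mulrn ?(ltW x0)// -powRD ?(gt_eqF x0) ?implybT//.
- move=> e e0; apply: nearW => m; apply: le_trans (H m) _.
  by rewrite lee_fin lerDl ltW.
Qed.

(** [min(4, |xi|^2)] has the shape of the squared increment of a 1-Lipschitz function bounded by 1,
    whence the constant 4. *)
Lemma minsq_integral : exists K : R, 0 < K /\
  (\int[lebV R n]_xi (Num.min 4 (enorm xi ^+ 2) * weight s xi)%:E <= K%:E)%E.
Proof.
have [K1 h1] := outer_integral; have [K2 h2] := inner_integral.
have m1 : measurable_fun setT (fun xi : V => ((enorm xi <= 1)%R%:R * (enorm xi ^+ 2 * weight s xi))%:E).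
  apply/measurable_EFinP; apply: measurable_funM.
    by apply: measurable_indic_le => //; exact: measurable_enorm.
  apply: measurable_funM; last exact: measurable_weight.
  by apply: measurable_funX; exact: measurable_enorm.
have m2 : measurable_fun setT (fun xi : V => ((1 <= enorm xi)%R%:R * weight s xi)%:E).
  apply/measurable_EFinP; apply: measurable_funM; last exact: measurable_weight.
  by apply: measurable_indic_le => //; exact: measurable_enorm.
have p1 (xi : V) : (0 <= ((enorm xi <= 1)%R%:R * (enorm xi ^+ 2 * weight s xi))%:E)%E.
  by rewrite lee_fin mulr_ge0// mulr_ge0 ?weight_ge0// sqr_ge0.
have p2 (xi : V) : (0 <= ((1 <= enorm xi)%R%:R * weight s xi)%:E)%E.
  by rewrite lee_fin mulr_ge0// weight_ge0.
exists (`|K2| + 4 * `|K1| + 1); split.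
  by rewrite ltr_wpDl// addr_ge0// mulr_ge0.
apply: (@le_trans _ _ (\int[lebV R n]_xi
   (((enorm xi <= 1)%R%:R * (enorm xi ^+ 2 * weight s xi))%:E +
     4%:E * ((1 <= enorm xi)%R%:R * weight s xi)%:E))%E).
  apply: ge0_le_integralT.
  - apply/measurable_EFinP; apply: measurable_funM; last exact: measurable_weight.
    by apply: measurable_minr => //; apply: measurable_funX; exact: measurable_enorm.
  - by apply: emeasurable_funD => //; exact: measurable_funeM.
  - by move=> xi; rewrite lee_fin mulr_ge0 ?weight_ge0// le_min sqr_ge0 ler0n.
  move=> xi; rewrite -EFinM -EFinD lee_fin.
  have w0 := weight_ge0 s xi.
  have [h|/ltW h] := leP (enorm xi) 1.
    rewrite mul1r ler_wpDr ?mulr_ge0// ler_wpM2r// ge_min lexx orbT//.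
  by rewrite h mul1r mul0r add0r ler_wpM2r// ge_min lexx.
rewrite ge0_integralDT//; [|exact: measurable_funeM|by move=> xi; rewrite mule_ge0].
rewrite ge0_integralZlT//.
apply: (@le_trans _ _ (K2%:E + 4%:E * K1%:E)%E).
  by apply: leeD => //; apply: lee_wpmul2l.
by rewrite -EFinM -EFinD lee_fin; have := ler_norm K1; have := ler_norm K2; lra.
Qed.

(** The substitution of [t xi] for [xi] produces [t^(2s - n) = t^(2r)]. *)
Lemma minsq_scaled (K t : R) : 0 < K -> 0 <= t ->
  (\int[lebV R n]_xi (Num.min 4 (enorm xi ^+ 2) * weight s xi)%:E <= K%:E)%E ->
  (\int[lebV R n]_xi (Num.min 4 ((t * enorm xi) ^+ 2) * weight s xi)%:E
    <= (K * t `^ (2 * r))%:E)%E.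
Proof.
have /andP[r0 r1] := r01.
move=> K0; rewrite le_eqVlt => /predU1P[<-|t0] hK.
  under eq_integral do rewrite mul0r expr0n/= minElt ltNge ler0n/= mul0r.
  by rewrite integral0 lee_fin mulr_ge0 ?powR_ge0// ltW.
have mf : measurable_fun setT (fun xi : V => (Num.min 4 (enorm xi ^+ 2) * weight s xi)%:E).
  apply/measurable_EFinP; apply: measurable_funM; last exact: measurable_weight.
  by apply: measurable_minr => //; apply: measurable_funX; exact: measurable_enorm.
have f0 (xi : V) : (0 <= (Num.min 4 (enorm xi ^+ 2) * weight s xi)%:E)%E.
  by rewrite lee_fin mulr_ge0 ?weight_ge0// le_min sqr_ge0 ler0n.
have mft : measurable_fun setT (fun xi : V =>
    (Num.min 4 (enorm (t *: xi) ^+ 2) * weight s (t *: xi))%:E).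
  by apply: measurableT_comp mf _; exact: measurable_scalev.
apply: (@le_trans _ _ (\int[lebV R n]_xi ((t `^ (2 * s))%:E *
    (Num.min 4 (enorm (t *: xi) ^+ 2) * weight s (t *: xi))%:E))%E).
  rewrite le_eqVlt; apply/orP; left; apply/eqP; apply: eq_integral => xi _.
  rewrite -EFinM enormZ gtr0_norm// /weight enormZ gtr0_norm//.
  rewrite (powRM _ (ltW t0)) ?enorm_ge0// (powRN t); congr (_%:E).
  have tt : t `^ (2 * s) != 0 by rewrite gt_eqF// powR_gt0.
  by rewrite (mulrC (t `^ (2 * s))) -!mulrA (mulrC _ (t `^ (2 * s))) (mulrA _^-1) mulVf// mul1r.
rewrite ge0_integralZlT//; last by rewrite lee_fin powR_ge0.
rewrite (lebV_dilate t0 mf f0) muleA -EFinM.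
have -> : t `^ (2 * s) / t ^+ n = t `^ (2 * r).
  rewrite twos powRD ?(gt_eqF t0) ?implybT// powR_mulrn ?(ltW t0)//.
  by rewrite mulrAC divff ?mul1r// gt_eqF// exprn_gt0.
by rewrite (mulrC K) EFinM; apply: lee_wpmul2l; rewrite // lee_fin powR_ge0.
Qed.

(** The energy of the dipole [delta_v - delta_w] is at most of order [|v - w|^(2r)]; the energies of
    jumps and of measures are built from it. *)
Lemma trig_energy (psi : R -> R) (K : R) (v w : V) : trig psi -> 0 < K ->
  (\int[lebV R n]_xi (Num.min 4 (enorm xi ^+ 2) * weight s xi)%:E <= K%:E)%E ->
  (\int[lebV R n]_xi ((psi (dotv xi v) - psi (dotv xi w)) ^+ 2 * weight s xi)%:E
    <= (K * enorm (v - w) `^ (2 * r))%:E)%E.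
Proof.
move=> tpsi K0 hK; have [_ _ mpsi] := tpsi.
apply: le_trans (minsq_scaled K0 (enorm_ge0 (v - w)) hK).
have mp u : measurable_fun setT (fun xi : V => psi (dotv xi u)).
  by apply: measurableT_comp => //; exact: measurable_dotv.
apply: ge0_le_integralT.
- apply/measurable_EFinP; apply: measurable_funM; last exact: measurable_weight.
  by apply: measurable_funX; apply: measurable_funB.
- apply/measurable_EFinP; apply: measurable_funM; last exact: measurable_weight.
  apply: measurable_minr => //; apply: measurable_funX; apply: measurable_funM => //.
  exact: measurable_enorm.
- by move=> xi; rewrite lee_fin mulr_ge0 ?weight_ge0// sqr_ge0.
move=> xi; rewrite lee_fin ler_wpM2r ?weight_ge0//.
apply: le_trans (trig_diff_sqr _ _ tpsi) _; rewrite le_min !ge_min lexx/=.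
apply/orP; right; rewrite -dotvBr -[X in X <= _]real_normK ?num_real//.
by rewrite ler_pXn2r ?nnegrE ?mulr_ge0 ?enorm_ge0// (mulrC (enorm (v - w))) dotv_CS.
Qed.

End power_integrals.

(** * Geometry of a collision *)

Section powR_real.
Context (R : realType).

(** The sum is at most twice its larger term, and [2^r <= 2]. *)
Lemma powR_sum_le (a b r : R) : 0 <= a -> 0 <= b -> 0 <= r -> r <= 1 ->
  (a + b) `^ r <= 2 * (a `^ r + b `^ r).
Proof.
move=> a0 b0 r0 r1.
have h2 : (2 : R) `^ r <= 2.
  by rewrite -[leRHS](@powRr1 _ 2)// ler_powR// ler1n.
have H x y : 0 <= x -> x <= y -> (x + y) `^ r <= 2 * (x `^ r + y `^ r).
  move=> x0 xy; have y0 := le_trans x0 xy.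
  apply: (@le_trans _ _ ((2 * y) `^ r)).
    by apply: ge0_ler_powR; rewrite ?nnegrE//; [apply: addr_ge0|apply: mulr_ge0|lra].
  rewrite powRM// mulrDr; apply: (@le_trans _ _ (2 * y `^ r)).
    by rewrite ler_wpM2r// powR_ge0.
  by rewrite lerDr mulr_ge0// powR_ge0.
have [ab|/ltW ba] := leP a b; first exact: H.
by rewrite addrC [X in 2 * X]addrC; exact: H.
Qed.

(** Interpolates a uniform bound and a Lipschitz bound into a Holder bound of exponent [r]. *)
Lemma min_powR_le (t r : R) : 0 <= t -> 0 < r -> r < 1 -> Num.min 4 (2 * t) <= 4 * t `^ r.
Proof.
move=> t0 r0 r1; have [t1|t1] := leP 1 t.
  rewrite ge_min; apply/orP; left; rewrite -[leLHS]mulr1 ler_wpM2l//.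
  by rewrite -(powRr0 t); exact: ler_powR t1 _ _ (ltW r0).
rewrite ge_min; apply/orP; right.
move: t0; rewrite le_eqVlt => /predU1P[<-|t0]; first by rewrite mulr0 mulr_ge0// powR_ge0.
have := @ger1_powR _ t r; rewrite t0 (ltW t1) => /(_ isT (ltW r1)).
by have := powR_ge0 t r; lra.
Qed.

(* With [p = min s c], [p^2 <= 1/2] and [max^r >= max^2 = 1 - p^2]. *)
Lemma min_powR_sc (s c r : R) : 0 < s -> 0 < c -> s ^+ 2 + c ^+ 2 = 1 ->
  0 < r -> r < 1 -> (Num.min s c) `^ r <= 4 * (s `^ r + c `^ r - 1).
Proof.
move=> s0 c0 sc r0 r1.
have H (p q : R) : 0 < p -> p <= q -> p ^+ 2 + q ^+ 2 = 1 ->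
    p `^ r <= 4 * (p `^ r + q `^ r - 1).
  move=> p0 pq pq1; have q0 := lt_le_trans p0 pq.
  (* Indeed [p^2 <= 1/2 < 9/16]. This gives [p^2 <= 3/4 p^r], and then
     [p^r + q^r - 1 >= p^r - p^2 >= p^r / 4]. *)
  have p34 : p <= 3 / 4.
    rewrite leNgt; apply/negP => h.
    have h2 : (3 / 4) ^+ 2 < p ^+ 2 by rewrite ltr_pXn2r// nnegrE ltW.
    have h3 : p ^+ 2 <= q ^+ 2 by rewrite ler_pXn2r// nnegrE ltW.
    have : (3 / 4 : R) ^+ 2 = 9 / 16 by rewrite expr2; field.
    lra.
  have q1 : q <= 1.
    rewrite leNgt; apply/negP => h.
    have : 1 < q ^+ 2 by rewrite expr_gt1// ltW.
    by have := sqr_ge0 p; lra.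
  have p1 : p <= 1 by lra.
  have h1 : q ^+ 2 <= q `^ r.
    rewrite -powR_mulrn ?(ltW q0)//; apply: ger_powR; first by rewrite q0.
    by rewrite (le_trans (ltW r1))// ler1n.
  have h2 : p ^+ 2 <= 3 / 4 * p `^ r.
    apply: (@le_trans _ _ (p * p `^ r)); last by rewrite ler_wpM2r// powR_ge0.
    rewrite expr2 ler_pM2l//; apply: ger1_powR; last exact: ltW.
    by rewrite p0.
  lra.
have [h|/ltW h] := leP s c; first exact: H.
by rewrite [X in 4 * (X - 1)]addrC; apply: H => //; rewrite addrC.
Qed.

End powR_real.

Section collision_geometry.
Context (R : realType) (n : nat).
Local Notation V := 'rV[R]_n.
Local Notation U := (uniform_ball R n).
Implicit Types (xi v w x : V) (theta : R).

Definition out1 v w theta x : V := (post_collision v w (theta, x)).1.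
Definition out2 v w theta x : V := (post_collision v w (theta, x)).2.

Lemma out1E v w theta x : out1 v w theta x =
  2^-1 *: (v + w) + (enorm (v - w) / 2) *: cone_point (unitv (v - w)) theta x.
Proof. by []. Qed.

Lemma out2E v w theta x : out2 v w theta x =
  2^-1 *: (v + w) - (enorm (v - w) / 2) *: cone_point (unitv (v - w)) theta x.
Proof. by []. Qed.

Let half : (2^-1 : R) + 2^-1 = 1. Proof. by field. Qed.

Lemma out1_same v theta x : out1 v v theta x = v.
Proof. by rewrite out1E subrr enorm0 mul0r scale0r addr0 scalerDr -scalerDl half scale1r. Qed.

Lemma out2_same v theta x : out2 v v theta x = v.
Proof. by rewrite out2E subrr enorm0 mul0r scale0r subr0 scalerDr -scalerDl half scale1r. Qed.

Lemma midpointD v w : v - 2^-1 *: (v + w) = (enorm (v - w) / 2) *: unitv (v - w).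
Proof.
by rewrite mulrC -scalerA -unitvE; apply/rowP => i; rewrite !mxE; field.
Qed.

Lemma sub_out1 v w theta x : v - out1 v w theta x =
  (enorm (v - w) / 2) *: (unitv (v - w) - cone_point (unitv (v - w)) theta x).
Proof. by rewrite out1E opprD addrA midpointD scalerBr. Qed.

Lemma sub_out2 v w theta x : v - out2 v w theta x =
  (enorm (v - w) / 2) *: (unitv (v - w) + cone_point (unitv (v - w)) theta x).
Proof.
rewrite out2E; move: (cone_point _ _ _) => c; rewrite (scalerDr (enorm (v - w) / 2)).
by rewrite -midpointD; move: (_ *: c) => e; apply/rowP => i; rewrite !mxE; ring.
Qed.

Lemma out_momentum v w theta x : out1 v w theta x + out2 v w theta x = v + w.
Proof. by rewrite out1E out2E addrACA subrr addr0 -scalerDl half scale1r. Qed.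

Lemma sub_out2r v w theta x : w - out2 v w theta x = - (v - out1 v w theta x).
Proof.
have := out_momentum v w theta x; move: (out1 _ _ _ _) (out2 _ _ _ _) => a b h.
have -> : b = v + w - a by rewrite -h addrC addKr.
by apply/rowP => i; rewrite !mxE; ring.
Qed.

Lemma sub_out1r v w theta x : w - out1 v w theta x = - (v - out2 v w theta x).
Proof.
have := out_momentum v w theta x; move: (out1 _ _ _ _) (out2 _ _ _ _) => a b h.
have -> : b = v + w - a by rewrite -h addrC addKr.
by apply/rowP => i; rewrite !mxE; ring.
Qed.

Lemma sin_half theta : 2 - 2 * cos theta = (2 * sin (theta / 2)) ^+ 2.
Proof.
rewrite {1}(_ : theta = (theta / 2) *+ 2); last by rewrite mulr2n; field.
by rewrite cos_mulr2n exprMn sin2cos2; ring.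
Qed.

Lemma cos_half theta : 2 + 2 * cos theta = (2 * cos (theta / 2)) ^+ 2.
Proof.
rewrite {1}(_ : theta = (theta / 2) *+ 2); last by rewrite mulr2n; field.
by rewrite cos_mulr2n exprMn; ring.
Qed.

Lemma enorm_sub_cone e theta x : enorm e = 1 -> enorm (cone_point e theta x) = 1 ->
  0 <= sin (theta / 2) -> enorm (e - cone_point e theta x) = 2 * sin (theta / 2).
Proof.
move=> e1 c1 s0; apply/eqP; rewrite -(@eqrXn2 _ 2%N) ?enorm_ge0 ?mulr_ge0//.
by rewrite sqr_enormB -!sqr_enorm e1 c1 dotv_cone_point// -sin_half; apply/eqP; ring.
Qed.

Lemma enorm_add_cone e theta x : enorm e = 1 -> enorm (cone_point e theta x) = 1 ->
  0 <= cos (theta / 2) -> enorm (e + cone_point e theta x) = 2 * cos (theta / 2).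
Proof.
move=> e1 c1 s0; apply/eqP; rewrite -(@eqrXn2 _ 2%N) ?enorm_ge0 ?mulr_ge0//.
rewrite -{1}[cone_point _ _ _]opprK sqr_enormB dotvNl !dotvNr.
by rewrite -!sqr_enorm e1 c1 dotv_cone_point// -cos_half; apply/eqP; ring.
Qed.

(* [good v w theta x] excludes only a null set of [x] *)
Definition good v w theta x :=
  v = w \/ enorm (cone_point (unitv (v - w)) theta x) = 1.

Lemma ae_good v w theta : (1 < n)%N -> {ae U, forall x, good v w theta x}.
Proof.
move=> n1; have [->|vw] := eqVneq v w; first by apply: aeW => x; left.
have e1 : enorm (unitv (v - w)) = 1 by rewrite enorm_unitv// subr_eq0.
have [A [mA A0 hA]] := ae_enorm_cone_point theta n1 e1.
by exists A; split => // x nx; apply: hA => h; apply: nx; right.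
Qed.

Lemma enorm_sub_out1 v w theta x : good v w theta x -> 0 <= sin (theta / 2) ->
  enorm (v - out1 v w theta x) = enorm (v - w) * sin (theta / 2).
Proof.
move=> [->|c1] s0; first by rewrite out1_same subrr enorm0 mul0r.
have [->|vw] := eqVneq v w; first by rewrite out1_same subrr enorm0 mul0r.
rewrite sub_out1 enormZ ger0_norm ?divr_ge0 ?enorm_ge0//.
by rewrite enorm_sub_cone// ?enorm_unitv ?subr_eq0//; field.
Qed.

Lemma enorm_sub_out2 v w theta x : good v w theta x -> 0 <= cos (theta / 2) ->
  enorm (v - out2 v w theta x) = enorm (v - w) * cos (theta / 2).
Proof.
move=> [->|c1] s0; first by rewrite out2_same subrr enorm0 mul0r.
have [->|vw] := eqVneq v w; first by rewrite out2_same subrr enorm0 mul0r.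
rewrite sub_out2 enormZ ger0_norm ?divr_ge0 ?enorm_ge0//.
by rewrite enorm_add_cone// ?enorm_unitv ?subr_eq0//; field.
Qed.

Lemma measurable_out d (T : measurableType d) (v w x : T -> V) (t : T -> R) :
  measurable_fun setT v -> measurable_fun setT w -> measurable_fun setT t ->
  measurable_fun setT x ->
  measurable_fun setT (fun z => out1 (v z) (w z) (t z) (x z)) /\
  measurable_fun setT (fun z => out2 (v z) (w z) (t z) (x z)).
Proof.
move=> mv mw mt mx.
have mvw : measurable_fun setT (fun z => v z - w z).
  by apply: measurable_addv => //; exact: measurable_oppv.
have m1 : measurable_fun setT (fun z => 2^-1 *: (v z + w z)).
  by apply: measurable_scalev => //; exact: measurable_addv.
have m2 : measurable_fun setT (fun z =>
    (enorm (v z - w z) / 2) *: cone_point (unitv (v z - w z)) (t z) (x z)).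
  apply: measurable_scalev; first by apply: measurable_funM => //; exact: measurable_enorm.
  by apply: measurable_cone_point => //; exact: measurable_unitv.
by split; apply: measurable_addv => //; exact: measurable_oppv.
Qed.

Definition jump (psi : R -> R) xi v w theta x : R :=
  - psi (dotv xi v) - psi (dotv xi w)
  + psi (dotv xi (out1 v w theta x)) + psi (dotv xi (out2 v w theta x)).

Lemma jump_same psi xi v theta x : jump psi xi v v theta x = 0.
Proof. by rewrite /jump out1_same out2_same; ring. Qed.

Lemma measurable_jump psi d (T : measurableType d) (xi v w x : T -> V) (t : T -> R) :
  measurable_fun setT psi ->
  measurable_fun setT xi -> measurable_fun setT v -> measurable_fun setT w ->
  measurable_fun setT t -> measurable_fun setT x ->
  measurable_fun setT (fun z => jump psi (xi z) (v z) (w z) (t z) (x z)).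
Proof.
move=> mp mxi mv mw mt mx; have [m1 m2] := measurable_out mv mw mt mx.
have h u : measurable_fun setT u -> measurable_fun setT (fun z => psi (dotv (xi z) (u z))).
  by move=> mu; apply: measurableT_comp => //; exact: measurable_dotv.
apply: measurable_funD; last exact: h.
apply: measurable_funD; last exact: h.
by apply: measurable_funB; [apply: measurableT_comp => //|]; exact: h.
Qed.

Lemma jump_le4 psi xi v w theta x : trig psi -> `|jump psi xi v w theta x| <= 4.
Proof.
move=> [p1 _ _]; rewrite /jump ler_norml.
have H y : -1 <= psi y <= 1 by rewrite -ler_norml.
have /andP[a1 a2] := H (dotv xi v); have /andP[b1 b2] := H (dotv xi w).
have /andP[c1 c2] := H (dotv xi (out1 v w theta x)).
have /andP[d1 d2] := H (dotv xi (out2 v w theta x)).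
by apply/andP; split; lra.
Qed.

(** Either outgoing velocity may be matched with [v]. A collision has little effect for [theta] near
    0 and also, the velocities being nearly exchanged, for [theta] near [pi]; [good_out] takes the
    better matching. *)
Lemma jump_pairs psi xi v w theta x :
  jump psi xi v w theta x =
    - ((psi (dotv xi v) - psi (dotv xi (out1 v w theta x)))
       + (psi (dotv xi w) - psi (dotv xi (out2 v w theta x)))) /\
  jump psi xi v w theta x =
    - ((psi (dotv xi v) - psi (dotv xi (out2 v w theta x)))
       + (psi (dotv xi w) - psi (dotv xi (out1 v w theta x)))).
Proof. by rewrite /jump; split; ring. Qed.

Variable r : R.
Hypotheses (r0 : 0 < r) (r1 : r < 1).

Definition minsc theta : R := Num.min (sin (theta / 2)) (cos (theta / 2)).
(** The size of the effect of a collision in the Sobolev norm, small at both ends of []0, pi[]. *)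
Definition rho theta : R := minsc theta `^ r.

Lemma rho_ge0 theta : 0 <= rho theta. Proof. exact: powR_ge0. Qed.

Section angle.
Variable theta : R.
Hypotheses (s0 : 0 < sin (theta / 2)) (c0 : 0 < cos (theta / 2)).

Lemma minsc_ge0 : 0 <= minsc theta.
Proof. by rewrite /minsc le_min !ltW. Qed.

Lemma good_out v w x : good v w theta x -> exists a b : V,
  [/\ enorm (v - a) = enorm (v - w) * minsc theta,
      enorm (w - b) = enorm (v - w) * minsc theta &
      forall psi xi, jump psi xi v w theta x =
        - ((psi (dotv xi v) - psi (dotv xi a)) + (psi (dotv xi w) - psi (dotv xi b)))].
Proof.
move=> g; rewrite /minsc; have [sc|cs] := leP (sin (theta / 2)) (cos (theta / 2)).
  exists (out1 v w theta x), (out2 v w theta x); split => [||psi xi].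
  - by rewrite enorm_sub_out1// ltW.
  - by rewrite sub_out2r enormN enorm_sub_out1// ltW.
  - by have [-> _] := jump_pairs psi xi v w theta x.
exists (out2 v w theta x), (out1 v w theta x); split => [||psi xi].
- by rewrite enorm_sub_out2// ltW.
- by rewrite sub_out1r enormN enorm_sub_out2// ltW.
- by have [_ ->] := jump_pairs psi xi v w theta x.
Qed.

(** Pointwise in [xi], this bound serves the absolute integrability over velocities and angles; the
    estimate in norm is [jump_energy]. *)
Lemma jump_bound psi xi v w x : trig psi -> good v w theta x ->
  `|jump psi xi v w theta x| <= 4 * (enorm xi `^ r * enorm (v - w) `^ r * rho theta).
Proof.
move=> tp g; have [a [b [ha hb hj]]] := good_out g.
have t0 : 0 <= enorm xi * enorm (v - w) * minsc theta.
  by rewrite !mulr_ge0 ?enorm_ge0 ?minsc_ge0.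
apply: (@le_trans _ _ (Num.min 4 (2 * (enorm xi * enorm (v - w) * minsc theta)))).
  rewrite le_min jump_le4//= hj normrN.
  have [_ pL _] := tp.
  have h u u' : `|psi (dotv xi u) - psi (dotv xi u')| <= enorm xi * enorm (u - u').
    by apply: le_trans (pL _ _) _; rewrite -dotvBr dotv_CS.
  apply: le_trans (ler_normD _ _) _; have := h v a; have := h w b.
  by rewrite ha hb !mulrA; lra.
apply: le_trans (min_powR_le t0 r0 r1) _.
by rewrite !powRM ?mulr_ge0 ?enorm_ge0 ?minsc_ge0.
Qed.

(** The jump is a sum of two dipoles of length [|v - w| minsc], and [(p + q)^2 <= 2 p^2 + 2 q^2]
    accounts for the factor 4. *)
Lemma jump_energy psi v w x (K : R) : (1 < n)%N -> trig psi -> good v w theta x -> 0 < K ->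
  (\int[lebV R n]_xi (Num.min 4 (enorm xi ^+ 2) * weight (n%:R / 2 + r) xi)%:E <= K%:E)%E ->
  (\int[lebV R n]_xi (jump psi xi v w theta x ^+ 2 * weight (n%:R / 2 + r) xi)%:E
   <= (4 * K * (enorm (v - w) `^ r * rho theta) ^+ 2)%:E)%E.
Proof.
move=> n1 tp g K0 hK; have [a [b [ha hb hj]]] := good_out g.
have r01 : 0 < r < 1 by rewrite r0.
have [_ _ mp] := tp.
have md u u' : measurable_fun setT (fun xi : V =>
    ((psi (dotv xi u) - psi (dotv xi u')) ^+ 2 * weight (n%:R / 2 + r) xi)%:E).
  apply/measurable_EFinP; apply: measurable_funM; last exact: measurable_weight.
  apply: measurable_funX; apply: measurable_funB;
    by apply: measurableT_comp mp _; exact: measurable_dotv.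
have d0 u u' xi : (0 <= ((psi (dotv xi u) - psi (dotv xi u')) ^+ 2 *
    weight (n%:R / 2 + r) xi)%:E)%E.
  by rewrite lee_fin mulr_ge0 ?sqr_ge0 ?weight_ge0.
have E1 := trig_energy r01 v a tp K0 hK.
have E2 := trig_energy r01 w b tp K0 hK.
apply: (@le_trans _ _ (\int[lebV R n]_xi (2%:E *
   (((psi (dotv xi v) - psi (dotv xi a)) ^+ 2 * weight (n%:R / 2 + r) xi)%:E +
    ((psi (dotv xi w) - psi (dotv xi b)) ^+ 2 * weight (n%:R / 2 + r) xi)%:E)))%E).
  apply: ge0_le_integralT.
  - apply/measurable_EFinP; apply: measurable_funM; last exact: measurable_weight.
    by apply: measurable_funX; apply: measurable_jump.
  - by apply: measurable_funeM; exact: emeasurable_funD.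
  - by move=> xi; rewrite lee_fin mulr_ge0 ?sqr_ge0 ?weight_ge0.
  move=> xi; rewrite -EFinD -EFinM lee_fin hj sqrrN -mulrDl mulrA.
  rewrite ler_wpM2r ?weight_ge0//.
  set p := _ - _; set q := _ - _.
  rewrite -subr_ge0 (_ : _ - _ = (p - q) ^+ 2) ?sqr_ge0//; by ring.
rewrite ge0_integralZlT; [|exact: emeasurable_funD|by move=> xi; rewrite adde_ge0|by []].
rewrite ge0_integralDT; [|exact: md|exact: md|exact: d0|exact: d0].
apply: (@le_trans _ _ (2%:E * ((K * enorm (v - a) `^ (2 * r))%:E +
    (K * enorm (w - b) `^ (2 * r))%:E))%E).
  by apply: lee_wpmul2l; [rewrite lee_fin|exact: leeD E1 E2].
have e2 (y : R) : 0 <= y -> y `^ (2 * r) = (y `^ r) ^+ 2.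
  by move=> y0; rewrite mulrC powRrM powR_mulrn// powR_ge0.
rewrite -EFinD -EFinM lee_fin ha hb e2 ?mulr_ge0 ?enorm_ge0 ?minsc_ge0//.
rewrite powRM ?enorm_ge0 ?minsc_ge0// -/(rho theta).
by rewrite le_eqVlt; apply/orP; left; apply/eqP; ring.
Qed.

End angle.
End collision_geometry.

(** * The collision form at a fixed angle *)

(** The bound [C] valid everywhere ensures integrability; the almost everywhere bound [c] gives the
    estimate. *)
Lemma rintegral_ae_bound d (T : measurableType d) (R : realType) (P : probability T R)
    (f : T -> R) (C c : R) :
  measurable_fun setT f -> (forall x, `|f x| <= C) -> 0 <= c ->
  {ae P, forall x, `|f x| <= c} -> `|\int[P]_x f x| <= c.
Proof.
move=> mf fC c0 fc; have intf := rint_bounded P mf fC.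
apply: le_trans (rintegral_norm intf) _.
have intnf : P.-integrable setT (EFin \o (fun x => `|f x|)).
  apply: (rint_bounded P (c := C)); first exact: measurableT_comp.
  by move=> x; rewrite normr_id.
rewrite -lee_fin EFin_Rintegral//.
apply: (@le_trans _ _ (\int[P]_x cst c%:E x)%E); last by rewrite (integral_prob_cst P).
apply: ae_ge0_le_integral => //.
- by apply/measurable_EFinP; exact: measurableT_comp.
- by case: fc => A [mA A0 hA]; exists A; split => // x nx; apply: hA => h; apply: nx => _; rewrite lee_fin.
Qed.

Lemma rintegral_prodM d1 d2 (T1 : measurableType d1) (T2 : measurableType d2) (R : realType)
    (m1 : {finite_measure set T1 -> \bar R}) (m2 : {finite_measure set T2 -> \bar R})
    (f : T1 -> R) (g : T2 -> R) (C : R) :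
  measurable_fun setT f -> measurable_fun setT g ->
  (forall x, `|f x| <= C) -> (forall x, `|g x| <= C) ->
  (m1 \x m2)%E.-integrable setT (EFin \o (fun p => f p.1 * g p.2)) /\
  \int[(m1 \x m2)%E]_p (f p.1 * g p.2) = \int[m1]_x f x * \int[m2]_y g y.
Proof.
move=> mf mg fC gC.
have mfg : measurable_fun setT (fun p : T1 * T2 => f p.1 * g p.2).
  by apply: measurable_funM; apply: measurableT_comp.
have i1 := rint_bounded m1 mf fC; have i2 := rint_bounded m2 mg gC.
have ifg : (m1 \x m2)%E.-integrable setT (EFin \o (fun p => f p.1 * g p.2)).
  apply/integrableP; split; first exact/measurable_EFinP.
  rewrite (tonelli_prod m1 m2 (f := fun p => `|(f p.1 * g p.2)%:E|)%E)//; last first.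
    by apply: measurableT_comp => //; exact/measurable_EFinP.
  under eq_integral => x _.
    under eq_integral do rewrite /= normrM EFinM.
    rewrite ge0_integralZlT//; last by apply/measurable_EFinP; exact: measurableT_comp.
    over.
  rewrite ge0_integralZrT//; first last.
  - exact: integral_ge0.
  - by apply/measurable_EFinP; exact: measurableT_comp.
  have h1 := rint_lty i1; have h2 := rint_lty i2.
  apply: lte_mul_pinfty => //; first exact: integral_ge0.
  by rewrite ge0_fin_numE// integral_ge0.
split => //; rewrite -(rfubini1 ifg)/=.
under eq_Rintegral do rewrite rintegralZ//.
by under eq_Rintegral do rewrite mulrC; rewrite rintegralZ// mulrC.
Qed.

Section bilinear_form.
Context (R : realType) (n : nat) (r : R).
Local Notation V := 'rV[R]_n.
Local Notation U := (uniform_ball R n).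
Hypotheses (n1 : (1 < n)%N) (r0 : 0 < r) (r1 : r < 1).
Local Notation s := (n%:R / 2 + r).
Implicit Types (xi v w x : V) (theta : R) (psi : R -> R).

Definition mean_jump psi xi v w theta : R := \int[U]_x jump psi xi v w theta x.

Lemma int_jump psi xi v w theta : trig psi ->
  U.-integrable setT (EFin \o jump psi xi v w theta).
Proof.
move=> tp; have [_ _ mp] := tp; apply: (rint_bounded U (c := 4)).
  exact: measurable_jump.
by move=> x; exact: jump_le4.
Qed.

Lemma measurable_mean_jump psi d (T : measurableType d) (xi v w : T -> V) (t : T -> R) :
  measurable_fun setT psi ->
  measurable_fun setT xi -> measurable_fun setT v -> measurable_fun setT w ->
  measurable_fun setT t ->
  measurable_fun setT (fun z => mean_jump psi (xi z) (v z) (w z) (t z)).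
Proof.
move=> mp mxi mv mw mt; apply: (measurable_Rintegral_snd U
  (f := fun z => jump psi (xi z.1) (v z.1) (w z.1) (t z.1) z.2)).
by apply: measurable_jump => //; apply: measurableT_comp.
Qed.

Lemma mean_jump_same psi xi v theta : mean_jump psi xi v v theta = 0.
Proof.
rewrite /mean_jump; under eq_Rintegral do rewrite jump_same.
exact: rintegral_prob_cst.
Qed.

Lemma mean_jump_bound psi xi v w theta : trig psi ->
  0 < sin (theta / 2) -> 0 < cos (theta / 2) ->
  `|mean_jump psi xi v w theta| <= 4 * (enorm xi `^ r * enorm (v - w) `^ r * rho r theta).
Proof.
move=> tp s0 c0; have [_ _ mp] := tp.
apply: (rintegral_ae_bound (C := 4)).
- exact: measurable_jump.
- by move=> x; exact: jump_le4.
- by rewrite !mulr_ge0 ?powR_ge0.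
have [A [mA A0 hA]] := ae_good v w theta n1.
by exists A; split => // x nx; apply: hA => g; apply: nx; exact: jump_bound.
Qed.

Let mvw : measurable_fun setT (fun p : V * V => enorm (p.1 - p.2) `^ r).
Proof. by apply: measurable_enorm_powR; apply: measurable_addv => //; exact: measurable_oppv. Qed.

Lemma int_moment (mu : probability V R) (m : {finite_measure set V -> \bar R}) :
  (\int[mu]_v (enorm v `^ r)%:E < +oo)%E -> (\int[m]_v (enorm v `^ r)%:E < +oo)%E ->
  (mu \x m)%E.-integrable setT (EFin \o (fun p : V * V => enorm (p.1 - p.2) `^ r)).
Proof.
move=> hmu hm; set mum := (mu \x m)%E.
have i1 : mum.-integrable setT (EFin \o (fun p : V * V => enorm p.1 `^ r)).
  apply: rint_ge0; first exact: measurable_enorm_powR measurable_fst.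
    by move=> p; exact: powR_ge0.
  rewrite (tonelli_prod mu m (f := fun p => (enorm p.1 `^ r)%:E)); first last.
  - by move=> z; rewrite lee_fin powR_ge0.
  - exact/measurable_EFinP/measurable_enorm_powR.
  - under eq_integral => v _ do rewrite (_ : (fun y => _) = cst (enorm v `^ r)%:E)// integral_cst//.
    rewrite ge0_integralZrT//; first last.
    + by move=> v; rewrite lee_fin powR_ge0.
    + exact/measurable_EFinP/measurable_enorm_powR.
    + apply: lte_mul_pinfty; first by apply: integral_ge0 => v _; rewrite lee_fin powR_ge0.
      * rewrite ge0_fin_numE; first exact: hmu.
        by apply: integral_ge0 => v _; rewrite lee_fin powR_ge0.
      * by rewrite ltey_eq fin_num_measure.
have i2 : mum.-integrable setT (EFin \o (fun p : V * V => enorm p.2 `^ r)).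
  apply: rint_ge0; first exact: measurable_enorm_powR measurable_snd.
    by move=> p; exact: powR_ge0.
  rewrite (tonelli_prod mu m (f := fun p => (enorm p.2 `^ r)%:E)).
  - by rewrite /= integral_prob_cst.
  - exact/measurable_EFinP/measurable_enorm_powR.
  - by move=> z; rewrite lee_fin powR_ge0.
apply: (rint_le (g := fun p : V * V => 2 * (enorm p.1 `^ r + enorm p.2 `^ r))) => //.
  move=> p; rewrite ger0_norm ?powR_ge0//.
  apply: le_trans (powR_sum_le (enorm_ge0 _) (enorm_ge0 _) (ltW r0) (ltW r1)).
  apply: ge0_ler_powR; rewrite ?nnegrE ?enorm_ge0 ?addr_ge0 ?enorm_ge0 ?(ltW r0)//.
  by apply: le_trans (enorm_triangle _ _) _; rewrite enormN.
by apply: rintZ; apply: rintD.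
Qed.

Section pair_measure.
Variables (pm : {sigma_finite_measure set (V * V)%type -> \bar R}) (M : R).
Hypotheses (M_gt0 : 0 < M)
  (M_bound : (\int[pm]_p (enorm (p.1 - p.2) `^ r)%:E <= M%:E)%E).

(** [pm] is the joint measure of the two incoming velocities, a product measure in the
    applications. *)
Definition form psi xi theta : R := \int[pm]_p mean_jump psi xi p.1 p.2 theta.

Lemma int_pair_moment : pm.-integrable setT (EFin \o (fun p => enorm (p.1 - p.2) `^ r)).
Proof.
apply: rint_ge0 => //; first by move=> p; exact: powR_ge0.
by apply: le_lt_trans M_bound _; rewrite ltry.
Qed.

Section angle.
Variable theta : R.
Hypotheses (s0 : 0 < sin (theta / 2)) (c0 : 0 < cos (theta / 2)).

Lemma int_mean_jump psi xi : trig psi ->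
  pm.-integrable setT (EFin \o (fun p => mean_jump psi xi p.1 p.2 theta)).
Proof.
move=> tp; have [_ _ mp] := tp.
apply: (rint_le (g := fun p : V * V => 4 * enorm xi `^ r * rho r theta * enorm (p.1 - p.2) `^ r)).
- exact: measurable_mean_jump.
- by move=> p; apply: le_trans (mean_jump_bound _ _ _ tp s0 c0) _; rewrite le_eqVlt;
    apply/orP; left; apply/eqP; ring.
- by apply: rintZ; exact: int_pair_moment.
Qed.

(** Cauchy-Schwarz over pairs with the weight [|v - w|^r] costs one factor [M]. The square of this
    weight in [jump_energy] loses one power to the division by it, and the remaining power
    integrates to the second factor [M]. *)
Lemma form_energy psi (K : R) : trig psi -> 0 < K ->
  (\int[lebV R n]_xi (Num.min 4 (enorm xi ^+ 2) * weight s xi)%:E <= K%:E)%E ->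
  (\int[lebV R n]_xi (form psi xi theta ^+ 2 * weight s xi)%:E
    <= (4 * K * M ^+ 2 * rho r theta ^+ 2)%:E)%E.
Proof.
move=> tp K0 hK; have [_ _ mp] := tp.
pose q (p : V * V) := enorm (p.1 - p.2) `^ r.
pose k xi (p : V * V) := mean_jump psi xi p.1 p.2 theta.
have q0 p : 0 <= q p by exact: powR_ge0.
have mk d (T : measurableType d) (f : T -> V) (g : T -> V * V) :
    measurable_fun setT f -> measurable_fun setT g ->
    measurable_fun setT (fun t => k (f t) (g t)).
  by move=> mf mg; apply: measurable_mean_jump => //; apply: measurableT_comp.
have mW d (T : measurableType d) (f : T -> V) : measurable_fun setT f ->
    measurable_fun setT (fun t => weight s (f t)).
  by move=> mf; exact: measurableT_comp (measurable_weight _) mf.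
have mq d (T : measurableType d) (g : T -> V * V) : measurable_fun setT g ->
    measurable_fun setT (fun t => (q (g t))^-1).
  move=> mg; rewrite (_ : (fun t => _) = fun t => q (g t) `^ (-1)); last first.
    by apply/funext => t; rewrite powR_inv1.
  by apply: (measurableT_comp (measurable_powR _)); exact: measurableT_comp mvw mg.
pose G xi p : \bar R := (weight s xi * (k xi p ^+ 2 / q p))%:E.
have G0 xi p : (0 <= G xi p)%E.
  by rewrite lee_fin mulr_ge0 ?weight_ge0// divr_ge0// sqr_ge0.
have mG d (T : measurableType d) (f : T -> V) (g : T -> V * V) :
    measurable_fun setT f -> measurable_fun setT g ->
    measurable_fun setT (fun t => G (f t) (g t)).
  move=> mf mg; apply/measurable_EFinP; apply: measurable_funM; first exact: mW.
  by apply: measurable_funM; [apply: measurable_funX; exact: mk|exact: mq].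
apply: (@le_trans _ _ (\int[lebV R n]_xi (M%:E * \int[pm]_p G xi p))%E).
  apply: ge0_le_integralT.
  - apply/measurable_EFinP; apply: measurable_funM; last exact: measurable_weight.
    apply: measurable_funX.
    have -> : (form psi)^~ theta = (fun xi => \int[pm]_p k xi p) by [].
    apply: (measurable_Rintegral_snd pm (f := fun z : V * (V * V) => k z.1 z.2)).
    by apply: mk; [exact: measurable_fst|exact: measurable_snd].
  - apply: measurable_funeM.
    apply: (measurable_integral_snd pm (f := fun z => G z.1 z.2)).
      by apply: mG; [exact: measurable_fst|exact: measurable_snd].
    by move=> z; exact: G0.
  - by move=> xi; rewrite lee_fin mulr_ge0 ?weight_ge0// sqr_ge0.
  move=> xi; rewrite mulrC EFinM.
  have -> : (\int[pm]_p G xi p = \int[pm]_p ((weight s xi)%:E * (k xi p ^+ 2 / q p)%:E))%E.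
    by apply: eq_integral => p _; rewrite /G EFinM.
  rewrite ge0_integralZlT//; last 3 first.
  - apply/measurable_EFinP; apply: measurable_funM; last exact: mq.
    by apply: measurable_funX; exact: mk.
  - by move=> p; rewrite lee_fin divr_ge0// sqr_ge0.
  - by rewrite lee_fin weight_ge0.
  rewrite muleCA; apply: lee_wpmul2l; first by rewrite lee_fin weight_ge0.
  apply: (weighted_CS (rho := q)) => //; first exact: int_mean_jump.
  move=> p /eqP; rewrite powR_eq0 enorm_eq0 subr_eq0 => /andP[/eqP -> _].
  exact: mean_jump_same.
rewrite ge0_integralZlT; first last.
- by rewrite lee_fin ltW.
- by move=> xi; exact: integral_ge0.
- apply: (measurable_integral_snd pm (f := fun z => G z.1 z.2)).
    by apply: mG; [exact: measurable_fst|exact: measurable_snd].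
  by move=> z; exact: G0.
rewrite (tonelli (lebV R n) pm (f := fun z => G z.1 z.2)); first last.
- by move=> z; exact: G0.
- by apply: mG; [exact: measurable_fst|exact: measurable_snd].
have -> : 4 * K * M ^+ 2 * rho r theta ^+ 2 =
  M * (4 * K * rho r theta ^+ 2 * M) by ring.
rewrite EFinM; apply: lee_wpmul2l; first by rewrite lee_fin ltW.
apply: (@le_trans _ _ (\int[pm]_p ((4 * K * rho r theta ^+ 2)%:E * (q p)%:E))%E); last first.
  have C0 : 0 <= 4 * K * rho r theta ^+ 2.
    by rewrite mulr_ge0 ?sqr_ge0// mulr_ge0// ltW.
  rewrite ge0_integralZlT; [|exact/measurable_EFinP| |]; last 2 first.
  - by move=> p; rewrite lee_fin.
  - by rewrite lee_fin.
  by rewrite [leRHS]EFinM; apply: lee_wpmul2l; [rewrite lee_fin|exact: M_bound].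
apply: ge0_le_integralT.
- apply: (measurable_integral_fst (lebV R n) (f := fun z => G z.1 z.2)).
    by apply: mG; [exact: measurable_fst|exact: measurable_snd].
  by move=> z; exact: G0.
- by apply: measurable_funeM; exact/measurable_EFinP.
- by move=> p; exact: integral_ge0.
move=> p /=.
have mJ d (T : measurableType d) (f g : T -> V) :
    measurable_fun setT f -> measurable_fun setT g ->
    measurable_fun setT (fun t => (jump psi (f t) p.1 p.2 theta (g t) ^+ 2 * weight s (f t))%:E).
  move=> mf mg; apply/measurable_EFinP; apply: measurable_funM; last exact: mW.
  by apply: measurable_funX; exact: measurable_jump.
have J0 xi x : (0 <= (jump psi xi p.1 p.2 theta x ^+ 2 * weight s xi)%:E)%E.
  by rewrite lee_fin mulr_ge0 ?sqr_ge0 ?weight_ge0.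
apply: (@le_trans _ _ ((q p)^-1%:E * \int[lebV R n]_xi \int[U]_x
    (jump psi xi p.1 p.2 theta x ^+ 2 * weight s xi)%:E)%E).
  rewrite -ge0_integralZlT; first last.
  - by rewrite lee_fin invr_ge0.
  - by move=> xi; exact: integral_ge0.
  - apply: (measurable_integral_snd U
      (f := fun z => (jump psi z.1 p.1 p.2 theta z.2 ^+ 2 * weight s z.1)%:E)).
      by apply: mJ; [exact: measurable_fst|exact: measurable_snd].
    by move=> z; exact: J0.
  apply: ge0_le_integralT.
  - exact: mG.
  - apply: measurable_funeM; apply: (measurable_integral_snd U
      (f := fun z => (jump psi z.1 p.1 p.2 theta z.2 ^+ 2 * weight s z.1)%:E)).
      by apply: mJ; [exact: measurable_fst|exact: measurable_snd].
    by move=> z; exact: J0.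
  - by move=> xi; exact: G0.
  move=> xi; rewrite /G.
  have -> : weight s xi * (k xi p ^+ 2 / q p) = (q p)^-1 * (k xi p ^+ 2 * weight s xi) by ring.
  rewrite [leLHS]EFinM.
  apply: lee_wpmul2l; first by rewrite lee_fin invr_ge0.
  rewrite [leLHS]EFinM.
  have -> : (\int[U]_x (jump psi xi p.1 p.2 theta x ^+ 2 * weight s xi)%:E =
      \int[U]_x ((jump psi xi p.1 p.2 theta x ^+ 2)%:E * (weight s xi)%:E))%E.
    by apply: eq_integral => x _; rewrite EFinM.
  rewrite ge0_integralZrT; [|exact/measurable_EFinP/measurable_funX/measurable_jump| |]; last 2 first.
  - by move=> x; rewrite lee_fin sqr_ge0.
  - by rewrite lee_fin weight_ge0.
  apply: lee_wpmul2r; first by rewrite lee_fin weight_ge0.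
  by apply: sqr_rintegral_prob; exact: int_jump.
(* Equal velocities: the factor [(q p)^-1] is [0^-1 = 0]. *)
have [qp|qp] := eqVneq (q p) 0; first by rewrite qp invr0 mul0e mule0.
rewrite (tonelli (lebV R n) U
  (f := fun z => (jump psi z.1 p.1 p.2 theta z.2 ^+ 2 * weight s z.1)%:E)); first last.
- by move=> z; exact: J0.
- by apply: mJ; [exact: measurable_fst|exact: measurable_snd].
have -> : ((4 * K * rho r theta ^+ 2)%R%:E * (q p)%:E =
    (q p)^-1%:E * (4 * K * (q p * rho r theta) ^+ 2)%R%:E)%E.
  by rewrite -!EFinM; congr (_%:E); field.
apply: lee_wpmul2l; first by rewrite lee_fin invr_ge0.
apply: (@le_trans _ _ (\int[U]_x cst (4 * K * (q p * rho r theta) ^+ 2)%:E x)%E); last first.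
  by rewrite (integral_prob_cst U).
apply: ae_ge0_le_integral => //.
- by move=> x _; exact: integral_ge0.
- apply: (measurable_integral_fst (lebV R n)
    (f := fun z => (jump psi z.1 p.1 p.2 theta z.2 ^+ 2 * weight s z.1)%:E)).
    by apply: mJ; [exact: measurable_fst|exact: measurable_snd].
  by move=> z; exact: J0.
- by move=> x _; rewrite lee_fin mulr_ge0 ?sqr_ge0// mulr_ge0// ltW.
have [A [mA A0 hA]] := ae_good p.1 p.2 theta n1.
exists A; split => // x nx; apply: hA => g; apply: nx => _.
exact: jump_energy.
Qed.

End angle.

End pair_measure.
End bilinear_form.

(** * Average over the deviation angle *)

Section prod_measure.
Context d1 d2 (T1 : measurableType d1) (T2 : measurableType d2) (R : realType).
Variables (m1 : {sigma_finite_measure set T1 -> \bar R})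
  (m2 : {sigma_finite_measure set T2 -> \bar R}).

(* An alias of the product measure carrying its sigma-finiteness. *)
Definition prodm : set (T1 * T2)%type -> \bar R := (m1 \x m2)%E.

HB.instance Definition _ := Measure.copy prodm (m1 \x m2)%E.

Let prodm_sigma_finite : sigma_finite setT prodm.
Proof.
have /sigma_finiteP[F [TF ndF Foo]] := sigma_finiteT m1.
have /sigma_finiteP[G [TG ndG Goo]] := sigma_finiteT m2.
exists (fun k => F k `*` G k).
  apply/seteqP; split => // -[x y] _.
  have [i _ Fix] : (\bigcup_i F i) x by rewrite -TF.
  have [j _ Gjy] : (\bigcup_i G i) y by rewrite -TG.
  exists (maxn i j) => //; split.
    by move: x Fix; exact/subsetPset/ndF/leq_maxl.
  by move: y Gjy; exact/subsetPset/ndG/leq_maxr.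
move=> k; have [? ?] := Foo k; have [? ?] := Goo k.
split; first exact: measurableX.
by rewrite /prodm product_measure1E// lte_mul_pinfty// ge0_fin_numE.
Qed.

HB.instance Definition _ := Measure_isSigmaFinite.Build _ _ _ prodm prodm_sigma_finite.

End prod_measure.

Section angular_average.
Context (R : realType) (n : nat) (r : R).
Local Notation V := 'rV[R]_n.
Local Notation U := (uniform_ball R n).
Hypotheses (n1 : (1 < n)%N) (r0 : 0 < r) (r1 : r < 1).
Local Notation s := (n%:R / 2 + r).
Context d0 (Theta : measurableType d0).
Variables (g0 : {sigma_finite_measure set Theta -> \bar R}) (tau : Theta -> R) (a : R).
Hypotheses (mtau : measurable_fun setT tau)
  (tau_sin : forall theta, 0 < sin (tau theta / 2))
  (tau_cos : forall theta, 0 < cos (tau theta / 2))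
  (a_gt0 : 0 < a) (a_bound : (\int[g0]_theta (rho r (tau theta))%:E <= a%:E)%E).
Implicit Types (xi v w x : V) (theta : Theta) (psi : R -> R).

Let mrho : measurable_fun setT (fun theta => rho r (tau theta)).
Proof.
have mh : measurable_fun setT (fun theta => tau theta / 2) by exact: measurable_funM.
apply: (measurableT_comp (measurable_powR _)); apply: measurable_minr.
  exact: (measurableT_comp (continuous_measurable_fun (@continuous_sin R)) mh).
exact: (measurableT_comp (continuous_measurable_fun (@continuous_cos R)) mh).
Qed.

Section pair_measure.
Variables (pm : {sigma_finite_measure set (V * V)%type -> \bar R}) (M : R).
Hypotheses (M_gt0 : 0 < M)
  (M_bound : (\int[pm]_p (enorm (p.1 - p.2) `^ r)%:E <= M%:E)%E).

Let mvw : measurable_fun setT (fun p : V * V => enorm (p.1 - p.2) `^ r).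
Proof. by apply: measurable_enorm_powR; apply: measurable_addv => //; exact: measurable_oppv. Qed.

(** The angle is read through [tau] on an abstract parameter space, so that the sine and cosine of
    the half angle are positive at every parameter. *)
Definition qform psi xi : R := \int[g0]_theta form pm psi xi (tau theta).

Lemma measurable_form psi d (T : measurableType d) (f : T -> V) (g : T -> R) :
  measurable_fun setT psi -> measurable_fun setT f -> measurable_fun setT g ->
  measurable_fun setT (fun t => form pm psi (f t) (g t)).
Proof.
move=> mp mf mg; apply: (measurable_Rintegral_snd pm
  (f := fun z : T * (V * V) => mean_jump psi (f z.1) z.2.1 z.2.2 (g z.1))).
by apply: measurable_mean_jump => //; apply: measurableT_comp => //; apply: measurableT_comp.
Qed.

Lemma form_bound psi xi theta : trig psi ->
  `|form pm psi xi (tau theta)| <= 4 * enorm xi `^ r * M * rho r (tau theta).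
Proof.
move=> tp; have [_ _ mp] := tp.
have ij := int_mean_jump n1 r0 r1 M_bound (tau_sin theta) (tau_cos theta) xi tp.
apply: le_trans (rintegral_norm ij) _.
rewrite -lee_fin EFin_Rintegral; last first.
  apply: (rint_le (g := fun p : V * V => `|mean_jump psi xi p.1 p.2 (tau theta)|)).
  - by apply: measurableT_comp => //; exact: rint_measurable ij.
  - by move=> p; rewrite normr_id.
  - have : pm.-integrable setT (abse \o (EFin \o (fun p : V * V =>
        mean_jump psi xi p.1 p.2 (tau theta)))) by exact: integrable_abse.
    by [].
apply: (@le_trans _ _ (\int[pm]_p ((4 * enorm xi `^ r * rho r (tau theta))%R%:E
    * (enorm (p.1 - p.2) `^ r)%:E))%E).
  apply: ge0_le_integralT.
  - apply/measurable_EFinP; apply: measurableT_comp => //; exact: rint_measurable ij.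
  - by apply: measurable_funeM; exact/measurable_EFinP.
  - by move=> p; rewrite lee_fin.
  move=> p; rewrite -EFinM lee_fin.
  apply: le_trans (mean_jump_bound n1 r0 r1 _ _ _ tp (tau_sin theta) (tau_cos theta)) _.
  by rewrite le_eqVlt; apply/orP; left; apply/eqP; ring.
have C0 : 0 <= 4 * enorm xi `^ r * rho r (tau theta) by rewrite !mulr_ge0 ?powR_ge0// rho_ge0.
rewrite ge0_integralZlT; first last.
- by rewrite lee_fin.
- by move=> p; rewrite lee_fin powR_ge0.
- exact/measurable_EFinP.
rewrite [X in (_ <= X%:E)%E](_ : _ = 4 * enorm xi `^ r * rho r (tau theta) * M); last by ring.
by rewrite [leRHS]EFinM; apply: lee_wpmul2l; [rewrite lee_fin|exact: M_bound].
Qed.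

Let int_rho : g0.-integrable setT (EFin \o (fun theta => rho r (tau theta))).
Proof.
apply: rint_ge0 => //; first by move=> theta; exact: rho_ge0.
by apply: le_lt_trans a_bound _; rewrite ltry.
Qed.

Lemma int_form psi xi : trig psi ->
  g0.-integrable setT (EFin \o (fun theta => form pm psi xi (tau theta))).
Proof.
move=> tp; have [_ _ mp] := tp.
apply: (rint_le (g := fun theta => 4 * enorm xi `^ r * M * rho r (tau theta))).
- exact: measurable_form.
- by move=> theta; exact: form_bound.
- exact: rintZ int_rho.
Qed.

(** Domination by [|v - w|^r rho] makes the averaged jump absolutely integrable jointly in
    velocities and angle, even for an infinite angular measure; the exchanges in [qform_iterated]
    rest on this. *)
Lemma int_angular_jump psi xi : trig psi ->
  (pm \x g0)%E.-integrable setT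
    (EFin \o (fun z => mean_jump psi xi z.1.1 z.1.2 (tau z.2))).
Proof.
move=> tp; have [_ _ mp] := tp.
pose C : R := 4 * enorm xi `^ r.
apply: (rint_le (T := (V * V * Theta)%type) (g := fun z => C * (enorm (z.1.1 - z.1.2) `^ r * rho r (tau z.2)))).
- apply: measurable_mean_jump => //; apply: measurableT_comp => //; exact: measurableT_comp.
- move=> z; apply: le_trans (mean_jump_bound n1 r0 r1 _ _ _ tp (tau_sin _) (tau_cos _)) _.
  by rewrite le_eqVlt; apply/orP; left; apply/eqP; rewrite /C; ring.
apply: rintZ.
have mqr : measurable_fun setT (fun z : (V * V) * Theta =>
    enorm (z.1.1 - z.1.2) `^ r * rho r (tau z.2)).
  by apply: measurable_funM; [exact: (measurableT_comp mvw)|exact: (measurableT_comp mrho)].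
have qr0 (z : (V * V) * Theta) : 0 <= enorm (z.1.1 - z.1.2) `^ r * rho r (tau z.2).
  by rewrite mulr_ge0 ?powR_ge0// rho_ge0.
apply: rint_ge0 => //.
rewrite (tonelli_prod pm g0 (f := fun z => (enorm (z.1.1 - z.1.2) `^ r * rho r (tau z.2))%:E)); first last.
- by move=> z; rewrite lee_fin.
- exact/measurable_EFinP.
apply: (@le_lt_trans _ _ (\int[pm]_p ((enorm (p.1 - p.2) `^ r)%:E * a%:E))%E).
  apply: ge0_le_integralT.
  - apply: (measurable_integral_snd g0 (f := fun z : (V * V) * Theta => (enorm (z.1.1 - z.1.2) `^ r * rho r (tau z.2))%:E)).
      exact/measurable_EFinP.
    by move=> z; rewrite lee_fin.
  - by apply: emeasurable_funM => //; exact/measurable_EFinP.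
  - by move=> p; apply: integral_ge0 => t _; rewrite lee_fin (qr0 (p, t)).
  move=> p /=; under eq_integral do rewrite EFinM.
  rewrite ge0_integralZlT; first last.
  - by rewrite lee_fin powR_ge0.
  - by move=> t; rewrite lee_fin rho_ge0.
  - exact/measurable_EFinP.
  by apply: lee_wpmul2l; [rewrite lee_fin powR_ge0|exact: a_bound].
rewrite ge0_integralZrT; first last.
- by rewrite lee_fin ltW.
- by move=> p; rewrite lee_fin powR_ge0.
- exact/measurable_EFinP.
apply: (@le_lt_trans _ _ (M%:E * a%:E)%E); last by rewrite -EFinM ltry.
by apply: lee_wpmul2r; [rewrite lee_fin ltW|exact: M_bound].
Qed.

End pair_measure.

Definition pairm (m1 m2 : {sigma_finite_measure set V -> \bar R}) :
  {sigma_finite_measure set (V * V)%type -> \bar R} := prodm m1 m2.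

(** The collision kernel has the angle innermost, while the estimates at a fixed angle need it
    outermost. *)
Lemma qform_iterated (mu : probability V R) (m : {finite_measure set V -> \bar R}) psi xi (M : R) :
  trig psi ->
  (\int[pairm mu m]_p (enorm (p.1 - p.2) `^ r)%:E <= M%:E)%E ->
  \int[mu]_v \int[m]_w \int[g0]_theta mean_jump psi xi v w (tau theta) =
    qform (pairm mu m) psi xi.
Proof.
move=> tp hM.
have ij := int_angular_jump hM xi tp.
have ij1 := rint_fubini1 ij.
rewrite (rfubini1 (f := fun p : V * V => \int[g0]_theta mean_jump psi xi p.1 p.2 (tau theta)) ij1).
by rewrite (rfubini ij).
Qed.

End angular_average.

(** * Bobylev's identity *)

Lemma rint_prod_bounded d1 d2 (T1 : measurableType d1) (T2 : measurableType d2) (R : realType)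
    (m1 : {sigma_finite_measure set T1 -> \bar R}) (P : probability T2 R)
    (f : T1 * T2 -> R) (C : R) :
  (m1 setT < +oo)%E -> measurable_fun setT f -> 0 <= C -> (forall z, `|f z| <= C) ->
  (m1 \x P)%E.-integrable setT (EFin \o f).
Proof.
move=> m1T mf C0 fC; apply/integrableP; split; first exact/measurable_EFinP.
have mnf : measurable_fun setT (fun z => `|(f z)%:E|)%E.
  by apply: measurableT_comp => //; exact/measurable_EFinP.
rewrite (tonelli_prod m1 P (f := fun z => `|(f z)%:E|)%E mnf)//.
apply: (@le_lt_trans _ _ (\int[m1]_x C%:E)%E).
  apply: ge0_le_integralT => [| | |x].
  - exact: (measurable_integral_snd P mnf).
  - exact: measurable_cst.
  - by move=> x; apply: integral_ge0.
  rewrite -[leRHS](integral_prob_cst P); apply: ge0_le_integralT => //.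
    exact: (measurableT_comp mnf (measurable_pair1 x)).
  by move=> y; rewrite lee_fin.
by rewrite integral_cst//; apply: lte_mul_pinfty.
Qed.

Section bobylev.
Context (R : realType) (n : nat).
Local Notation V := 'rV[R]_n.
Local Notation U := (uniform_ball R n).
Implicit Types (xi eta zeta v w x : V) (theta : R) (psi : R -> R).

(* The pre-collisional frequencies of Bobylev's identity. *)
Definition xip xi theta x : V :=
  2^-1 *: (xi + enorm xi *: cone_point (unitv xi) theta x).
Definition xim xi theta x : V :=
  2^-1 *: (xi - enorm xi *: cone_point (unitv xi) theta x).

Lemma measurable_xip d (T : measurableType d) (f g : T -> V) (t : T -> R) :
  measurable_fun setT f -> measurable_fun setT t -> measurable_fun setT g ->
  measurable_fun setT (fun z => xip (f z) (t z) (g z)).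
Proof.
move=> mf mt mg; apply: measurable_scalev => //; apply: measurable_addv => //.
apply: measurable_scalev; first exact: measurable_enorm.
by apply: measurable_cone_point => //; exact: measurable_unitv.
Qed.

Lemma measurable_xim d (T : measurableType d) (f g : T -> V) (t : T -> R) :
  measurable_fun setT f -> measurable_fun setT t -> measurable_fun setT g ->
  measurable_fun setT (fun z => xim (f z) (t z) (g z)).
Proof.
move=> mf mt mg; apply: measurable_scalev => //; apply: measurable_addv => //.
apply: measurable_oppv; apply: measurable_scalev; first exact: measurable_enorm.
by apply: measurable_cone_point => //; exact: measurable_unitv.
Qed.

(** The jump depends on the direction only through [|v - w|] times its inner product with [xi].
    [cone_point_swap] exchanges the roles of [xi] and [v - w]: the cone is then around [xi], and the
    outgoing velocities give way to the frequencies [xip] and [xim], tested against [v] and [w]. *)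
Lemma mean_jump_xipm psi xi v w theta : measurable_fun setT psi ->
  mean_jump psi xi v w theta =
  \int[U]_x (psi (dotv (xip xi theta x) v + dotv (xim xi theta x) w)
    + psi (dotv (xim xi theta x) v + dotv (xip xi theta x) w)
    - psi (dotv xi v) - psi (dotv xi w)).
Proof.
move=> mp; rewrite /mean_jump /Rintegral; congr fine.
pose c := 2^-1 * (dotv xi v + dotv xi w).
pose phi (t : R) : \bar R := (psi (c + t / 2) + psi (c - t / 2)
  - psi (dotv xi v) - psi (dotv xi w))%:E.
have mphi : measurable_fun setT phi.
  apply/measurable_EFinP; do 2!(apply: measurable_funB => //).
  by apply: measurable_funD; apply: measurableT_comp => //;
    [apply: measurable_funD|apply: measurable_funB] => //; exact: measurable_funM.
have := cone_point_swap xi (v - w) theta mphi.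
rewrite [X in X = _ -> _](_ : _ = \int[U]_x (jump psi xi v w theta x)%:E)%E; last first.
  apply: eq_integral => x _; rewrite /phi /jump out1E out2E.
  move: (cone_point _ _ _) => k; congr (_%:E).
  rewrite !(dotvDr, dotvNr, dotvZr) -/c.
  have -> : enorm (v - w) * dotv xi k / 2 = enorm (v - w) / 2 * dotv xi k by ring.
  by ring.
move=> ->; apply: eq_integral => x _; rewrite /phi /xip /xim.
move: (cone_point _ _ _) => k; congr (_%:E).
rewrite (dotvC (v - w)) !(dotvDr, dotvNr) !(dotvZl, dotvDl, dotvNl).
have -> : c + enorm xi * (dotv k v - dotv k w) / 2 =
  2^-1 * (dotv xi v + enorm xi * dotv k v) + 2^-1 * (dotv xi w - enorm xi * dotv k w).
  by rewrite /c; field.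
have -> : c - enorm xi * (dotv k v - dotv k w) / 2 =
  2^-1 * (dotv xi v - enorm xi * dotv k v) + 2^-1 * (dotv xi w + enorm xi * dotv k w).
  by rewrite /c; field.
by [].
Qed.

Let mdot d (T : measurableType d) (f g : T -> V) psi :
  measurable_fun setT psi -> measurable_fun setT f -> measurable_fun setT g ->
  measurable_fun setT (fun z => psi (dotv (f z) (g z))).
Proof. by move=> mp mf mg; apply: measurableT_comp => //; exact: measurable_dotv. Qed.

Definition ft psi (m : {measure set V -> \bar R}) eta : R := \int[m]_v psi (dotv eta v).

Section products.
Variables (mu m : {finite_measure set V -> \bar R}).
Local Notation pm := (prodm mu m).

Lemma rintegral_prodm psi phi eta zeta : trig psi -> trig phi ->
  pm.-integrable setT (EFin \o (fun p : V * V => psi (dotv eta p.1) * phi (dotv zeta p.2))) /\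
  \int[pm]_p (psi (dotv eta p.1) * phi (dotv zeta p.2)) = ft psi mu eta * ft phi m zeta.
Proof.
move=> [p1 _ mp] [q1 _ mq].
apply: (rintegral_prodM mu m (f := fun v => psi (dotv eta v)) (g := fun w => phi (dotv zeta w)) (C := 1)).
- exact: mdot.
- exact: mdot.
- by move=> v; exact: p1.
- by move=> v; exact: q1.
Qed.

(** For [psi] equal to [cos] or [sin], up to sign the real or imaginary part of the transform of the
    product measure at [(eta, zeta)]. *)
Definition pairing psi eta zeta : R := \int[pm]_p psi (dotv eta p.1 + dotv zeta p.2).

Lemma pairing_cos eta zeta : pairing cos eta zeta =
  ft cos mu eta * ft cos m zeta - ft sin mu eta * ft sin m zeta.
Proof.
have tc := @trig_cos R; have ts := @trig_sin R.
have [i1 <-] := rintegral_prodm eta zeta tc tc.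
have [i2 <-] := rintegral_prodm eta zeta ts ts.
by rewrite -rintegralB//; apply: eq_Rintegral => p _; rewrite cosD.
Qed.

Lemma pairing_sin eta zeta : pairing sin eta zeta =
  ft sin mu eta * ft cos m zeta + ft cos mu eta * ft sin m zeta.
Proof.
have tc := @trig_cos R; have ts := @trig_sin R.
have [i1 <-] := rintegral_prodm eta zeta ts tc.
have [i2 <-] := rintegral_prodm eta zeta tc ts.
by rewrite -rintegralD//; apply: eq_Rintegral => p _; rewrite sinD.
Qed.

Let pm_fin : (pm setT < +oo)%E.
Proof.
rewrite -setXTT [X in (X < _)%E](_ : _ = mu setT * m setT)%E; last exact: product_measure1E.
by apply: lte_mul_pinfty; rewrite ?ltey_eq ?fin_num_measure.
Qed.

(** Fubini's theorem moves the direction outside; the loss terms become pairings with one zero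
    frequency. *)
Lemma form_pairing psi xi theta : trig psi ->
  form pm psi xi theta = \int[U]_x (pairing psi (xip xi theta x) (xim xi theta x)
    + pairing psi (xim xi theta x) (xip xi theta x) - pairing psi xi 0 - pairing psi 0 xi).
Proof.
move=> tp; have [p1 _ mp] := tp.
pose k (z : (V * V) * V) := psi (dotv (xip xi theta z.2) z.1.1 + dotv (xim xi theta z.2) z.1.2)
    + psi (dotv (xim xi theta z.2) z.1.1 + dotv (xip xi theta z.2) z.1.2)
    - psi (dotv xi z.1.1) - psi (dotv xi z.1.2).
have mD d (T : measurableType d) (f1 f2 g1 g2 : T -> V) :
    measurable_fun setT f1 -> measurable_fun setT g1 ->
    measurable_fun setT f2 -> measurable_fun setT g2 ->
    measurable_fun setT (fun z => psi (dotv (f1 z) (g1 z) + dotv (f2 z) (g2 z))).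
  move=> h1 h2 h3 h4; apply: measurableT_comp => //.
  by apply: measurable_funD; exact: measurable_dotv.
have m11 : measurable_fun setT (fun z : (V * V) * V => z.1.1) by exact: measurableT_comp.
have m12 : measurable_fun setT (fun z : (V * V) * V => z.1.2) by exact: measurableT_comp.
have m2 : measurable_fun setT (fun z : (V * V) * V => z.2) by exact: measurable_snd.
have mxp : measurable_fun setT (fun z : (V * V) * V => xip xi theta z.2) by exact: measurable_xip.
have mxm : measurable_fun setT (fun z : (V * V) * V => xim xi theta z.2) by exact: measurable_xim.
have mk : measurable_fun setT k.
  by do 2!(apply: measurable_funB; last exact: mdot); apply: measurable_funD; exact: mD.
have k4 z : `|k z| <= 4.
  rewrite /k; have H y : -1 <= psi y <= 1 by rewrite -ler_norml.
  set a := psi _; set b := psi _; set c := psi _; set e := psi _.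
  have /andP[a1 a2] : -1 <= a <= 1 by exact: H.
  have /andP[b1 b2] : -1 <= b <= 1 by exact: H.
  have /andP[c1 c2] : -1 <= c <= 1 by exact: H.
  have /andP[e1 e2] : -1 <= e <= 1 by exact: H.
  by rewrite ler_norml; apply/andP; split; lra.
have ik := rint_prod_bounded U pm_fin mk (ler0n _ 4) k4.
rewrite /form; transitivity (\int[pm]_p \int[U]_x k (p, x)).
  by apply: eq_Rintegral => p _; exact: mean_jump_xipm.
rewrite (rfubini ik); apply: eq_Rintegral => x _; rewrite /k /=.
have ib (f : V * V -> R) : measurable_fun setT f -> (forall p, `|f p| <= 1) ->
    pm.-integrable setT (EFin \o f).
  move=> mf fC; apply: (rint_le (g := cst 1)) => //.
  by apply: rint_ge0 => //; rewrite /= integral_cst// mul1e.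
have mfst := @measurable_fst _ _ V V; have msnd := @measurable_snd _ _ V V.
have I eta zeta : pm.-integrable setT (EFin \o (fun p : V * V => psi (dotv eta p.1 + dotv zeta p.2))).
  by apply: ib => //; exact: mD.
have I1 : pm.-integrable setT (EFin \o (fun p : V * V => psi (dotv xi p.1))).
  by apply: ib => //; exact: mdot.
have I2 : pm.-integrable setT (EFin \o (fun p : V * V => psi (dotv xi p.2))).
  by apply: ib => //; exact: mdot.
rewrite rintegralB//; last by apply: rintB => //; exact: rintD.
rewrite rintegralB//; last exact: rintD.
rewrite rintegralD//; congr (_ - _ - _).
- by apply: eq_Rintegral => p _; rewrite dotv0l addr0.
- by apply: eq_Rintegral => p _; rewrite dotv0l add0r.
Qed.

End products.

(** Bounded [r]-Holder functions: a class containing the transforms of finite measures with an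
    [r]-th moment, stable under sums and products. It supplies the continuity that [cone_mean_le]
    asks for. *)
Definition tame (r : R) (X : V -> R) : Prop := exists2 C, 0 <= C &
  [/\ measurable_fun setT X, forall eta, `|X eta| <= C
    & forall eta zeta, `|X eta - X zeta| <= C * enorm (eta - zeta) `^ r].

Lemma tameD r X Y : tame r X -> tame r Y -> tame r (fun xi => X xi + Y xi).
Proof.
move=> [C C0 [mX XC hX]] [D D0 [mY YD hY]]; exists (C + D); first exact: addr_ge0.
split => [|eta|eta zeta].
- exact: measurable_funD.
- by apply: le_trans (ler_normD _ _) _; exact: lerD.
- rewrite opprD addrACA mulrDl; apply: le_trans (ler_normD _ _) _; exact: lerD.
Qed.

Lemma tameZ r c X : tame r X -> tame r (fun xi => c * X xi).
Proof.
move=> [C C0 [mX XC hX]]; exists (`|c| * C); first exact: mulr_ge0.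
split => [|eta|eta zeta].
- exact: measurable_funM.
- by rewrite normrM ler_wpM2l.
- by rewrite -mulrBr normrM -mulrA ler_wpM2l.
Qed.

Lemma tameN r X : tame r X -> tame r (fun xi => - X xi).
Proof. by move=> /(tameZ (-1)); under eq_fun do rewrite mulN1r. Qed.

Lemma tameB r X Y : tame r X -> tame r Y -> tame r (fun xi => X xi - Y xi).
Proof. by move=> hX hY; apply: tameD => //; exact: tameN. Qed.

Lemma tame_ft r psi (m : {finite_measure set V -> \bar R}) : 0 < r -> r < 1 -> trig psi ->
  (\int[m]_v (enorm v `^ r)%:E < +oo)%E -> tame r (ft psi m).
Proof.
move=> r0 r1 [p1 pl mp] hm.
pose c1 : R := \int[m]_v cst 1 v; pose c2 : R := \int[m]_v (enorm v `^ r).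
have i1 : m.-integrable setT (EFin \o (cst 1 : V -> R)).
  by apply: (rint_bounded m (c := 1)) => // x; rewrite normr1.
have i2 : m.-integrable setT (EFin \o (fun v => enorm v `^ r)).
  apply: rint_ge0 => //; first exact: measurable_enorm_powR.
  by move=> v; exact: powR_ge0.
have ip eta : m.-integrable setT (EFin \o (fun v => psi (dotv eta v))).
  by apply: (rint_bounded m (c := 1)) => //; exact: mdot.
have c10 : 0 <= c1 by apply: Rintegral_ge0 => x _ /=.
have c20 : 0 <= c2 by apply: Rintegral_ge0 => x _ /=; exact: powR_ge0.
have ia (f : V -> R) : m.-integrable setT (EFin \o f) ->
    m.-integrable setT (EFin \o (fun v => `|f v|)).
  move=> hf; apply: rint_ge0 => //; last exact: rint_lty.
  by apply: measurableT_comp => //; exact: rint_measurable hf.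
exists (c1 + 4 * c2); first by rewrite addr_ge0// mulr_ge0.
split.
- apply: (measurable_Rintegral_snd m (f := fun z : V * V => psi (dotv z.1 z.2))).
  exact: mdot.
- move=> eta; apply: le_trans (rintegral_norm (ip _)) _.
  apply: (@le_trans _ _ c1); last by rewrite lerDl mulr_ge0.
  by apply: rintegral_le => //; exact: ia.
- move=> eta zeta; rewrite /ft -rintegralB//.
  apply: le_trans (rintegral_norm (rintB (ip _) (ip _))) _.
  apply: (@le_trans _ _ (4 * enorm (eta - zeta) `^ r * c2)); last first.
    by rewrite mulrAC ler_wpM2r ?powR_ge0// lerDr.
  rewrite -rintegralZ//; apply: rintegral_le.
  + by apply: ia; exact: rintB.
  + exact: rintZ.
  move=> v; rewrite -mulrA -powRM ?enorm_ge0//.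
  apply: le_trans (min_powR_le _ r0 r1); last by rewrite mulr_ge0 ?enorm_ge0.
  rewrite le_min; apply/andP; split.
    apply: le_trans (ler_normB _ _) _.
    by apply: le_trans (lerD (p1 _) (p1 _)) _; lra.
  apply: le_trans (pl _ _) _; rewrite -dotvBl.
  apply: le_trans (dotv_CS _ _) _; rewrite -[leLHS]mul1r ler_wpM2r ?mulr_ge0 ?enorm_ge0//; lra.
Qed.

End bobylev.

(** * Dissipation at a fixed angle *)

Section square_inequalities.
Context (R : realFieldType).
Implicit Types (a b c x y t k : R).

Lemma sqr3_le a b c : (a + b - c) ^+ 2 <= 3 * (a ^+ 2 + b ^+ 2 + c ^+ 2).
Proof.
rewrite -subr_ge0 [X in 0 <= X](_ : _ = (a - b) ^+ 2 + (a + c) ^+ 2 + (b + c) ^+ 2); last by ring.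
by rewrite !addr_ge0 ?sqr_ge0.
Qed.

Lemma normM_le_sqr a x : `|a * x| <= a ^+ 2 + x ^+ 2.
Proof.
have := sqr_ge0 (a - x); have := sqr_ge0 (a + x).
by have := sqr_ge0 a; have := sqr_ge0 x; rewrite ler_norml; move=> *; apply/andP; split; nra.
Qed.

(** Young's inequality. In the dissipation estimate [t] is [sin(theta/2)^r] or [cos(theta/2)^r], for
    which both terms on the right have the same integrated bound. *)
Lemma amgm_pair t a b x y k : 0 < t -> a ^+ 2 + b ^+ 2 <= k ->
  a * x + b * y <= t / 2 * (x ^+ 2 + y ^+ 2) + (2 * t)^-1 * k.
Proof.
move=> t0 abk; apply: (@le_trans _ _ (t / 2 * (x ^+ 2 + y ^+ 2) + (2 * t)^-1 * (a ^+ 2 + b ^+ 2))).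
  rewrite -subr_ge0.
  have -> : t / 2 * (x ^+ 2 + y ^+ 2) + (2 * t)^-1 * (a ^+ 2 + b ^+ 2) - (a * x + b * y) =
      (2 * t)^-1 * ((t * x - a) ^+ 2 + (t * y - b) ^+ 2) by field; rewrite gt_eqF.
  by rewrite mulr_ge0 ?addr_ge0 ?sqr_ge0// invr_ge0 mulr_ge0// ltW.
by rewrite lerD2l ler_wpM2l// invr_ge0 mulr_ge0// ltW.
Qed.

End square_inequalities.

Section collision_operator.
Context (R : realType) (n : nat) (r : R).
Local Notation V := 'rV[R]_n.
Local Notation U := (uniform_ball R n).
Hypotheses (n1 : (1 < n)%N) (r0 : 0 < r) (r1 : r < 1).
Local Notation s := (n%:R / 2 + r).
Local Notation W := (weight s).
Implicit Types (xi eta zeta v w x : V) (theta : R) (X Y h : V -> R).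

Lemma tameM X Y : tame r X -> tame r Y -> tame r (fun xi => X xi * Y xi).
Proof.
move=> [C C0 [mX XC hX]] [D D0 [mY YD hY]]; exists (C * D + C * D); first by rewrite addr_ge0 ?mulr_ge0.
split => [|eta|eta zeta].
- exact: measurable_funM.
- rewrite normrM; apply: (@le_trans _ _ (C * D)); last by rewrite lerDl mulr_ge0.
  exact: ler_pM.
have -> : X eta * Y eta - X zeta * Y zeta =
  X eta * (Y eta - Y zeta) + (X eta - X zeta) * Y zeta by ring.
apply: le_trans (ler_normD _ _) _; rewrite !normrM mulrDl; apply: lerD.
  by rewrite -mulrA; exact: ler_pM.
by rewrite mulrAC; apply: ler_pM.
Qed.

Lemma tame_eps_delta X : tame r X -> forall y e, 0 < e ->
  exists2 d, 0 < d & forall z, enorm (z - y) < d -> `|X z - X y| < e.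
Proof.
move=> [C C0 [_ _ hX]] y e e0.
have C1 : 0 < C + 1 by rewrite ltr_wpDl.
(* The radius [d] with [(C + 1) d^r = e]; the added 1 avoids a division by 0. *)
exists ((e / (C + 1)) `^ r^-1); first by rewrite powR_gt0// divr_gt0.
move=> z zy; apply: le_lt_trans (hX _ _) _.
have h : enorm (z - y) `^ r < e / (C + 1).
  have -> : e / (C + 1) = ((e / (C + 1)) `^ r^-1) `^ r.
    by rewrite -powRrM mulVf ?gt_eqF// powRr1// divr_ge0// ltW.
  by apply: gt0_ltr_powR; rewrite ?nnegrE ?enorm_ge0 ?powR_ge0.
apply: (@le_lt_trans _ _ ((C + 1) * enorm (z - y) `^ r)).
  by rewrite ler_wpM2r ?powR_ge0// lerDl.
by rewrite mulrC -ltr_pdivlMr.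
Qed.

(** By the half-angle formulas [xip] is a multiple of a point of another cone around [xi], of half
    the angle, so that [cone_mean_le] applies to it. *)
Lemma xipE xi theta x : xip xi theta x =
  cos (theta / 2) *: (enorm xi *: cone_point (unitv xi) (theta / 2) x).
Proof.
rewrite /xip /cone_point {1}(unitvE xi); move: (unitv xi) (enorm xi) => e c.
move: (unitv (x - _)) => y; apply/rowP => i; rewrite !mxE.
have := cos_half theta; have := sin2cos2 (theta / 2).
have : sin theta = 2 * (sin (theta / 2) * cos (theta / 2)).
  rewrite {1}(_ : theta = (theta / 2) *+ 2); last by rewrite mulr2n; field.
  by rewrite sin_mulr2n mulr_natl mulrC.
move: (sin theta) (cos theta) (cos (theta / 2)) (sin (theta / 2)) => S C c2 s2 -> _ h.
have -> : C = 2 * c2 ^+ 2 - 1 by lra.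
by field.
Qed.

(** The angle [(theta - pi)/2] has cosine [sin(theta/2)] and sine [- cos(theta/2)]; the sign
    reflects that [xim] and the cone point lie on opposite sides of the axis. *)
Lemma ximE xi theta x : xim xi theta x =
  sin (theta / 2) *: (enorm xi *: cone_point (unitv xi) ((theta - pi) / 2) x).
Proof.
have a1 : cos ((theta - pi) / 2) = sin (theta / 2) by rewrite mulrBl cosB cos_pihalf sin_pihalf; ring.
have a2 : sin ((theta - pi) / 2) = - cos (theta / 2) by rewrite mulrBl sinB cos_pihalf sin_pihalf; ring.
rewrite /xim /cone_point {1}(unitvE xi) a1 a2; move: (unitv xi) (enorm xi) => e c.
move: (unitv (x - _)) => y; apply/rowP => i; rewrite !mxE.
have := sin_half theta.
have : sin theta = 2 * (sin (theta / 2) * cos (theta / 2)).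
  rewrite {1}(_ : theta = (theta / 2) *+ 2); last by rewrite mulr2n; field.
  by rewrite sin_mulr2n mulr_natl mulrC.
move: (sin theta) (cos theta) (cos (theta / 2)) (sin (theta / 2)) => S C c2 s2 -> h.
have -> : C = 1 - 2 * s2 ^+ 2 by lra.
by field.
Qed.

(** The dilation contributes [c^(2s)] through the weight and [c^(-n)] through the volume, together
    [c^(2r)]. *)
Lemma cone_scaled_le h (c phi : R) : 0 < c -> measurable_fun setT h -> (forall z, 0 <= h z) ->
  tame r h ->
  (\int[lebV R n]_xi \int[U]_x
     (W xi * h (c *: (enorm xi *: cone_point (unitv xi) phi x)))%:E
   <= (c `^ r * c `^ r)%:E * \int[lebV R n]_z (W z * h z)%:E)%E.
Proof.
move=> c0 mh h0 th.
have mW := @measurable_weight R n s.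
have s20 : 0 < 2 * s by rewrite mulr_gt0// ltr_wpDl// mulr_ge0.
have mhc : measurable_fun setT (fun z : V => h (c *: z)).
  by apply: measurableT_comp => //; exact: measurable_scalev.
apply: (@le_trans _ _ (\int[lebV R n]_z (W z * h (c *: z))%:E)%E).
  apply: (cone_mean_le phi n1 s20 (h := fun z => h (c *: z))) => // y e e0.
  have [d d0 hd] := tame_eps_delta th (c *: y) e0.
  exists (d / c); first exact: divr_gt0.
  move=> z zy; apply: hd; rewrite -scalerBr enormZ gtr0_norm//.
  by rewrite mulrC -ltr_pdivlMr.
pose f (z : V) : \bar R := (W (c^-1 *: z) * h z)%:E.
have -> : (\int[lebV R n]_z (W z * h (c *: z))%:E = \int[lebV R n]_z f (c *: z))%E.
  by apply: eq_integral => z _; rewrite /f scalerA mulVf ?gt_eqF// scale1r.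
have f0 z : (0 <= f z)%E by rewrite lee_fin mulr_ge0 ?weight_ge0.
have mf : measurable_fun setT f.
  apply/measurable_EFinP; apply: measurable_funM => //.
  by apply: (measurableT_comp mW); exact: measurable_scalev.
rewrite (lebV_dilate c0 mf f0).
have -> : (\int[lebV R n]_z f z = \int[lebV R n]_z ((c `^ (2 * s))%:E * (W z * h z)%:E))%E.
  apply: eq_integral => z _; rewrite /f -EFinM; congr (_%:E).
  rewrite /weight enormZ gtr0_norm ?invr_gt0// powRM ?enorm_ge0 ?invr_ge0 ?(ltW c0)//.
  have -> : c^-1 `^ (- (2 * s)) = c `^ (2 * s).
    by rewrite -powR_inv1 ?(ltW c0)// -powRrM mulrNN mul1r.
  by rewrite mulrA.
rewrite ge0_integralZlT; first last.
- by rewrite lee_fin powR_ge0.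
- by move=> z; rewrite lee_fin mulr_ge0// weight_ge0.
- by apply/measurable_EFinP; exact: measurable_funM.
rewrite muleA -EFinM; apply: lee_wpmul2r.
  by apply: integral_ge0 => z _; rewrite lee_fin mulr_ge0// weight_ge0.
rewrite lee_fin -powR_mulrn ?(ltW c0)// -powRN -!powRD ?(gt_eqF c0) ?implybT//.
by rewrite le_eqVlt; apply/orP; left; apply/eqP; congr (_ `^ _); field.
Qed.

Section fixed_angle.
Variables (A1 A2 : V -> R).
Hypotheses (mA1 : measurable_fun setT A1) (mA2 : measurable_fun setT A2)
  (A12 : forall xi, A1 xi ^+ 2 + A2 xi ^+ 2 <= 1).

(** Real part of [(A1 - i A2)(eta) (X + i Y)(zeta)]. The imaginary part is [bgain Y (- X)], since
    [(Y, - X)] is the pair of [- i (X + i Y)]. *)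
Definition bgain X Y eta zeta : R := A1 eta * X zeta + A2 eta * Y zeta.

(** Real part of the transform of [2 Q(mu, f)] at one angle, when [X + i Y] is the transform of [f];
    the loss term containing its value at 0 is absent because the mass is zero. *)
Definition bop X Y xi theta : R := \int[U]_x
  (bgain X Y (xip xi theta x) (xim xi theta x) + bgain X Y (xim xi theta x) (xip xi theta x))
  - X xi.

Lemma measurable_bgain d (T : measurableType d) X Y (f g : T -> V) :
  measurable_fun setT X -> measurable_fun setT Y ->
  measurable_fun setT f -> measurable_fun setT g ->
  measurable_fun setT (fun t => bgain X Y (f t) (g t)).
Proof.
by move=> mX mY mf mg; apply: measurable_funD; apply: measurable_funM;
  exact: measurableT_comp.
Qed.

Lemma measurable_bop d (T : measurableType d) X Y (f : T -> V) (g : T -> R) :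
  measurable_fun setT X -> measurable_fun setT Y ->
  measurable_fun setT f -> measurable_fun setT g ->
  measurable_fun setT (fun t => bop X Y (f t) (g t)).
Proof.
move=> mX mY mf mg; apply: measurable_funB; last exact: measurableT_comp.
apply: (measurable_Rintegral_snd U (f := fun z : T * V =>
  bgain X Y (xip (f z.1) (g z.1) z.2) (xim (f z.1) (g z.1) z.2) +
  bgain X Y (xim (f z.1) (g z.1) z.2) (xip (f z.1) (g z.1) z.2))).
have mf1 : measurable_fun setT (fun z : T * V => f z.1) by exact: measurableT_comp.
have mg1 : measurable_fun setT (fun z : T * V => g z.1) by exact: measurableT_comp.
have mp : measurable_fun setT (fun z : T * V => xip (f z.1) (g z.1) z.2).
  by apply: measurable_xip.
have mm : measurable_fun setT (fun z : T * V => xim (f z.1) (g z.1) z.2).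
  by apply: measurable_xim.
by apply: measurable_funD; exact: measurable_bgain.
Qed.

Lemma bgain_sqr X Y eta zeta :
  bgain X Y eta zeta ^+ 2 + bgain Y (fun xi => - X xi) eta zeta ^+ 2
    <= X zeta ^+ 2 + Y zeta ^+ 2.
Proof.
rewrite /bgain; have := A12 eta.
move: (A1 eta) (A2 eta) (X zeta) (Y zeta) => a b x y ab.
have -> : (a * x + b * y) ^+ 2 + (a * y + b * - x) ^+ 2 = (a ^+ 2 + b ^+ 2) * (x ^+ 2 + y ^+ 2) by ring.
by rewrite ler_piMl// addr_ge0 ?sqr_ge0.
Qed.

Let A1_le1 xi : `|A1 xi| <= 1.
Proof.
rewrite -(expr_le1 (n := 2))// real_normK ?num_real//.
by apply: le_trans (A12 xi); rewrite lerDl sqr_ge0.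
Qed.

Let A2_le1 xi : `|A2 xi| <= 1.
Proof.
rewrite -(expr_le1 (n := 2))// real_normK ?num_real//.
by apply: le_trans (A12 xi); rewrite lerDr sqr_ge0.
Qed.

Lemma int_bgain X Y (f g : V -> V) : tame r X -> tame r Y ->
  measurable_fun setT f -> measurable_fun setT g ->
  U.-integrable setT (EFin \o (fun x => bgain X Y (f x) (g x))).
Proof.
move=> [C C0 [mX XC _]] [D D0 [mY YD _]] mf mg.
apply: (rint_bounded U (c := C + D)); first exact: measurable_bgain.
move=> x; apply: le_trans (ler_normD _ _) _; rewrite !normrM.
apply: lerD; [rewrite -[leRHS]mul1r|rewrite -[leRHS]mul1r]; exact: ler_pM.
Qed.

Section energy.
Variables (X Y : V -> R) (theta : R).
Hypotheses (tX : tame r X) (tY : tame r Y)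
  (s0 : 0 < sin (theta / 2)) (c0 : 0 < cos (theta / 2)).
Local Notation S := (sin (theta / 2) `^ r).
Local Notation C := (cos (theta / 2) `^ r).
Let h xi : R := X xi ^+ 2 + Y xi ^+ 2.
Let h0 xi : 0 <= h xi. Proof. by rewrite addr_ge0 ?sqr_ge0. Qed.
Let th : tame r h. Proof. by apply: tameD; exact: tameM. Qed.
Let mh : measurable_fun setT h. Proof. by have [? _ []] := th. Qed.
Let mW := @measurable_weight R n s.
Hypothesis int_h : (lebV R n).-integrable setT (EFin \o (fun xi => W xi * h xi)).
Local Notation H := (\int[lebV R n]_xi (W xi * h xi)).

Let hm xi : R := \int[U]_x h (xim xi theta x).
Let hp xi : R := \int[U]_x h (xip xi theta x).

Let int_hU (f : V -> V) : measurable_fun setT f -> U.-integrable setT (EFin \o (fun x => h (f x))).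
Proof.
move=> mf; have [D _ [_ hD _]] := th; apply: (rint_bounded U (c := D)) => //.
exact: measurableT_comp.
Qed.

Let mean_energy (k : R) (f : V -> V -> V) :
  measurable_fun setT (fun z : V * V => f z.1 z.2) ->
  (\int[lebV R n]_xi \int[U]_x (W xi * h (f xi x))%:E <= (k * k)%:E * \int[lebV R n]_z (W z * h z)%:E)%E ->
  (lebV R n).-integrable setT (EFin \o (fun xi => W xi * \int[U]_x h (f xi x))) /\
  \int[lebV R n]_xi (W xi * \int[U]_x h (f xi x)) <= k * k * H.
Proof.
move=> mf hf; have fx xi : measurable_fun setT (f xi).
  exact: (measurableT_comp mf (measurable_pair1 xi)).
have E xi : (\int[U]_x (W xi * h (f xi x))%:E = (W xi * \int[U]_x h (f xi x))%:E)%E.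
  rewrite -rintegralZ; last exact: int_hU.
  by rewrite EFin_Rintegral//; apply: rintZ; exact: int_hU.
have mm : measurable_fun setT (fun xi => W xi * \int[U]_x h (f xi x)).
  apply: measurable_funM => //.
  apply: (measurable_Rintegral_snd U (f := fun z : V * V => h (f z.1 z.2))).
  exact: measurableT_comp.
move: hf; under eq_integral do rewrite E.
rewrite -(EFin_Rintegral int_h) -EFinM => hf.
have ii : (lebV R n).-integrable setT (EFin \o (fun xi => W xi * \int[U]_x h (f xi x))).
  apply: rint_ge0 => //.
    by move=> xi; rewrite mulr_ge0 ?weight_ge0//; apply: Rintegral_ge0 => x _.
  by apply: le_lt_trans hf _; rewrite ltry.
by split => //; rewrite -lee_fin EFin_Rintegral.
Qed.

Let hm_energy : (lebV R n).-integrable setT (EFin \o (fun xi => W xi * hm xi)) /\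
  \int[lebV R n]_xi (W xi * hm xi) <= S * S * H.
Proof.
apply: mean_energy; first by apply: measurable_xim.
under eq_integral => xi _ do under eq_integral do rewrite ximE.
exact: cone_scaled_le.
Qed.

Let hp_energy : (lebV R n).-integrable setT (EFin \o (fun xi => W xi * hp xi)) /\
  \int[lebV R n]_xi (W xi * hp xi) <= C * C * H.
Proof.
apply: mean_energy; first by apply: measurable_xip.
under eq_integral => xi _ do under eq_integral do rewrite xipE.
exact: cone_scaled_le.
Qed.

Let bgain_mean_sqr (f g : V -> V) : measurable_fun setT f -> measurable_fun setT g ->
  (\int[U]_x bgain X Y (f x) (g x)) ^+ 2
    + (\int[U]_x bgain Y (fun xi => - X xi) (f x) (g x)) ^+ 2 <= \int[U]_x h (g x).
Proof.
move=> mf mg; have tNX := tameN tX.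
have i1 := int_bgain tX tY mf mg; have i2 := int_bgain tY tNX mf mg.
have mX := measurable_bgain _ _ mf mg.
rewrite -lee_fin EFinD EFin_Rintegral; last exact: int_hU.
apply: le_trans (leeD (sqr_rintegral_prob i1) (sqr_rintegral_prob i2)) _.
have m1 := rint_measurable i1; have m2 := rint_measurable i2.
rewrite -ge0_integralDT; first last.
- by move=> x; rewrite lee_fin sqr_ge0.
- by move=> x; rewrite lee_fin sqr_ge0.
- by apply/measurable_EFinP; exact: measurable_funX.
- by apply/measurable_EFinP; exact: measurable_funX.
apply: ge0_le_integralT.
- by apply/measurable_EFinP; apply: measurable_funD; exact: measurable_funX.
- by apply/measurable_EFinP; exact: measurableT_comp.
- by move=> x; rewrite lee_fin addr_ge0 ?sqr_ge0.
- by move=> x; rewrite lee_fin; exact: bgain_sqr.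
Qed.

Let bX xi : R := bop X Y xi theta.
Let bY xi : R := bop Y (fun xi => - X xi) xi theta.

(** [a1 + i b1] and [a2 + i b2] are the two gain terms, in which the transform of [f] is taken at
    [xim] and at [xip]. *)
Let bopE xi : exists a1 a2 b1 b2,
  [/\ bX xi = a1 + a2 - X xi, bY xi = b1 + b2 - Y xi,
      a1 ^+ 2 + b1 ^+ 2 <= hm xi & a2 ^+ 2 + b2 ^+ 2 <= hp xi].
Proof.
have tNX := tameN tX.
have mp : measurable_fun setT (xip xi theta) by exact: measurable_xip.
have mm : measurable_fun setT (xim xi theta) by exact: measurable_xim.
exists (\int[U]_x bgain X Y (xip xi theta x) (xim xi theta x)).
exists (\int[U]_x bgain X Y (xim xi theta x) (xip xi theta x)).
exists (\int[U]_x bgain Y (fun xi => - X xi) (xip xi theta x) (xim xi theta x)).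
exists (\int[U]_x bgain Y (fun xi => - X xi) (xim xi theta x) (xip xi theta x)).
split; [| |exact: bgain_mean_sqr|exact: bgain_mean_sqr].
- by rewrite /bX /bop (rintegralD (int_bgain tX tY mp mm) (int_bgain tX tY mm mp)).
- by rewrite /bY /bop (rintegralD (int_bgain tY tNX mp mm) (int_bgain tY tNX mm mp)).
Qed.

(** Three terms of energy at most [H] each, with the factor 3 of [sqr3_le]. This crude bound gives
    integrability in [bop_dissipation] and the Lipschitz estimate for finite angular measures. *)
Lemma bop_sqr_le :
  (\int[lebV R n]_xi (W xi * (bX xi ^+ 2 + bY xi ^+ 2))%:E <= (9 * H)%:E)%E.
Proof.
have [im em] := hm_energy; have [ip ep] := hp_energy.
have H0 : 0 <= H by apply: Rintegral_ge0 => xi _; rewrite mulr_ge0 ?weight_ge0.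
have S1 : S <= 1.
  by apply: (@le_trans _ _ (1 `^ r)); last (by rewrite powR1); apply: ge0_ler_powR; rewrite ?nnegrE ?(ltW r0) ?(ltW s0)// sin_le1.
have C1 : C <= 1.
  by apply: (@le_trans _ _ (1 `^ r)); last (by rewrite powR1); apply: ge0_ler_powR; rewrite ?nnegrE ?(ltW r0) ?(ltW c0)// cos_le1.
have [[_ _ [mX _ _]] [_ _ [mY _ _]] [_ _ [mN _ _]]] := And3 tX tY (tameN tX).
pose u xi := 3 * (W xi * hm xi + W xi * hp xi + W xi * h xi).
have i2 := rintD im ip; have i3 := rintD i2 int_h.
have iu : (lebV R n).-integrable setT (EFin \o u).
  exact: rintZ i3.
apply: (@le_trans _ _ (\int[lebV R n]_xi (u xi)%:E)%E).
  apply: ge0_le_integralT.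
  - apply/measurable_EFinP; apply: measurable_funM => //.
    by apply: measurable_funD; apply: measurable_funX; exact: measurable_bop.
  - by apply/measurable_EFinP; exact: rint_measurable iu.
  - by move=> xi; rewrite lee_fin mulr_ge0 ?weight_ge0// addr_ge0 ?sqr_ge0.
  move=> xi; rewrite lee_fin /u -!mulrDr mulrCA; apply: ler_wpM2l; first exact: weight_ge0.
  have [a1 [a2 [b1 [b2 [-> -> e1 e2]]]]] := bopE xi.
  apply: le_trans (lerD (sqr3_le a1 a2 (X xi)) (sqr3_le b1 b2 (Y xi))) _.
  rewrite -mulrDr; apply: ler_wpM2l => //; rewrite /h.
  have -> : a1 ^+ 2 + a2 ^+ 2 + X xi ^+ 2 + (b1 ^+ 2 + b2 ^+ 2 + Y xi ^+ 2) =
    (a1 ^+ 2 + b1 ^+ 2) + (a2 ^+ 2 + b2 ^+ 2) + (X xi ^+ 2 + Y xi ^+ 2) by ring.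
  by apply: lerD => //; exact: lerD.
rewrite -(EFin_Rintegral iu) lee_fin /u (rintegralZ 3 i3) (rintegralD i2 int_h) (rintegralD im ip).
have SS : S * S <= 1 by apply: mulr_ile1 => //; exact: powR_ge0.
have CC : C * C <= 1 by apply: mulr_ile1 => //; exact: powR_ge0.
have -> : 9 * H = 3 * (H + H + H) by ring.
apply: ler_wpM2l => //; apply: lerD => //; apply: lerD.
  by apply: le_trans em _; rewrite ler_piMl.
by apply: le_trans ep _; rewrite ler_piMl.
Qed.

(** [amgm_pair] is used with [t = S] for the gain at [xim] and [t = C] for the gain at [xip]. Each
    yields half of its constant from the energy [H] and, the gain having energy at most [S^2 H],
    respectively [C^2 H], the other half; the loss term contributes [- H]. *)
Lemma bop_dissipation :
  (lebV R n).-integrable setT (EFin \o (fun xi => W xi * (bX xi * X xi + bY xi * Y xi))) /\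
  \int[lebV R n]_xi (W xi * (bX xi * X xi + bY xi * Y xi)) <= (S + C - 1) * H.
Proof.
have [im em] := hm_energy; have [ip ep] := hp_energy.
have H0 : 0 <= H by apply: Rintegral_ge0 => xi _; rewrite mulr_ge0 ?weight_ge0.
have S0 : 0 < S by exact: powR_gt0.
have C0 : 0 < C by exact: powR_gt0.
have [[_ _ [mX _ _]] [_ _ [mY _ _]] [_ _ [mN _ _]]] := And3 tX tY (tameN tX).
pose sq xi := W xi * (bX xi ^+ 2 + bY xi ^+ 2).
have mb : measurable_fun setT (fun xi => bX xi) by exact: measurable_bop.
have mb' : measurable_fun setT (fun xi => bY xi) by exact: measurable_bop.
have isq : (lebV R n).-integrable setT (EFin \o sq).
  apply: rint_ge0.
  - by apply: measurable_funM => //; apply: measurable_funD; exact: measurable_funX.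
  - by move=> xi; rewrite mulr_ge0 ?weight_ge0// addr_ge0 ?sqr_ge0.
  - by apply: le_lt_trans bop_sqr_le _; rewrite ltry.
have ib : (lebV R n).-integrable setT (EFin \o (fun xi => W xi * (bX xi * X xi + bY xi * Y xi))).
  apply: (rint_le (g := fun xi => sq xi + W xi * h xi)); last exact: rintD.
    apply: measurable_funM => //; apply: measurable_funD; exact: measurable_funM.
  move=> xi; rewrite /sq /h -mulrDr normrM ger0_norm ?weight_ge0//.
  apply: ler_wpM2l; first exact: weight_ge0.
  move: (bX xi) (bY xi) (X xi) (Y xi) => a b x y.
  apply: le_trans (ler_normD _ _) _; rewrite addrACA; exact: lerD (normM_le_sqr _ _) (normM_le_sqr _ _).
split => //.
pose u xi := ((S + C) / 2 - 1) * (W xi * h xi) + ((2 * S)^-1 * (W xi * hm xi) + (2 * C)^-1 * (W xi * hp xi)).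
have k1 := rintZ ((S + C) / 2 - 1) int_h.
have k2 := rintZ (2 * S)^-1 im; have k3 := rintZ (2 * C)^-1 ip.
have k23 := rintD k2 k3.
have iu : (lebV R n).-integrable setT (EFin \o u).
  exact: rintD k1 k23.
apply: (@le_trans _ _ (\int[lebV R n]_xi u xi)).
  apply: rintegral_le => // xi.
  have -> : u xi = W xi * (((S + C) / 2 - 1) * h xi + ((2 * S)^-1 * hm xi + (2 * C)^-1 * hp xi)).
    by rewrite /u; ring.
  apply: ler_wpM2l; first exact: weight_ge0.
  have [a1 [a2 [b1 [b2 [-> -> e1 e2]]]]] := bopE xi.
  have := amgm_pair (X xi) (Y xi) S0 e1; have := amgm_pair (X xi) (Y xi) C0 e2.
  have -> : (S + C) / 2 = S / 2 + C / 2 by rewrite mulrDl.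
  rewrite /h; move: ((2 * S)^-1 * hm xi) ((2 * C)^-1 * hp xi) (X xi) (Y xi) (S / 2) (C / 2) => p q x y k l.
  have e : (k + l - 1) * (x ^+ 2 + y ^+ 2) + (p + q) - ((a1 + a2 - x) * x + (b1 + b2 - y) * y) =
    (k * (x ^+ 2 + y ^+ 2) + p - (a1 * x + b1 * y)) + (l * (x ^+ 2 + y ^+ 2) + q - (a2 * x + b2 * y)) by ring.
  by move=> h2 h1; rewrite -subr_ge0 e addr_ge0// subr_ge0.
rewrite /u (rintegralD k1 k23) (rintegralD k2 k3) (rintegralZ _ int_h) (rintegralZ _ im) (rintegralZ _ ip).
have h1 : (2 * S)^-1 * (\int[lebV R n]_xi (W xi * hm xi)) <= S / 2 * H.
  rewrite ler_pdivrMl ?mulr_gt0//; apply: le_trans em _.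
  by rewrite le_eqVlt; apply/orP; left; apply/eqP; field.
have h2 : (2 * C)^-1 * (\int[lebV R n]_xi (W xi * hp xi)) <= C / 2 * H.
  rewrite ler_pdivrMl ?mulr_gt0//; apply: le_trans ep _.
  by rewrite le_eqVlt; apply/orP; left; apply/eqP; field.
apply: le_trans (lerD (lexx _) (lerD h1 h2)) _.
by rewrite le_eqVlt; apply/orP; left; apply/eqP; field.
Qed.

End energy.

End fixed_angle.
End collision_operator.

(** * Dissipation of the collision operator *)

Section angular_average.
Context (R : realType) (n : nat) d0 (Theta : measurableType d0).
Local Notation V := 'rV[R]_n.
Variables (t : R) (g0 : {sigma_finite_measure set Theta -> \bar R}).
Variables (B : V -> Theta -> R) (w : Theta -> R) (a D : R).
Hypotheses (mB : measurable_fun setT (fun z : Theta * V => B z.2 z.1))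
  (mw : measurable_fun setT w) (w0 : forall theta, 0 <= w theta)
  (wB0 : forall theta, w theta = 0 -> forall xi, B xi theta = 0)
  (a_gt0 : 0 < a) (w_bound : (\int[g0]_theta (w theta)%:E <= a%:E)%E) (D_ge0 : 0 <= D)
  (B_energy : forall theta,
    (\int[lebV R n]_xi (weight t xi * B xi theta ^+ 2)%:E <= (D * w theta ^+ 2)%:E)%E).
Local Notation W := (weight t).

Let mW := @measurable_weight R n t.
Let mwi : measurable_fun setT (fun theta => (w theta)^-1).
Proof.
rewrite (_ : (fun theta => _) = fun theta => w theta `^ (-1)); last first.
  by apply/funext => theta; rewrite powR_inv1.
exact: (measurableT_comp (measurable_powR _)).
Qed.
Let G (z : Theta * V) : \bar R := (W z.2 * (B z.2 z.1 ^+ 2 / w z.1))%:E.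
Let mG : measurable_fun setT G.
Proof.
apply/measurable_EFinP; apply: measurable_funM; first exact: (measurableT_comp mW).
by apply: measurable_funM; [exact: measurable_funX|exact: (measurableT_comp mwi)].
Qed.
Let G0 z : (0 <= G z)%E.
Proof. by rewrite lee_fin mulr_ge0 ?weight_ge0// divr_ge0 ?sqr_ge0. Qed.

Let G_bound : (\int[g0]_theta \int[lebV R n]_xi G (theta, xi) <= (D * a)%:E)%E.
Proof.
apply: (@le_trans _ _ (\int[g0]_theta (D%:E * (w theta)%:E))%E).
  apply: ge0_le_integralT => [| | |theta].
  - exact: (measurable_integral_snd (lebV R n) mG G0).
  - by apply: measurable_funeM; exact/measurable_EFinP.
  - by move=> theta; apply: integral_ge0 => xi _; exact: G0.
  have -> : (\int[lebV R n]_xi G (theta, xi) =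
      \int[lebV R n]_xi ((w theta)^-1%:E * (W xi * B xi theta ^+ 2)%:E))%E.
    by apply: eq_integral => xi _; rewrite /G -EFinM; congr (_%:E); rewrite /=; ring.
  rewrite ge0_integralZlT; first last.
  - by rewrite lee_fin invr_ge0.
  - by move=> xi; rewrite lee_fin mulr_ge0 ?weight_ge0// sqr_ge0.
  - apply/measurable_EFinP; apply: measurable_funM => //; apply: measurable_funX.
    exact: (measurableT_comp mB (measurable_pair1 theta)).
  apply: (@le_trans _ _ ((w theta)^-1%:E * (D * w theta ^+ 2)%:E)%E).
    by apply: lee_wpmul2l; [rewrite lee_fin invr_ge0|exact: B_energy].
  have [->|wn0] := eqVneq (w theta) 0; first by rewrite invr0 mul0e mule0.
  by rewrite -!EFinM lee_fin le_eqVlt; apply/orP; left; apply/eqP; field.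
rewrite ge0_integralZlT; first last.
- by rewrite lee_fin.
- by move=> theta; rewrite lee_fin.
- exact/measurable_EFinP.
by rewrite [leRHS]EFinM; apply: lee_wpmul2l; [rewrite lee_fin|exact: w_bound].
Qed.

(** Cauchy-Schwarz in [theta] with the weight [w], then Tonelli's theorem. The parameter space is
    abstract because it is used for angles with [w = rho], for angles with [w = 1], and for
    velocities with [w = |v|^r]. *)
Lemma angular_energy : (forall xi, g0.-integrable setT (EFin \o (B xi))) ->
  (\int[lebV R n]_xi (W xi * (\int[g0]_theta B xi theta) ^+ 2)%:E <= (a * (D * a))%:E)%E.
Proof.
move=> iB.
have mGi := measurable_integral_fst g0 mG G0.
apply: (@le_trans _ _ (\int[lebV R n]_xi (a%:E * \int[g0]_theta G (theta, xi)))%E).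
  apply: ge0_le_integralT => [| | |xi].
  - apply/measurable_EFinP; apply: measurable_funM; first exact: mW.
    apply: measurable_funX; apply: (measurable_Rintegral_snd g0
      (f := fun z : V * Theta => B z.1 z.2)).
    have msw : measurable_fun setT (fun z : V * Theta => (z.2, z.1)).
      by apply: measurable_fun_pair; [exact: measurable_snd|exact: measurable_fst].
    exact: (measurableT_comp mB msw).
  - exact: measurable_funeM.
  - by move=> xi; rewrite lee_fin mulr_ge0 ?weight_ge0// sqr_ge0.
  rewrite [leLHS]EFinM.
  have -> : (\int[g0]_theta G (theta, xi) = \int[g0]_theta ((W xi)%:E *
      (B xi theta ^+ 2 / w theta)%:E))%E.
    by apply: eq_integral => p _; rewrite /G EFinM.
  have mBx : measurable_fun setT (B xi) := rint_measurable (iB xi).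
  rewrite ge0_integralZlT; first last.
  - by rewrite lee_fin weight_ge0.
  - by move=> p; rewrite lee_fin divr_ge0 ?sqr_ge0.
  - by apply/measurable_EFinP; apply: measurable_funM => //; exact: measurable_funX.
  rewrite muleCA; apply: lee_wpmul2l; first by rewrite lee_fin weight_ge0.
  apply: (weighted_CS (iB xi) mw w0 _ a_gt0 w_bound).
  by move=> theta h; exact: wB0.
rewrite ge0_integralZlT; first last.
- by rewrite lee_fin ltW.
- by move=> xi; apply: integral_ge0 => theta _; exact: G0.
- exact: mGi.
rewrite -(tonelli g0 (lebV R n) mG G0) [leRHS]EFinM.
by apply: lee_wpmul2l; [rewrite lee_fin ltW|exact: G_bound].
Qed.

(** The product [|B X|] is dominated by [B^2 / w + w X^2], both integrable on the product space. *)
Lemma angular_integrable (X : V -> R) :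
  (lebV R n).-integrable setT (EFin \o (fun xi => W xi * X xi ^+ 2)) ->
  measurable_fun setT X ->
  (g0 \x lebV R n)%E.-integrable setT (EFin \o (fun z => W z.2 * (B z.2 z.1 * X z.2))).
Proof.
move=> iX mX.
have mWX : measurable_fun setT (fun z : Theta * V => w z.1 * (W z.2 * X z.2 ^+ 2)).
  apply: measurable_funM; first exact: (measurableT_comp mw).
  by apply: measurable_funM; [exact: (measurableT_comp mW)|apply: measurable_funX; exact: (measurableT_comp mX)].
have WX0 (z : Theta * V) : (0 <= (w z.1 * (W z.2 * X z.2 ^+ 2))%:E)%E.
  by rewrite lee_fin mulr_ge0// mulr_ge0 ?weight_ge0 ?sqr_ge0.
have iG : (g0 \x lebV R n)%E.-integrable setT
    (EFin \o (fun z => W z.2 * (B z.2 z.1 ^+ 2 / w z.1))).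
  apply: rint_ge0.
  - exact/measurable_EFinP.
  - by move=> z; rewrite -lee_fin; exact: G0.
  rewrite (tonelli_prod g0 (lebV R n) mG G0).
  by apply: le_lt_trans G_bound _; rewrite ltry.
have iWX : (g0 \x lebV R n)%E.-integrable setT
    (EFin \o (fun z : Theta * V => w z.1 * (W z.2 * X z.2 ^+ 2))).
  apply: rint_ge0 => //.
  rewrite (tonelli_prod g0 (lebV R n) (f := fun z => (w z.1 * (W z.2 * X z.2 ^+ 2))%:E)); last 2 first.
  - exact/measurable_EFinP.
  - exact: WX0.
  have e theta : (\int[lebV R n]_xi (w theta * (W xi * X xi ^+ 2))%:E =
      (w theta)%:E * \int[lebV R n]_xi (W xi * X xi ^+ 2)%:E)%E.
    under eq_integral do rewrite EFinM.
    rewrite ge0_integralZlT//.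
    - by apply/measurable_EFinP; exact: rint_measurable iX.
    - by move=> xi; rewrite lee_fin mulr_ge0 ?weight_ge0// sqr_ge0.
    - by rewrite lee_fin.
  under eq_integral do rewrite e.
  rewrite -(EFin_Rintegral iX) ge0_integralZrT; first last.
  - by rewrite lee_fin; apply: Rintegral_ge0 => xi _; rewrite mulr_ge0 ?weight_ge0// sqr_ge0.
  - by move=> theta; rewrite lee_fin.
  - exact/measurable_EFinP.
  apply: (@le_lt_trans _ _ (a%:E * (\int[lebV R n]_xi (W xi * X xi ^+ 2))%:E)%E).
    apply: lee_wpmul2r; last exact: w_bound.
    by rewrite lee_fin; apply: Rintegral_ge0 => xi _; rewrite mulr_ge0 ?weight_ge0// sqr_ge0.
  by rewrite -EFinM ltry.
apply: (rint_le _ _ (rintD iG iWX)).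
  apply: measurable_funM; first exact: (measurableT_comp mW).
  by apply: measurable_funM => //; exact: (measurableT_comp mX).
move=> z; rewrite normrM ger0_norm ?weight_ge0// [w z.1 * _]mulrCA -mulrDr.
apply: ler_wpM2l; first exact: weight_ge0.
have [wz|wn0] := eqVneq (w z.1) 0.
  by rewrite wz (wB0 wz) expr0n/= !mul0r normr0 addr0.
have wz : 0 < w z.1 by rewrite lt_def wn0 w0.
have := amgm_pair `|X z.2| 0 wz (lexx (`|B z.2 z.1| ^+ 2 + 0 ^+ 2)).
rewrite normrM !expr0n/= !addr0 mulr0 addr0 !real_normK ?num_real// => /le_trans; apply.
rewrite addrC; apply: lerD.
  rewrite [leRHS]mulrC ler_wpM2r ?sqr_ge0// invfM ler_piMl ?invr_ge0//.
  by rewrite invf_le1 ?ltr0n// ler1n.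
by rewrite ler_wpM2r ?sqr_ge0// ler_pdivrMr// ler_peMr// ler1n.
Qed.

End angular_average.

Section core_pair.
Context (R : realType) (n : nat) (r : R) d0 (Theta : measurableType d0).
Local Notation V := 'rV[R]_n.
Local Notation U := (uniform_ball R n).
Hypotheses (n1 : (1 < n)%N) (r0 : 0 < r) (r1 : r < 1).
Local Notation s := (n%:R / 2 + r).
Local Notation W := (weight s).
Local Notation L := (lebV R n).
Variables (g0 : {sigma_finite_measure set Theta -> \bar R}) (tau : Theta -> R) (k : R).
Hypotheses (mtau : measurable_fun setT tau)
  (tau_sin : forall theta, 0 < sin (tau theta / 2))
  (tau_cos : forall theta, 0 < cos (tau theta / 2)).
(** Minus the integrand of [kappa] at the angle [tau theta]. *)
Definition excess theta : R := sin (tau theta / 2) `^ r + cos (tau theta / 2) `^ r - 1.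
Hypotheses (k_ge0 : 0 <= k) (k_bound : (\int[g0]_theta (excess theta)%:E <= k%:E)%E).
Variables (A1 A2 : V -> R).
Hypotheses (mA1 : measurable_fun setT A1) (mA2 : measurable_fun setT A2)
  (A12 : forall xi, A1 xi ^+ 2 + A2 xi ^+ 2 <= 1).
Local Notation bopA := (bop A1 A2).
Implicit Types (X Y : V -> R) (theta : Theta).

Let w theta : R := rho r (tau theta).

Lemma rho_gt0 theta : 0 < w theta.
Proof. by rewrite powR_gt0// lt_min tau_sin tau_cos. Qed.

Let w0 theta : 0 <= w theta. Proof. exact: ltW (rho_gt0 theta). Qed.

Let wB0 (B : V -> Theta -> R) theta : w theta = 0 -> forall xi, B xi theta = 0.
Proof. by move=> h; have := rho_gt0 theta; rewrite h ltxx. Qed.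

Lemma measurable_half_angle (f : R -> R) : continuous f ->
  measurable_fun setT (fun theta => f (tau theta / 2)).
Proof.
move=> cf; have mh : measurable_fun setT (fun theta => tau theta / 2) by exact: measurable_funM.
exact: (measurableT_comp (continuous_measurable_fun cf) mh).
Qed.

Let mw : measurable_fun setT w.
Proof.
apply: (measurableT_comp (measurable_powR _)); apply: measurable_minr.
  exact: measurable_half_angle (@continuous_sin R).
exact: measurable_half_angle (@continuous_cos R).
Qed.

Lemma measurable_excess : measurable_fun setT excess.
Proof.
apply: measurable_funB => //; apply: measurable_funD;
  apply: (measurableT_comp (measurable_powR _)).
  exact: measurable_half_angle (@continuous_sin R).
exact: measurable_half_angle (@continuous_cos R).
Qed.

(** This is how finiteness of [kappa] controls the singularity of the angular measure. *)
Lemma rho_excess theta : w theta <= 4 * excess theta.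
Proof.
by apply: min_powR_sc => //; rewrite addrC cos2Dsin2.
Qed.

Lemma excess_ge0 theta : 0 <= excess theta.
Proof. by have := le_trans (ltW (rho_gt0 theta)) (rho_excess theta); rewrite pmulr_rge0. Qed.

Lemma int_excess : g0.-integrable setT (EFin \o excess).
Proof.
apply: rint_ge0; [exact: measurable_excess|exact: excess_ge0|].
by apply: le_lt_trans k_bound _; rewrite ltry.
Qed.

(** [4 k] bounds the integral of [rho]; the added 1 makes the constant positive when [k = 0]. *)
Let a : R := 4 * k + 1.
Let a_gt0 : 0 < a. Proof. by rewrite ltr_wpDl// mulr_ge0. Qed.

Lemma rho_bound : (\int[g0]_theta (w theta)%:E <= a%:E)%E.
Proof.
apply: (@le_trans _ _ (\int[g0]_theta (4%:E * (excess theta)%:E))%E).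
  apply: ge0_le_integralT.
  - exact/measurable_EFinP.
  - by apply: measurable_funeM; apply/measurable_EFinP; exact: measurable_excess.
  - by move=> theta; rewrite lee_fin ltW// rho_gt0.
  - by move=> theta; rewrite -EFinM lee_fin rho_excess.
rewrite ge0_integralZlT; first last.
- by rewrite lee_fin.
- by move=> theta; rewrite lee_fin excess_ge0.
- by apply/measurable_EFinP; exact: measurable_excess.
apply: (@le_trans _ _ (4%:E * k%:E)%E); first by apply: lee_wpmul2l; rewrite ?lee_fin.
by rewrite -EFinM lee_fin /a lerDl.
Qed.

(** The energy may depend on the angle only through [rho^2], the form that [angular_energy]
    integrates. *)
Definition tempered X Y : Prop :=
  (forall xi, g0.-integrable setT (EFin \o (fun theta => bopA X Y xi (tau theta)))) /\
  exists2 D, 0 <= D & forall theta,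
    (\int[L]_xi (W xi * bopA X Y xi (tau theta) ^+ 2)%:E <= (D * rho r (tau theta) ^+ 2)%:E)%E.

(** What the estimates use of the real and imaginary parts of the transform of a zero-mass measure;
    the two [tempered] conditions concern the real and imaginary parts of its image. They are
    properties of functions because differences are formed on transforms: Jordan parts do not
    subtract. *)
Definition core_pair X Y : Prop :=
  [/\ tame r X, tame r Y, L.-integrable setT (EFin \o (fun xi => W xi * (X xi ^+ 2 + Y xi ^+ 2))),
      tempered X Y & tempered Y (fun xi => - X xi)].

Definition qop X Y xi : R := \int[g0]_theta bopA X Y xi (tau theta).

Let mbop X Y : tame r X -> tame r Y ->
  measurable_fun setT (fun z : Theta * V => bopA X Y z.2 (tau z.1)).
Proof.
move=> [_ _ [mX _ _]] [_ _ [mY _ _]].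
by apply: measurable_bop => //; exact: measurableT_comp.
Qed.

Lemma measurable_qop X Y : tame r X -> tame r Y -> measurable_fun setT (qop X Y).
Proof.
move=> [_ _ [mX _ _]] [_ _ [mY _ _]].
apply: (measurable_Rintegral_snd g0 (f := fun z : V * Theta => bopA X Y z.1 (tau z.2))).
by apply: measurable_bop => //; exact: measurableT_comp.
Qed.

Lemma tempered_energy X Y : tame r X -> tame r Y -> tempered X Y ->
  L.-integrable setT (EFin \o (fun xi => W xi * qop X Y xi ^+ 2)).
Proof.
move=> tX tY [ib [D D0 hD]]; apply: rint_ge0.
- apply: measurable_funM; first exact: measurable_weight.
  by apply: measurable_funX; exact: measurable_qop.
- by move=> xi; rewrite mulr_ge0 ?weight_ge0// sqr_ge0.
apply: le_lt_trans (angular_energy (mbop tX tY) mw w0 (@wB0 _) a_gt0 rho_bound D0 hD ib) _.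
by rewrite ltry.
Qed.

Lemma core_sqr_int X Y : core_pair X Y ->
  L.-integrable setT (EFin \o (fun xi => W xi * X xi ^+ 2)) /\
  L.-integrable setT (EFin \o (fun xi => W xi * Y xi ^+ 2)).
Proof.
move=> [[_ _ [mX _ _]] [_ _ [mY _ _]] ih _ _].
have mW := @measurable_weight R n s.
split; apply: rint_le ih; first last.
- move=> xi; have p0 (f : V -> R) : 0 <= W xi * f xi ^+ 2 by rewrite mulr_ge0 ?weight_ge0// sqr_ge0.
  by rewrite (ger0_norm (p0 _)) ler_wpM2l ?weight_ge0// lerDr sqr_ge0.
- by apply: measurable_funM => //; exact: measurable_funX.
- move=> xi; have p0 (f : V -> R) : 0 <= W xi * f xi ^+ 2 by rewrite mulr_ge0 ?weight_ge0// sqr_ge0.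
  by rewrite (ger0_norm (p0 _)) ler_wpM2l ?weight_ge0// lerDl sqr_ge0.
- by apply: measurable_funM => //; exact: measurable_funX.
Qed.

(** [bop_dissipation] at each angle, integrated against the angular measure; [angular_integrable]
    justifies the exchange of integrals. *)
Lemma core_dissipation X Y : core_pair X Y ->
  \int[L]_xi (W xi * (qop X Y xi * X xi + qop Y (fun xi => - X xi) xi * Y xi))
    <= k * \int[L]_xi (W xi * (X xi ^+ 2 + Y xi ^+ 2)).
Proof.
move=> cXY; have [iX iY] := core_sqr_int cXY; have [tX tY ih t1 t2] := cXY.
have [_ _ [mX _ _]] := tX; have [_ _ [mY _ _]] := tY; have tNX := tameN tX.
have [ib1 [D1 D10 hD1]] := t1; have [ib2 [D2 D20 hD2]] := t2.
have j1 := angular_integrable (mbop tX tY) mw w0 (@wB0 _) rho_bound D10 hD1 iX mX.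
have j2 := angular_integrable (mbop tY tNX) mw w0 (@wB0 _) rho_bound D20 hD2 iY mY.
have j := rintD j1 j2.
pose f (z : Theta * V) := W z.2 * (bopA X Y z.2 (tau z.1) * X z.2)
  + W z.2 * (bopA Y (fun xi => - X xi) z.2 (tau z.1) * Y z.2).
have -> : \int[L]_xi (W xi * (qop X Y xi * X xi + qop Y (fun xi => - X xi) xi * Y xi)) =
    \int[L]_xi \int[g0]_theta f (theta, xi).
  apply: eq_Rintegral => xi _; rewrite /f /=.
  rewrite -/(qop _ _ _) mulrDr [qop X Y xi * _]mulrC [_ * Y xi]mulrC !mulrA.
  rewrite /qop -(rintegralZ _ (ib1 xi)) -(rintegralZ _ (ib2 xi)).
  rewrite -(rintegralD (rintZ _ (ib1 xi)) (rintZ _ (ib2 xi))).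
  by apply: eq_Rintegral => theta _; ring.
rewrite -(rfubini (f := f) j).
set H := \int[L]_xi (W xi * (X xi ^+ 2 + Y xi ^+ 2)).
have H0 : 0 <= H by apply: Rintegral_ge0 => xi _; rewrite mulr_ge0 ?weight_ge0// addr_ge0 ?sqr_ge0.
apply: (@le_trans _ _ (\int[g0]_theta (H * excess theta))).
  apply: (rintegral_le (rint_fubini1 j) (rintZ H int_excess)) => theta.
  have [_ hd] := bop_dissipation n1 r0 mA1 mA2 A12 tX tY (tau_sin theta) (tau_cos theta) ih.
  rewrite [leRHS]mulrC; apply: le_trans hd; rewrite le_eqVlt; apply/orP; left; apply/eqP.
  by apply: eq_Rintegral => xi _; rewrite /f /=; ring.
rewrite (rintegralZ _ int_excess) mulrC ler_wpM2r//.
by rewrite -lee_fin (EFin_Rintegral int_excess).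
Qed.

(** [angular_energy] with the constant weight 1 and the bound 9 of [bop_sqr_le], once for the real
    and once for the imaginary part, whence 18. *)
Lemma core_bounded (b : R) X Y : 0 < b -> (g0 setT <= b%:E)%E -> core_pair X Y ->
  (\int[L]_xi (W xi * (qop X Y xi ^+ 2 + qop Y (fun xi => - X xi) xi ^+ 2))%:E
    <= (18 * b ^+ 2 * \int[L]_xi (W xi * (X xi ^+ 2 + Y xi ^+ 2)))%:E)%E.
Proof.
move=> b0 hb cXY; have [tX tY ih t1 t2] := cXY.
have [ib1 _] := t1; have [ib2 _] := t2; have tNX := tameN tX.
have [_ _ [mX _ _]] := tX; have [_ _ [mY _ _]] := tY; have [_ _ [mN _ _]] := tNX.
set H := \int[L]_xi (W xi * (X xi ^+ 2 + Y xi ^+ 2)).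
have H0 : 0 <= H by apply: Rintegral_ge0 => xi _; rewrite mulr_ge0 ?weight_ge0// addr_ge0 ?sqr_ge0.
have mW := @measurable_weight R n s.
have mc : measurable_fun setT (cst 1 : Theta -> R) by exact: measurable_cst.
have c0 (theta : Theta) : 0 <= (cst 1 theta : R) by [].
have cB (B : V -> Theta -> R) (theta : Theta) : (cst 1 theta : R) = 0 -> forall xi, B xi theta = 0.
  by move=> /eqP; rewrite oner_eq0.
have bc : (\int[g0]_theta (cst 1 theta)%:E <= b%:E)%E by rewrite /= integral_cst// mul1e.
have H9 : 0 <= 9 * H by rewrite mulr_ge0.
have hB theta := bop_sqr_le n1 r0 mA1 mA2 A12 tX tY (tau_sin theta) (tau_cos theta) ih.
have m1 theta : measurable_fun setT (fun xi => bopA X Y xi (tau theta)).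
  by apply: measurable_bop.
have m2 theta : measurable_fun setT (fun xi => bopA Y (fun xi => - X xi) xi (tau theta)).
  by apply: measurable_bop.
have E1 theta : (\int[L]_xi (W xi * bopA X Y xi (tau theta) ^+ 2)%:E <= (9 * H * cst 1 theta ^+ 2)%:E)%E.
  rewrite /= expr1n mulr1; apply: le_trans (hB theta); apply: ge0_le_integralT => [| |xi|xi].
  - by apply/measurable_EFinP; apply: measurable_funM => //; exact: measurable_funX.
  - by apply/measurable_EFinP; apply: measurable_funM => //; apply: measurable_funD; exact: measurable_funX.
  - by rewrite lee_fin mulr_ge0 ?weight_ge0// sqr_ge0.
  - by rewrite lee_fin ler_wpM2l ?weight_ge0// lerDl sqr_ge0.
have E2 theta : (\int[L]_xi (W xi * bopA Y (fun xi => - X xi) xi (tau theta) ^+ 2)%:E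
    <= (9 * H * cst 1 theta ^+ 2)%:E)%E.
  rewrite /= expr1n mulr1; apply: le_trans (hB theta); apply: ge0_le_integralT => [| |xi|xi].
  - by apply/measurable_EFinP; apply: measurable_funM => //; exact: measurable_funX.
  - by apply/measurable_EFinP; apply: measurable_funM => //; apply: measurable_funD; exact: measurable_funX.
  - by rewrite lee_fin mulr_ge0 ?weight_ge0// sqr_ge0.
  - by rewrite lee_fin ler_wpM2l ?weight_ge0// lerDr sqr_ge0.
have q1 := angular_energy (mbop tX tY) mc c0 (@cB _) b0 bc H9 E1 ib1.
have q2 := angular_energy (mbop tY tNX) mc c0 (@cB _) b0 bc H9 E2 ib2.
have e : (18 * b ^+ 2 * H)%:E = (b * (9 * H * b))%:E + (b * (9 * H * b))%:E :> \bar R.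
  by rewrite -EFinD; congr (_%:E); ring.
rewrite e; apply: le_trans (leeD q1 q2).
rewrite -ge0_integralDT; first last.
- by move=> xi; rewrite lee_fin mulr_ge0 ?weight_ge0// sqr_ge0.
- by move=> xi; rewrite lee_fin mulr_ge0 ?weight_ge0// sqr_ge0.
- by apply/measurable_EFinP; apply: measurable_funM => //; apply: measurable_funX; exact: measurable_qop.
- by apply/measurable_EFinP; apply: measurable_funM => //; apply: measurable_funX; exact: measurable_qop.
by rewrite le_eqVlt; apply/orP; left; apply/eqP; apply: eq_integral => xi _; rewrite -EFinD mulrDr.
Qed.

Lemma bop_lin (c1 c2 : R) X1 Y1 X2 Y2 xi (theta : R) :
  tame r X1 -> tame r Y1 -> tame r X2 -> tame r Y2 ->
  bopA (fun xi => c1 * X1 xi + c2 * X2 xi) (fun xi => c1 * Y1 xi + c2 * Y2 xi) xi theta =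
    c1 * bopA X1 Y1 xi theta + c2 * bopA X2 Y2 xi theta.
Proof.
move=> tX1 tY1 tX2 tY2.
have mp : measurable_fun setT (xip xi theta) by exact: measurable_xip.
have mm : measurable_fun setT (xim xi theta) by exact: measurable_xim.
have i1 := rintD (int_bgain mA1 mA2 A12 tX1 tY1 mp mm) (int_bgain mA1 mA2 A12 tX1 tY1 mm mp).
have i2 := rintD (int_bgain mA1 mA2 A12 tX2 tY2 mp mm) (int_bgain mA1 mA2 A12 tX2 tY2 mm mp).
rewrite /bop !mulrBr -(rintegralZ c1 i1) -(rintegralZ c2 i2).
rewrite addrACA -opprD -(rintegralD (rintZ c1 i1) (rintZ c2 i2)); congr (_ - _).
by apply: eq_Rintegral => x _; rewrite /bgain; ring.
Qed.

Lemma tempered_lin (c1 c2 : R) X1 Y1 X2 Y2 :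
  tame r X1 -> tame r Y1 -> tame r X2 -> tame r Y2 ->
  tempered X1 Y1 -> tempered X2 Y2 ->
  let X xi := c1 * X1 xi + c2 * X2 xi in let Y xi := c1 * Y1 xi + c2 * Y2 xi in
  tempered X Y /\ forall xi, qop X Y xi = c1 * qop X1 Y1 xi + c2 * qop X2 Y2 xi.
Proof.
move=> tX1 tY1 tX2 tY2 [i1 [D1 D10 h1]] [i2 [D2 D20 h2]] X Y.
have e xi (theta : R) : bopA X Y xi theta = c1 * bopA X1 Y1 xi theta + c2 * bopA X2 Y2 xi theta.
  exact: bop_lin.
have [_ _ [mX1 _ _]] := tX1; have [_ _ [mY1 _ _]] := tY1.
have [_ _ [mX2 _ _]] := tX2; have [_ _ [mY2 _ _]] := tY2.
have mW := @measurable_weight R n s.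
split; last first.
  move=> xi; rewrite /qop -(rintegralZ c1 (i1 xi)) -(rintegralZ c2 (i2 xi)).
  rewrite -(rintegralD (rintZ c1 (i1 xi)) (rintZ c2 (i2 xi))).
  by apply: eq_Rintegral => theta _; rewrite e.
split.
  by move=> xi; under eq_fun do rewrite e; exact: rintD (rintZ c1 (i1 xi)) (rintZ c2 (i2 xi)).
pose a1 := 2 * c1 ^+ 2; pose a2 := 2 * c2 ^+ 2.
have a10 : 0 <= a1 by rewrite mulr_ge0 ?sqr_ge0.
have a20 : 0 <= a2 by rewrite mulr_ge0 ?sqr_ge0.
exists (a1 * D1 + a2 * D2); first by rewrite addr_ge0// mulr_ge0.
move=> theta.
have m1 : measurable_fun setT (fun xi => bopA X1 Y1 xi (tau theta)) by apply: measurable_bop.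
have m2 : measurable_fun setT (fun xi => bopA X2 Y2 xi (tau theta)) by apply: measurable_bop.
have mq (f : V -> R) : measurable_fun setT f -> measurable_fun setT (fun xi => (W xi * f xi ^+ 2)%:E).
  by move=> mf; apply/measurable_EFinP; apply: measurable_funM => //; exact: measurable_funX.
have q0 (f : V -> R) xi : (0 <= (W xi * f xi ^+ 2)%:E)%E.
  by rewrite lee_fin mulr_ge0 ?weight_ge0// sqr_ge0.
apply: (@le_trans _ _ (\int[L]_xi (a1%:E * (W xi * bopA X1 Y1 xi (tau theta) ^+ 2)%:E
    + a2%:E * (W xi * bopA X2 Y2 xi (tau theta) ^+ 2)%:E))%E).
  apply: ge0_le_integralT => [| |xi|xi].
  - apply: mq; under eq_fun do rewrite e.
    by apply: measurable_funD; exact: measurable_funM.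
  - by apply: emeasurable_funD; apply: measurable_funeM; exact: mq.
  - by rewrite lee_fin mulr_ge0 ?weight_ge0// sqr_ge0.
  - rewrite e -!EFinM -EFinD lee_fin; have := weight_ge0 s xi.
    move: (bopA X1 _ _ _) (bopA X2 _ _ _) (W xi) => p q c c0; rewrite -subr_ge0 /a1 /a2.
    rewrite [X in 0 <= X](_ : _ = c * (c1 * p - c2 * q) ^+ 2); last by ring.
    by rewrite mulr_ge0 ?sqr_ge0.
rewrite ge0_integralDT; first last.
- by move=> xi; apply: mule_ge0; rewrite lee_fin// mulr_ge0 ?weight_ge0// sqr_ge0.
- by move=> xi; apply: mule_ge0; rewrite lee_fin// mulr_ge0 ?weight_ge0// sqr_ge0.
- by apply: measurable_funeM; exact: mq.
- by apply: measurable_funeM; exact: mq.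
have a1E : (0 <= a1%:E)%E by rewrite lee_fin.
have a2E : (0 <= a2%:E)%E by rewrite lee_fin.
rewrite (ge0_integralZlT L (mq _ m1) (q0 _) a1E) (ge0_integralZlT L (mq _ m2) (q0 _) a2E).
set w2 := rho r (tau theta) ^+ 2 in h1 h2 *.
have -> : ((a1 * D1 + a2 * D2) * w2)%:E = (a1%:E * (D1 * w2)%:E + a2%:E * (D2 * w2)%:E)%E.
  by rewrite -!EFinM -EFinD; congr (_%:E); ring.
by apply: leeD; exact: lee_wpmul2l.
Qed.

Lemma temperedB X1 Y1 X2 Y2 : tame r X1 -> tame r Y1 -> tame r X2 -> tame r Y2 ->
  tempered X1 Y1 -> tempered X2 Y2 ->
  tempered (fun xi => X1 xi - X2 xi) (fun xi => Y1 xi - Y2 xi) /\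
  forall xi, qop (fun xi => X1 xi - X2 xi) (fun xi => Y1 xi - Y2 xi) xi = qop X1 Y1 xi - qop X2 Y2 xi.
Proof.
move=> tX1 tY1 tX2 tY2 t1 t2.
have e (f g : V -> R) : (fun xi => f xi - g xi) = fun xi => 1 * f xi + (-1) * g xi.
  by apply/funext => z; rewrite mul1r mulN1r.
have [h q] := tempered_lin 1 (-1) tX1 tY1 tX2 tY2 t1 t2.
by rewrite !e; split=> // xi; rewrite q mul1r mulN1r.
Qed.

Lemma core_pairB X1 Y1 X2 Y2 : core_pair X1 Y1 -> core_pair X2 Y2 ->
  core_pair (fun xi => X1 xi - X2 xi) (fun xi => Y1 xi - Y2 xi).
Proof.
move=> c1 c2; have [iX1 iY1] := core_sqr_int c1; have [iX2 iY2] := core_sqr_int c2.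
have [tX1 tY1 i1 s1 s1'] := c1; have [tX2 tY2 i2 s2 s2'] := c2.
have [_ _ [mX1 _ _]] := tX1; have [_ _ [mY1 _ _]] := tY1.
have [_ _ [mX2 _ _]] := tX2; have [_ _ [mY2 _ _]] := tY2.
split; [exact: tameB|exact: tameB| | |].
- apply: (rint_le _ _ (rintZ 2 (rintD i1 i2))).
    apply: measurable_funM; first exact: measurable_weight.
    by apply: measurable_funD; apply: measurable_funX; exact: measurable_funB.
  move=> xi; rewrite ger0_norm ?mulr_ge0 ?weight_ge0 ?addr_ge0 ?sqr_ge0// -mulrDr mulrCA.
  apply: ler_wpM2l; first exact: weight_ge0.
  rewrite -subr_ge0 [X in 0 <= X](_ : _ = (X1 xi + X2 xi) ^+ 2 + (Y1 xi + Y2 xi) ^+ 2); last by ring.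
  by rewrite addr_ge0 ?sqr_ge0.
- by have [] := temperedB tX1 tY1 tX2 tY2 s1 s2.
- have [h _] := temperedB tY1 (tameN tX1) tY2 (tameN tX2) s1' s2'.
  by rewrite (_ : (fun xi => - (X1 xi - X2 xi)) = fun xi => - X1 xi - - X2 xi)//; apply/funext => xi; ring.
Qed.

End core_pair.

(** * Fourier transforms of signed measures *)

Section core_of_measures.
Context (R : realType) (n : nat) (r : R) d0 (Theta : measurableType d0).
Local Notation V := 'rV[R]_n.
Hypotheses (n1 : (1 < n)%N) (r0 : 0 < r) (r1 : r < 1).
Local Notation s := (n%:R / 2 + r).
Local Notation W := (weight s).
Local Notation L := (lebV R n).
Variables (g0 : {sigma_finite_measure set Theta -> \bar R}) (tau : Theta -> R) (k : R).
Hypotheses (mtau : measurable_fun setT tau)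
  (tau_sin : forall theta, 0 < sin (tau theta / 2))
  (tau_cos : forall theta, 0 < cos (tau theta / 2)).
Hypotheses (k_ge0 : 0 <= k) (k_bound : (\int[g0]_theta (excess r tau theta)%:E <= k%:E)%E).
Implicit Types (psi : R -> R) (xi : V).

Let r01 : 0 < r < 1. Proof. by rewrite r0 r1. Qed.

Definition rmoment (m : {measure set V -> \bar R}) : Prop :=
  (\int[m]_v (enorm v `^ r)%:E < +oo)%E.

(** [angular_energy] with the velocity as parameter and the weight [|v|^r], applied to the dipoles
    [delta_v - delta_0]. *)
Lemma ft_energy psi (m : {finite_measure set V -> \bar R}) : trig psi -> rmoment m ->
  L.-integrable setT (EFin \o (fun xi => W xi * (ft psi m xi - ft psi m 0) ^+ 2)).
Proof.
move=> tp hm; have [p1 pl mp] := tp.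
have [K [K0 hK]] := minsq_integral r01 n1.
have mr : measurable_fun setT (fun v : V => enorm v `^ r) by exact: measurable_enorm_powR.
have im : m.-integrable setT (EFin \o (fun v => enorm v `^ r)).
  by apply: rint_ge0 => // v; exact: powR_ge0.
pose M := \int[m]_v (enorm v `^ r) + 1.
have M0 : 0 < M by rewrite ltr_wpDl//; apply: Rintegral_ge0 => v _; exact: powR_ge0.
have hM : (\int[m]_v (enorm v `^ r)%:E <= M%:E)%E.
  by rewrite -(EFin_Rintegral im) lee_fin lerDl.
pose B xi v := psi (dotv xi v) - psi (dotv xi 0).
have mB : measurable_fun setT (fun z : V * V => B z.2 z.1).
  apply: measurable_funB; apply: measurableT_comp => //.
    by apply: measurable_dotv; [exact: measurable_snd|exact: measurable_fst].
  by apply: measurable_dotv; [exact: measurable_snd|exact: measurable_cst].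
have w0 (v : V) : 0 <= enorm v `^ r by exact: powR_ge0.
have wB0 (v : V) : enorm v `^ r = 0 -> forall xi, B xi v = 0.
  by move=> /eqP; rewrite powR_eq0 enorm_eq0 => /andP[/eqP -> _] xi; rewrite /B subrr.
have hE (v : V) : (\int[L]_xi (W xi * B xi v ^+ 2)%:E <= (K * (enorm v `^ r) ^+ 2)%:E)%E.
  rewrite -[X in enorm X]subr0 expr2 -powRD; last by rewrite gt_eqF ?implybT// addr_gt0.
  rewrite -[X in (_ * _ `^ X)%:E](_ : 2 * r = r + r); last by ring.
  under eq_integral do rewrite mulrC.
  exact: (trig_energy r01 v 0 tp K0 hK).
have ipv (xi : V) : m.-integrable setT (EFin \o (fun v => psi (dotv xi v))).
  apply: (rint_bounded m (c := 1)) => //.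
  by apply: measurableT_comp => //; apply: measurable_dotv.
have ic xi : m.-integrable setT (EFin \o (fun v : V => psi (dotv xi 0))).
  by apply: (rint_bounded m (c := 1)).
have iB xi : m.-integrable setT (EFin \o B xi) by exact: rintB (ipv xi) (ic xi).
have e xi : ft psi m xi - ft psi m 0 = \int[m]_v B xi v.
  rewrite /ft /B -(rintegralB (ipv xi) (ipv 0)); apply: eq_Rintegral => v _.
  by rewrite dotv0l dotv0r.
have [_ _ [mf _ _]] := tame_ft r0 r1 tp hm.
apply: rint_ge0.
- by apply: measurable_funM; [exact: measurable_weight|apply: measurable_funX; exact: measurable_funB].
- by move=> xi; rewrite mulr_ge0 ?weight_ge0// sqr_ge0.
under eq_integral do rewrite e.
have h := angular_energy mB mr w0 wB0 M0 hM (ltW K0) hE iB.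
by apply: le_lt_trans h _; rewrite ltry.
Qed.

Variable mu : probability V R.
Hypothesis mu_moment : rmoment mu.
Local Notation A1 := (ft cos mu).
Local Notation A2 := (ft sin mu).
Local Notation bopA := (bop A1 A2).

Lemma tameA psi : trig psi -> tame r (ft psi mu).
Proof. by move=> tp; exact: tame_ft. Qed.

(** Jensen's inequality and [cos^2 + sin^2 = 1]: the transform of a probability measure has modulus
    at most 1. *)
Lemma ft_cos_sin xi : A1 xi ^+ 2 + A2 xi ^+ 2 <= 1.
Proof.
have md psi : measurable_fun setT psi -> measurable_fun setT (fun v : V => psi (dotv xi v)).
  by move=> mp; apply: measurableT_comp => //; exact: measurable_dotv.
have [p1 _ mp] := @trig_cos R; have [q1 _ mq] := @trig_sin R.
have i1 := rint_bounded mu (md _ mp) (fun v => p1 (dotv xi v)).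
have i2 := rint_bounded mu (md _ mq) (fun v => q1 (dotv xi v)).
rewrite -lee_fin EFinD.
apply: le_trans (leeD (sqr_rintegral_prob i1) (sqr_rintegral_prob i2)) _.
rewrite -ge0_integralDT; first last.
- by move=> x; rewrite lee_fin sqr_ge0.
- by move=> x; rewrite lee_fin sqr_ge0.
- by apply/measurable_EFinP; apply: measurable_funX; exact: md.
- by apply/measurable_EFinP; apply: measurable_funX; exact: md.
under eq_integral do rewrite -EFinD cos2Dsin2.
by rewrite integral_prob_cst.
Qed.

Section signed.
Variables (p q : {finite_measure set V -> \bar R}).
Hypotheses (p_moment : rmoment p) (q_moment : rmoment q) (pq_mass : p setT = q setT).

Definition sft psi xi : R := ft psi p xi - ft psi q xi.

Lemma tame_sft psi : trig psi -> tame r (sft psi).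
Proof. by move=> tp; apply: tameB; exact: tame_ft. Qed.

Lemma sft0 psi : sft psi 0 = 0.
Proof.
rewrite /sft /ft; under eq_Rintegral do rewrite dotv0l.
under [X in _ - X]eq_Rintegral do rewrite dotv0l.
have E (m : {finite_measure set V -> \bar R}) : \int[m]_x psi 0 = psi 0 * fine (m setT).
  exact: Rintegral_cst.
by rewrite !E pq_mass subrr.
Qed.

Lemma sft_energy psi : trig psi ->
  L.-integrable setT (EFin \o (fun xi => W xi * sft psi xi ^+ 2)).
Proof.
move=> tp; have [_ _ [mf _ _]] := tame_sft tp.
apply: (rint_le _ _ (rintZ 2 (rintD (ft_energy tp p_moment) (ft_energy tp q_moment)))).
  by apply: measurable_funM; [exact: measurable_weight|exact: measurable_funX].
move=> xi; have p0 : 0 <= W xi * sft psi xi ^+ 2 by rewrite mulr_ge0 ?weight_ge0 ?sqr_ge0.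
rewrite (ger0_norm p0) -mulrDr [leRHS]mulrCA.
apply: ler_wpM2l; first exact: weight_ge0.
have -> : sft psi xi = (ft psi p xi - ft psi p 0) - (ft psi q xi - ft psi q 0).
  have h : ft psi p 0 = ft psi q 0 by apply/eqP; rewrite -subr_eq0; apply/eqP; exact: sft0.
  by rewrite /sft h; ring.
move: (ft psi p xi - _) (ft psi q xi - _) => a b; rewrite -subr_ge0.
by rewrite [X in 0 <= X](_ : _ = (a + b) ^+ 2); [exact: sqr_ge0|ring].
Qed.

(** The transform of [p - q] is [sft cos - i sft sin], whence the sign. *)
Lemma pairing_diff_cos eta zeta : pairing mu p cos eta zeta - pairing mu q cos eta zeta =
  bgain A1 A2 (sft cos) (fun xi => - sft sin xi) eta zeta.
Proof. by rewrite !pairing_cos /bgain /sft; ring. Qed.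

(** [sin] corresponds to [i] times the transform of [p - q], that is [sft sin + i sft cos]. *)
Lemma pairing_diff_sin eta zeta : pairing mu p sin eta zeta - pairing mu q sin eta zeta =
  bgain A1 A2 (sft sin) (sft cos) eta zeta.
Proof. by rewrite !pairing_sin /bgain /sft; ring. Qed.

Lemma form_diff psi (X Y : V -> R) xi theta : trig psi -> tame r X -> tame r Y ->
  X =1 sft psi ->
  (forall eta zeta, pairing mu p psi eta zeta - pairing mu q psi eta zeta =
    bgain A1 A2 X Y eta zeta) ->
  X 0 = 0 -> Y 0 = 0 ->
  form (prodm mu p) psi xi theta - form (prodm mu q) psi xi theta = bopA X Y xi theta.
Proof.
move=> tp tX tY eX eP X0 Y0.
have A10 : A1 0 = 1.
  rewrite /ft; under eq_Rintegral do rewrite dotv0l cos0; exact: rintegral_prob_cst.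
have A20 : A2 0 = 0.
  rewrite /ft; under eq_Rintegral do rewrite dotv0l sin0; exact: rintegral_prob_cst.
have [_ _ [mA1 _ _]] := tameA (@trig_cos R); have [_ _ [mA2 _ _]] := tameA (@trig_sin R).
have mp : measurable_fun setT (xip xi theta) by exact: measurable_xip.
have mm : measurable_fun setT (xim xi theta) by exact: measurable_xim.
have mpair (m : {finite_measure set V -> \bar R}) (f g : V -> V) :
    measurable_fun setT f -> measurable_fun setT g ->
    (uniform_ball R n).-integrable setT (EFin \o (fun x => pairing mu m psi (f x) (g x))).
  move=> mf mg; have [p1 _ mpsi] := tp.
  have mh : measurable_fun setT (fun z : V * (V * V) => psi (dotv (f z.1) z.2.1 + dotv (g z.1) z.2.2)).
    apply: measurableT_comp => //; apply: measurable_funD; apply: measurable_dotv;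
      apply: measurableT_comp => //; exact: measurableT_comp.
  apply: (rint_bounded _ (c := \int[prodm mu m]_z 1)).
    exact: (measurable_Rintegral_snd (prodm mu m) mh).
  move=> x.
  have pmT : (prodm mu m setT < +oo)%E.
    rewrite -setXTT [X in (X < _)%E](_ : _ = mu setT * m setT)%E; last exact: product_measure1E.
    by apply: lte_mul_pinfty; rewrite ?ltey_eq ?fin_num_measure.
  have i1 : (prodm mu m).-integrable setT (EFin \o (cst 1 : V * V -> R)).
    by apply: rint_ge0 => //; rewrite /= integral_cst// mul1e.
  have mhx : measurable_fun setT (fun z : V * V => psi (dotv (f x) z.1 + dotv (g x) z.2)).
    exact: (measurableT_comp mh (measurable_pair1 x)).
  have i2 : (prodm mu m).-integrable setT
      (EFin \o (fun z : V * V => psi (dotv (f x) z.1 + dotv (g x) z.2))).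
    by apply: (rint_le mhx _ i1) => z; exact: p1.
  apply: le_trans (rintegral_norm i2) _; apply: (rintegral_le _ i1) => [|z]; last exact: p1.
  by apply: (rint_le _ _ i1) => [|z]; [exact: measurableT_comp|rewrite normr_id; exact: p1].
have c0 (c : R) : (uniform_ball R n).-integrable setT (EFin \o (fun _ : V => c)).
  by apply: (rint_bounded _ (c := `|c|)).
have ip := rintD (mpair p _ _ mp mm) (mpair p _ _ mm mp).
have iq := rintD (mpair q _ _ mp mm) (mpair q _ _ mm mp).
have ip1 := rintB ip (c0 (pairing mu p psi xi 0)); have iq1 := rintB iq (c0 (pairing mu q psi xi 0)).
have ip2 := rintB ip1 (c0 (pairing mu p psi 0 xi)); have iq2 := rintB iq1 (c0 (pairing mu q psi 0 xi)).
rewrite !form_pairing// -(rintegralB ip2 iq2).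
have ig := rintD (int_bgain mA1 mA2 ft_cos_sin tX tY mp mm) (int_bgain mA1 mA2 ft_cos_sin tX tY mm mp).
rewrite /bop -[X in _ - X](rintegral_prob_cst (uniform_ball R n)) -(rintegralB ig (c0 _)).
apply: eq_Rintegral => x _; rewrite -!eP.
(* The loss term [A(xi) F(0)], which is 0. *)
have e1 : pairing mu p psi xi 0 = pairing mu q psi xi 0.
  by apply/eqP; rewrite -subr_eq0 eP /bgain X0 Y0 !mulr0 addr0.
(* The loss term [A(0) F(xi)], with [A(0) = 1]. *)
have e2 : X xi = pairing mu p psi 0 xi - pairing mu q psi 0 xi.
  by rewrite eP /bgain A10 A20 mul1r mul0r addr0.
have E (a b c d u v v' : R) : a + b - u - v - (c + d - u - v') = a - c + (b - d) - (v - v') by ring.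
by rewrite e2 e1; exact: E.
Qed.

Lemma form_diff_cos xi theta :
  form (prodm mu p) cos xi theta - form (prodm mu q) cos xi theta =
    bopA (sft cos) (fun xi => - sft sin xi) xi theta.
Proof.
have tc := tame_sft (@trig_cos R); have ts := tame_sft (@trig_sin R).
apply: form_diff => //; [exact: trig_cos|exact: tameN|exact: pairing_diff_cos|exact: sft0|].
by rewrite sft0 oppr0.
Qed.

Lemma form_diff_sin xi theta :
  form (prodm mu p) sin xi theta - form (prodm mu q) sin xi theta =
    bopA (sft sin) (sft cos) xi theta.
Proof.
have tc := tame_sft (@trig_cos R); have ts := tame_sft (@trig_sin R).
by apply: form_diff => //; [exact: trig_sin|exact: pairing_diff_sin|exact: sft0|exact: sft0].
Qed.

Lemma pair_moment_bound (m : {finite_measure set V -> \bar R}) : rmoment m ->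
  exists2 M, 0 < M & (\int[prodm mu m]_z (enorm (z.1 - z.2) `^ r)%:E <= M%:E)%E.
Proof.
move=> hm; have im : (prodm mu m).-integrable setT (EFin \o (fun z : V * V => enorm (z.1 - z.2) `^ r)).
  exact: (int_moment r0 r1 mu_moment hm).
exists (\int[prodm mu m]_z (enorm (z.1 - z.2) `^ r) + 1).
  by rewrite ltr_wpDl//; apply: Rintegral_ge0 => z _; exact: powR_ge0.
by rewrite -(EFin_Rintegral im) lee_fin lerDl.
Qed.

(** Each of [p] and [q] obeys [form_energy], and [(x - y)^2 <= 2 x^2 + 2 y^2] doubles the constant 4
    found there. *)
Lemma tempered_form_diff psi X Y : trig psi ->
  (forall xi theta, form (prodm mu p) psi xi theta - form (prodm mu q) psi xi theta = bopA X Y xi theta) ->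
  tempered r g0 tau A1 A2 X Y /\
  forall xi, qop g0 tau A1 A2 X Y xi = qform g0 tau (prodm mu p) psi xi - qform g0 tau (prodm mu q) psi xi.
Proof.
move=> tp e; have [_ _ mpsi] := tp.
have [K [K0 hK]] := minsq_integral r01 n1.
have [Mp Mp0 hMp] := pair_moment_bound p_moment; have [Mq Mq0 hMq] := pair_moment_bound q_moment.
have rb := rho_bound r0 r1 mtau tau_sin tau_cos k_bound.
have a0 : 0 < 4 * k + 1 by rewrite ltr_wpDl// mulr_ge0.
have ifp xi := int_form n1 r0 r1 mtau tau_sin tau_cos rb hMp xi tp.
have ifq xi := int_form n1 r0 r1 mtau tau_sin tau_cos rb hMq xi tp.
split; last first.
  move=> xi; rewrite /qop /qform -(rintegralB (ifp xi) (ifq xi)).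
  by apply: eq_Rintegral => theta _; rewrite -e.
split.
  move=> xi; have -> : (fun theta => bopA X Y xi (tau theta)) = fun theta =>
      form (prodm mu p) psi xi (tau theta) - form (prodm mu q) psi xi (tau theta).
    by apply/funext => theta; rewrite e.
  exact: (rintB (ifp xi) (ifq xi)).
exists (8 * K * Mp ^+ 2 + 8 * K * Mq ^+ 2); first by rewrite addr_ge0// !mulr_ge0 ?sqr_ge0// ltW.
move=> theta; have fp := form_energy n1 r0 r1 Mp0 hMp (tau_sin theta) (tau_cos theta) tp K0 hK.
have fq := form_energy n1 r0 r1 Mq0 hMq (tau_sin theta) (tau_cos theta) tp K0 hK.
have mf (m : {finite_measure set V -> \bar R}) :
    measurable_fun setT (fun xi => form (prodm mu m) psi xi (tau theta)).
  by apply: measurable_form => //; exact: measurable_cst.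
have mW := @measurable_weight R n s.
have m2 (m : {finite_measure set V -> \bar R}) : measurable_fun setT
    (fun xi => (form (prodm mu m) psi xi (tau theta) ^+ 2 * W xi)%:E).
  by apply/measurable_EFinP; apply: measurable_funM => //; exact: measurable_funX.
have p2 (m : {finite_measure set V -> \bar R}) xi :
    (0 <= (form (prodm mu m) psi xi (tau theta) ^+ 2 * W xi)%:E)%E.
  by rewrite lee_fin mulr_ge0 ?sqr_ge0// weight_ge0.
have two : (0 <= 2%:E :> \bar R)%E by rewrite lee_fin.
apply: (@le_trans _ _ (\int[L]_xi (2%:E * (form (prodm mu p) psi xi (tau theta) ^+ 2 * W xi)%:E
    + 2%:E * (form (prodm mu q) psi xi (tau theta) ^+ 2 * W xi)%:E))%E).
  apply: ge0_le_integralT => [| |xi|xi].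
  - apply/measurable_EFinP; apply: measurable_funM => //; apply: measurable_funX.
    by under eq_fun do rewrite -e; exact: measurable_funB.
  - by apply: emeasurable_funD; apply: measurable_funeM; exact: m2.
  - by rewrite lee_fin mulr_ge0 ?weight_ge0// sqr_ge0.
  rewrite -e -!EFinM -EFinD lee_fin; have := weight_ge0 s xi.
  move: (form (prodm mu p) _ _ _) (form (prodm mu q) _ _ _) (W xi) => x y c c0; rewrite -subr_ge0.
  by rewrite [X in 0 <= X](_ : _ = c * (x + y) ^+ 2); [rewrite mulr_ge0 ?sqr_ge0|ring].
rewrite ge0_integralDT; first last.
- by move=> xi; rewrite mule_ge0.
- by move=> xi; rewrite mule_ge0.
- by apply: measurable_funeM; exact: m2.
- by apply: measurable_funeM; exact: m2.
rewrite (ge0_integralZlT L (m2 p) (p2 p) two) (ge0_integralZlT L (m2 q) (p2 q) two).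
set w2 := rho r (tau theta) ^+ 2 in fp fq *.
have -> : ((8 * K * Mp ^+ 2 + 8 * K * Mq ^+ 2) * w2)%:E =
    (2%:E * (4 * K * Mp ^+ 2 * w2)%:E + 2%:E * (4 * K * Mq ^+ 2 * w2)%:E)%E.
  by rewrite -!EFinM -EFinD; congr (_%:E); ring.
by apply: leeD; exact: lee_wpmul2l.
Qed.

End signed.

Section complex.
Variables (p1 q1 p2 q2 : {finite_measure set V -> \bar R}) (c : R).
Hypotheses (hp1 : rmoment p1) (hq1 : rmoment q1) (pq1 : p1 setT = q1 setT)
  (hp2 : rmoment p2) (hq2 : rmoment q2) (pq2 : p2 setT = q2 setT).

(* Real and imaginary parts of the Fourier transform of
   [(p1 - q1) + i (p2 - q2)], up to the normalization [c]. *)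
Definition ftX xi : R := c * sft p1 q1 cos xi + c * sft p2 q2 sin xi.
Definition ftY xi : R := c * sft p2 q2 cos xi + (- c) * sft p1 q1 sin xi.

Lemma core_pair_ft :
  [/\ core_pair r g0 tau A1 A2 ftX ftY,
    forall xi, qop g0 tau A1 A2 ftX ftY xi =
      c * (qform g0 tau (prodm mu p1) cos xi - qform g0 tau (prodm mu q1) cos xi)
      + c * (qform g0 tau (prodm mu p2) sin xi - qform g0 tau (prodm mu q2) sin xi)
  & forall xi, qop g0 tau A1 A2 ftY (fun xi => - ftX xi) xi =
      c * (qform g0 tau (prodm mu p2) cos xi - qform g0 tau (prodm mu q2) cos xi)
      - c * (qform g0 tau (prodm mu p1) sin xi - qform g0 tau (prodm mu q1) sin xi)].
Proof.
have tcs := @trig_cos R; have tsn := @trig_sin R.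
have c1 := tame_sft hp1 hq1 tcs; have s1 := tame_sft hp1 hq1 tsn.
have c2 := tame_sft hp2 hq2 tcs; have s2 := tame_sft hp2 hq2 tsn.
have [_ _ [mA1 _ _]] := tameA tcs; have [_ _ [mA2 _ _]] := tameA tsn.
have [C1 QC1] := tempered_form_diff hp1 hq1 tcs (form_diff_cos hp1 hq1 pq1).
have [S1 QS1] := tempered_form_diff hp1 hq1 tsn (form_diff_sin hp1 hq1 pq1).
have [C2 QC2] := tempered_form_diff hp2 hq2 tcs (form_diff_cos hp2 hq2 pq2).
have [S2 QS2] := tempered_form_diff hp2 hq2 tsn (form_diff_sin hp2 hq2 pq2).
have tX : tame r ftX by apply: tameD; exact: tameZ.
have tY : tame r ftY by apply: tameD; exact: tameZ.
have [_ _ [mX _ _]] := tX; have [_ _ [mY _ _]] := tY.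
have [T1 Q1] := tempered_lin mA1 mA2 ft_cos_sin c c c1 (tameN s1) s2 c2 C1 S2.
have [T2 Q2] := tempered_lin mA1 mA2 ft_cos_sin c (- c) c2 (tameN s2) s1 c1 C2 S1.
have eY : (fun xi => c * - sft p1 q1 sin xi + c * sft p2 q2 cos xi) = ftY.
  by apply/funext => xi; rewrite /ftY; ring.
have eX : (fun xi => c * - sft p2 q2 sin xi + - c * sft p1 q1 cos xi) = fun xi => - ftX xi.
  by apply/funext => xi; rewrite /ftX; ring.
rewrite eY -/ftX in T1 Q1; rewrite eX -/ftY in T2 Q2.
split; last 2 first.
- by move=> xi; rewrite Q1 QC1 QS2.
- by move=> xi; rewrite Q2 QC2 QS1 mulNr.
split => //.
have i1 := rintD (rintD (sft_energy hp1 hq1 pq1 tcs) (sft_energy hp1 hq1 pq1 tsn))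
  (rintD (sft_energy hp2 hq2 pq2 tcs) (sft_energy hp2 hq2 pq2 tsn)).
apply: (rint_le _ _ (rintZ (2 * c ^+ 2) i1)).
  by apply: measurable_funM; [exact: measurable_weight|apply: measurable_funD; exact: measurable_funX].
move=> xi; have p0 : 0 <= W xi * (ftX xi ^+ 2 + ftY xi ^+ 2).
  by rewrite mulr_ge0 ?weight_ge0// addr_ge0 ?sqr_ge0.
rewrite (ger0_norm p0) /ftX /ftY; have := weight_ge0 s xi.
move: (W xi) (sft p1 q1 cos xi) (sft p1 q1 sin xi) (sft p2 q2 cos xi) (sft p2 q2 sin xi) => w a1 b1 a2 b2 w0.
rewrite -subr_ge0 [X in 0 <= X](_ : _ = w * c ^+ 2 * ((a1 - b2) ^+ 2 + (a2 + b1) ^+ 2)); last by ring.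
apply: mulr_ge0; first by rewrite mulr_ge0 ?sqr_ge0.
by rewrite addr_ge0 ?sqr_ge0.
Qed.

End complex.
End core_of_measures.

(** * The collision model and its angular measure *)

Lemma integral_pushforward_measure d1 d2 (T1 : measurableType d1) (T2 : measurableType d2)
    (R : realType) (m : {measure set T1 -> \bar R}) (f : T1 -> T2)
    (mf : measurable_fun setT f) (h : T2 -> \bar R) : measurable_fun setT h ->
  (\int[pushforward_measure m mf]_y h y = \int[m]_x h (f x))%E.
Proof.
move=> mh; rewrite integralE [in RHS]integralE; congr (_ - _)%E.
- rewrite (ge0_integral_pushforward mf)//; last exact: measurable_funepos.
  by rewrite preimage_setT; apply: eq_integral => x _; rewrite /= !funeposE.
- rewrite (ge0_integral_pushforward mf)//; last exact: measurable_funeneg.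
  by rewrite preimage_setT; apply: eq_integral => x _; rewrite /= !funenegE.
Qed.

Section sigma_finite_alias.
Context d (T : measurableType d) (R : realType).
Variables (m : {measure set T -> \bar R}) (sf : sigma_finite setT m).

(* [sf] is a parameter of the alias so that instance inference can recover it. *)
Definition sfm : set T -> \bar R := let _ := sf in m.

HB.instance Definition _ := Measure.copy sfm m.
HB.instance Definition _ := Measure_isSigmaFinite.Build _ _ _ sfm sf.

End sigma_finite_alias.

Section angular_restriction.
Context (R : realType).
Local Notation T := (R : measurableType _).
Variables (gbar : {measure set R -> \bar R}) (D : set R).
Hypothesis mD : measurable D.
Variables (d2 : measure_display) (T2 : measurableType d2) (U : probability T2 R).
Variable (g0 : {measure set R -> \bar R}).
Hypotheses (g0E : forall A, measurable A -> A `<=` D -> g0 A = gbar A)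
  (g0D : g0 (~` D) = 0%E).

Lemma integral_restricted (G : R -> \bar R) : (forall x, ~ D x -> G x = 0%E) ->
  (\int[gbar]_x G x = \int[g0]_x G x)%E.
Proof.
move=> G0; have -> : G = G \_ D.
  by apply/funext => x; rewrite patchE; case: ifPn => // /negP; rewrite inE => /G0.
rewrite -!integral_mkcond; apply: eq_measure_integral => A mA AD.
exact: esym (g0E mA AD).
Qed.

(** [gbar] may fail to be sigma-finite, so Tonelli's theorem is out of reach for its product with
    [U]. The two products are compared on measurable sets, where each is by definition the integral
    of the measures of the sections. *)
Lemma prod_restricted (f : R * T2 -> \bar R) (N : set R) : measurable_fun setT f ->
  measurable N -> gbar N = 0%E ->
  (forall z, ~ D z.1 -> ~ N z.1 -> f z = 0%E) ->
  (\int[(gbar \x U)%E]_z f z = \int[(g0 \x U)%E]_z f z)%E.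
Proof.
move=> mf mN N0 f0; pose E : set (R * T2) := D `*` setT.
have mE : measurable E by exact: measurableX.
have mfE : measurable_fun setT (f \_ E).
  by apply/(measurable_restrictT _ _).1 => //; exact: measurable_funTS.
have xN (m : {measure set R -> \bar R}) (B : set R) : measurable B -> m B = 0%E ->
    (m \x U)%E (B `*` setT) = 0%E.
  by move=> mB B0; rewrite product_measure1E// B0 mul0e.
transitivity (\int[(gbar \x U)%E]_z (f \_ E) z)%E.
  apply: ae_eq_integral => //; exists (N `*` setT); split.
  - exact: measurableX.
  - exact: xN.
  - move=> z /= h; split => //; apply: contrapT => nN; apply: h => _.
    by rewrite patchE; case: ifPn => // /negP; rewrite inE => nE; apply: f0 => // Dz; apply: nE.
transitivity (\int[(g0 \x U)%E]_z (f \_ E) z)%E; last first.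
  apply/esym/ae_eq_integral => //; exists ((~` D) `*` setT); split.
  - by apply: measurableX => //; exact: measurableC.
  - by apply: xN => //; exact: measurableC.
  - move=> z /= h; split => //= Dz; apply: h => _.
    by rewrite patchE mem_set.
rewrite -!integral_mkcond; apply: eq_measure_integral => A mA AE.
rewrite /product_measure1; apply: integral_restricted => x nDx /=.
rewrite (_ : xsection A x = set0) ?measure0//; apply/seteqP; split => // y.
by rewrite /xsection /= inE => /AE[].
Qed.

End angular_restriction.

Section collision_mean.
Context (R : realType) (n : nat) (r : R).
Local Notation V := 'rV[R]_n.
Local Notation U := (uniform_ball R n).
Hypotheses (n1 : (1 < n)%N) (r0 : 0 < r) (r1 : r < 1).

(* Only the angles in ]0, pi[ matter, the post-collisional velocities being
   those before collision for the angle pi. *)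
Definition tau (theta : R) : R := if (0 < theta) && (theta < pi) then theta else pi / 2.

Lemma tauE theta : 0 < theta -> theta < pi -> tau theta = theta.
Proof. by rewrite /tau => -> ->. Qed.

(** The default [pi / 2] lies in the open interval, so that the estimates at a fixed angle hold for
    every parameter and not only almost everywhere. *)
Lemma tau_itv theta : 0 < tau theta /\ tau theta < pi.
Proof.
rewrite /tau; case: ifPn => [/andP[]//|_]; have p0 := pi_gt0 R.
by split; [rewrite divr_gt0|rewrite ltr_pdivrMr// ltr_pMr// ltr1n].
Qed.

Lemma tau_sin theta : 0 < sin (tau theta / 2).
Proof.
have [t0 tpi] := tau_itv theta; apply: sin_gt0_pi; rewrite divr_gt0//=.
by apply: lt_trans tpi; rewrite ltr_pdivrMr// ltr_pMr// ltr1n.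
Qed.

Lemma tau_cos theta : 0 < cos (tau theta / 2).
Proof.
have [t0 tpi] := tau_itv theta; apply: cos_gt0_pihalf; apply/andP; split.
  by apply: (@lt_trans _ _ 0); [rewrite oppr_lt0 divr_gt0// pi_gt0|rewrite divr_gt0].
by rewrite ltr_pM2r// invr_gt0.
Qed.

Lemma measurable_tau : measurable_fun setT tau.
Proof.
apply: measurable_fun_ifT => //.
by apply: measurable_and; exact: measurable_fun_ltr.
Qed.

Lemma jump_pi psi (xi v w x : V) : jump psi xi v w pi x = 0.
Proof.
rewrite /jump out1E out2E /cone_point cospi sinpi scale0r addr0 scaleN1r scalerN.
have -> : (enorm (v - w) / 2) *: unitv (v - w) = 2^-1 *: (v - w).
  by rewrite [in RHS](unitvE (v - w)) [in RHS]scalerA mulrC.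
have -> : 2^-1 *: (v + w) - 2^-1 *: (v - w) = w by apply/rowP => i; rewrite !mxE; field.
have -> : 2^-1 *: (v + w) - - (2^-1 *: (v - w)) = v by apply/rowP => i; rewrite !mxE; field.
by ring.
Qed.

Variables (gbar : {measure set R -> \bar R}) (k : R).
Local Notation D := (`]0%R, pi[%classic : set R).
Hypotheses (gbar_supp : gbar (~` `]0, pi]) = 0%E) (k_ge0 : 0 <= k)
  (gbar_k : (\int[gbar]_(theta in `]0%R, pi])
     (sin (theta / 2) `^ r + cos (theta / 2) `^ r - 1)%:E <= k%:E)%E).
Let mD : measurable D. Proof. exact: measurable_itv. Qed.
Local Notation exc := (excess r tau).

Let mexc : measurable_fun setT exc.
Proof. exact: measurable_excess measurable_tau. Qed.

Let rho_exc theta : 0 < rho r (tau theta) /\ rho r (tau theta) <= 4 * exc theta.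
Proof. split; first exact: rho_gt0 tau_sin tau_cos _.
apply: min_powR_sc => //; [exact: tau_sin|exact: tau_cos|].
by rewrite addrC cos2Dsin2. Qed.

Let exc_gt0 theta : 0 < exc theta.
Proof. by have [h1 h2] := rho_exc theta; have := lt_le_trans h1 h2; rewrite pmulr_rgt0. Qed.

Let restr_exc (g0 : {measure set R -> \bar R}) :
  (forall A, measurable A -> A `<=` D -> g0 A = gbar A) -> g0 (~` D) = 0%E ->
  (\int[g0]_theta (exc theta)%:E <= k%:E)%E.
Proof.
move=> g0E g0D; apply: le_trans gbar_k.
have mexcD : measurable_fun setT ((EFin \o exc) \_ D).
  by apply/(measurable_restrictT _ _).1 => //; apply: measurable_funTS; exact/measurable_EFinP.
have -> : (\int[g0]_theta (exc theta)%:E = \int[g0]_theta ((EFin \o exc) \_ D) theta)%E.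
  apply: ae_eq_integral => //; first exact/measurable_EFinP.
  exists (~` D); split => //; first exact: measurableC.
  by move=> z /= h Dz; apply: h => _; rewrite patchE mem_set.
rewrite -(integral_restricted (gbar := gbar) (D := D) g0E); last first.
  by move=> x nDx; rewrite patchE memNset.
rewrite [leRHS]integral_mkcond; apply: ge0_le_integralT => //.
- apply/(measurable_restrictT _ _).1; first exact: measurable_itv.
  apply: measurable_funTS; apply/measurable_EFinP.
  have mh (f : R -> R) : continuous f -> measurable_fun setT (fun t : R => f (t / 2) `^ r).
    move=> cf; apply: (measurableT_comp (measurable_powR _)).
    by apply: (measurableT_comp (continuous_measurable_fun cf)); exact: measurable_funM.
  apply: measurable_funB => //; apply: measurable_funD.
    exact: mh (@continuous_sin R).
  exact: mh (@continuous_cos R).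
- by move=> x; rewrite patchE; case: ifPn => // _; rewrite lee_fin ltW.
move=> x; rewrite !patchE; case: ifPn => [|nD].
  rewrite inE /= in_itv/= => /andP[x0 xpi]; rewrite mem_set/= ?in_itv/= ?x0 ?(ltW xpi)//.
  by rewrite /excess tauE.
case: ifPn => // xi; have {xi nD} -> : x = pi.
  move: nD xi; rewrite notin_setE inE /= !in_itv/= => /negP; rewrite negb_and => h /andP[x0 xp].
  by move: h; rewrite x0/= -leNgt => h; apply/eqP; rewrite eq_le xp h.
by rewrite sin_pihalf cos_pihalf powR1 powR0 ?gt_eqF// addr0 subrr.
Qed.

(** The excess is positive with a finite integral on the open interval, so its superlevel sets have
    finite measure by Markov's inequality and the restriction is sigma-finite. The point [pi], where
    the excess vanishes, may carry infinite mass. *)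
Lemma angular_measure : exists g0 : {sigma_finite_measure set R -> \bar R},
  [/\ forall A, measurable A -> A `<=` D -> g0 A = gbar A,
      g0 (~` D) = 0%E,
      (\int[g0]_theta (exc theta)%:E <= k%:E)%E
    & (g0 setT <= gbar setT)%E].
Proof.
pose m : {measure set R -> \bar R} := mrestr gbar mD.
have mE A : measurable A -> A `<=` D -> m A = gbar A.
  by move=> mA AD; rewrite /m/= /mrestr setIidl.
have mD0 : m (~` D) = 0%E by rewrite /m/= /mrestr setICl measure0.
have hk := restr_exc mE mD0.
have sf : sigma_finite setT m.
  pose F j := [set theta : R | (j.+1%:R^-1 : R) <= exc theta].
  have mF j : measurable (F j).
    rewrite (_ : F j = setT `&` exc @^-1` `[j.+1%:R^-1, +oo[).
      exact: mexc.
    by rewrite setTI; apply/seteqP; split => x /=; rewrite in_itv/= andbT.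
  exists F.
    apply/seteqP; split => // theta _.
    near \oo => j; exists j => //=; apply: ltW; near: j.
    exact: near_infty_natSinv_lt (PosNum (exc_gt0 theta)).
  move=> j; split; first exact: mF.
  rewrite -[X in m X]setIT -integral_indic//.
  apply: (@le_lt_trans _ _ (\int[m]_theta (j.+1%:R%:E * (exc theta)%:E))%E).
    apply: ge0_le_integralT.
    - by apply/measurable_EFinP; exact: measurable_indic.
    - by apply: measurable_funeM; exact/measurable_EFinP.
    - by move=> x; rewrite lee_fin.
    - move=> x; rewrite -EFinM lee_fin indicE.
      case h : (x \in F j); last by rewrite mulr_ge0// ltW.
      have : F j x by exact: set_mem h.
      by rewrite /F /= -[leLHS]mul1r ler_pdivrMr// mulrC.
  rewrite ge0_integralZl//; first last.
  - by move=> x _; rewrite lee_fin ltW.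
  - exact/measurable_EFinP.
  apply: (@le_lt_trans _ _ (j.+1%:R%:E * k%:E)%E); first exact: lee_wpmul2l.
  by rewrite -EFinM ltry.
exists (sfm sf); split => //.
by apply: le_measure; rewrite ?inE//; exact: measurableI.
Unshelve. all: by end_near.
Qed.

Section with_angular.
Variable g0 : {sigma_finite_measure set R -> \bar R}.
Hypotheses (g0E : forall A, measurable A -> A `<=` D -> g0 A = gbar A)
  (g0D : g0 (~` D) = 0%E) (g0k : (\int[g0]_theta (exc theta)%:E <= k%:E)%E).

Lemma collision_rate_jump (M : collision_model R) psi (xi v w : V) :
  maxwellian M gbar -> trig psi ->
  \int[collision_rate M v w]_p (- psi (dotv xi v) - psi (dotv xi w)
    + psi (dotv xi p.1) + psi (dotv xi p.2)) =
  \int[g0]_theta mean_jump psi xi v w (tau theta).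
Proof.
move=> hM tp; have [p1 _ mp] := tp.
pose J (p : V * V) := - psi (dotv xi v) - psi (dotv xi w) + psi (dotv xi p.1) + psi (dotv xi p.2).
have mJ : measurable_fun setT J.
  have md (f : V * V -> V) : measurable_fun setT f -> measurable_fun setT (fun p => psi (dotv xi (f p))).
    by move=> mf; apply: measurableT_comp => //; exact: measurable_dotv.
  by apply: measurable_funD; [apply: measurable_funD => //|]; apply: md.
rewrite /Rintegral integral_pushforward_measure; last exact/measurable_EFinP.
(* The Maxwellian assumption says nothing about the angular measure at relative speed 0, but there
   the jump vanishes. *)
have [->|vw] := eqVneq v w.
  have e1 (m : {measure set (R * V)%type -> \bar R}) : (\int[m]_z
      (- psi (dotv xi w) - psi (dotv xi w) + psi (dotv xi (post_collision w w z).1)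
       + psi (dotv xi (post_collision w w z).2))%R%:E = 0)%E.
    apply: integral0_eq => z _; congr (_%:E).
    by have := jump_same psi xi w z.1 z.2; rewrite /jump /out1 /out2 -surjective_pairing.
  have e2 : (\int[g0]_theta (mean_jump psi xi w w (tau theta))%:E = 0)%E.
    by apply: integral0_eq => theta _; rewrite mean_jump_same.
  by rewrite e2; congr fine; exact: e1.
rewrite hM; last by rewrite enorm_gt0 subr_eq0.
pose f (z : R * V) : \bar R := (J (post_collision v w z))%:E.
have mf : measurable_fun setT f.
  by apply/measurable_EFinP; apply: (measurableT_comp mJ); exact: measurable_post_collision.
have fJ theta x : f (theta, x) = (jump psi xi v w theta x)%:E by [].
rewrite -[X in fine X]/(\int[(gbar \x U)%E]_z f z)%E.
(* The discarded angles contribute nothing: the jump vanishes at [pi], and the complement of []0,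
   pi]] is null for [gbar]. *)
rewrite (prod_restricted mD U g0E g0D mf (N := ~` `]0, pi]))//; first last.
- move=> [theta x] /= nD nN; have -> : theta = pi.
    move: nD nN; rewrite /= !in_itv/= => h /contrapT /andP[t0 tpi].
    by apply/eqP; rewrite eq_le tpi leNgt; apply/negP => tp'; apply: h; rewrite t0.
  by rewrite fJ jump_pi.
- by apply: measurableC; exact: measurable_itv.
pose c := 4 * (enorm xi `^ r * enorm (v - w) `^ r).
pose F (z : R * V) := jump psi xi v w (tau z.1) z.2.
have mF : measurable_fun setT F.
  by apply: measurable_jump => //; apply: measurableT_comp => //; exact: measurable_tau.
have -> : (\int[(g0 \x U)%E]_z f z = \int[(g0 \x U)%E]_z (F z)%:E)%E.
  apply: ae_eq_integral => //; first exact/measurable_EFinP.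
  exists ((~` D) `*` setT); split.
  - by apply: measurableX => //; exact: measurableC.
  - have mDC : measurable (~` D) by exact: measurableC.
    transitivity (g0 (~` D) * U setT)%E; first exact: product_measure1E.
    by rewrite g0D mul0e.
  - move=> [theta x] /= h; split => //= Dt; apply: h => _; rewrite fJ /F /=.
    by move: Dt; rewrite in_itv/= => /andP[t0 tpi]; rewrite tauE.
have c0 : 0 <= c by rewrite !mulr_ge0 ?powR_ge0.
have mrho : measurable_fun setT (fun theta => rho r (tau theta)).
  have mh : measurable_fun setT (fun theta : R => tau theta / 2).
    by apply: measurable_funM => //; exact: measurable_tau.
  apply: (measurableT_comp (measurable_powR _)); apply: measurable_minr.
    exact: (measurableT_comp (continuous_measurable_fun (@continuous_sin R)) mh).
  exact: (measurableT_comp (continuous_measurable_fun (@continuous_cos R)) mh).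
have mnF : measurable_fun setT (fun z => `|F z|%:E).
  by apply/measurable_EFinP; exact: measurableT_comp.
have iF : (g0 \x U)%E.-integrable setT (EFin \o F).
  apply/integrableP; split; first exact/measurable_EFinP.
  rewrite (tonelli_prod g0 U (f := fun z => `|F z|%:E) mnF)//.
  apply: (@le_lt_trans _ _ (\int[g0]_theta ((4 * c)%:E * (exc theta)%:E))%E).
    apply: ge0_le_integralT.
    - exact: (measurable_integral_snd U mnF).
    - by apply: measurable_funeM; exact/measurable_EFinP.
    - by move=> theta; apply: integral_ge0.
    move=> theta; apply: (@le_trans _ _ (\int[U]_x cst (c * rho r (tau theta))%:E x)%E).
      apply: ae_ge0_le_integral => //.
      - exact: (measurableT_comp mnF (measurable_pair1 theta)).
      - by move=> x _; rewrite lee_fin mulr_ge0// rho_ge0.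
      have [A [mA A0 hA]] := ae_good v w (tau theta) n1.
      exists A; split => // x nx; apply: hA => g; apply: nx => _; rewrite lee_fin.
      apply: le_trans (jump_bound r0 r1 (tau_sin theta) (tau_cos theta) xi tp g) _.
      by rewrite le_eqVlt; apply/orP; left; apply/eqP; rewrite /c; ring.
    rewrite (integral_prob_cst U) -EFinM lee_fin.
    have -> : 4 * c * exc theta = c * (4 * exc theta) by ring.
    rewrite ler_wpM2l//.
    by have [] := rho_exc theta.
  rewrite ge0_integralZlT; first last.
  - by rewrite lee_fin mulr_ge0.
  - by move=> theta; rewrite lee_fin ltW.
  - exact/measurable_EFinP.
  apply: (@le_lt_trans _ _ ((4 * c)%:E * k%:E)%E).
    by apply: lee_wpmul2l => //; rewrite lee_fin mulr_ge0.
  by rewrite -EFinM ltry.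
by have := rfubini1 iF; rewrite /Rintegral => <-.
Qed.

Variable mu : probability V R.
Hypothesis mu_moment : rmoment r mu.

Let tau_s (theta : R) := tau_sin theta.
Let tau_c (theta : R) := tau_cos theta.

Lemma Qtest_qform (M : collision_model R) (nu : {charge set V -> \bar R}) psi (xi : V) :
  maxwellian M gbar -> trig psi -> zero_mass r nu ->
  Qtest M mu nu (fun x => psi (dotv xi x)) =
  2^-1 * (qform g0 tau (prodm mu (jordan_pos (hahn_posnegP nu))) psi xi
        - qform g0 tau (prodm mu (jordan_neg (hahn_posnegP nu))) psi xi).
Proof.
move=> hM tp [_ hm]; rewrite /Qtest; congr (_ * _).
set jp := jordan_pos _ in hm *; set jn := jordan_neg _ in hm *.
have ge0m (m : {measure set V -> \bar R}) : (0 <= \int[m]_v (enorm v `^ r)%:E)%E.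
  by apply: integral_ge0 => v _; rewrite lee_fin powR_ge0.
have hp : rmoment r jp by apply: le_lt_trans hm; apply: leeDl; exact: ge0m.
have hn : rmoment r jn by apply: le_lt_trans hm; apply: leeDr; exact: ge0m.
have [Mp Mp0 hMp] := pair_moment_bound r0 r1 mu_moment hp.
have [Mn Mn0 hMn] := pair_moment_bound r0 r1 mu_moment hn.
have rb := rho_bound r0 r1 measurable_tau tau_s tau_c g0k.
have a0 : 0 < 4 * k + 1 by rewrite ltr_wpDl// mulr_ge0.
have jp' := int_angular_jump n1 r0 r1 measurable_tau tau_s tau_c a0 rb hMp xi tp.
have jn' := int_angular_jump n1 r0 r1 measurable_tau tau_s tau_c a0 rb hMn xi tp.
have ip := rint_fubini1 (rint_fubini1 jp'); have iN := rint_fubini1 (rint_fubini1 jn').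
rewrite -(qform_iterated n1 r0 r1 measurable_tau tau_s tau_c a0 rb xi tp hMp).
rewrite -(qform_iterated n1 r0 r1 measurable_tau tau_s tau_c a0 rb xi tp hMn).
rewrite -(rintegralB ip iN); apply: eq_Rintegral => v _; rewrite /charge_Rintegral.
by congr (_ - _); apply: eq_Rintegral => w _; exact: collision_rate_jump.
Qed.

End with_angular.
End collision_mean.

(** * The weighted L2 space *)

Section weighted_L2.
Context (R : realType) (n : nat) (s : R).
Local Notation V := 'rV[R]_n.
Local Notation C := R[i].
Local Notation W := (weight s).
Local Notation L := (lebV R n).
Implicit Types (F G : V -> C).

Definition sqn F xi : R := complex.Re (F xi) ^+ 2 + complex.Im (F xi) ^+ 2.
Definition wnorm F : R := \int[L]_xi (W xi * sqn F xi).

Lemma sqn_ge0 F xi : 0 <= sqn F xi.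
Proof. by rewrite addr_ge0 ?sqr_ge0. Qed.

Lemma wnorm_ge0 F : 0 <= wnorm F.
Proof. by apply: Rintegral_ge0 => xi _; rewrite mulr_ge0 ?weight_ge0 ?sqn_ge0. Qed.

Lemma hnorm2_lebV F : hnorm2 s F = (\int[L]_xi (W xi * sqn F xi)%:E)%E.
Proof.
rewrite /hnorm2 integral_lebVE; apply: eq_integral => xi _.
by rewrite mulrC.
Qed.

Lemma ReB (a b : C) : complex.Re (a - b) = complex.Re a - complex.Re b.
Proof. by case: a; case: b. Qed.

Lemma ImB (a b : C) : complex.Im (a - b) = complex.Im a - complex.Im b.
Proof. by case: a; case: b. Qed.

Lemma measurable_sqn F : measurable_fun setT (fun xi => complex.Re (F xi)) ->
  measurable_fun setT (fun xi => complex.Im (F xi)) ->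
  measurable_fun setT (fun xi => W xi * sqn F xi).
Proof.
move=> mR mI; apply: measurable_funM; first exact: measurable_weight.
by apply: measurable_funD; exact: measurable_funX.
Qed.

Lemma weighted_L2_int F : weighted_L2 s F ->
  L.-integrable setT (EFin \o (fun xi => W xi * sqn F xi)).
Proof.
move=> [mR mI fin]; apply: rint_ge0.
- exact: measurable_sqn.
- by move=> xi; rewrite mulr_ge0 ?weight_ge0 ?sqn_ge0.
- by rewrite -hnorm2_lebV.
Qed.

Lemma hnorm2E F : weighted_L2 s F -> hnorm2 s F = (wnorm F)%:E.
Proof. by move=> hF; rewrite hnorm2_lebV EFin_Rintegral//; exact: weighted_L2_int. Qed.

Lemma weighted_L2_intP F : measurable_fun setT (fun xi => complex.Re (F xi)) ->
  measurable_fun setT (fun xi => complex.Im (F xi)) ->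
  L.-integrable setT (EFin \o (fun xi => W xi * sqn F xi)) -> weighted_L2 s F.
Proof.
move=> mR mI iF; split => //; rewrite hnorm2_lebV -(EFin_Rintegral iF).
by rewrite ltry.
Qed.

Lemma sqnB_le F G xi : sqn (fun xi => F xi - G xi) xi <= 2 * (sqn F xi + sqn G xi).
Proof.
rewrite /sqn ReB ImB; move: (complex.Re _) (complex.Im _) (complex.Re _) (complex.Im _) => a b c d.
rewrite -subr_ge0 [X in 0 <= X](_ : _ = (a + c) ^+ 2 + (b + d) ^+ 2); last by ring.
by rewrite addr_ge0 ?sqr_ge0.
Qed.

Lemma weighted_L2B F G : weighted_L2 s F -> weighted_L2 s G ->
  weighted_L2 s (fun xi => F xi - G xi).
Proof.
move=> hF hG; have [mF1 mF2 _] := hF; have [mG1 mG2 _] := hG.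
have m1 : measurable_fun setT (fun xi => complex.Re (F xi - G xi)).
  by under eq_fun do rewrite ReB; exact: measurable_funB.
have m2 : measurable_fun setT (fun xi => complex.Im (F xi - G xi)).
  by under eq_fun do rewrite ImB; exact: measurable_funB.
apply: weighted_L2_intP => //.
apply: (rint_le _ _ (rintZ 2 (rintD (weighted_L2_int hF) (weighted_L2_int hG)))).
  exact: measurable_sqn.
move=> xi; rewrite ger0_norm; last by rewrite mulr_ge0 ?weight_ge0 ?sqn_ge0.
by rewrite -mulrDr mulrCA; apply: ler_wpM2l; [exact: weight_ge0|exact: sqnB_le].
Qed.

Lemma wnormB_le F G : weighted_L2 s F -> weighted_L2 s G ->
  wnorm (fun xi => F xi - G xi) <= 2 * (wnorm F + wnorm G).
Proof.
move=> hF hG; have iF := weighted_L2_int hF; have iG := weighted_L2_int hG.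
rewrite /wnorm -(rintegralD iF iG) -(rintegralZ 2 (rintD iF iG)).
apply: (rintegral_le (weighted_L2_int (weighted_L2B hF hG)) (rintZ 2 (rintD iF iG))) => xi.
by rewrite -mulrDr mulrCA; apply: ler_wpM2l; [exact: weight_ge0|exact: sqnB_le].
Qed.

Definition wdot F G xi : R :=
  complex.Re (F xi) * complex.Re (G xi) + complex.Im (F xi) * complex.Im (G xi).

Lemma wdot_int F G : weighted_L2 s F -> weighted_L2 s G ->
  L.-integrable setT (EFin \o (fun xi => W xi * wdot F G xi)).
Proof.
move=> hF hG; have [mF1 mF2 _] := hF; have [mG1 mG2 _] := hG.
apply: (rint_le _ _ (rintD (weighted_L2_int hF) (weighted_L2_int hG))).
  apply: measurable_funM; first exact: measurable_weight.
  by apply: measurable_funD; exact: measurable_funM.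
move=> xi; rewrite normrM ger0_norm ?weight_ge0// -mulrDr.
apply: ler_wpM2l; first exact: weight_ge0.
apply: le_trans (ler_normD _ _) _; rewrite /sqn addrACA.
by apply: lerD; exact: normM_le_sqr.
Qed.

Lemma Re_hdot2 F G : weighted_L2 s F -> weighted_L2 s G ->
  complex.Re (hdot s (fun xi => 2 * G xi) F) = 2 * \int[L]_xi (W xi * wdot G F xi).
Proof.
move=> hF hG; rewrite /hdot /= -(rintegralZ 2 (wdot_int hG hF)).
rewrite /Rintegral integral_lebVE; congr fine; apply: eq_integral => xi _; congr (_%:E).
rewrite /wdot /weight; case: (F xi) (G xi) => a b [c d] /=.
by ring.
Qed.

Lemma hcvg_wnorm (Fk : nat -> V -> C) F : (forall k, weighted_L2 s (Fk k)) -> weighted_L2 s F ->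
  hcvg s Fk F <-> (wnorm (fun xi => Fk k xi - F xi) @[k --> \oo] --> 0).
Proof.
move=> hk hF; rewrite /hcvg.
have -> : (fun k => hnorm2 s (fun xi => Fk k xi - F xi)) =
    EFin \o (fun k => wnorm (fun xi => Fk k xi - F xi)).
  by apply/funext => k /=; rewrite hnorm2E//; exact: weighted_L2B.
split => [/fine_cvgP[_ h]|h]; first exact: h.
by apply: cvg_EFin => //; exact: nearW.
Qed.

(** The difference of the two sides is a sum of squares. Only the approximation errors [(q - g)^2]
    and [(p - f)^2] carry [1/e]; the squares of the limits carry [e]. *)
Lemma wdot_perturb (e g q p f : R) : 0 < e ->
  2 * (g * f) <= 2 * (q * p) + ((e^-1 + 1) * (q - g) ^+ 2 + (e^-1 + 1) * (p - f) ^+ 2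
    + (e * f ^+ 2 + e * g ^+ 2)).
Proof.
move=> e0; rewrite -subr_ge0 [X in 0 <= X](_ : _ =
  e^-1 * ((e * g + (p - f)) ^+ 2 + (e * f + (q - g)) ^+ 2) + ((q - g) + (p - f)) ^+ 2); last first.
  by field; rewrite gt_eqF.
by rewrite addr_ge0 ?sqr_ge0// mulr_ge0 ?invr_ge0 ?(ltW e0)// addr_ge0 ?sqr_ge0.
Qed.

Lemma sqr_perturb (e p f : R) : 0 < e ->
  p ^+ 2 <= (1 + e) * f ^+ 2 + (1 + e^-1) * (p - f) ^+ 2.
Proof.
move=> e0; rewrite -subr_ge0 [X in 0 <= X](_ : _ = e^-1 * (e * f - (p - f)) ^+ 2); last first.
  by field; rewrite gt_eqF.
by rewrite mulr_ge0 ?invr_ge0 ?(ltW e0)// sqr_ge0.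
Qed.

(** The inequality passes to the limit through the quadratic perturbation bounds: an approximation
    within [e^2] in squared norm absorbs the factor [1/e] and leaves an error [e A]. *)
Lemma limit_dissipation (Fk Qk : nat -> V -> C) F G (K : R) : 0 <= K ->
  (forall k, weighted_L2 s (Fk k)) -> weighted_L2 s F ->
  (forall k, weighted_L2 s (Qk k)) -> weighted_L2 s G ->
  hcvg s Fk F -> hcvg s Qk G ->
  (forall k, 2 * \int[L]_xi (W xi * wdot (Qk k) (Fk k) xi) <= K * wnorm (Fk k)) ->
  2 * \int[L]_xi (W xi * wdot G F xi) <= K * wnorm F.
Proof.
move=> K0 hFk hF hQk hG /(hcvg_wnorm hFk hF) cF /(hcvg_wnorm hQk hG) cQ hd.
(* [K wnorm F + 2 K] comes from [sqr_perturb], 4 from the two squared errors in [wdot_perturb], the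
   rest from its terms [e f^2 + e g^2]. *)
pose A := (K * wnorm F + 2 * K) + (4 + wnorm F + wnorm G).
have A1 : 0 < A.
  have := wnorm_ge0 F; have := wnorm_ge0 G; have := mulr_ge0 K0 (wnorm_ge0 F); rewrite /A.
  by move: (wnorm F) (wnorm G) (K * wnorm F) K0 => x y z ? ? ? ?; lra.
apply/ler_addgt0Pr => e' e'0.
pose e := Num.min 1 (e' / A).
have e0 : 0 < e by rewrite lt_min ltr01 divr_gt0.
have e1 : e <= 1 by rewrite ge_min lexx.
have eA : e * A <= e' by rewrite -ler_pdivlMr// ge_min lexx orbT.
have ee0 : 0 < e ^+ 2 by rewrite exprn_gt0.
have /cvgrPdist_le /(_ _ ee0) [N1 _ h1] := cF; have /cvgrPdist_le /(_ _ ee0) [N2 _ h2] := cQ.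
pose j := maxn N1 N2.
have {h1} h1 : wnorm (fun xi => Fk j xi - F xi) <= e ^+ 2.
  have := h1 j (leq_maxl _ _); rewrite sub0r normrN ger0_norm//; exact: wnorm_ge0.
have {h2} h2 : wnorm (fun xi => Qk j xi - G xi) <= e ^+ 2.
  have := h2 j (leq_maxr _ _); rewrite sub0r normrN ger0_norm//; exact: wnorm_ge0.
have iFd := weighted_L2_int (weighted_L2B (hFk j) hF).
have iQd := weighted_L2_int (weighted_L2B (hQk j) hG).
have iF := weighted_L2_int hF; have iG := weighted_L2_int hG; have iFj := weighted_L2_int (hFk j).
have id := wdot_int (hQk j) (hFk j).
have B1 : 2 * \int[L]_xi (W xi * wdot G F xi) <= 2 * \int[L]_xi (W xi * wdot (Qk j) (Fk j) xi)
    + ((e^-1 + 1) * wnorm (fun xi => Qk j xi - G xi) + (e^-1 + 1) * wnorm (fun xi => Fk j xi - F xi)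
       + (e * wnorm F + e * wnorm G)).
  have k1 := rintZ 2 id; have k2 := rintZ (e^-1 + 1) iQd; have k3 := rintZ (e^-1 + 1) iFd.
  have k4 := rintZ e iF; have k5 := rintZ e iG.
  have k23 := rintD k2 k3; have k45 := rintD k4 k5; have k6 := rintD k23 k45.
  have i2 := wdot_int hG hF.
  rewrite /wnorm -(rintegralZ 2 i2) -(rintegralZ 2 id) -(rintegralZ _ iQd) -(rintegralZ _ iFd).
  rewrite -(rintegralZ _ iF) -(rintegralZ _ iG) -(rintegralD k2 k3) -(rintegralD k4 k5).
  rewrite -(rintegralD k23 k45) -(rintegralD k1 k6).
  apply: (rintegral_le (rintZ 2 i2) (rintD k1 k6)) => xi.
  rewrite !(mulrCA _ (W xi)) -!mulrDr; apply: ler_wpM2l; first exact: weight_ge0.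
  rewrite /wdot /sqn !ReB !ImB.
  move: (complex.Re (F xi)) (complex.Im (F xi)) (complex.Re (G xi)) (complex.Im (G xi)) => f f' g g'.
  move: (complex.Re (Fk j xi)) (complex.Im (Fk j xi)) (complex.Re (Qk j xi)) (complex.Im (Qk j xi)) => p p' q q'.
  apply: (le_trans _ (le_trans (lerD (wdot_perturb g q p f e0) (wdot_perturb g' q' p' f' e0)) _)).
    by rewrite mulrDr.
  by rewrite le_eqVlt; apply/orP; left; apply/eqP; ring.
have B2 : wnorm (Fk j) <= (1 + e) * wnorm F + (1 + e^-1) * wnorm (fun xi => Fk j xi - F xi).
  rewrite /wnorm -(rintegralZ _ iF) -(rintegralZ _ iFd) -(rintegralD (rintZ _ iF) (rintZ _ iFd)).
  apply: (rintegral_le iFj (rintD (rintZ _ iF) (rintZ _ iFd))) => xi.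
  rewrite !(mulrCA _ (W xi)) -!mulrDr; apply: ler_wpM2l; first exact: weight_ge0.
  rewrite /sqn !ReB !ImB.
  move: (complex.Re (F xi)) (complex.Im (F xi)) (complex.Re (Fk j xi)) (complex.Im (Fk j xi)) => f f' p p'.
  apply: (le_trans (lerD (sqr_perturb p f e0) (sqr_perturb p' f' e0))).
  by rewrite le_eqVlt; apply/orP; left; apply/eqP; ring.
have ei : e^-1 * e ^+ 2 = e by rewrite expr2 mulrA mulVf ?mul1r// gt_eqF.
have ee : e ^+ 2 <= e by rewrite expr2 ler_piMr// ltW.
have ei0 : 0 <= e^-1 by rewrite invr_ge0 ltW.
apply: (@le_trans _ _ (K * wnorm F + e * A)); last by rewrite lerD2l.
have b (x : R) : x <= e ^+ 2 -> (e^-1 + 1) * x <= 2 * e.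
  move=> hx; apply: (@le_trans _ _ ((e^-1 + 1) * e ^+ 2)).
    by apply: ler_wpM2l => //; rewrite addr_ge0.
  by rewrite mulrDl ei mul1r mulr2n mulrDl mul1r lerD2l.
have B3 := le_trans (hd j) (ler_wpM2l K0 B2).
have C1 := b _ h1; have C2 := b _ h2.
have C3 : K * ((1 + e) * wnorm F + (1 + e^-1) * wnorm (fun xi => Fk j xi - F xi)) <=
    K * ((1 + e) * wnorm F + 2 * e).
  by apply: ler_wpM2l => //; rewrite lerD2l addrC.
apply: le_trans B1 _; apply: le_trans (lerD (le_trans B3 C3) (lerD (lerD C2 C1) (lexx _))) _.
by rewrite le_eqVlt; apply/orP; left; apply/eqP; rewrite /A; ring.
Qed.

(** Subtracting [2 B 2^-j] from [u j] gives a nondecreasing sequence, and adding it gives a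
    nonincreasing one, which bounds the former. *)
Lemma geometric_increments_cvg (u : R^nat) (B : R) : 0 <= B ->
  (forall j, `|u j.+1 - u j| <= B * 2^-1 ^+ j) -> cvgn u.
Proof.
move=> B0 hu; pose v j := u j - 2 * B * 2^-1 ^+ j.
have h (j : nat) : 0 <= (2^-1 : R) ^+ j by rewrite exprn_ge0.
have vE j : v j.+1 - v j = (u j.+1 - u j) + B * 2^-1 ^+ j.
  by rewrite /v exprS; field.
have vnd : nondecreasing_seq v.
  apply/nondecreasing_seqP => j; rewrite -subr_ge0 vE.
  by have := hu j; rewrite ler_norml => /andP[]; move: (u j.+1 - u j) (B * _) => x y; lra.
have wB j : u j + 2 * B * 2^-1 ^+ j <= u 0%N + 2 * B.
  elim: j => [|j IH]; first by rewrite expr0 mulr1.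
  apply: le_trans IH; rewrite exprS; have := hu j; rewrite ler_norml => /andP[_].
  have -> : 2 * B * (2^-1 * 2^-1 ^+ j) = B * 2^-1 ^+ j by field.
  rewrite -[2 * B * _]mulrA; move: (u j.+1) (u j) (B * _) => x y z; lra.
have vub : has_ubound (range v).
  exists (u 0%N + 2 * B) => _ [j _ <-]; apply: le_trans (wB j).
  by rewrite /v lerD2l; apply: le_trans (_ : 0 <= _); rewrite ?oppr_le0 !mulr_ge0.
have cv : cvgn v := nondecreasing_is_cvgn vnd vub.
have c2 : (fun j => 2 * B * 2^-1 ^+ j) @ \oo --> (2 * B * 0 : R).
  by apply: cvgMr; apply: cvg_expr; rewrite ger0_norm// invf_lt1// ltr1n.
have -> : u = v \+ (fun j => 2 * B * 2^-1 ^+ j) by apply/funext => j; rewrite /v /= subrK.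
by apply: is_cvgD => //; apply: cvgP c2.
Qed.

(** Along a subsequence with squared increments at most [16^-j], the series of increments weighted
    by [4^j] has a finite integral. Almost everywhere it is finite, hence the increments are of
    order [2^-j] and the subsequence converges; Fatou's lemma gives convergence in norm. *)
Lemma riesz_fischer (Qk : nat -> V -> C) : (forall k, weighted_L2 s (Qk k)) ->
  (forall e, 0 < e -> exists N, forall j k, (N <= j)%N -> (N <= k)%N ->
     wnorm (fun xi => Qk j xi - Qk k xi) <= e) ->
  exists G, weighted_L2 s G /\ hcvg s Qk G.
Proof.
move=> hQ hC.
have c0 j : 0 < (16^-1 : R) ^+ j by rewrite exprn_gt0// invr_gt0.
have /choice[N hN] : forall j, exists N, forall i k, (N <= i)%N -> (N <= k)%N ->
    wnorm (fun xi => Qk i xi - Qk k xi) <= 16^-1 ^+ j by move=> j; exact: hC.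
(* A sum in place of a maximum: [M j] dominates every [N i] with [i <= j]. *)
pose M j := (\sum_(i < j.+1) N i)%N.
have NM i j : (i <= j)%N -> (N i <= M j)%N.
  move=> ij; rewrite /M (bigD1 (Ordinal (ij : (i < j.+1)%N)))//=; exact: leq_addr.
pose f j := Qk (M j).
have hf j : weighted_L2 s (f j) by exact: hQ.
pose d j xi : R := 4 ^+ j * (W xi * sqn (fun xi => f j.+1 xi - f j xi) xi).
have d0 j xi : 0 <= d j xi by rewrite mulr_ge0 ?exprn_ge0// mulr_ge0 ?weight_ge0 ?sqn_ge0.
have id j : L.-integrable setT (EFin \o d j).
  by apply: rintZ; exact: weighted_L2_int (weighted_L2B (hf j.+1) (hf j)).
have hd j : (\int[L]_xi (d j xi)%:E <= (4^-1 ^+ j)%:E)%E.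
  rewrite -(EFin_Rintegral (id j)) lee_fin.
  rewrite (rintegralZ _ (weighted_L2_int (weighted_L2B (hf j.+1) (hf j)))).
  have h : wnorm (fun xi => f j.+1 xi - f j xi) <= 16^-1 ^+ j.
    by apply: hN; apply: NM.
  have -> : (4^-1 : R) ^+ j = 4 ^+ j * 16^-1 ^+ j by rewrite -exprMn; congr (_ ^+ _); field.
  by apply: ler_wpM2l => //; rewrite exprn_ge0.
pose g xi : \bar R := (\sum_(j <oo) (d j xi)%:E)%E.
have md j : measurable_fun setT (fun xi => (d j xi)%:E).
  by apply/measurable_EFinP; exact: rint_measurable (id j).
have g0 xi : (0 <= g xi)%E by apply: nneseries_ge0 => j _ _; rewrite lee_fin.
have gfin : (\int[L]_xi g xi < +oo)%E.
  rewrite integral_nneseries//; last by move=> j xi _; rewrite lee_fin.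
  apply: (@le_lt_trans _ _ 2%:E); last by rewrite ltry.
  apply: lime_le.
    by apply: is_cvg_nneseries => j _ _; apply: integral_ge0 => xi _; rewrite lee_fin.
  apply: nearW => m; apply: (@le_trans _ _ (\sum_(0 <= j < m) (2^-1 ^+ j)%:E)%E).
    apply: lee_sum => j _; apply: le_trans (hd j) _; rewrite lee_fin.
    by apply: lerXn2r; rewrite ?nnegrE// ler_pV2 ?inE ?unitfE ?gt_eqF//= ler_nat.
  rewrite sumEFin lee_fin.
  have -> : \sum_(0 <= j < m) (2^-1 : R) ^+ j = 2 - 2 * 2^-1 ^+ m.
    elim: m => [|m IH]; first by rewrite big_nil expr0; ring.
    by rewrite big_nat_recr//= IH exprS; field.
  by rewrite gerBl mulr_ge0// exprn_ge0.
have mg : measurable_fun setT g.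
  by apply: ge0_emeasurable_sum => // j xi _ _; rewrite lee_fin.
have gae : {ae L, forall xi, g xi \is a fin_num}.
  have ig : L.-integrable setT g.
    apply/integrableP; split => //.
    by under eq_integral do rewrite gee0_abs//.
  have [A [mA A0 hA]] := integrable_ae measurableT ig.
  by exists A; split => // xi h; apply: hA => h'; apply: h; exact: h'.
(* The condition [0 < W xi] excludes the origin, where the weight gives no control; the limit is set
   to 0 off [E]. *)
pose E := [set xi | g xi \is a fin_num /\ 0 < W xi].
have mE : measurable E.
  rewrite /E (_ : [set _ | _] = [set xi | g xi \is a fin_num] `&` [set xi | 0 < W xi])//.
  apply: measurableI.
    by have := emeasurable_fin_num measurableT mg; rewrite setTI.
  rewrite (_ : [set xi | 0 < W xi] = setT `&` W @^-1` [set` `]0, +oo[]).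
    by apply: measurable_weight => //; exact: measurable_itv.
  by rewrite setTI; apply/seteqP; split => xi /=; rewrite in_itv/= andbT.
have ce xi : E xi -> forall (phi : C -> R), (forall a b, phi (a - b) = phi a - phi b) ->
    (forall a, phi a ^+ 2 <= complex.Re a ^+ 2 + complex.Im a ^+ 2) -> cvgn (fun j => phi (f j xi)).
  move=> [gf W0] phi phiB phile.
  (* The added 1 gives [B <= B^2], so that the bound on squares yields one on the increments. *)
  pose B := fine (g xi) / W xi + 1.
  have B0 : 0 <= fine (g xi) / W xi by rewrite divr_ge0 ?fine_ge0// ltW.
  have B1 : 1 <= B by rewrite lerDr.
  apply: (@geometric_increments_cvg _ B); first exact: le_trans B1.
  move=> j; rewrite -phiB -(ler_pXn2r (n := 2))// ?nnegrE ?mulr_ge0 ?exprn_ge0 ?(le_trans _ B1)//.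
  rewrite real_normK ?num_real//; apply: le_trans (phile _) _.
  have hdj : d j xi <= fine (g xi).
    rewrite -lee_fin fineK//.
    apply: le_trans (nneseries_lim_ge (m := 0) (P := xpredT) j.+1 _); last by move=> i _ _; rewrite lee_fin.
    rewrite big_nat_recr//=; apply: leeDr; apply: sume_ge0 => i _; by rewrite lee_fin.
  have : sqn (fun xi => f j.+1 xi - f j xi) xi <= fine (g xi) / W xi * 4^-1 ^+ j.
    rewrite -ler_pdivrMr ?exprn_gt0 ?invr_gt0// ler_pdivlMr//.
    by apply: le_trans hdj; rewrite /d exprVn invrK le_eqVlt; apply/orP; left; apply/eqP; ring.
  move=> /le_trans; apply; rewrite exprMn.
  have -> : (4^-1 : R) ^+ j = (2^-1 ^+ j) ^+ 2.
    by rewrite -exprM mulnC exprM; congr (_ ^+ _); field.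
  apply: ler_wpM2r; first by rewrite sqr_ge0.
  apply: (@le_trans _ _ B); first by rewrite lerDl.
  by rewrite expr2 ler_peMl// (le_trans _ B1).
pose lR xi := if xi \in E then limn (fun j => complex.Re (f j xi)) else 0.
pose lI xi := if xi \in E then limn (fun j => complex.Im (f j xi)) else 0.
pose G xi : C := (lR xi +i* lI xi)%C.
have cR xi : E xi -> (fun j => complex.Re (f j xi)) @ \oo --> complex.Re (G xi).
  move=> Exi; rewrite /= /lR mem_set//; apply: ce => // [a b|a]; first exact: ReB.
  by rewrite lerDl sqr_ge0.
have cI xi : E xi -> (fun j => complex.Im (f j xi)) @ \oo --> complex.Im (G xi).
  move=> Exi; rewrite /= /lI mem_set//; apply: ce => // [a b|a]; first exact: ImB.
  by rewrite lerDr sqr_ge0.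
have mcut (phi : C -> R) (l : V -> R) : (forall j, measurable_fun setT (fun xi => phi (f j xi))) ->
    (forall xi, E xi -> (fun j => phi (f j xi)) @ \oo --> l xi) ->
    (forall xi, ~ E xi -> l xi = 0) -> measurable_fun setT l.
  move=> mphi hl l0.
  apply: (measurable_fun_cvg (h := fun j => (fun xi => phi (f j xi)) \_ E)).
    move=> j; apply/(measurable_restrictT _ _).1 => //; exact: measurable_funTS.
  move=> xi _; case: (pselect (E xi)) => Exi.
    by under eq_fun do rewrite patchE mem_set//; exact: hl.
  by under eq_fun do rewrite patchE memNset//; rewrite l0//; exact: cvg_cst.
have mR : measurable_fun setT (fun xi => complex.Re (G xi)).
  apply: (mcut (@complex.Re R) (fun xi => complex.Re (G xi))) => //; first by move=> j; case: (hf j).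
  by move=> xi nE; rewrite /= /lR memNset.
have mI : measurable_fun setT (fun xi => complex.Im (G xi)).
  apply: (mcut (@complex.Im R) (fun xi => complex.Im (G xi))) => //; first by move=> j; case: (hf j).
  by move=> xi nE; rewrite /= /lI memNset.
have msq (F : V -> C) : measurable_fun setT (fun xi => complex.Re (F xi)) ->
    measurable_fun setT (fun xi => complex.Im (F xi)) ->
    measurable_fun setT (fun xi => (W xi * sqn F xi)%:E).
  by move=> h1 h2; apply/measurable_EFinP; exact: measurable_sqn.
have mB (F H : V -> C) : measurable_fun setT (fun xi => complex.Re (F xi)) ->
    measurable_fun setT (fun xi => complex.Im (F xi)) ->
    measurable_fun setT (fun xi => complex.Re (H xi)) ->
    measurable_fun setT (fun xi => complex.Im (H xi)) ->
    measurable_fun setT (fun xi => (W xi * sqn (fun xi => F xi - H xi) xi)%:E).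
  move=> h1 h2 h3 h4; apply: msq.
    by under eq_fun do rewrite ReB; exact: measurable_funB.
  by under eq_fun do rewrite ImB; exact: measurable_funB.
have key i k : (N i <= k)%N ->
    (\int[L]_xi (W xi * sqn (fun xi => Qk k xi - G xi) xi)%:E <= (16^-1 ^+ i)%:E)%E.
  move=> Nk; have [q1 q2 _] := hQ k.
  apply: (@fatou_bound _ _ _ L _ (fun j xi => (W xi * sqn (fun xi => Qk k xi - f j xi) xi)%:E)).
  - exact: mB.
  - by move=> xi; rewrite lee_fin mulr_ge0 ?weight_ge0 ?sqn_ge0.
  - by move=> j; have [? ? _] := hf j; exact: mB.
  - by move=> j xi; rewrite lee_fin mulr_ge0 ?weight_ge0 ?sqn_ge0.
  - have [A [mA A0 hA]] := gae; exists A; split => // xi nxi; apply: hA => gf; apply: nxi => a.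
    rewrite lte_fin => ha.
    have [W0|W0] := ltP 0 (W xi); last first.
      have {}W0 : W xi = 0 by apply/eqP; rewrite eq_le W0 weight_ge0.
      by apply: nearW => j; rewrite lee_fin W0 mul0r; move: ha; rewrite W0 mul0r => /ltW.
    have Exi : E xi by [].
    have cc : (fun j => W xi * sqn (fun xi => Qk k xi - f j xi) xi) @ \oo -->
        W xi * sqn (fun xi => Qk k xi - G xi) xi.
      apply: cvgMr; rewrite /sqn.
      under eq_fun do rewrite ReB ImB !expr2; rewrite ReB ImB !expr2.
      have r1 : (fun j => complex.Re (Qk k xi) - complex.Re (f j xi)) @ \oo -->
          complex.Re (Qk k xi) - complex.Re (G xi).
        by apply: cvgB; [exact: cvg_cst|exact: cR].
      have r2 : (fun j => complex.Im (Qk k xi) - complex.Im (f j xi)) @ \oo -->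
          complex.Im (Qk k xi) - complex.Im (G xi).
        by apply: cvgB; [exact: cvg_cst|exact: cI].
      by apply: cvgD; apply: cvgM.
    have [j0 _ hj0] := cvgr_gt _ cc _ ha.
    by exists j0 => // j /= hj; rewrite lee_fin; apply: ltW; exact: hj0.
  - move=> e e0; exists i => // j /= ij.
    rewrite -hnorm2_lebV hnorm2E; last exact: weighted_L2B.
    rewrite lee_fin; apply: le_trans (hN i k (M j) Nk (NM _ _ ij)) _.
    by rewrite lerDl ltW.
have hG : weighted_L2 s G.
  have h0 : weighted_L2 s (fun xi => Qk (N 0) xi - G xi).
    have [q1 q2 _] := hQ (N 0); split.
    - by under eq_fun do rewrite ReB; exact: measurable_funB.
    - by under eq_fun do rewrite ImB; exact: measurable_funB.
    - by rewrite hnorm2_lebV; apply: le_lt_trans (key 0 _ (leqnn _)) _; rewrite ltry.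
  have := weighted_L2B (hQ (N 0)) h0; congr weighted_L2.
  by apply/funext => xi; rewrite subKr.
exists G; split => //; apply/(hcvg_wnorm hQ hG)/cvgrPdist_le => e e0.
have c16 : ((16^-1 : R) ^+ i) @[i --> \oo] --> 0.
  by apply: cvg_expr; rewrite ger0_norm// invf_lt1// ltr1n.
have /cvgrPdist_le /(_ _ e0) [i _ /(_ i (leqnn i))] := c16.
rewrite sub0r normrN ger0_norm; last exact: ltW.
move=> hi; exists (N i) => // k /= Nk.
rewrite sub0r normrN ger0_norm; last exact: wnorm_ge0.
apply: le_trans hi; rewrite -lee_fin -hnorm2E; last exact: weighted_L2B.
by rewrite hnorm2_lebV; exact: key.
Qed.

End weighted_L2.

(** * Contractivity *)

Section core_operator.
Context (R : realType) (n : nat) (r : R) (M : collision_model R)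
  (gbar : {measure set R -> \bar R}).
Local Notation V := 'rV[R]_n.
Hypotheses (n1 : (1 < n)%N) (r0 : 0 < r) (r1 : r < 1).
Local Notation s := (n%:R / 2 + r).
Local Notation W := (weight s).
Local Notation L := (lebV R n).
Hypothesis hM : maxwellian M gbar.

Let exc_ge0 theta : 0 <= excess r (@tau R) theta.
Proof.
have h1 : 0 < rho r (tau theta) by exact: rho_gt0 (@tau_sin R) (@tau_cos R) _.
have h2 : rho r (tau theta) <= 4 * excess r (@tau R) theta.
  apply: min_powR_sc => //; [exact: tau_sin|exact: tau_cos|].
  by rewrite addrC cos2Dsin2.
by have := lt_le_trans h1 h2; rewrite pmulr_rgt0// => /ltW.
Qed.

(** The excess is nonnegative on []0, pi]], so [kappa] is minus an integral that is finite or [+oo],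
    and [k] is its finite value. *)
Lemma kappaE : (-oo < kappa r gbar)%E -> exists2 k, 0 <= k &
  kappa r gbar = (- k)%:E /\
  (\int[gbar]_(theta in `]0%R, pi])
     (sin (theta / 2) `^ r + cos (theta / 2) `^ r - 1)%:E <= k%:E)%E.
Proof.
set J := (\int[gbar]_(theta in `]0%R, pi]) (sin (theta / 2) `^ r + cos (theta / 2) `^ r - 1)%:E)%E.
have J0 theta : `]0, pi]%classic theta -> 0 <= sin (theta / 2) `^ r + cos (theta / 2) `^ r - 1.
  rewrite /= in_itv/= => /andP[t0]; rewrite le_eqVlt => /orP[/eqP ->|tpi].
    by rewrite sin_pihalf cos_pihalf powR1 powR0 ?gt_eqF// addr0 subrr.
  by have := exc_ge0 theta; rewrite /excess tauE.
have Jp : (0 <= J)%E by apply: integral_ge0 => theta ht; rewrite lee_fin J0.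
have kJ : kappa r gbar = (- J)%E.
  rewrite /kappa /J -integral_ge0N; last by move=> theta ht; rewrite lee_fin J0.
  by apply: eq_integral => theta _; rewrite -EFinN; congr (_%:E); ring.
rewrite kJ -[X in (X < _)%E]/(- +oo)%E lteN2 => Jfin.
have Jf : J \is a fin_num by rewrite ge0_fin_numE.
exists (fine J); first exact: fine_ge0.
by rewrite EFinN fineK.
Qed.

Lemma gbar_supp : gbar (~` `]0, pi]) = 0%E.
Proof. by rewrite -(hM ltr01); exact: angular_supp. Qed.

Section fixed_mu.
Variables (k : R) (g0 : {sigma_finite_measure set R -> \bar R}).
Hypotheses (k_ge0 : 0 <= k).
Local Notation D := (`]0%R, pi[%classic : set R).
Hypotheses (g0E : forall A, measurable A -> A `<=` D -> g0 A = gbar A)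
  (g0D : g0 (~` D) = 0%E)
  (g0k : (\int[g0]_theta (excess r (@tau R) theta)%:E <= k%:E)%E).
Variable mu : probability V R.
Hypothesis mu_moment : rmoment r mu.
Local Notation A1 := (ft cos mu).
Local Notation A2 := (ft sin mu).
Local Notation cpair := (core_pair r g0 (@tau R) A1 A2).
Local Notation q := (qop g0 (@tau R) A1 A2).

Let tau_s (theta : R) := tau_sin theta.
Let tau_c (theta : R) := tau_cos theta.
Let mtau := @measurable_tau R.
Let mA psi : trig psi -> measurable_fun setT (ft psi mu).
Proof. by move=> tp; have [? _ [h _ _]] := tameA r0 r1 mu_moment tp; exact: h. Qed.
Let mA1 := mA (@trig_cos R).
Let mA2 := mA (@trig_sin R).
Let A12 := @ft_cos_sin R n mu.

(** [q] is the transform of [2 Q(mu, .)], and [2^-1] is the factor of the collision kernel. The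
    Jordan parts have equal masses because the total mass is 0. *)
Lemma core_fourier nu : core r nu ->
  let X xi := complex.Re (fourier_meas nu xi) in
  let Y xi := complex.Im (fourier_meas nu xi) in
  [/\ cpair X Y, forall xi, complex.Re (fourier_Q M mu nu xi) = 2^-1 * q X Y xi
    & forall xi, complex.Im (fourier_Q M mu nu xi) = 2^-1 * q Y (fun xi => - X xi) xi].
Proof.
move=> [z1 z2] X Y; set c : R := (2 * pi) `^ (- (n%:R / 2)).
have mom (nu' : {charge set V -> \bar R}) : zero_mass r nu' ->
    [/\ rmoment r (jordan_pos (hahn_posnegP nu')), rmoment r (jordan_neg (hahn_posnegP nu'))
      & jordan_pos (hahn_posnegP nu') setT = jordan_neg (hahn_posnegP nu') setT].
  move=> [nu0 hm].
  have ge0m (m : {measure set V -> \bar R}) : (0 <= \int[m]_v (enorm v `^ r)%:E)%E.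
    by apply: integral_ge0 => v _; rewrite lee_fin powR_ge0.
  split.
  - by apply: le_lt_trans hm; apply: leeDl; exact: ge0m.
  - by apply: le_lt_trans hm; apply: leeDr; exact: ge0m.
  - have := jordan_decomp (hahn_posnegP nu') measurableT.
    rewrite nu0 /cadd /= cscaleN1 => /esym/eqP.
    by rewrite sube_eq ?add0e ?fin_num_measure// ?fin_num_adde_defl ?fin_num_measure// => /eqP.
have [p1 q1 e1] := mom _ z1; have [p2 q2 e2] := mom _ z2.
have [cXY QX QY] := core_pair_ft n1 r0 r1 mtau tau_s tau_c k_ge0 g0k mu_moment c p1 q1 e1 p2 q2 e2.
have eX : X = ftX (jordan_pos (hahn_posnegP (re_part nu))) (jordan_neg (hahn_posnegP (re_part nu)))
    (jordan_pos (hahn_posnegP (im_part nu))) (jordan_neg (hahn_posnegP (im_part nu))) c.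
  apply/funext => xi; rewrite /X /fourier_meas /fourierC /fourier /ftX /sft /ft /=.
  by rewrite /charge_Rintegral -/c; ring.
have eY : Y = ftY (jordan_pos (hahn_posnegP (re_part nu))) (jordan_neg (hahn_posnegP (re_part nu)))
    (jordan_pos (hahn_posnegP (im_part nu))) (jordan_neg (hahn_posnegP (im_part nu))) c.
  apply/funext => xi; rewrite /Y /fourier_meas /fourierC /fourier /ftY /sft /ft /=.
  by rewrite /charge_Rintegral -/c; ring.
have lin_re (P S Q : R) : c * (2^-1 * P) + (0 * (c * (2^-1 * S)) - 1 * - (c * (2^-1 * Q))) =
  2^-1 * (c * P + c * Q) by ring.
have lin_im (P S Q : R) : - (c * (2^-1 * P)) + (0 * - (c * (2^-1 * S)) + 1 * (c * (2^-1 * Q))) =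
  2^-1 * (c * Q - c * P) by ring.
rewrite eX eY; split => // xi.
- rewrite QX /fourier_Q /fourierC /fourier /= -/c.
  rewrite !(Qtest_qform n1 r0 r1 gbar_supp k_ge0 g0E g0D g0k mu_moment xi hM (@trig_cos R))//.
  rewrite !(Qtest_qform n1 r0 r1 gbar_supp k_ge0 g0E g0D g0k mu_moment xi hM (@trig_sin R))//.
- rewrite QY /fourier_Q /fourierC /fourier /= -/c.
  rewrite !(Qtest_qform n1 r0 r1 gbar_supp k_ge0 g0E g0D g0k mu_moment xi hM (@trig_cos R))//.
  rewrite !(Qtest_qform n1 r0 r1 gbar_supp k_ge0 g0E g0D g0k mu_moment xi hM (@trig_sin R))//.
Qed.

Lemma core_weighted_L2 nu : core r nu ->
  weighted_L2 s (fourier_meas nu) /\ weighted_L2 s (fourier_Q M mu nu).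
Proof.
move=> /core_fourier [cXY QX QY]; have [tX tY iXY tp1 tp2] := cXY.
have [_ _ [mX _ _]] := tX; have [_ _ [mY _ _]] := tY; have tNX := tameN tX.
split; first exact: weighted_L2_intP.
have m1 := measurable_qop g0 mtau mA1 mA2 tX tY.
have m2 := measurable_qop g0 mtau mA1 mA2 tY tNX.
have e1 := tempered_energy r0 r1 mtau tau_s tau_c k_ge0 g0k mA1 mA2 tX tY tp1.
have e2 := tempered_energy r0 r1 mtau tau_s tau_c k_ge0 g0k mA1 mA2 tY tNX tp2.
apply: weighted_L2_intP.
- by under eq_fun do rewrite QX; exact: measurable_funM.
- by under eq_fun do rewrite QY; exact: measurable_funM.
have -> : (fun xi => W xi * sqn (fourier_Q M mu nu) xi) = fun xi => 4^-1 *
    (W xi * q (fun xi => complex.Re (fourier_meas nu xi)) (fun xi => complex.Im (fourier_meas nu xi)) xi ^+ 2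
     + W xi * q (fun xi => complex.Im (fourier_meas nu xi)) (fun xi => - complex.Re (fourier_meas nu xi)) xi ^+ 2).
  by apply/funext => xi; rewrite /sqn QX QY; field.
exact: rintZ (rintD e1 e2).
Qed.

Lemma core_dissipative nu : core r nu ->
  2 * \int[L]_xi (W xi * wdot (fourier_Q M mu nu) (fourier_meas nu) xi)
    <= k * wnorm s (fourier_meas nu).
Proof.
move=> hnu; have [wF wQ] := core_weighted_L2 hnu.
have [cXY QX QY] := core_fourier hnu.
have h := core_dissipation n1 r0 r1 mtau tau_s tau_c g0k mA1 mA2 A12 cXY.
refine (le_trans _ h).
rewrite -(rintegralZ 2 (wdot_int wQ wF)) le_eqVlt; apply/orP; left; apply/eqP.
by apply: eq_Rintegral => xi _; rewrite /wdot QX QY; field.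
Qed.

(** By linearity in the pair this is [core_bounded] for the difference; the factor [2^-1] is bounded
    by 1. *)
Lemma core_pair_Lipschitz (b : R) (X1 Y1 X2 Y2 : V -> R) : 0 < b -> (g0 setT <= b%:E)%E ->
  cpair X1 Y1 -> cpair X2 Y2 ->
  (\int[L]_xi (W xi * ((2^-1 * q X1 Y1 xi - 2^-1 * q X2 Y2 xi) ^+ 2 +
      (2^-1 * q Y1 (fun xi => - X1 xi) xi - 2^-1 * q Y2 (fun xi => - X2 xi) xi) ^+ 2))%:E
    <= (18 * b ^+ 2 * \int[L]_xi (W xi * ((X1 xi - X2 xi) ^+ 2 + (Y1 xi - Y2 xi) ^+ 2)))%:E)%E.
Proof.
move=> b0 hb c1 c2; have [tX1 tY1 _ s1 s1'] := c1; have [tX2 tY2 _ s2 s2'] := c2.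
have c12 := core_pairB mA1 mA2 A12 c1 c2.
have hB := core_bounded n1 r0 mtau tau_s tau_c mA1 mA2 A12 b0 hb c12.
have [_ q12] := temperedB mA1 mA2 A12 tX1 tY1 tX2 tY2 s1 s2.
have [_ q12'] := temperedB mA1 mA2 A12 tY1 (tameN tX1) tY2 (tameN tX2) s1' s2'.
have eN : (fun xi => - (X1 xi - X2 xi)) = fun xi => - X1 xi - - X2 xi.
  by apply/funext => xi; rewrite opprB opprK addrC.
rewrite eN in hB; apply: le_trans hB.
have m1 := measurable_qop g0 mtau mA1 mA2 tX1 tY1; have m2 := measurable_qop g0 mtau mA1 mA2 tX2 tY2.
have m3 := measurable_qop g0 mtau mA1 mA2 tY1 (tameN tX1).
have m4 := measurable_qop g0 mtau mA1 mA2 tY2 (tameN tX2).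
have mW := @measurable_weight R n s.
apply: ge0_le_integralT => [| |xi|xi].
- apply/measurable_EFinP; apply: measurable_funM => //.
  by apply: measurable_funD; apply: measurable_funX; apply: measurable_funB; exact: measurable_funM.
- under eq_fun do rewrite q12 q12'.
  apply/measurable_EFinP; apply: measurable_funM => //.
  by apply: measurable_funD; apply: measurable_funX; exact: measurable_funB.
- by rewrite lee_fin mulr_ge0 ?weight_ge0// addr_ge0 ?sqr_ge0.
rewrite lee_fin; apply: ler_wpM2l; first exact: weight_ge0.
have half_sqr (a b' c d : R) :
    (2^-1 * a - 2^-1 * b') ^+ 2 + (2^-1 * c - 2^-1 * d) ^+ 2 <= (a - b') ^+ 2 + (c - d) ^+ 2.
  rewrite -subr_ge0 [X in 0 <= X](_ : _ = 3 / 4 * ((a - b') ^+ 2 + (c - d) ^+ 2)); last by field.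
  by rewrite mulr_ge0 ?addr_ge0 ?sqr_ge0.
by rewrite q12 q12'; exact: half_sqr.
Qed.

Lemma core_Lipschitz (b : R) nu1 nu2 : 0 < b -> (g0 setT <= b%:E)%E -> core r nu1 -> core r nu2 ->
  wnorm s (fun xi => fourier_Q M mu nu1 xi - fourier_Q M mu nu2 xi) <=
    18 * b ^+ 2 * wnorm s (fun xi => fourier_meas nu1 xi - fourier_meas nu2 xi).
Proof.
move=> b0 hb h1 h2; have [_ wQ1] := core_weighted_L2 h1; have [_ wQ2] := core_weighted_L2 h2.
have [c1 Q1 Q1'] := core_fourier h1; have [c2 Q2 Q2'] := core_fourier h2.
have hB := core_pair_Lipschitz b0 hb c1 c2.
rewrite -lee_fin /wnorm EFin_Rintegral; last first.
  exact: weighted_L2_int (weighted_L2B wQ1 wQ2).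
have eF xi : sqn (fun xi => fourier_meas nu1 xi - fourier_meas nu2 xi) xi =
  (complex.Re (fourier_meas nu1 xi) - complex.Re (fourier_meas nu2 xi)) ^+ 2
  + (complex.Im (fourier_meas nu1 xi) - complex.Im (fourier_meas nu2 xi)) ^+ 2.
  by rewrite /sqn ReB ImB.
under [in leRHS]eq_Rintegral do rewrite eF.
refine (le_trans _ hB); rewrite le_eqVlt; apply/orP; left; apply/eqP.
apply: eq_integral => xi _; rewrite /sqn ReB ImB; congr (_ * (_ ^+ 2 + _ ^+ 2))%:E.
- by congr (_ - _); [exact: Q1|exact: Q2].
- by congr (_ - _); [exact: Q1'|exact: Q2'].
Qed.

End fixed_mu.

Lemma contractiveP : (-oo < kappa r gbar)%E -> contractive n M r s (kappa r gbar).
Proof.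
move=> /kappaE [k k0 [-> hk]] mu hmu F G [wF _] [wG [nu [hnu cF cQ]]].
have [g0 [g0E g0D g0k _]] := angular_measure r0 r1 hk.
have w j := core_weighted_L2 k0 g0E g0D g0k hmu (hnu j).
have wFk j : weighted_L2 s (fourier_meas (nu j)) by have [] := w j.
have wQk j : weighted_L2 s (fourier_Q M mu (nu j)) by have [] := w j.
have h := limit_dissipation k0 wFk wF wQk wG cF cQ
  (fun j => core_dissipative k0 g0E g0D g0k hmu (hnu j)).
by rewrite Re_hdot2// hnorm2E// -EFinN opprK -EFinM lee_fin.
Qed.

End core_operator.

(** * Measures with a density and their differences *)

Lemma ge0_integral_mrestr d (T : measurableType d) (R : realType) (m : {measure set T -> \bar R})
    (S : set T) (mS : measurable S) (h : T -> \bar R) : measurable_fun setT h ->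
  (\int[mrestr m mS]_x h x = \int[m]_(x in S) h x)%E.
Proof.
move=> mh; have mhS : measurable_fun setT (h \_ S).
  by apply/(measurable_restrictT _ _).1 => //; exact: measurable_funTS.
transitivity (\int[mrestr m mS]_x (h \_ S) x)%E.
  apply: ae_eq_integral => //; exists (~` S); split; first exact: measurableC.
    by rewrite /= /mrestr setICl measure0.
  by move=> x /= nx Sx; apply: nx => _; rewrite patchE mem_set.
rewrite -integral_mkcond; apply: eq_measure_integral => A mA AS.
by rewrite /= /mrestr setIidl.
Qed.

Section density.
Context d (T : measurableType d) (R : realType).
Variables (m : {sigma_finite_measure set T -> \bar R}) (f : T -> R).
Hypotheses (mf : measurable_fun setT f) (f0 : forall x, 0 <= f x).

Definition under_graph : set (T * measurableTypeR R) := [set p | (0 <= p.2 < f p.1)].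

Lemma measurable_under_graph : measurable under_graph.
Proof.
pose b (p : T * measurableTypeR R) := (0 <= p.2) && (p.2 < f p.1).
have mb : measurable_fun setT b.
  apply: measurable_and; first by apply: measurable_fun_ler => //; exact: measurable_snd.
  by apply: measurable_fun_ltr; [exact: measurable_snd|exact: measurableT_comp mf measurable_fst].
by have := mb measurableT [set true] I; rewrite setTI.
Qed.

(* The measure with density [f], as the first marginal of the product measure
   restricted to the region below the graph of [f]. *)
Definition density : {measure set T -> \bar R} :=
  pushforward_measure (mrestr (m \x @lebesgue_measure R)%E measurable_under_graph)
    (@measurable_fst _ _ T (measurableTypeR R)).

Lemma integral_density (g : T -> \bar R) : measurable_fun setT g -> (forall x, 0 <= g x)%E ->
  (\int[density]_x g x = \int[m]_x (g x * (f x)%:E))%E.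
Proof.
move=> mg g0; rewrite /density integral_pushforward_measure//.
pose h (p : T * measurableTypeR R) := g p.1.
have mh : measurable_fun setT h by exact: measurableT_comp.
rewrite (ge0_integral_mrestr _ measurable_under_graph mh) integral_mkcond.
have mhS : measurable_fun setT (h \_ under_graph).
  apply/(measurable_restrictT _ _).1; first exact: measurable_under_graph.
  exact: measurable_funTS.
have hS0 p : (0 <= (h \_ under_graph) p)%E by rewrite patchE; case: ifPn => // _; exact: g0.
rewrite (tonelli_prod m (@lebesgue_measure R) mhS hS0); apply: eq_integral => x _.
transitivity (\int[@lebesgue_measure R]_(y in `[0%R, f x[) g x)%E.
  by rewrite [RHS]integral_mkcond; apply: eq_integral => y _; rewrite !patchE; congr (if _ then _ else _).
have mI : measurable (`[0%R, f x[%classic : set (measurableTypeR R)) := measurable_itv _.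
rewrite (integral_cst _ mI); congr (_ * _)%E.
have lE : @lebesgue_measure R `[0%R, f x[%classic = (f x)%:E.
  rewrite lebesgue_measure_itv/= lte_fin; case: ltP => [_|fx]; first by rewrite sube0.
  by congr (_%:E); apply/eqP; rewrite eq_le fx f0.
exact: lE.
Qed.

Lemma density_setT : (density setT = \int[m]_x (f x)%:E)%E.
Proof.
rewrite -[LHS]mul1e -integral_cst// integral_density//.
by apply: eq_integral => x _; rewrite mul1e.
Qed.

End density.

Section finite_alias.
Context d (T : measurableType d) (R : realType).
Variables (m : {measure set T -> \bar R}) (fin : (m setT < +oo)%E).

(** As for [sfm], the proof of finiteness is a parameter so that instance inference recovers it. *)
Definition finm : set T -> \bar R := let _ := fin in m.

HB.instance Definition _ := Measure.copy finm m.

Let finm_fin : fin_num_fun finm.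
Proof.
move=> A mA; rewrite ge0_fin_numE//; apply: le_lt_trans fin.
by apply: le_measure; rewrite ?inE.
Qed.

HB.instance Definition _ := Measure_isFinite.Build _ _ _ finm finm_fin.

End finite_alias.

Section difference_charge.
Context d (T : measurableType d) (R : realType).
Variables (m1 m2 : {finite_measure set T -> \bar R}).

Definition chargeB : {charge set T -> \bar R} :=
  cadd (charge_of_finite_measure m1) (cscale (-1) (charge_of_finite_measure m2)).

Local Notation jp := (jordan_pos (hahn_posnegP chargeB)).
Local Notation jn := (jordan_neg (hahn_posnegP chargeB)).

Lemma chargeBE A : chargeB A = (m1 A - m2 A)%E.
Proof. by rewrite /chargeB /= /cadd /= cscaleN1. Qed.

(** Written with sums, the Jordan decomposition is an equality of measures, which integrals
    inherit. *)
Lemma chargeB_jordan A : measurable A -> (jp A + m2 A = jn A + m1 A)%E.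
Proof.
move=> mA; have := jordan_decomp (hahn_posnegP chargeB) mA.
have -> : cadd jp (cscale (-1) jn) A = (jp A - jn A)%E by rewrite /cadd /= cscaleN1.
rewrite chargeBE.
have : jp A \is a fin_num by rewrite fin_num_measure.
have : jn A \is a fin_num by rewrite fin_num_measure.
have : m1 A \is a fin_num by rewrite fin_num_measure.
have : m2 A \is a fin_num by rewrite fin_num_measure.
move: (m1 A) (m2 A) (jp A) (jn A) => [a| |]//[b| |]//[c| |]//[e| |]// _ _ _ _.
by rewrite -!EFinB -!EFinD => -[h]; congr (_%:E); lra.
Qed.

(** Minimality of the Jordan decomposition; it transfers the finite moment of [m1] to the positive
    part. *)
Lemma jordan_pos_chargeB A : measurable A -> (jp A <= m1 A)%E.
Proof.
move=> mA; have [[mP _] _ _ _] := hahn_posnegP chargeB.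
rewrite jordan_posE cjordan_posE /crestr0 mem_set// /crestr chargeBE.
apply: (@le_trans _ _ (m1 (A `&` hahn_pos chargeB))).
  by rewrite -[leRHS]sube0; apply: leeB.
by apply: le_measure; rewrite ?inE//; exact: measurableI.
Qed.

Lemma jordan_neg_chargeB A : measurable A -> (jn A <= m2 A)%E.
Proof.
move=> mA; have [_ [mN _] _ _] := hahn_posnegP chargeB.
rewrite jordan_negE cjordan_negE /crestr0 mem_set// /crestr chargeBE.
have mI : measurable (A `&` hahn_neg chargeB) by exact: measurableI.
rewrite fin_num_oppeB ?fin_num_measure// addeC.
apply: (@le_trans _ _ (m2 (A `&` hahn_neg chargeB))).
  by rewrite -[leRHS]sube0; apply: leeB.
by apply: le_measure; rewrite ?inE.
Qed.

Lemma charge_Rintegral_chargeB (psi : T -> R) (C : R) : measurable_fun setT psi ->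
  (forall x, `|psi x| <= C) ->
  charge_Rintegral chargeB psi = \int[m1]_x psi x - \int[m2]_x psi x.
Proof.
move=> mpsi hC.
have key (g : T -> R) : measurable_fun setT g -> (forall x, 0 <= g x) -> (exists D, forall x, `|g x| <= D) ->
    \int[jp]_x g x + \int[m2]_x g x = \int[jn]_x g x + \int[m1]_x g x.
  move=> mg g0 [D gD].
  have i (m : {finite_measure set T -> \bar R}) := rint_bounded m mg gD.
  apply: EFin_inj; rewrite !EFinD (EFin_Rintegral (i jp)) (EFin_Rintegral (i m2)) (EFin_Rintegral (i jn)) (EFin_Rintegral (i m1)).
  have mE : measurable_fun setT (fun x => (g x)%:E) by exact/measurable_EFinP.
  have gE x : setT x -> (0 <= (g x)%:E)%E by rewrite lee_fin.
  rewrite -(ge0_integral_measure_add jp m2 measurableT gE mE).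
  rewrite -(ge0_integral_measure_add jn m1 measurableT gE mE).
  apply: eq_measure_integral => A mA _.
  transitivity (jp A + m2 A)%E; first exact: measure_addE.
  by rewrite chargeB_jordan//; apply/esym; exact: measure_addE.
(* Adding [K] makes [psi] nonnegative; the identity for the constant [K] is then subtracted. *)
pose K := `|C|.
have hK x : `|psi x| <= K by exact: le_trans (hC x) (ler_norm C).
have K0 x : 0 <= psi x + K by have := hK x; rewrite ler_norml => /andP[h _]; lra.
have h1 : \int[jp]_x (psi x + K) + \int[m2]_x (psi x + K) = \int[jn]_x (psi x + K) + \int[m1]_x (psi x + K).
  apply: key => //; first exact: measurable_funD.
  exists (K + `|K|) => x; apply: le_trans (ler_normD _ _) _; exact: lerD.
have h2 : \int[jp]_x cst K x + \int[m2]_x cst K x = \int[jn]_x cst K x + \int[m1]_x cst K x.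
  by apply: key => //; exists K => x; rewrite /= normr_id.
have ipsi (m : {finite_measure set T -> \bar R}) := rint_bounded m mpsi hK.
have iK (m : {finite_measure set T -> \bar R}) : m.-integrable setT (EFin \o (cst K : T -> R)).
  by apply: (rint_bounded m (c := K)) => // x; rewrite /= normr_id.
rewrite /charge_Rintegral; move: h1 h2.
rewrite !(rintegralD (ipsi _) (iK _)).
move: (\int[jp]_x psi x) (\int[jn]_x psi x) (\int[m1]_x psi x) (\int[m2]_x psi x) => a b c e.
move: (\int[jp]_x _) (\int[jn]_x _) (\int[m1]_x _) (\int[m2]_x _) => a' b' c' e' /= h1 h2.
lra.
Qed.

End difference_charge.

(** * Schwartz functions *)

Section schwartz_functions.
Context (R : realType) (n : nat).
Local Notation V := 'rV[R]_n.
Local Notation L := (lebV R n).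
Implicit Types (f : V -> R) (x y v : V).

(** Division by [c] brings the derivative along the line below 1, as [derive_lipschitz] requires. *)
Lemma directional_lipschitz f v (c : R) : 0 < c ->
  (forall x, derivable f x v) -> (forall x, `|'D_v f x| <= c) ->
  forall x (t : R), `|f (x + t *: v) - f x| <= c * `|t|.
Proof.
move=> c0 fd fc x t; pose phi (t : R) := c^-1 * f (x + t *: v).
have e (u h : R) : f (x + (h + u) *: v) = (f \o shift (x + u *: v)) (h *: v).
  by rewrite /= scalerDl addrCA [x + _]addrC addrA -addrA [u *: v + x]addrC.
have fdt (u : R) : is_derive u (1 : R) (fun t => f (x + t *: v)) ('D_v f (x + u *: v)).
  have E : (fun h : R => h^-1 *: ((fun t : R => f (x + t *: v)) \o shift u) (h *: 1)) = fun h => h^-1 *: f (x + (h + u) *: v).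
    by apply/funext => h /=; rewrite [h *: 1]mulr1.
  have E2 : (fun h : R => h^-1 *: (((fun t : R => f (x + t *: v)) \o shift u) (h *: 1) - f (x + u *: v))) =
      fun h => h^-1 *: ((f \o shift (x + u *: v)) (h *: v) - f (x + u *: v)).
    by apply/funext => h /=; rewrite [h *: 1]mulr1 e.
  apply: DeriveDef.
    by have := fd (x + u *: v); rewrite /derivable E2.
  by rewrite /derive E2.
have phid (u : R) : is_derive u (1 : R) phi (c^-1 * 'D_v f (x + u *: v)).
  exact: is_deriveZ.
have h := derive_lipschitz phid _ t 0.
have /h : forall u : R, `|c^-1 * 'D_v f (x + u *: v)| <= 1.
  by move=> u; rewrite normrM ger0_norm ?invr_ge0 ?(ltW c0)// mulrC ler_pdivrMr// mul1r.
rewrite /phi scale0r addr0 subr0 -mulrBr normrM ger0_norm ?invr_ge0 ?(ltW c0)//.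
by rewrite mulrC ler_pdivrMr// mulrC.
Qed.

Lemma coordinate_lipschitz f (c : R) : 0 <= c ->
  (forall i x (t : R), `|f (x + t *: delta_mx 0 i) - f x| <= c * `|t|) ->
  forall x y, `|f x - f y| <= c * \sum_(i < n) `|x 0 i - y 0 i|.
Proof.
move=> c0 hf x y.
(* [z k] has the first [k] coordinates of [y] and the others of [x], so that consecutive points
   differ in one direction. *)
pose z (k : nat) : V := \row_i (if (i < k)%N then y 0 i else x 0 i).
have H k : (k <= n)%N -> `|f x - f (z k)| <= c * \sum_(i < n | (i < k)%N) `|x 0 i - y 0 i|.
  elim: k => [|k IH] kn.
    have -> : z 0%N = x by apply/rowP => i; rewrite mxE.
    by rewrite subrr normr0 mulr_ge0// sumr_ge0.
  have {}IH := IH (ltnW kn); pose i0 := Ordinal kn.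
  have zE : z k.+1 = z k + (y 0 i0 - x 0 i0) *: delta_mx 0 i0.
    apply/rowP => i; rewrite !mxE eqxx /= ltnS leq_eqVlt.
    have [->|ni] := eqVneq i i0; first by rewrite eqxx /= ltnn mulr1 addrC subrK.
    have -> : (nat_of_ord i == k) = false by apply/negbTE; apply: contra ni => /eqP h; apply/eqP/val_inj.
    by rewrite /= mulr0 addr0.
  rewrite (bigD1 i0)//= mulrDr.
  have -> : f x - f (z k.+1) = (f x - f (z k)) - (f (z k.+1) - f (z k)) by ring.
  apply: le_trans (ler_normB _ _) _; rewrite addrC; apply: lerD.
    by rewrite zE [in leRHS]distrC; exact: hf.
  apply: le_trans IH _; apply: ler_wpM2l => //; rewrite le_eqVlt; apply/orP; left; apply/eqP.
  by apply: eq_bigl => i; rewrite -(inj_eq val_inj) /= ltnS ltn_neqAle andbC.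
have := H n (leqnn n); have -> : z n = y by apply/rowP => i; rewrite mxE ltn_ord.
move=> /le_trans; apply; apply: ler_wpM2l => //.
by rewrite le_eqVlt; apply/orP; left; apply/eqP; apply: eq_bigl => i; rewrite ltn_ord.
Qed.

(* [f] is the pointwise limit of its values at grid points. *)
Lemma lipschitz_measurable f (c : R) :
  (forall x y, `|f x - f y| <= c * \sum_(i < n) `|x 0 i - y 0 i|) ->
  measurable_fun setT f.
Proof.
move=> hf.
pose fl (m : nat) (x : V) : 'rV[int]_n := \row_i Num.floor (m.+1%:R * x 0 i).
pose gr (m : nat) (z : 'rV[int]_n) : V := \row_i ((z 0 i)%:~R / m.+1%:R).
apply: (measurable_fun_cvg (h := fun m x => f (gr m (fl m x)))) => [m|x _].
  move=> _ B mB; rewrite setTI.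
  have mcell (z : 'rV[int]_n) : measurable [set x | fl m x = z].
    have -> : [set x | fl m x = z] =
        \bigcap_(i in [set: 'I_n]) [set x : V | Num.floor (m.+1%:R * x 0 i) = z 0 i].
      apply/seteqP; split => x /=; first by move=> <- i _; rewrite /= mxE.
      by move=> h; apply/rowP => i; rewrite mxE; exact: h.
    apply: fin_bigcap_measurable; first exact: finite_finset.
    move=> i _; have mi : measurable_fun setT (fun x : V => m.+1%:R * x 0 i).
      by apply: measurable_funM => //; exact: measurable_coord.
    have -> : [set x : V | Num.floor (m.+1%:R * x 0 i) = z 0 i] =
        setT `&` (fun x : V => m.+1%:R * x 0 i) @^-1` [set` `[(z 0 i)%:~R, (z 0 i + 1)%:~R[].
      rewrite setTI; apply/seteqP; split => x /=; rewrite in_itv/=.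
        by move=> <-; exact: floor_itv.
      by move=> h; apply: floor_def.
    by apply: mi => //; exact: measurable_itv.
  rewrite (_ : _ @^-1` B = \bigcup_(z : 'rV[int]_n) (if pselect (B (f (gr m z))) then [set x | fl m x = z] else set0)).
    apply: countable_bigcupT_measurable; first exact: countableP.
    by move=> z; case: (pselect _) => _ /=; [exact: mcell|exact: measurable0].
  apply/seteqP; split => x /=.
    by move=> Bx; exists (fl m x) => //; case: pselect.
  by move=> [z _]; case: (pselect _) => // Bz /= ->.
apply/cvgrPdist_le => e e0.
have c1 : 0 < `|c| * n%:R + 1 by rewrite ltr_wpDl// mulr_ge0.
near=> m; apply: le_trans (hf _ _) _.
apply: (@le_trans _ _ (`|c| * \sum_(i < n) m.+1%:R^-1)).
  apply: (@le_trans _ _ (`|c| * \sum_(i < n) `|x 0 i - gr m (fl m x) 0 i|)).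
    by apply: ler_wpM2r; [exact: sumr_ge0|exact: ler_norm].
  apply: ler_wpM2l => //; apply: ler_sum => i _; rewrite !mxE.
  have m0 : 0 < (m.+1%:R : R) by rewrite ltr0n.
  rewrite -[X in X - _](mulfK (lt0r_neq0 m0)) -mulrBl normrM [`|_^-1|]ger0_norm ?invr_ge0//.
  rewrite -[leRHS]mul1r; apply: ler_wpM2r; first by rewrite invr_ge0.
  rewrite [x 0 i * _]mulrC; move: (m.+1%:R * x 0 i) => t.
  have /andP[h1] := floor_itv t; rewrite intrD mulr1z => /ltW h2.
  by rewrite ger0_norm ?subr_ge0// lerBlDl.
rewrite sumr_const card_ord -[_ *+ n]mulr_natr mulrCA mulrC.
apply: (@le_trans _ _ ((`|c| * n%:R + 1) * m.+1%:R^-1)).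
  by apply: ler_wpM2r; [rewrite invr_ge0|rewrite lerDl].
rewrite mulrC -ler_pdivlMr//; apply: ltW; near: m.
exact: near_infty_natSinv_lt (PosNum (divr_gt0 e0 c1)).
Unshelve. all: by end_near.
Qed.

(** Bounded first partials make the function Lipschitz, and [lipschitz_measurable] applies to the
    sigma-algebra generated by the coordinates. *)
Lemma schwartz_measurable f : schwartz f -> measurable_fun setT f.
Proof.
move=> sf.
have /choice[c hc] : forall i : 'I_n, exists c : R, forall x, `|'D_(delta_mx 0 i) f x| <= c.
  move=> i; have [_ /(_ 0%N)[c hc]] := sf [:: i].
  by exists c => x; have := hc x; rewrite expr0 mul1r.
pose C := \sum_(i < n) `|c i| + 1.
have C0 : 0 < C by rewrite ltr_wpDl// sumr_ge0.
apply: (@lipschitz_measurable _ C); apply: coordinate_lipschitz; first exact: ltW.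
move=> i; apply: directional_lipschitz => //.
  by move=> x; have [h _] := sf [::]; exact: h.
move=> x; apply: le_trans (hc i x) _; apply: le_trans (ler_norm _) _.
by rewrite /C (bigD1 i)//= -addrA lerDl addr_ge0// sumr_ge0.
Qed.

End schwartz_functions.

Section density_rintegral.
Context d (T : measurableType d) (R : realType).
Variables (m : {sigma_finite_measure set T -> \bar R}) (f : T -> R).
Hypotheses (mf : measurable_fun setT f) (f0 : forall x, 0 <= f x)
  (fi : m.-integrable setT (EFin \o f)).

Lemma density_setT_lty : (density m mf setT < +oo)%E.
Proof.
rewrite (density_setT m mf f0) -(EFin_Rintegral fi); exact: ltry.
Qed.

Lemma Rintegral_density (g : T -> R) (C : R) : measurable_fun setT g ->
  (forall x, `|g x| <= C) ->
  \int[finm density_setT_lty]_x g x = \int[m]_x (f x * g x).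
Proof.
move=> mg gC; set D := finm _.
have pos (h : T -> R) : measurable_fun setT h -> (forall x, 0 <= h x) ->
    \int[D]_x h x = \int[m]_x (f x * h x).
  move=> mh h0; rewrite /Rintegral; congr fine.
  transitivity (\int[m]_x ((h x)%:E * (f x)%:E))%E.
    by apply: (integral_density m mf f0) => [|x]; [exact/measurable_EFinP|rewrite lee_fin].
  by apply: eq_integral => x _; rewrite -EFinM mulrC.
have ig : D.-integrable setT (EFin \o g) := rint_bounded D mg gC.
have C0 (x : T) : 0 <= C by exact: le_trans (normr_ge0 _) (gC x).
have iC : D.-integrable setT (EFin \o (cst C : T -> R)).
  by apply: (rint_bounded D (c := C)) => // x; rewrite /= ger0_norm// (C0 x).
have ifg : m.-integrable setT (EFin \o (fun x => f x * g x)).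
  apply: (rint_le _ _ (rintZ C fi)); first exact: measurable_funM.
  by move=> x; rewrite normrM ger0_norm// mulrC; apply: ler_wpM2r.
have ifC : m.-integrable setT (EFin \o (fun x => f x * C)).
  by have := rintZ C fi; congr (m.-integrable _ (EFin \o _)); apply/funext => x; rewrite mulrC.
have h1 : \int[D]_x (g x + C) = \int[m]_x (f x * (g x + C)).
  apply: pos => [|x]; first exact: measurable_funD.
  by have := gC x; rewrite ler_norml => /andP[h _]; rewrite -lerBlDr sub0r.
have h2 : \int[D]_x C = \int[m]_x (f x * C) by apply: pos => // x; exact: C0.
move: h1; rewrite (rintegralD ig iC) h2.
under [RHS]eq_Rintegral do rewrite mulrDr.
by rewrite (rintegralD ifg ifC) => /addIr.
Qed.

End density_rintegral.

(** * Non-integrability of the weight and integrability of rapidly decreasing functions *)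

Section weight_at_infinity.
Context (R : realType) (n : nat) (r : R).
Local Notation V := 'rV[R]_n.
Hypotheses (n1 : (1 < n)%N) (r0 : 0 < r) (r1 : r < 1).
Local Notation s := (n%:R / 2 + r).
Local Notation W := (weight s).
Local Notation L := (lebV R n).
Implicit Types (f : V -> R) (x y : V).

Let r01 : 0 < r < 1. Proof. by rewrite r0 r1. Qed.

Let twos : 2 * s = n%:R + 2 * r. Proof. by field. Qed.

Let gap (u : R) : u < 1 -> 1 <= 3 - 2 * u. Proof. by lra. Qed.

(* By scaling, [\int W] would be [0] if it were finite. *)
Lemma weight_not_integrable (a : R) : L.-integrable setT (EFin \o (fun xi : V => W xi * a ^+ 2)) -> a = 0.
Proof.
move=> ia; apply/eqP; case: (eqVneq a 0) => // a0; exfalso.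
have a2 : 0 < a ^+ 2 by rewrite exprn_even_gt0.
have iW : L.-integrable setT (EFin \o W).
  have := rintZ (a ^- 2) ia; congr (L.-integrable _ (EFin \o _)); apply/funext => xi.
  by rewrite mulrCA mulVf ?mulr1// gt_eqF.
have mW : measurable_fun setT (fun x : V => (W x)%:E) by apply/measurable_EFinP; exact: measurable_weight.
have W0 x : (0 <= (W x)%:E)%E by rewrite lee_fin weight_ge0.
pose I := \int[L]_x W x.
(* The integral of the weight at [2 x] is [2^(-2s) I] by homogeneity and [2^(-n) I] by change of
   variables, and [2s > n]. *)
have scal : 2 `^ (- (2 * s)) * I = 2 ^- n * I.
  apply: EFin_inj; rewrite !EFinM (EFin_Rintegral iW).
  have p0 : (0 <= (2 `^ (- (2 * s)) : R)%:E)%E by rewrite lee_fin powR_ge0.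
  rewrite -(ge0_integralZlT L mW W0 p0); apply: etrans (lebV_dilate (ltr0Sn R 1) mW W0).
  apply: eq_integral => x _; rewrite -EFinM; congr (_%:E).
  by rewrite /weight enormZ ger0_norm// powRM// enorm_ge0.
have I0 : I = 0.
  apply/eqP; apply/negPn/negP => I0; move/(mulIf I0) : scal => /eqP.
  rewrite powRN twos powRD ?pnatr_eq0 ?implybT// powR_mulrn//; apply/negP.
  rewrite (inj_eq (@invr_inj _)) -[X in _ == X]mulr1 (inj_eq (mulfI _)) ?expf_neq0 ?pnatr_eq0//.
  rewrite gt_eqF// -[ltLHS](_ : 1 `^ (2 * r) = 1); last by rewrite powR1.
  by apply: gt0_ltr_powR; rewrite ?nnegrE ?ltr1n// mulr_gt0.
(* The unit ball around this point stays away from the origin, so the weight has a positive lower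
   bound on it and its integral cannot be 0. *)
pose y : V := const_mx 2.
have y2 : 2 <= enorm y.
  by have := normr_coord_le y (Ordinal (ltnW n1)); rewrite mxE ger0_norm.
have lo x : (enorm (x - y) <= 1)%R%:R * (enorm y + 1) `^ (- (2 * s)) <= W x.
  have [h|_] := leP (enorm (x - y)) 1; last by rewrite mul0r weight_ge0.
  have h1 : enorm x <= enorm y + 1.
    by have := enorm_triangle (x - y) y; rewrite subrK; lra.
  have h2 : 1 <= enorm x.
    by have := enorm_triangle (y - x) x; rewrite subrK enormC; lra.
  rewrite mul1r /weight !powRN lef_pV2 ?posrE ?powR_gt0//; [|lra|lra].
  apply: ge0_ler_powR => //; rewrite ?nnegrE; [|lra|lra].
  by rewrite twos addr_ge0// mulr_ge0// ltW.
have := ball_volume_gt0 R n; set v := ball_volume R n => v0.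
have : 0 < v * (enorm y + 1) `^ (- (2 * s)) by rewrite mulr_gt0// powR_gt0//; lra.
apply/negP; rewrite -leNgt -I0 -lee_fin EFinM -[v in v%:E]mul1r -[X in X * v](expr1n _ n).
rewrite -(integral_ball y ltr01) -ge0_integralZrT; first last.
- by rewrite lee_fin powR_ge0.
- by move=> x; rewrite lee_fin.
- apply/measurable_EFinP; apply: measurable_indic_le => //; apply: measurable_enorm.
  by apply: measurable_addv => //; exact: measurable_cst.
rewrite (EFin_Rintegral iW); apply: ge0_le_integralT => //.
- apply/measurable_EFinP; apply: measurable_funM => //; apply: measurable_indic_le => //; apply: measurable_enorm.
  by apply: measurable_addv => //; exact: measurable_cst.
- by move=> x; rewrite -EFinM lee_fin mulr_ge0// powR_ge0.
Qed.

(** Boundedness suffices near the origin. At infinity [|x|^a] is at most [|x|^(n+3) W], whose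
    exponent is [n + 3 - 2s = 3 - 2r], at least 1, and [W] is integrable there. *)
Lemma decay_integrable f (a c0 c1 : R) : measurable_fun setT f -> 0 <= a -> a <= 1 ->
  (forall x, `|f x| <= c0) -> (forall x, enorm x ^+ (n + 3) * `|f x| <= c1) ->
  L.-integrable setT (EFin \o (fun x => `|f x| * enorm x `^ a)).
Proof.
move=> mf a0 a1 h0 h1.
have c00 : 0 <= c0 by exact: le_trans (normr_ge0 (f 0)) (h0 0).
have c10 : 0 <= c1 by apply: le_trans (h1 0); rewrite mulr_ge0// exprn_ge0// enorm_ge0.
have mb : measurable_fun setT (fun x : V => (enorm x <= 1)%R%:R : R).
  by apply: measurable_indic_le => //; exact: measurable_enorm.
have mW : measurable_fun setT (fun x : V => (1 <= enorm x)%R%:R * W x).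
  by apply: measurable_funM; [apply: measurable_indic_le => //; exact: measurable_enorm|exact: measurable_weight].
have ib : L.-integrable setT (EFin \o (fun x : V => (enorm x <= 1)%R%:R : R)).
  apply: rint_ge0 => //; have := integral_ball (0 : V) ltr01.
  under [X in X = _ -> _]eq_integral do rewrite subr0.
  by move=> ->; exact: ltry.
have iW : L.-integrable setT (EFin \o (fun x : V => (1 <= enorm x)%R%:R * W x)).
  apply: rint_ge0 => //; first by move=> x; rewrite mulr_ge0// weight_ge0.
  by have [K hK] := outer_integral n r01; apply: le_lt_trans hK _; exact: ltry.
apply: (rint_le _ _ (rintD (rintZ c0 ib) (rintZ c1 iW))).
  by apply: measurable_funM; [exact: measurableT_comp|exact: measurable_enorm_powR].
move=> x; rewrite normrM normr_id (ger0_norm (powR_ge0 _ _)).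
have e0 := enorm_ge0 x.
have [h|/ltW h] := leP (enorm x) 1.
  apply: (@le_trans _ _ (c0 * 1)); last by rewrite lerDl mulr_ge0// mulr_ge0// weight_ge0.
  apply: ler_pM => //; first exact: powR_ge0.
  rewrite -[leRHS](_ : 1 `^ a = 1); last by rewrite powR1.
  by apply: ge0_ler_powR => //; rewrite nnegrE.
rewrite h mul1r; apply: ler_wpDl; first by rewrite mulr_ge0.
have x0 : 0 < enorm x by exact: lt_le_trans h.
apply: (@le_trans _ _ (enorm x ^+ (n + 3) * `|f x| * W x)); last first.
  by apply: ler_wpM2r; [exact: weight_ge0|exact: h1].
rewrite mulrC -mulrA [`|f x| * _]mulrC mulrA; apply: ler_wpM2r => //.
rewrite /weight -powR_mulrn// -powRD; last by rewrite (gt_eqF x0) implybT.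
apply: ler_powR => //; rewrite twos natrD.
rewrite opprD addrACA subrr add0r; exact: le_trans a1 (gap r1).
Qed.

End weight_at_infinity.

(** * Vanishing mass of Schwartz functions of finite norm *)

Section mass_of_finite_energy.
Context (R : realType) (n : nat) (r : R).
Local Notation V := 'rV[R]_n.
Hypotheses (n1 : (1 < n)%N) (r0 : 0 < r) (r1 : r < 1).
Local Notation s := (n%:R / 2 + r).
Local Notation W := (weight s).
Local Notation L := (lebV R n).
Local Notation energy X := (L.-integrable setT (EFin \o (fun xi : V => W xi * X xi ^+ 2))).

Let r01 : 0 < r < 1. Proof. by rewrite r0 r1. Qed.

Let energyD (X Y : V -> R) : measurable_fun setT X -> measurable_fun setT Y ->
  energy X -> energy Y -> energy (fun xi => X xi + Y xi).
Proof.
move=> mX mY eX eY; apply: (rint_le _ _ (rintZ 2 (rintD eX eY))).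
  by apply: measurable_funM; [exact: measurable_weight|apply: measurable_funX; exact: measurable_funD].
move=> xi; have p0 : 0 <= W xi * (X xi + Y xi) ^+ 2 by rewrite mulr_ge0 ?weight_ge0 ?sqr_ge0.
rewrite (ger0_norm p0) -mulrDr [leRHS]mulrCA; apply: ler_wpM2l; first exact: weight_ge0.
rewrite -subr_ge0 [X in 0 <= X](_ : _ = (X xi - Y xi) ^+ 2); [exact: sqr_ge0|ring].
Qed.

Let energyZ (c : R) (X : V -> R) : energy X -> energy (fun xi => c * X xi).
Proof.
move=> eX; have := rintZ (c ^+ 2) eX; congr (L.-integrable _ (EFin \o _)).
by apply/funext => xi; rewrite exprMn mulrCA.
Qed.

Lemma sft_increment_energy psi (p q : {finite_measure set V -> \bar R}) : trig psi ->
  rmoment r p -> rmoment r q -> energy (fun xi => sft p q psi xi - sft p q psi 0).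
Proof.
move=> tp hp hq.
have mft (m : {finite_measure set V -> \bar R}) : rmoment r m -> measurable_fun setT (ft psi m).
  by move=> hm; have [? _ []] := tame_ft r0 r1 tp hm.
have ep := ft_energy n1 r0 r1 tp hp; have eq := ft_energy n1 r0 r1 tp hq.
have : energy (fun xi => (ft psi p xi - ft psi p 0) + (-1) * (ft psi q xi - ft psi q 0)); last first.
  congr (L.-integrable _ (EFin \o _)); apply/funext => xi; congr (_ * _ ^+ 2).
  by rewrite /sft; ring.
apply: energyD => //; last exact: energyZ.
  by apply: measurable_funB => //; exact: mft.
by apply: measurable_funM => //; apply: measurable_funB => //; exact: mft.
Qed.

(** The moments give [X - X 0] finite energy; so the constant [X 0] has finite energy as well and
    must be 0. Two functions [psi] occur because the real part of the transform of a complex measure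
    mixes [cos] and [sin]. *)
Lemma finite_energy_at0 psi1 psi2 (p1 q1 p2 q2 : {finite_measure set V -> \bar R}) (c1 c2 : R) :
  trig psi1 -> trig psi2 -> rmoment r p1 -> rmoment r q1 -> rmoment r p2 -> rmoment r q2 ->
  let X xi := c1 * sft p1 q1 psi1 xi + c2 * sft p2 q2 psi2 xi in
  energy X -> X 0 = 0.
Proof.
move=> t1 t2 hp1 hq1 hp2 hq2 X eX.
have msft psi (p q : {finite_measure set V -> \bar R}) : trig psi -> rmoment r p -> rmoment r q ->
    measurable_fun setT (sft p q psi).
  by move=> tp hp hq; have [? _ [h _ _]] := tame_sft r0 r1 hp hq tp.
have m1 := msft _ _ _ t1 hp1 hq1; have m2 := msft _ _ _ t2 hp2 hq2.
have e1 := sft_increment_energy t1 hp1 hq1; have e2 := sft_increment_energy t2 hp2 hq2.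
apply: (weight_not_integrable n1 r0).
have : energy (fun xi => X xi + ((- c1) * (sft p1 q1 psi1 xi - sft p1 q1 psi1 0) +
    (- c2) * (sft p2 q2 psi2 xi - sft p2 q2 psi2 0))).
  have mD psi p q c : measurable_fun setT (sft p q psi) ->
      measurable_fun setT (fun xi : V => - c * (sft p q psi xi - sft p q psi 0)).
    by move=> h; apply: measurable_funM => //; exact: measurable_funB.
  apply: energyD => //; last by apply: energyD; [exact: mD|exact: mD|exact: energyZ|exact: energyZ].
    by apply: measurable_funD; apply: measurable_funM.
  by apply: measurable_funD; exact: mD.
congr (L.-integrable _ (EFin \o _)); apply/funext => xi; congr (_ * _ ^+ 2).
by rewrite /X; ring.
Qed.

(** The positive and negative parts of [f] are densities of finite measures, whose moments come from
    the decay of [f]. *)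
Lemma schwartz_charge (f : V -> R) : schwartz f ->
  exists m1 m2 : {finite_measure set V -> \bar R}, [/\ rmoment r m1, rmoment r m2 &
    forall psi : V -> R, measurable_fun setT psi -> (forall x, `|psi x| <= 1) ->
      \int[m1]_x psi x - \int[m2]_x psi x = \int[L]_x (f x * psi x)].
Proof.
move=> sf; have mf := schwartz_measurable sf; have [_ dec] := sf [::].
have [c0 h0] := dec 0%N; have [c1 h1] := dec (n + 3)%N.
have {}h0 x : `|f x| <= c0 by have := h0 x; rewrite expr0 mul1r.
have ir := decay_integrable r0 r1 mf (ltW r0) (ltW r1) h0 h1.
have i0 : L.-integrable setT (EFin \o (fun x => `|f x|)).
  have := decay_integrable r0 r1 mf (lexx 0) ler01 h0 h1.
  by congr (L.-integrable _ (EFin \o _)); apply/funext => x; rewrite powRr0 mulr1.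
have part (g : V -> R) : measurable_fun setT g -> (forall x, 0 <= g x) -> (forall x, g x <= `|f x|) ->
    exists m : {finite_measure set V -> \bar R}, rmoment r m /\
    forall psi : V -> R, measurable_fun setT psi -> (forall x, `|psi x| <= 1) ->
      \int[m]_x psi x = \int[L]_x (g x * psi x).
  move=> mg g0 gf.
  have ig : L.-integrable setT (EFin \o g).
    by apply: (rint_le mg _ i0) => x; rewrite ger0_norm.
  exists (finm (density_setT_lty mg g0 ig)); split; last first.
    by move=> psi mpsi hpsi; exact: Rintegral_density mpsi hpsi.
  have mr : measurable_fun setT (fun x : V => enorm x `^ r) by exact: measurable_enorm_powR.
  apply: (@le_lt_trans _ _ (\int[L]_x ((enorm x `^ r)%:E * (g x)%:E))%E).
    rewrite -(integral_density L mg g0); last 2 first.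
    - exact/measurable_EFinP.
    - by move=> x; rewrite lee_fin powR_ge0.
    exact: lexx.
  have igr : L.-integrable setT (EFin \o (fun x => enorm x `^ r * g x)).
    apply: (rint_le _ _ ir) => [|x]; first exact: measurable_funM.
    rewrite ger0_norm ?mulr_ge0 ?powR_ge0// mulrC.
    by apply: ler_wpM2r; [exact: powR_ge0|exact: gf].
  by under eq_integral do rewrite -EFinM; rewrite -(EFin_Rintegral igr); exact: ltry.
have [m1 [hm1 E1]] : exists m : {finite_measure set V -> \bar R}, rmoment r m /\
    forall psi : V -> R, measurable_fun setT psi -> (forall x, `|psi x| <= 1) ->
      \int[m]_x psi x = \int[L]_x (Num.max (f x) 0 * psi x).
  apply: part => [|x|x]; first exact: measurable_maxr.
  - by rewrite le_max lexx orbT.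
  - by rewrite ge_max ler_norm normr_ge0.
have [m2 [hm2 E2]] : exists m : {finite_measure set V -> \bar R}, rmoment r m /\
    forall psi : V -> R, measurable_fun setT psi -> (forall x, `|psi x| <= 1) ->
      \int[m]_x psi x = \int[L]_x (Num.max (- f x) 0 * psi x).
  apply: part => [|x|x]; first by apply: measurable_maxr => //; exact: measurableT_comp.
  - by rewrite le_max lexx orbT.
  - by rewrite ge_max normr_ge0 -normrN ler_norm.
exists m1, m2; split => // psi mpsi hpsi; rewrite E1// E2//.
have im (g : V -> R) : measurable_fun setT g -> (forall x, `|g x| <= `|f x|) ->
    L.-integrable setT (EFin \o (fun x => g x * psi x)).
  move=> mg gf; apply: (rint_le _ _ i0); first exact: measurable_funM.
  by move=> x; rewrite normrM -[leRHS]mulr1; apply: ler_pM.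
rewrite -rintegralB.
- apply: eq_Rintegral => x _; rewrite -mulrBl; congr (_ * _).
  by case: (leP (f x) 0) => h; case: (leP (- f x) 0) => h'; lra.
- apply: im => [|x]; first exact: measurable_maxr.
  by case: (leP (f x) 0); rewrite ?normr0.
- apply: im => [|x]; first by apply: measurable_maxr => //; exact: measurableT_comp.
  by case: (leP (- f x) 0); rewrite ?normr0 ?normrN.
Qed.

Lemma core_of_schwartz (f g : V -> R) : schwartz f -> schwartz g ->
  (hnorm2 s (fourier_fun f g) < +oo)%E ->
  exists nu, core r nu /\ fourier_meas nu = fourier_fun f g.
Proof.
move=> /schwartz_charge[p1 [q1 [hp1 hq1 E1]]] /schwartz_charge[p2 [q2 [hp2 hq2 E2]]] fin.
have Echarge (p q : {finite_measure set V -> \bar R}) (h : V -> R) :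
    (forall psi : V -> R, measurable_fun setT psi -> (forall x, `|psi x| <= 1) ->
      \int[p]_x psi x - \int[q]_x psi x = \int[L]_x (h x * psi x)) ->
    forall psi : R -> R, trig psi -> forall xi : V,
      charge_Rintegral (chargeB p q) (fun x => psi (dotv xi x)) = sft p q psi xi /\
      \int[lebesgue_rV R n]_x (h x * psi (dotv xi x)) = sft p q psi xi.
  move=> E psi [psi1 _ mpsi] xi.
  have m : measurable_fun setT (fun x : V => psi (dotv xi x)).
    by apply: measurableT_comp mpsi _; exact: measurable_dotv.
  have b x : `|psi (dotv xi x)| <= 1 by [].
  by split; [exact: charge_Rintegral_chargeB m b|exact: esym (E _ m b)].
have [tc ts] := (@trig_cos R, @trig_sin R).
set c : R := (2 * pi) `^ (- (n%:R / 2)).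
have c0 : 0 < c by rewrite powR_gt0// mulr_gt0// pi_gt0.
pose X xi := c * sft p1 q1 cos xi + c * sft p2 q2 sin xi.
pose Y xi := c * sft p2 q2 cos xi + (- c) * sft p1 q1 sin xi.
have FX xi : complex.Re (fourier_fun f g xi) = X xi.
  rewrite /fourier_fun /fourierC /fourier /= -/c.
  rewrite (Echarge _ _ _ E1 _ tc xi).2 (Echarge _ _ _ E2 _ tc xi).2.
  by rewrite (Echarge _ _ _ E2 _ ts xi).2 /X; ring.
have FY xi : complex.Im (fourier_fun f g xi) = Y xi.
  rewrite /fourier_fun /fourierC /fourier /= -/c.
  rewrite (Echarge _ _ _ E2 _ tc xi).2 (Echarge _ _ _ E1 _ ts xi).2.
  by rewrite (Echarge _ _ _ E2 _ ts xi).2 /Y; ring.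
have msft psi (p q : {finite_measure set V -> \bar R}) : trig psi -> rmoment r p -> rmoment r q ->
    measurable_fun setT (sft p q psi).
  by move=> tp hp hq; have [? _ [h _ _]] := tame_sft r0 r1 hp hq tp.
have mX : measurable_fun setT X.
  by apply: measurable_funD; apply: measurable_funM => //; exact: msft.
have mY : measurable_fun setT Y.
  by apply: measurable_funD; apply: measurable_funM => //; exact: msft.
have iXY : L.-integrable setT (EFin \o (fun xi => W xi * (X xi ^+ 2 + Y xi ^+ 2))).
  apply: rint_ge0.
  - apply: measurable_funM; first exact: measurable_weight.
    by apply: measurable_funD; exact: measurable_funX.
  - by move=> xi; rewrite mulr_ge0 ?weight_ge0// addr_ge0 ?sqr_ge0.
  - move: fin; rewrite hnorm2_lebV; congr (_ < _)%E; apply: eq_integral => xi _.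
    by rewrite /sqn FX FY.
have eX : energy X.
  apply: (rint_le _ _ iXY) => [|xi].
    by apply: measurable_funM; [exact: measurable_weight|exact: measurable_funX].
  rewrite ger0_norm; last by rewrite mulr_ge0 ?weight_ge0 ?sqr_ge0.
  by apply: ler_wpM2l; [exact: weight_ge0|rewrite lerDl sqr_ge0].
have eY : energy Y.
  apply: (rint_le _ _ iXY) => [|xi].
    by apply: measurable_funM; [exact: measurable_weight|exact: measurable_funX].
  rewrite ger0_norm; last by rewrite mulr_ge0 ?weight_ge0 ?sqr_ge0.
  by apply: ler_wpM2l; [exact: weight_ge0|rewrite lerDr sqr_ge0].
(* At the origin the [sin] terms vanish, so [X 0] and [Y 0] are [c] times the masses of the real and
   imaginary parts. *)
have X0 := finite_energy_at0 tc ts hp1 hq1 hp2 hq2 eX.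
have Y0 := finite_energy_at0 tc ts hp2 hq2 hp1 hq1 eY.
have ft0 psi (m : {finite_measure set V -> \bar R}) : ft psi m 0 = psi 0 * fine (m setT).
  by rewrite /ft; under eq_Rintegral do rewrite dotv0l; exact: Rintegral_cst.
have zero (p q : {finite_measure set V -> \bar R}) : rmoment r p -> rmoment r q ->
    c * sft p q cos 0 = 0 -> zero_mass r (chargeB p q).
  move=> hp hq; rewrite /sft !ft0 cos0 !mul1r => /eqP; rewrite mulf_eq0 gt_eqF//= subr_eq0 => /eqP h.
  have pq : p setT = q setT.
    by rewrite -[LHS]fineK ?fin_num_measure// h fineK ?fin_num_measure.
  split; first by rewrite chargeBE pq subee// fin_num_measure.
  have mE : measurable_fun setT (fun v : V => (enorm v `^ r)%:E).
    by apply/measurable_EFinP; exact: measurable_enorm_powR.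
  have E0 (v : V) : (0 <= (enorm v `^ r)%:E)%E by rewrite lee_fin powR_ge0.
  apply: lte_add_pinfty.
  - apply: le_lt_trans hp; apply: ge0_le_measure_integral => // A mA.
    exact: jordan_pos_chargeB.
  - apply: le_lt_trans hq; apply: ge0_le_measure_integral => // A mA.
    exact: jordan_neg_chargeB.
have s0 (p q : {finite_measure set V -> \bar R}) : sft p q sin 0 = 0.
  by rewrite /sft !ft0 sin0 !mul0r subrr.
exists (CMeasure (chargeB p1 q1) (chargeB p2 q2)); split.
  split; apply: zero => //.
    by move: X0; rewrite s0 mulr0 addr0.
  by move: Y0; rewrite s0 mulr0 addr0.
apply/funext => xi; rewrite /fourier_meas /fourier_fun /fourierC /fourier /=.
rewrite (Echarge _ _ _ E1 _ tc xi).1 (Echarge _ _ _ E2 _ tc xi).1.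
rewrite (Echarge _ _ _ E1 _ ts xi).1 (Echarge _ _ _ E2 _ ts xi).1.
rewrite (Echarge _ _ _ E1 _ tc xi).2 (Echarge _ _ _ E2 _ tc xi).2.
by rewrite (Echarge _ _ _ E1 _ ts xi).2 (Echarge _ _ _ E2 _ ts xi).2.
Qed.

End mass_of_finite_energy.

(** * Definition of the collision operator on the whole space *)

Section Q_operator_defined.
Context (R : realType) (n : nat) (r : R) (M : collision_model R)
  (gbar : {measure set R -> \bar R}).
Hypotheses (n1 : (1 < n)%N) (r0 : 0 < r) (r1 : r < 1).
Local Notation s := (n%:R / 2 + r).
Hypothesis hM : maxwellian M gbar.

Lemma Q_operatorP : (-oo < kappa r gbar)%E -> Q_operator n M gbar r s.
Proof.
move=> /(kappaE r0 r1)[k k0 [_ hk]] mu hmu.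
have [g0 [g0E g0D g0k g0le]] := angular_measure r0 r1 hk.
have w nu : core r nu -> weighted_L2 s (fourier_meas nu) /\ weighted_L2 s (fourier_Q M mu nu).
  exact: (core_weighted_L2 n1 r0 r1 hM k0 g0E g0D g0k hmu).
split=> // gfin F [wF [f [g [hfg cF]]]].
have /choice[nu hnu] : forall j, exists nu, core r nu /\ fourier_meas nu = fourier_fun (f j) (g j).
  by move=> j; have [sf sg fin] := hfg j; exact: core_of_schwartz.
have wFk j : weighted_L2 s (fourier_meas (nu j)) := (w _ (hnu j).1).1.
have wQk j : weighted_L2 s (fourier_Q M mu (nu j)) := (w _ (hnu j).1).2.
have {}cF : hcvg s (fun j => fourier_meas (nu j)) F.
  by move: cF; congr (hcvg s _ F); apply/funext => j; rewrite (hnu j).2.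
pose b := fine (gbar setT) + 1.
have b0 : 0 < b by rewrite ltr_wpDl// fine_ge0.
have hb : (g0 setT <= b%:E)%E.
  by apply: le_trans g0le _; rewrite EFinD fineK ?ge0_fin_numE// leeDl.
suff cauchy : forall e, 0 < e -> exists N, forall i j, (N <= i)%N -> (N <= j)%N ->
    wnorm s (fun xi => fourier_Q M mu (nu i) xi - fourier_Q M mu (nu j) xi) <= e.
  have [G [wG cQ]] := riesz_fischer wQk cauchy.
  by exists G; split => //; exists nu; split => // j; exact: (hnu j).1.
move=> e e0; have [cv _] := hcvg_wnorm wFk wF.
(* [72 = 18 * 2 * 2]: the Lipschitz constant, the factor of [wnormB_le], and two approximation
   errors. *)
have d0 : 0 < e / (72 * b ^+ 2) by rewrite divr_gt0// mulr_gt0// exprn_gt0.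
have /cvgrPdist_le /(_ _ d0) [N _ hN] := cv cF.
have small j : (N <= j)%N -> wnorm s (fun xi => fourier_meas (nu j) xi - F xi) <= e / (72 * b ^+ 2).
  by move=> Nj; have := hN j Nj; rewrite /= sub0r normrN ger0_norm// wnorm_ge0.
exists N => i j Ni Nj.
apply: le_trans (core_Lipschitz n1 r0 r1 hM k0 g0E g0D g0k hmu b0 hb (hnu i).1 (hnu j).1) _.
have := wnormB_le (weighted_L2B (wFk i) wF) (weighted_L2B (wFk j) wF).
under [X in wnorm s X <= _ -> _]eq_fun do rewrite opprB addrA subrK.
move=> h; apply: le_trans (ler_wpM2l _ h) _; first by rewrite mulr_ge0// sqr_ge0.
have hij := lerD (small i Ni) (small j Nj).
apply: le_trans (ler_wpM2l _ (ler_wpM2l _ hij)) _ => //; first by rewrite mulr_ge0// sqr_ge0.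
by rewrite le_eqVlt; apply/orP; left; apply/eqP; field; rewrite gt_eqF.
Qed.

End Q_operator_defined.

Theorem theorem4p8 (R : realType) (d : nat) (r : R) (M : collision_model R)
    (gbar : {measure set R -> \bar R}) :
  (2 <= d)%N -> 0 < r < 1 -> maxwellian M gbar ->
  (-oo < kappa r gbar)%E ->
  let s := d%:R / 2 + r in
  Q_operator d M gbar r s /\ contractive d M r s (kappa r gbar).
Proof.
move=> d2 /andP[r0 r1] hM hk s.
by split; [exact: Q_operatorP|exact: contractiveP].
Qed.
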